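(* Let $\mathbb{P}$ be a finite quantum space and let $\mathbb{O}$ be a compact quantum space such that $C(\mathbb{O})$ is separable and has the lifting property. Then the C*-algebra $C(\mathbb{M}_{\mathbb{P},\mathbb{O}})$ has the lifting property.
   Context: A C*-algebra $A$ has the lifting property if for any C*-algebra $B$ with a (closed two-sided) ideal $J\subset B$, any contractive completely positive map $\varphi\colon A\to B/J$ admits a contractive completely positive lift $\widetilde{\varphi}\colon A\to B$. (For unital $A$ this is equivalent to the analogous property with ''contractive completely positive'' replaced by ''unital completely positive''.) A quantum space $\mathbb{X}$ is an object of the category dual to the category of C*-algebras; the corresponding C*-algebra is denoted $C_0(\mathbb{X})$, or $C(\mathbb{X})$ when it is unital. $\mathbb{X}$ is compact if $C(\mathbb{X})$ is unital and finite if $C(\mathbb{X})$ is finite-dimensional. For C*-algebras $A,B$, $\mathrm{Mor}(A,B)$ is the set of non-degenerate $*$-homomorphisms from $A$ to the multiplier algebra $M(B)$ (unital $*$-homomorphisms $A\to B$ if both are unital). $\otimes$ is the minimal tensor product. For $\mathbb{P}$ finite and $\mathbb{O}$ compact, $(C(\mathbb{M}_{\mathbb{P},\mathbb{O}}),\boldsymbol{\Phi}_{\mathbb{P},\mathbb{O}})$ denotes the (existing, unique up to isomorphism) pair consisting of a unital C*-algebra and a unital $*$-homomorphism $\boldsymbol{\Phi}_{\mathbb{P},\mathbb{O}}\colon C(\mathbb{O})\to C(\mathbb{P})\otimes C(\mathbb{M}_{\mathbb{P},\mathbb{O}})$ with the universal property: for every quantum space $\mathbb{X}$ and every $\Psi\in\mathrm{Mor}(C(\mathbb{O}),C(\mathbb{P})\otimes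 C_0(\mathbb{X}))$ there is a unique $\Lambda\in\mathrm{Mor}(C(\mathbb{M}_{\mathbb{P},\mathbb{O}}),C_0(\mathbb{X}))$ with $\Psi=(\mathrm{id}\otimes\Lambda)\circ\boldsymbol{\Phi}_{\mathbb{P},\mathbb{O}}$. The C*-algebra $C(\mathbb{M}_{\mathbb{P},\mathbb{O}})$ is generated by $\{(\omega\otimes\mathrm{id})\boldsymbol{\Phi}_{\mathbb{P},\mathbb{O}}(a) : a\in C(\mathbb{O}),\ \omega\in C(\mathbb{P})^*\}$. *)

(* Defs.v *)
From HB Require Import structures.
From mathcomp Require Import all_boot all_order all_algebra.
From mathcomp Require Import all_classical all_reals all_analysis.
From mathcomp Require Export complex.
Set Implicit Arguments.
Unset Strict Implicit.
Unset Printing Implicit Defensive.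
Import Order.TTheory GRing.Theory Num.Theory.
Import numFieldNormedType.Exports.
Local Open Scope classical_set_scope.
Local Open Scope ring_scope.

(** Algebras are not assumed unital, and the zero algebra is allowed.  The
    structures are declared over a [numClosedFieldType] [K], the class that
    provides the conjugation; C*-algebras in the usual sense are those with
    [K := R[i]] for [R : realType].  Norms take their values in [K]. *)

HB.mixin Record Lmodule_isStarAlg (K : numClosedFieldType) A
    of GRing.Lmodule K A := {
  smul : A -> A -> A ;
  star : A -> A ;
  smulA : forall x y z, smul x (smul y z) = smul (smul x y) z ;
  smul_linearl : forall y, linear (smul^~ y) ;
  smul_linearr : forall x, linear (smul x) ;
  star_conjlinear : forall (c : K) x y,
    star (c *: x + y) = (c^*)%R *: star x + star y ;
  starM : forall x y, star (smul x y) = smul (star y) (star x) ;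
  starK : forall x, star (star x) = x }.

#[short(type="starAlgType")]
HB.structure Definition StarAlg (K : numClosedFieldType) :=
  {A of GRing.Lmodule K A & Lmodule_isStarAlg K A}.

HB.mixin Record StarAlg_isCStarAlg (K : numClosedFieldType) A
    of CompleteNormedModule K A & StarAlg K A := {
  norm_smul : forall x y : A, `|smul x y| <= `|x| * `|y| ;
  cstar_identity : forall x : A, `|smul (star x) x| = `|x| ^+ 2 }.

#[short(type="cstarAlgType")]
HB.structure Definition CStarAlg (K : numClosedFieldType) :=
  {A of CompleteNormedModule K A & StarAlg K A & StarAlg_isCStarAlg K A}.

Declare Scope cstar_scope.
Delimit Scope cstar_scope with cstar.
Local Open Scope cstar_scope.
Infix "∗" := smul (at level 40, left associativity) : cstar_scope.
Notation "x ^†" := (star x) (at level 2, format "x ^†") : cstar_scope.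

Section StarAlgTheory.
Context {K : numClosedFieldType}.
Implicit Types A D : starAlgType K.

Definition is_unit A (e : A) := forall x, e ∗ x = x /\ x ∗ e = x.

Definition unital A := exists e : A, is_unit e.

Record is_star_hom A D (f : A -> D) : Prop := {
  star_hom_linear : linear f ;
  star_homM : forall x y, f (x ∗ y) = f x ∗ f y ;
  star_hom_star : forall x, f x^† = (f x)^† }.

Definition unit_preserving A D (f : A -> D) :=
  forall e, is_unit e -> is_unit (f e).

(** The *-algebra [M_n(A)]; the matrix operations of the library require
    entries in a ring with unit. *)
Definition mxsmul A n (X Y : 'M[A]_n) : 'M[A]_n :=
  \matrix_(i, j) \sum_k (X i k ∗ Y k j).

Definition mxstar A n (X : 'M[A]_n) : 'M[A]_n := \matrix_(i, j) (X j i)^†.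

(** Positive elements of the C*-algebra [M_n(A)]: those of the form [Y^* Y]. *)
Definition positive_mx A n (X : 'M[A]_n) :=
  exists Y : 'M[A]_n, X = mxsmul (mxstar Y) Y.

Definition completely_positive A D (f : A -> D) :=
  linear f /\
  forall n (X : 'M[A]_n), positive_mx X -> positive_mx (map_mx f X).

Lemma smul0x A (y : A) : 0 ∗ y = 0.
Proof.
have := smul_linearl y (- 1) 0 0.
by rewrite /= scaler0 addr0 => ->; rewrite scaleN1r addNr.
Qed.

Lemma smulx0 A (x : A) : x ∗ 0 = 0.
Proof.
have := smul_linearr x (- 1) 0 0.
by rewrite /= scaler0 addr0 => ->; rewrite scaleN1r addNr.
Qed.

Lemma smulDl A (x y z : A) : (x + y) ∗ z = x ∗ z + y ∗ z.
Proof. by have := smul_linearl z 1 x y; rewrite /= !scale1r. Qed.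

Lemma smulDr A (x y z : A) : z ∗ (x + y) = z ∗ x + z ∗ y.
Proof. by have := smul_linearr z 1 x y; rewrite /= !scale1r. Qed.

Lemma smulZl A (c : K) (x z : A) : (c *: x) ∗ z = c *: (x ∗ z).
Proof. by have := smul_linearl z c x 0; rewrite /= !addr0 smul0x addr0. Qed.

Lemma smulZr A (c : K) (x z : A) : z ∗ (c *: x) = c *: (z ∗ x).
Proof. by have := smul_linearr z c x 0; rewrite /= !addr0 smulx0 addr0. Qed.

Lemma smulNl A (x z : A) : (- x) ∗ z = - (x ∗ z).
Proof. by rewrite -scaleN1r smulZl scaleN1r. Qed.

Lemma smulNr A (x z : A) : z ∗ (- x) = - (z ∗ x).
Proof. by rewrite -scaleN1r smulZr scaleN1r. Qed.

End StarAlgTheory.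

Section Span.
Context {K : numClosedFieldType}.

Definition linear_span (V : lmodType K) (S : set V) : set V :=
  [set x | exists n (c : 'I_n -> K) (s : 'I_n -> V),
     (forall i, S (s i)) /\ x = \sum_(i < n) c i *: s i].

Definition finite_dimensional (V : lmodType K) :=
  exists2 S : set V, finite_set S & linear_span S = setT.

Definition linearly_independent (V : lmodType K) n (a : 'I_n -> V) :=
  forall c : 'I_n -> K, \sum_(i < n) c i *: a i = 0 -> forall i, c i = 0.

Definition separable (T : topologicalType) :=
  exists2 S : set T, countable S & dense S.

End Span.

Section Multipliers.
Context {K : numClosedFieldType}.

(** Double centralizers in the sense of Busby.  In a C*-algebra the condition
    below implies that both maps are linear and bounded, that
    [multL (x y) = multL x y] and that [multR (x y) = x multR y]. *)
Record multiplier (B : cstarAlgType K) := Multiplier {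
  multL : B -> B ;
  multR : B -> B ;
  multP : forall x y, x ∗ multL y = multR x ∗ y }.

Variable B : cstarAlgType K.
Implicit Types m : multiplier B.

Lemma multiplier_eq m1 m2 :
  multL m1 =1 multL m2 -> multR m1 =1 multR m2 -> m1 = m2.
Proof.
case: m1 m2 => [l1 r1 p1] [l2 r2 p2] /= /funext el /funext er.
by subst; congr Multiplier; exact: Prop_irrelevance.
Qed.

Lemma smul_injl (x y : B) : (forall z, z ∗ x = z ∗ y) -> x = y.
Proof.
move=> h; apply/eqP; rewrite -subr_eq0 -normr_eq0 -sqrf_eq0.
by rewrite -cstar_identity smulDr smulNr h subrr normr0.
Qed.

Lemma smul_injr (x y : B) : (forall z, x ∗ z = y ∗ z) -> x = y.
Proof.
move=> h; rewrite -[x]starK -[y]starK; congr star; apply: smul_injl => z.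
by rewrite -[z]starK -!starM h.
Qed.

Lemma multL_linear m : linear (multL m).
Proof.
move=> c x y; apply: smul_injl => z.
by rewrite smulDr smulZr !multP smulDr smulZr.
Qed.

Lemma multR_linear m : linear (multR m).
Proof.
move=> c x y; apply: smul_injr => z.
by rewrite smulDl smulZl -!multP smulDl smulZl.
Qed.

Fact mult0P (x y : B) : x ∗ 0 = 0 ∗ y.
Proof. by rewrite smulx0 smul0x. Qed.
Definition mult0 := Multiplier mult0P.

Fact multNP m x y : x ∗ (- multL m y) = (- multR m x) ∗ y.
Proof. by rewrite smulNl smulNr multP. Qed.
Definition multN m := Multiplier (multNP m).

Fact multDP m1 m2 x y :
  x ∗ (multL m1 y + multL m2 y) = (multR m1 x + multR m2 x) ∗ y.
Proof. by rewrite smulDl smulDr !multP. Qed.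
Definition multD m1 m2 := Multiplier (multDP m1 m2).

Fact multZP (c : K) m x y : x ∗ (c *: multL m y) = (c *: multR m x) ∗ y.
Proof. by rewrite smulZl smulZr multP. Qed.
Definition multZ c m := Multiplier (multZP c m).

Fact multMP m1 m2 x y :
  x ∗ multL m1 (multL m2 y) = multR m2 (multR m1 x) ∗ y.
Proof. by rewrite !multP. Qed.
Definition multM m1 m2 := Multiplier (multMP m1 m2).

Fact mult_starP m x y : x ∗ (multR m y^†)^† = (multL m x^†)^† ∗ y.
Proof. by rewrite -[x in LHS]starK -[y in RHS]starK -!starM multP. Qed.
Definition mult_star m := Multiplier (mult_starP m).

HB.instance Definition _ := gen_eqMixin (multiplier B).
HB.instance Definition _ := gen_choiceMixin (multiplier B).

Fact multDA : associative multD.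
Proof. by move=> ? ? ?; apply: multiplier_eq => x /=; rewrite addrA. Qed.
Fact multDC : commutative multD.
Proof. by move=> ? ?; apply: multiplier_eq => x /=; rewrite addrC. Qed.
Fact mult0D : left_id mult0 multD.
Proof. by move=> ?; apply: multiplier_eq => x /=; rewrite add0r. Qed.
Fact multND : left_inverse mult0 multN multD.
Proof. by move=> ?; apply: multiplier_eq => x /=; rewrite addNr. Qed.

HB.instance Definition _ :=
  GRing.isZmodule.Build (multiplier B) multDA multDC mult0D multND.

Fact multZA c d m : multZ c (multZ d m) = multZ (c * d) m.
Proof. by apply: multiplier_eq => x /=; rewrite scalerA. Qed.
Fact mult1Z : left_id 1 multZ.
Proof. by move=> ?; apply: multiplier_eq => x /=; rewrite scale1r. Qed.
Fact multZDr : right_distributive multZ +%R.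
Proof. by move=> ? ? ?; apply: multiplier_eq => x /=; rewrite scalerDr. Qed.
Fact multZDl m : {morph multZ^~ m : c d / c + d}.
Proof. by move=> ? ?; apply: multiplier_eq => x /=; rewrite scalerDl. Qed.

HB.instance Definition _ :=
  GRing.Zmodule_isLmodule.Build K (multiplier B) multZA mult1Z multZDr multZDl.

Fact multMA m1 m2 m3 : multM m1 (multM m2 m3) = multM (multM m1 m2) m3.
Proof. exact: multiplier_eq. Qed.
Fact multM_linearl m : linear (multM^~ m).
Proof. by move=> c ? ?; apply: multiplier_eq => x //=; exact: multR_linear. Qed.
Fact multM_linearr m : linear (multM m).
Proof. by move=> c ? ?; apply: multiplier_eq => x //=; exact: multL_linear. Qed.
Fact mult_star_conjlinear (c : K) m1 m2 :
  mult_star (c *: m1 + m2) = (c^*)%R *: mult_star m1 + mult_star m2.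
Proof. by apply: multiplier_eq => x /=; exact: star_conjlinear. Qed.
Fact mult_starM m1 m2 :
  mult_star (multM m1 m2) = multM (mult_star m2) (mult_star m1).
Proof. by apply: multiplier_eq => x /=; rewrite starK. Qed.
Fact mult_starK m : mult_star (mult_star m) = m.
Proof. by apply: multiplier_eq => x /=; rewrite !starK. Qed.

HB.instance Definition _ :=
  Lmodule_isStarAlg.Build K (multiplier B) multMA multM_linearl multM_linearr
    mult_star_conjlinear mult_starM mult_starK.

End Multipliers.

Section CStarTheory.
Context {K : numClosedFieldType}.
Implicit Types A B C X T : cstarAlgType K.

Definition contractive A B (f : A -> B) := forall x, `|f x| <= `|x|.

Record closed_ideal B (J : set B) : Prop := {
  ideal_closed : closed J ;
  ideal0 : J 0 ;
  ideal_submod : forall (c : K) x y, J x -> J y -> J (c *: x + y) ;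
  ideal_mull : forall b x, J x -> J (b ∗ x) ;
  ideal_mulr : forall b x, J x -> J (x ∗ b) }.

(** [C], with the projection [q], is the quotient C*-algebra [B / J]; the last
    two clauses say that [`|q b|] is the infimum of the [`|b + j|], [j] in [J]. *)
Record is_quotient B (J : set B) C (q : B -> C) : Prop := {
  quotient_hom : is_star_hom q ;
  quotient_surj : forall c, exists b, q b = c ;
  quotient_ker : forall b, q b = 0 <-> J b ;
  quotient_norm_le : forall b j, J j -> `|q b| <= `|b + j| ;
  quotient_norm_inf : forall b (e : K), 0 < e ->
    exists2 j, J j & `|b + j| < `|q b| + e }.

Definition lifting_property A :=
  forall B (J : set B), closed_ideal J ->
  forall C (q : B -> C), is_quotient J q ->
  forall f : A -> C, completely_positive f -> contractive f ->
  exists g : A -> B,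
    [/\ completely_positive g, contractive g & forall a, q (g a) = f a].

(** [T], with [t a b] in the role of the elementary tensor of [a] and [b], is a
    completion of the algebraic tensor product for some C*-norm. *)
Record is_cstar_tensor A B T (t : A -> B -> T) : Prop := {
  tensor_linearl : forall b, linear (t^~ b) ;
  tensor_linearr : forall a, linear (t a) ;
  tensorM : forall a b a' b', t a b ∗ t a' b' = t (a ∗ a') (b ∗ b') ;
  tensor_star : forall a b, (t a b)^† = t a^† b^† ;
  tensor_inj : forall n (a : 'I_n -> A) (b : 'I_n -> B),
    linearly_independent a -> \sum_(i < n) t (a i) (b i) = 0 ->
    forall i, b i = 0 ;
  tensor_dense : dense (linear_span [set t a b | a in setT & b in setT]) }.

Record is_min_tensor A B T (t : A -> B -> T) : Prop := {
  min_tensor_tensor : is_cstar_tensor t ;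
  min_tensor_min : forall T' (t' : A -> B -> T'), is_cstar_tensor t' ->
    forall n (a : 'I_n -> A) (b : 'I_n -> B),
    `|\sum_(i < n) t (a i) (b i)| <= `|\sum_(i < n) t' (a i) (b i)| }.

(** [is_mor f] says that [f] belongs to [Mor(A, B)]. *)
Record is_mor A B (f : A -> multiplier B) : Prop := {
  mor_hom : is_star_hom f ;
  mor_nondegenerate :
    dense (linear_span [set multL (f a) b | a in setT & b in setT]) }.

(** Given models [t] of [P ⊗ A] and [t'] of [P ⊗ X], the map [F] is the
    morphism [id ⊗ L]: it sends [p ⊗ a] to the multiplier [p ⊗ L a]. *)
Record is_id_tensor (P A X T T' : cstarAlgType K)
    (t : P -> A -> T) (t' : P -> X -> T')
    (L : A -> multiplier X) (F : T -> multiplier T') : Prop := {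
  id_tensor_mor : is_mor F ;
  id_tensorL : forall p a p' x,
    multL (F (t p a)) (t' p' x) = t' (p ∗ p') (multL (L a) x) ;
  id_tensorR : forall p a p' x,
    multR (F (t p a)) (t' p' x) = t' (p' ∗ p) (multR (L a) x) }.

(** [(M, Phi)] is the universal pair [(C(M_{P,O}), Phi_{P,O})], where [t]
    presents [T] as [P ⊗ M]. *)
Record is_quantum_maps (P O M T : cstarAlgType K) (t : P -> M -> T)
    (Phi : O -> T) : Prop := {
  qmaps_unital : unital M ;
  qmaps_tensor : is_min_tensor t ;
  qmaps_hom : is_star_hom Phi ;
  qmaps_unit : unit_preserving Phi ;
  qmaps_universal : forall X T' (t' : P -> X -> T'), is_min_tensor t' ->
    forall Psi : O -> multiplier T', is_mor Psi ->
    exists! L : M -> multiplier X,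
      is_mor L /\
      exists2 F, is_id_tensor t t' L F & forall a, Psi a = F (Phi a) }.

End CStarTheory.

(* Main.v *)
(** It suffices to lift a completely positive contraction [f : M -> C] along a surjection
    [q : B -> C] of unital algebras, and, by Arveson's argument with elements of the ideal
    [ker q] that are almost central, to do so approximately on finitely many words in the
    coefficients [Phi_ij(a)], since these words span a dense subspace of [M].

    Fix words [y_0 = 1, y_1, ..., y_N] and compress: with the Gram matrix
    [G = (f (y_r^* y_s))] and [S = (delta + G)^(-1/2)], the map
    [Theta m = S (f (y_r^* m y_s)) S] is completely positive into matrices over [C] and
    [Theta 1] is almost a projection.  Applied to the coefficients of [Phi] it gives a
    completely positive map on [O], which lifts along [q] because [O] has the lifting
    property.  The lift has a dilation to a representation [rho] of [O] on a Hilbert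
    module.  Conjugate [1 (x) rho] by the unitary [k + i sqrt(1 - k^2)], where the
    self-adjoint contraction [k] over [P] exchanges a fixed vector with the vectors of the
    dilation; the universal property turns the conjugate into a *-homomorphism on [M].
    Its compression [D] to the fixed vector is completely positive on all of [M], and
    [q (D (Phi_ij a))] is close to [Theta 1 * Theta (Phi_ij a) * Theta 1], the error being
    controlled by [Theta 1 - (Theta 1)^3].

    Thus [D] is right on the generators only; the Cauchy-Schwarz inequality together with
    [sum_k Phi_kj(a)^* Phi_kj(a) = Phi_jj(a^* a)], which is again a generator, propagates
    this from generators to words. *)

From HB Require Import structures.
Require Import Defs.
From mathcomp Require Import all_boot all_order all_algebra.
From mathcomp Require Import all_classical all_reals all_analysis.
From mathcomp Require Import ring lra.
Set Implicit Arguments.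
Unset Strict Implicit.
Unset Printing Implicit Defensive.
Import Order.TTheory GRing.Theory Num.Theory.
Import numFieldNormedType.Exports.
Local Open Scope classical_set_scope.
Local Open Scope complex_scope.
Local Open Scope ring_scope.
Local Open Scope cstar_scope.

(** * Real-valued norms *)

Section RealNorm.
Context {R : realType}.

(** The universal property produces *-homomorphisms on [M], whereas the lifting property of [O]
    produces only a completely positive map, entry by entry. Dilation turns it into a homomorphism
    of [O], but compressing [rho] to one vector sees a single entry. The unitary over [P] removes
    this obstacle: a frame with [sum b_i b_i^† = 1] satisfies [sum b_r b_s^† (x) Y_rs = Y] for all
    [Y] in [P (x) X], so sending one vector to [sum b_i^† (x) V_i] makes all entries appear at once,
    each in its place. The vector has squared length [z], a lift of [Theta 1], which enters once on
    each side: this is the origin of the two outer factors. Compression sends 1 to [z] and [k^2] to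
    [z^3], whence the cube. For the Gram matrix [Theta 1 = G / (delta + G)], and on the vectors
    [(delta + G)^(1/2) e_s] it differs from 1 by [delta (delta + G)^(-1/2) e_s], at most
    [sqrt delta] whatever the spectrum of [G]. One step applied to [f] itself would say nothing
    about products, hence the matrix indexed by words. *)

Definition nr (V : normedZmodType R[i]) (x : V) : R := complex.Re `|x|.

Lemma nrE (V : normedZmodType R[i]) (x : V) : `|x| = (nr x)%:C.
Proof. by rewrite /nr RRe_real. Qed.

Lemma nr_ge0 (V : normedZmodType R[i]) (x : V) : 0 <= nr x.
Proof. by rewrite -ler0c -nrE. Qed.
Hint Resolve nr_ge0 : core.

Lemma nr0 (V : normedZmodType R[i]) : nr (0 : V) = 0.
Proof. by rewrite /nr normr0. Qed.

Lemma nr_eq0 (V : normedZmodType R[i]) (x : V) : nr x = 0 -> x = 0.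
Proof. by move=> h; apply/eqP; rewrite -normr_eq0 nrE h. Qed.

Lemma nr_le0 (V : normedZmodType R[i]) (x : V) : nr x <= 0 -> x = 0.
Proof. by move=> h; apply: nr_eq0; apply/eqP; rewrite eq_le h nr_ge0. Qed.

Lemma nrN (V : normedZmodType R[i]) (x : V) : nr (- x) = nr x.
Proof. by rewrite /nr normrN. Qed.

Lemma nrC (V : normedZmodType R[i]) (x y : V) : nr (x - y) = nr (y - x).
Proof. by rewrite -nrN opprB. Qed.

Lemma nrD (V : normedZmodType R[i]) (x y : V) : nr (x + y) <= nr x + nr y.
Proof. by rewrite -lecR rmorphD /= -!nrE ler_normD. Qed.

Lemma nrB (V : normedZmodType R[i]) (x y : V) : nr (x - y) <= nr x + nr y.
Proof. by rewrite -(nrN y) nrD. Qed.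

Lemma nr_tri (V : normedZmodType R[i]) (z x y : V) :
  nr (x - y) <= nr (x - z) + nr (z - y).
Proof. by rewrite -lecR rmorphD /= -!nrE ler_distD. Qed.

Lemma nr_sum (V : normedZmodType R[i]) I (r : seq I) (P : pred I) (F : I -> V) :
  nr (\sum_(i <- r | P i) F i) <= \sum_(i <- r | P i) nr (F i).
Proof.
elim/big_rec2: _ => [|i a b _ h]; first by rewrite nr0.
exact: le_trans (nrD _ _) (lerD (lexx _) h).
Qed.

Lemma nrR (r : R) : nr (r%:C : R[i]) = `|r|.
Proof. by rewrite /nr normc_def /= expr0n /= addr0 sqrtr_sqr. Qed.

Lemma nr_conj (c : R[i]) : nr (c^*)%R = nr c.
Proof. by rewrite /nr norm_conjC. Qed.

Lemma nr_i : nr ('i : R[i])%C = 1.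
Proof. by rewrite /nr normc_def /= expr0n /= add0r expr1n sqrtr1. Qed.

Lemma nrZ (V : normedModType R[i]) (c : R[i]) (x : V) : nr (c *: x) = nr c * nr x.
Proof. by apply: complexI; rewrite rmorphM /= -!nrE normrZ. Qed.

Lemma nrZR (V : normedModType R[i]) (r : R) (x : V) : nr (r%:C *: x) = `|r| * nr x.
Proof. by rewrite nrZ nrR. Qed.

(** Limits of sequences with real, non-strict bounds; the filters of a normed module, whose radii
    lie in [R[i]], are reached through [ncv_cvg]. *)
Definition ncv (V : normedZmodType R[i]) (u : nat -> V) (l : V) :=
  forall e : R, 0 < e -> exists N, forall n, (N <= n)%N -> nr (u n - l) <= e.

Definition ncauchy (V : normedZmodType R[i]) (u : nat -> V) :=
  forall e : R, 0 < e ->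
    exists N, forall m n, (N <= m)%N -> (N <= n)%N -> nr (u m - u n) <= e.

Lemma ncv_cvg (V : normedModType R[i]) (u : nat -> V) (l : V) :
  ncv u l <-> u @ \oo --> l.
Proof.
split=> [h|/cvgrPdist_le h e e0].
  apply/cvgrPdist_le => e; case: e => [a b]; rewrite ltcE /= => /andP[/eqP b0 a0].
  have [N hN] := h a a0; exists N => // n /= Nn.
  rewrite nrE lecE /= -b0 eqxx /=; rewrite nrC; exact: hN.
have [|N _ hN] := h e%:C; first by rewrite ltcR.
exists N => n Nn; have /= := hN n Nn; by rewrite nrE lecR nrC.
Qed.

Lemma invS_small (e : R) : 0 < e -> exists N, forall n, (N <= n)%N -> n.+1%:R^-1 <= e.
Proof.
move=> e0; exists (Num.truncn e^-1) => n hn.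
rewrite invf_ple ?posrE ?ltr0n//.
apply: (le_trans (ltW (truncnS_gt _))); by rewrite ler_nat.
Qed.

Lemma ncauchy_ncv (V : completeNormedModType R[i]) (u : nat -> V) :
  ncauchy u -> exists l, ncv u l.
Proof.
move=> h; have /cauchy_cvg/cvg_ex [l hl] : cauchy (u @ \oo).
  apply: cauchy_exP => e; case: e => [a b]; rewrite ltcE /= => /andP[/eqP b0 a0].
  have [|N hN] := h (a / 2); first by rewrite divr_gt0.
  exists (u N); exists N => // n /= Nn; rewrite -ball_normE /= nrE ltcE /= -b0 eqxx /=.
  by apply: le_lt_trans (hN _ _ _ _) _ => //; rewrite ltr_pdivrMr// ltr_pMr // ltr1n.
exists l; exact/ncv_cvg.
Qed.

Lemma ncv_uniq (V : normedModType R[i]) (u : nat -> V) l l' :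
  ncv u l -> ncv u l' -> l = l'.
Proof.
move=> h h'; apply/eqP; rewrite -subr_eq0; apply/eqP/nr_le0.
apply/ler_addgt0Pl => e e0; rewrite addr0.
have [|N hN] := h (e / 2); first by rewrite divr_gt0.
have [|N' hN'] := h' (e / 2); first by rewrite divr_gt0.
apply: (le_trans (nr_tri (u (maxn N N')) _ _)); rewrite [e]splitr nrC.
by apply: lerD; [apply: hN; rewrite leq_maxl | apply: hN'; rewrite leq_maxr].
Qed.

End RealNorm.
#[export] Hint Extern 0 (is_true (_ <= nr _)) => exact: nr_ge0 : core.

(** * Unital C*-algebras *)

HB.mixin Record CStarAlg_isUnital (R : realType) A of CStarAlg R[i] A := {
  uone : A ;
  smul1x : forall x : A, smul uone x = x ;
  smulx1 : forall x : A, smul x uone = x }.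

#[short(type="ucstarType")]
HB.structure Definition UCStarAlg (R : realType) :=
  {A of CStarAlg R[i] A & CStarAlg_isUnital R A}.
Notation "𝟏" := uone : cstar_scope.

(** The interface for the unital algebras constructed below: a real-valued norm and completeness for
    sequences. The builder derives the complex-valued norm, the topology and completeness for
    filters. *)
HB.factory Record isUCStarAlg (R : realType) A of GRing.Lmodule R[i] A := {
  umul : A -> A -> A ;
  uunit : A ;
  ustar : A -> A ;
  unorm : A -> R ;
  umulA : forall x y z, umul x (umul y z) = umul (umul x y) z ;
  umul_linl : forall y, linear (umul^~ y) ;
  umul_linr : forall x, linear (umul x) ;
  umul1x : forall x, umul uunit x = x ;
  umulx1 : forall x, umul x uunit = x ;
  ustar_conjlinear : forall (c : R[i]) x y,
    ustar (c *: x + y) = (c^*)%R *: ustar x + ustar y ;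
  ustarM : forall x y, ustar (umul x y) = umul (ustar y) (ustar x) ;
  ustarK : forall x, ustar (ustar x) = x ;
  unormD : forall x y, unorm (x + y) <= unorm x + unorm y ;
  unormZ : forall (c : R[i]) x, unorm (c *: x) = nr c * unorm x ;
  unorm_eq0 : forall x, unorm x = 0 -> x = 0 ;
  unormM : forall x y, unorm (umul x y) <= unorm x * unorm y ;
  unormS : forall x, unorm (umul (ustar x) x) = unorm x ^+ 2 ;
  ucomplete : forall u : nat -> A,
    (forall e : R, 0 < e -> exists N, forall m n, (N <= m)%N -> (N <= n)%N ->
      unorm (u m - u n) <= e) ->
    exists l, forall e : R, 0 < e -> exists N, forall n, (N <= n)%N ->
      unorm (u n - l) <= e }.

HB.builders Context (R : realType) A of isUCStarAlg R A.

HB.instance Definition _ := Lmodule_isStarAlg.Build R[i] A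
  umulA umul_linl umul_linr ustar_conjlinear ustarM ustarK.

Fact cnormD (x y : A) : (unorm (x + y))%:C <= (unorm x)%:C + (unorm y)%:C :> R[i].
Proof. by rewrite -rmorphD lecR unormD. Qed.
Fact cnormZ (l : R[i]) (x : A) : (unorm (l *: x))%:C = `|l| * (unorm x)%:C :> R[i].
Proof. by rewrite unormZ rmorphM /= -nrE. Qed.
Fact cnorm_eq0 (x : A) : (unorm x)%:C = 0 :> R[i] -> x = 0.
Proof. by move=> [/unorm_eq0]. Qed.

HB.instance Definition _ := @Lmodule_isNormed.Build R[i] A
  (fun x : A => (unorm x)%:C) cnormD cnormZ cnorm_eq0.

Fact nr_unorm (x : A) : nr x = unorm x.
Proof. by apply: complexI; rewrite -nrE. Qed.

(** A Cauchy filter is followed by a sequence: [u n] is the centre of a ball of radius [1 / (n+1)]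
    belonging to the filter. Two such balls meet, so [u] is Cauchy, and the filter converges to its
    limit. *)
Fact unorm_complete (F : set_system A) : ProperFilter F -> cauchy F -> cvg F.
Proof.
move=> FF /cauchyP Fc.
have [u hu] : {u : nat -> A & forall n, F (ball (u n) (n.+1%:R^-1)%:C)}.
  apply: (@choice _ _ (fun n (x : A) => F (ball x (n.+1%:R^-1)%:C))) => n.
  by apply: Fc; rewrite ltcR invr_gt0 ltr0n.
have bE (x y : A) (e : R) : ball x e%:C y -> nr (x - y) <= e.
  by rewrite -ball_normE /= nrE ltcR => /ltW.
have [l hl] : exists l : A, ncv u l.
  suff /ucomplete [l hl] : forall e : R, 0 < e -> exists N, forall m n,
      (N <= m)%N -> (N <= n)%N -> unorm (u m - u n) <= e.
    by exists l => e /hl [N hN]; exists N => n /hN; rewrite nr_unorm.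
  move=> e e0; have [|N hN] := @invS_small R (e / 2); first by rewrite divr_gt0.
  exists N => m n mN nN; rewrite -nr_unorm.
  have [z [/bE h1 /bE h2]] := filter_ex (filterI (hu m) (hu n)).
  apply: (le_trans (nr_tri z _ _)); rewrite [e]splitr [nr (z - _)]nrC.
  by apply: lerD; [apply: le_trans h1 _|apply: le_trans h2 _]; apply: hN.
apply/cvg_ex; exists l; apply/fcvg_ballP => e.
case: e => [a b]; rewrite ltcE /= => /andP[/eqP b0 a0].
have a20 : 0 < a / 3 by rewrite divr_gt0.
have [N1 h1] := hl _ a20; have [N2 h2] := @invS_small R _ a20.
pose N := maxn N1 N2; apply: filterS (hu N) => y /bE hy.
rewrite -ball_normE /= nrE ltcE /= -b0 eqxx /=.
apply: le_lt_trans (nr_tri (u N) _ _) _.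
have := h1 N (leq_maxl _ _); have := h2 N (leq_maxr _ _); rewrite nrC => h3 h4.
apply: (@le_lt_trans _ _ (a / 3 + a / 3)); last by lra.
by apply: lerD => //; exact: le_trans hy h3.
Qed.

HB.instance Definition _ := Uniform_isComplete.Build A unorm_complete.

Fact cnormM (x y : A) : `|smul x y| <= `|x| * `|y|.
Proof. by rewrite !nrE -rmorphM lecR !nr_unorm unormM. Qed.
Fact cnormS (x : A) : `|smul (star x) x| = `|x| ^+ 2.
Proof. by rewrite !nrE -rmorphXn !nr_unorm /= -unormS. Qed.

HB.instance Definition _ := StarAlg_isCStarAlg.Build R[i] A cnormM cnormS.
HB.instance Definition _ := CStarAlg_isUnital.Build R A umul1x umulx1.

HB.end.

(** * Linear identities by reflection *)

Inductive lexp (K : Type) : Type :=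
| LAtom of nat | LZero | LAdd of lexp K & lexp K | LOpp of lexp K
| LScale of K & lexp K.
Arguments LAtom {K}. Arguments LZero {K}.

Section LinearReflection.
Context {K : comPzRingType} {V : lmodType K}.

Fixpoint leval (env : seq V) (e : lexp K) : V :=
  match e with
  | LAtom n => nth 0 env n
  | LZero => 0
  | LAdd a b => leval env a + leval env b
  | LOpp a => - leval env a
  | LScale c a => c *: leval env a
  end.

Fixpoint lcoef (e : lexp K) (n : nat) : K :=
  match e with
  | LAtom m => if eqn m n then 1 else 0
  | LZero => 0
  | LAdd a b => lcoef a n + lcoef b n
  | LOpp a => - lcoef a n
  | LScale c a => c * lcoef a n
  end.

Lemma leval_coef env e :
  leval env e = \sum_(i < size env) lcoef e i *: nth 0 env i.
Proof.
elim: e => [m||a IHa b IHb|a IHa|c a IHa] /=; rewrite ?IHa ?IHb.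
- have [mn|mn] := ltnP m (size env).
    rewrite (bigD1 (Ordinal mn)) //= -[eqn m m]/(m == m) eqxx scale1r big1 ?addr0// => i im.
    case: eqnP => [mi|_]; last by rewrite scale0r.
    by case/eqP: im; apply: val_inj.
  rewrite nth_default// big1// => i _; case: eqnP => [mi|_].
    by have := ltn_ord i; rewrite -mi ltnNge mn.
  by rewrite scale0r.
- by rewrite big1// => i _; rewrite scale0r.
- by rewrite -big_split; apply: eq_bigr => i _; rewrite scalerDl.
- by rewrite -sumrN; apply: eq_bigr => i _; rewrite scaleNr.
- by rewrite scaler_sumr; apply: eq_bigr => i _; rewrite scalerA.
Qed.

Fixpoint lcoefs_eq (e1 e2 : lexp K) (n : nat) : Prop :=
  if n is m.+1 then lcoef e1 m = lcoef e2 m /\ lcoefs_eq e1 e2 m else True.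

Lemma leval_eq env e1 e2 :
  lcoefs_eq e1 e2 (size env) -> leval env e1 = leval env e2.
Proof.
move=> h; rewrite !leval_coef; apply: eq_bigr => -[i /= hi] _; congr (_ *: _).
elim: (size env) h hi => // n IH /= [h1 h2]; rewrite ltnS leq_eqVlt => /orP[/eqP->//|].
exact: IH.
Qed.

End LinearReflection.

Ltac lmember x l :=
  match l with
  | (?y :: _)%SEQ => let u := match goal with _ => unify x y end in constr:(0%N)
  | (_ :: ?t)%SEQ => let n := lmember x t in constr:(S n)
  end.
Ltac latoms e l :=
  match e with
  | (?a + ?b)%R => let l1 := latoms a l in latoms b l1
  | (- ?a)%R => latoms a l
  | (_ *: ?a)%R => latoms a l
  | 0%R => l
  | _ => match l with
         | _ => let n := lmember e l in l
         | _ => constr:((e :: l)%SEQ)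
         end
  end.
Ltac lreify K e l :=
  match e with
  | (?a + ?b)%R => let x := lreify K a l in let y := lreify K b l in
                   constr:(@LAdd K x y)
  | (- ?a)%R => let x := lreify K a l in constr:(@LOpp K x)
  | (?c *: ?a)%R => let x := lreify K a l in constr:(@LScale K c x)
  | 0%R => constr:(@LZero K)
  | _ => let n := lmember e l in constr:(@LAtom K n)
  end.
(** Two expressions are equal if each atom has the same coefficient on both sides; [ring] compares
    the coefficients. A product counts as an atom and is expanded beforehand, by [nc]. *)
Ltac lmod :=
  match goal with
  | R : realType |- @eq ?V ?x ?y =>
    let K := constr:(complex R) in
    let l0 := constr:((@nil V)) in
    let l1 := latoms x l0 in let l := latoms y l1 in
    let e1 := lreify K x l in let e2 := lreify K y l in
    change (@leval _ _ l e1 = @leval _ _ l e2);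
    apply: leval_eq; cbn [lcoefs_eq lcoef size eqn];
    repeat (split; [try ring|]); try exact I
  end.

(** * Arithmetic of *-algebras and limits of sequences *)

Section StarTheory.
Context {R : realType}.
Implicit Types A : ucstarType R.

Section Basic.
Context {K : numClosedFieldType} {A : starAlgType K}.
Implicit Types x y z : A.

Lemma smulBl x y z : (x - y) ∗ z = x ∗ z - y ∗ z.
Proof. by rewrite smulDl smulNl. Qed.
Lemma smulBr x y z : z ∗ (x - y) = z ∗ x - z ∗ y.
Proof. by rewrite smulDr smulNr. Qed.

Lemma smul_suml I (r : seq I) (P : pred I) (F : I -> A) z :
  (\sum_(i <- r | P i) F i) ∗ z = \sum_(i <- r | P i) F i ∗ z.
Proof.
by elim/big_rec2: _ => [|i y1 y2 _ <-]; rewrite ?smul0x ?smulDl.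
Qed.

Lemma smul_sumr I (r : seq I) (P : pred I) (F : I -> A) z :
  z ∗ (\sum_(i <- r | P i) F i) = \sum_(i <- r | P i) z ∗ F i.
Proof.
by elim/big_rec2: _ => [|i y1 y2 _ <-]; rewrite ?smulx0 ?smulDr.
Qed.

Lemma star0 : (0 : A)^† = 0.
Proof.
have := star_conjlinear (-1) (0 : A) 0; rewrite scaler0 addr0 => /= h.
by rewrite {}h rmorphN rmorph1 scaleN1r addNr.
Qed.
Lemma starD x y : (x + y)^† = x^† + y^†.
Proof. by have := star_conjlinear 1 x y; rewrite scale1r rmorph1 scale1r. Qed.
Lemma starZ c x : (c *: x)^† = (c^*)%R *: x^†.
Proof. by have := star_conjlinear c x 0; rewrite addr0 star0 addr0. Qed.
Lemma starN x : (- x)^† = - x^†.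
Proof. by rewrite -scaleN1r starZ rmorphN rmorph1 scaleN1r. Qed.
Lemma starB x y : (x - y)^† = x^† - y^†.
Proof. by rewrite starD starN. Qed.
Lemma star_inj : injective (@star K A).
Proof. exact: can_inj starK. Qed.

Lemma star_sum I (r : seq I) (P : pred I) (F : I -> A) :
  (\sum_(i <- r | P i) F i)^† = \sum_(i <- r | P i) (F i)^†.
Proof. by elim/big_rec2: _ => [|i y1 y2 _ <-]; rewrite ?star0 ?starD. Qed.

End Basic.

Section Norm.
Context {A : cstarAlgType R[i]}.
Implicit Types x y z : A.

Lemma nrM x y : nr (x ∗ y) <= nr x * nr y.
Proof. by rewrite -lecR rmorphM /= -!nrE norm_smul. Qed.
Lemma nrS x : nr (x^† ∗ x) = nr x ^+ 2.
Proof. by apply: complexI; rewrite rmorphXn /= -!nrE cstar_identity. Qed.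
Lemma nr_star x : nr x^† = nr x.
Proof.
have h y : nr y <= nr y^†.
  have [->|y0] := eqVneq (nr y) 0; first exact: nr_ge0.
  have yp : 0 < nr y by rewrite lt_def y0 nr_ge0.
  by rewrite -(ler_pM2r yp) -expr2 -nrS nrM.
by apply/eqP; rewrite eq_le h -[X in _ <= nr X]starK h.
Qed.
Lemma nrS' x : nr (x ∗ x^†) = nr x ^+ 2.
Proof. by rewrite -{1}[x]starK nrS nr_star. Qed.
Lemma nr_sa2 x : x^† = x -> nr (x ∗ x) = nr x ^+ 2.
Proof. by move=> h; rewrite -nrS h. Qed.

Lemma nrM_le x y a b : nr x <= a -> nr y <= b -> nr (x ∗ y) <= a * b.
Proof. by move=> h k; apply: le_trans (nrM _ _) (ler_pM _ _ h k). Qed.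

Lemma sS_eq0 x : x^† ∗ x = 0 -> x = 0.
Proof.
move=> h; have := nrS x; rewrite h nr0 => /esym/eqP.
by rewrite sqrf_eq0 => /eqP/nr_eq0.
Qed.
Lemma sa2_eq0 x : x^† = x -> x ∗ x = 0 -> x = 0.
Proof. by move=> h k; apply: sS_eq0; rewrite h. Qed.

Lemma ncvM (u v : nat -> A) a b :
  ncv u a -> ncv v b -> ncv (fun n => u n ∗ v n) (a ∗ b).
Proof.
move=> ha hb e e0.
(* As [d <= 1], the three terms add up to at most [d * (1 + nr a + nr b)]. *)
pose d := Num.min 1 (e / (1 + nr a + nr b)).
have P0 : 0 < 1 + nr a + nr b by rewrite -addrA ltr_pwDl// addr_ge0.
have d0 : 0 < d by rewrite /d lt_min ltr01 divr_gt0.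
have [N1 h1] := ha _ d0; have [N2 h2] := hb _ d0.
exists (maxn N1 N2) => n; rewrite geq_max => /andP[/h1 k1 /h2 k2].
have -> : u n ∗ v n - a ∗ b = (u n - a) ∗ (v n - b) + (u n - a) ∗ b + a ∗ (v n - b).
  by rewrite !smulBl !smulBr; lmod.
have d1 : d <= 1 by rewrite /d ge_min lexx.
have de : d * (1 + nr a + nr b) <= e.
  by rewrite -ler_pdivlMr// /d ge_min lexx orbT.
apply: (le_trans (nrD _ _)); apply: (le_trans (lerD (nrD _ _) (lexx _))).
have := nrM_le k1 k2; have := nrM_le k1 (lexx (nr b)).
have := nrM_le (lexx (nr a)) k2; have := d0; nra.
Qed.

Lemma ncv_star (u : nat -> A) a : ncv u a -> ncv (fun n => (u n)^†) a^†.
Proof. by move=> h e /h [N hN]; exists N => n /hN; rewrite -starB nr_star. Qed.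

End Norm.

Section SumLimits.
Context {V : normedZmodType R[i]}.
Implicit Types (u v : nat -> V).

Lemma ncv_cst (a : V) : ncv (fun=> a) a.
Proof. by move=> e e0; exists 0%N => n _; rewrite subrr nr0 ltW. Qed.

Lemma ncvD u v a b : ncv u a -> ncv v b -> ncv (fun n => u n + v n) (a + b).
Proof.
move=> ha hb e e0; have e20 : 0 < e / 2 by rewrite divr_gt0.
have [N1 h1] := ha _ e20; have [N2 h2] := hb _ e20.
exists (maxn N1 N2) => n; rewrite geq_max => /andP[/h1 k1 /h2 k2].
rewrite opprD addrACA; apply: (le_trans (nrD _ _)); lra.
Qed.

Lemma ncv_ext u v a : u =1 v -> ncv u a -> ncv v a.
Proof. by move=> uv h e /h [N hN]; exists N => n /hN; rewrite uv. Qed.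

Lemma ncv_sum n (F : 'I_n -> nat -> V) (l : 'I_n -> V) :
  (forall i, ncv (F i) (l i)) ->
  ncv (fun k => \sum_i F i k) (\sum_i l i).
Proof.
elim: n F l => [|n IH] F l h.
  by rewrite big_ord0; apply: ncv_ext (ncv_cst 0) => k; rewrite big_ord0.
rewrite big_ord_recl; apply: (@ncv_ext (fun k => F ord0 k + \sum_i F (lift ord0 i) k)).
  by move=> k; rewrite big_ord_recl.
by apply: ncvD => //; apply: IH.
Qed.

End SumLimits.

Section NormedLimits.
Context {V : normedModType R[i]}.
Implicit Types (u v : nat -> V).

Lemma ncvZ u a c : ncv u a -> ncv (fun n => c *: u n) (c *: a).
Proof.
move=> ha e e0; have P0 : 0 < 1 + nr c by rewrite ltr_pwDl.
have [|N h] := ha (e / (1 + nr c)); first by rewrite divr_gt0.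
exists N => n /h; rewrite -scalerBr nrZ ler_pdivlMr// => k.
have := nr_ge0 (u n - a); nra.
Qed.

Lemma ncvB u v a b : ncv u a -> ncv v b -> ncv (fun n => u n - v n) (a - b).
Proof.
move=> ha /(ncvZ (-1)) hb; rewrite -[- b]scaleN1r; apply: ncv_ext (ncvD ha hb) => n; by rewrite scaleN1r.
Qed.

Lemma ncv_le u a (r : R) : (forall n, nr (u n) <= r) -> ncv u a -> nr a <= r.
Proof.
move=> hu ha; apply/ler_addgt0Pl => e e0; have [N h] := ha _ e0.
have -> : a = u N - (u N - a) by rewrite opprB addrC subrK.
by apply: (le_trans (nrB _ _)); rewrite addrC; apply: lerD => //; apply: h.
Qed.

End NormedLimits.

End StarTheory.

(** For identities between noncommutative polynomials: products are expanded and reassociated, and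
    the monomials become the atoms of [lmod]. *)
Ltac nc :=
  rewrite ?(smulDl, smulDr, smulNl, smulNr, smulZl, smulZr, smul0x, smulx0,
            smul1x, smulx1) ?smulA; lmod.


(** * Square roots and positivity *)

Section SquareRoot.
Context {R : realType}.

Lemma conjCR (r : R) : (r%:C^* = r%:C :> R[i])%R.
Proof. by rewrite conj_Creal// complex_real. Qed.

Lemma starR (A : starAlgType R[i]) (r : R) (x : A) : (r%:C *: x)^† = r%:C *: x^†.
Proof. by rewrite starZ conjCR. Qed.

(** The scalar majorant of [ssq]. Its fixed point 1 is a double root of [t = (1 + t^2) / 2]; the gap
    [d = 1 - t] evolves by [d - d^2 / 2], which explains the slow rate [2 / (n+2)]. *)
Fixpoint tsq (n : nat) : R := if n is m.+1 then (1 + tsq m ^+ 2) / 2 else 0.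

Lemma tsq_bounds n : [/\ 0 <= tsq n, tsq n <= 1 & 1 - tsq n <= 2 / n.+2%:R].
Proof.
elim: n => [|n [h0 h1 h2]] /=; first by split=> //; rewrite ?ler01// subr0 divff.
split; [nra|nra|].
have n0 : 0 <= n%:R :> R by [].
have e : (n.+2%:R = n%:R + 2 :> R) * (n.+3%:R = n%:R + 3 :> R).
  by split; [rewrite -(addn2 n) natrD|rewrite -(addn3 n) natrD].
move: h2; rewrite !e ler_pdivlMr; last by lra.
rewrite ler_pdivlMr; last by lra.
move: (tsq n) h0 h1 => t h0 h1 h2.
set d := 1 - t in h2; have -> : t = 1 - d by rewrite /d; ring.
have d0 : 0 <= d by rewrite /d; lra.
have d1 : d <= 1 by rewrite /d; lra.
nra.
Qed.

Context {A : ucstarType R}.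
Implicit Types x y z h k : A.

Lemma star1 : (𝟏 : A)^† = 𝟏.
Proof. by rewrite -[LHS]smulx1 -{2}[𝟏]starK -starM smulx1 starK. Qed.

Lemma nr1 : nr (𝟏 : A) <= 1.
Proof.
have := nrS (𝟏 : A); rewrite star1 smul1x => h.
by have := nr_ge0 (𝟏 : A); nra.
Qed.

(** Iteration for [y = (x + y^2) / 2], that is, [(1 - y)^2 = 1 - x]. Norms and increments are
    dominated by those of [tsq], so it converges on the whole closed unit ball, boundary
    included. *)
Fixpoint ssq x n : A :=
  if n is m.+1 then (2^-1)%:C *: (x + ssq x m ∗ ssq x m) else 0.

Lemma ssq_le x n : nr x <= 1 -> nr (ssq x n) <= tsq n.
Proof.
move=> x1; elim: n => [|n IH] /=; first by rewrite nr0.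
rewrite nrZR ger0_norm ?invr_ge0// mulrC ler_pM2r ?invr_gt0//.
apply: le_trans (nrD _ _) _; apply: lerD => //.
by rewrite expr2; apply: nrM_le.
Qed.

Lemma ssq_sub x n m : nr x <= 1 -> (n <= m)%N ->
  nr (ssq x m - ssq x n) <= tsq m - tsq n.
Proof.
move=> x1; elim: n m => [|n IH] [|m] //= nm; rewrite ?subrr ?nr0//.
  rewrite !subr0; exact: (ssq_le m.+1).
have -> : (2^-1)%:C *: (x + ssq x m ∗ ssq x m) - (2^-1)%:C *: (x + ssq x n ∗ ssq x n)
  = (2^-1)%:C *: (ssq x m ∗ (ssq x m - ssq x n) + (ssq x m - ssq x n) ∗ ssq x n).
  by nc.
rewrite nrZR ger0_norm ?invr_ge0//.
have h1 := nrM_le (ssq_le m x1) (IH _ nm).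
have h2 := nrM_le (IH _ nm) (ssq_le n x1).
have := nrD (ssq x m ∗ (ssq x m - ssq x n)) ((ssq x m - ssq x n) ∗ ssq x n).
lra.
Qed.

(** This is [1 - sqrt (1 - x)] when [nr x <= 1]; the value is 0 if the iteration has no limit. *)
Definition slim x : A := xget 0 [set l | ncv (ssq x) l].

Lemma slimP x : nr x <= 1 -> ncv (ssq x) (slim x).
Proof.
move=> x1; suff [l hl] : exists l, ncv (ssq x) l by exact: (xgetPex 0 (ex_intro _ l hl)).
apply: ncauchy_ncv => e e0.
have [|N hN] := @invS_small R (e / 2); first by rewrite divr_gt0.
have k n : (N <= n)%N -> 1 - tsq n <= e.
  move=> Nn; have [_ _ h] := tsq_bounds n; apply: (le_trans h).
  by have := hN n.+1 (leqW Nn); move: (n.+2%:R^-1) => z; lra.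
exists N => m n; wlog mn : m n / (m <= n)%N => [hw mN nN|mN nN].
  by have [/hw|/ltnW/hw] := leqP m n => [->//|h]; rewrite nrC h.
rewrite nrC; apply: (le_trans (ssq_sub x1 mn)).
have := k _ mN; have [] := tsq_bounds n; lra.
Qed.

(** An explicit rate, for use where the number of iterations is weighed against the growth of a
    commutator. *)
Lemma slim_approx x n : nr x <= 1 -> nr (slim x - ssq x n) <= 2 / n.+2%:R.
Proof.
move=> x1; have [_ _] := tsq_bounds n; apply: le_trans.
apply: (@ncv_le _ _ (fun m => ssq x (m + n) - ssq x n)) => [m|].
  apply: le_trans (ssq_sub x1 (leq_addl _ _)) _.
  by have [_ h _] := tsq_bounds (m + n); lra.
apply: ncvB (ncv_cst _) => e /(slimP x1)[N h]; exists N => m Nm.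
by apply: h; rewrite (leq_trans Nm)// leq_addr.
Qed.

Lemma slim_le x : nr x <= 1 -> nr (slim x) <= 1.
Proof.
move=> x1; apply: ncv_le (slimP x1) => n; apply: le_trans (ssq_le n x1) _.
by have [] := tsq_bounds n.
Qed.

Lemma slim_sq x : nr x <= 1 -> (𝟏 - slim x) ∗ (𝟏 - slim x) = 𝟏 - x.
Proof.
move=> x1; have hl := slimP x1; set s := slim x in hl *.
have e : s = (2^-1)%:C *: (x + s ∗ s).
  apply: (@ncv_uniq _ _ (fun n => ssq x n.+1)).
    by move=> e /hl[N h]; exists N => n Nn; apply: h; exact: leqW.
  by apply: ncvZ; apply: ncvD (ncv_cst _) (ncvM hl hl).
have e2 : s ∗ s = 2 *: s - x.
  rewrite {3}e scalerA (_ : 2 * (2^-1)%:C = 1) ?scale1r; first by lmod.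
  by rewrite fmorphV rmorph_nat divff ?pnatr_eq0.
rewrite smulBl !smulBr !smul1x smulx1 e2; lmod.
Qed.

Lemma slim_sa x : nr x <= 1 -> x^† = x -> (slim x)^† = slim x.
Proof.
move=> x1 xs; apply: (ncv_uniq (ncv_star (slimP x1))).
apply: ncv_ext (slimP x1) => n; elim: n => [|n IH] /=; first by rewrite star0.
by rewrite starR starD starM -IH xs.
Qed.

Lemma slim_comm x y : nr x <= 1 -> y ∗ x = x ∗ y -> y ∗ slim x = slim x ∗ y.
Proof.
move=> x1 c; apply: (ncv_uniq (ncvM (ncv_cst y) (slimP x1))).
apply: ncv_ext (ncvM (slimP x1) (ncv_cst y)) => n /=.
elim: n => [|n IH] /=; first by rewrite smul0x smulx0.
by rewrite smulZl smulZr smulDl smulDr c -!smulA IH !smulA IH.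
Qed.

End SquareRoot.

(** * Positive elements, their square roots and the order *)

Section Positivity.
Context {R : realType} {A : ucstarType R}.
Implicit Types x y z h k a b u v w m s : A.

(** Squares of self-adjoint elements, so that no spectrum has to be formed. That each [y^† ∗ y] is
    such a square is [posS]. *)
Definition pos h := exists2 k, k^† = k & h = k ∗ k.

Lemma pos_sa h : pos h -> h^† = h.
Proof. by case=> k ks ->; rewrite starM ks. Qed.

Lemma pos0 : pos 0.
Proof. by exists 0; rewrite ?star0 ?smul0x. Qed.

Lemma pos1 : pos 𝟏.
Proof. by exists 𝟏; rewrite ?star1 ?smul1x. Qed.

Lemma posZ (r : R) h : 0 <= r -> pos h -> pos (r%:C *: h).
Proof.
move=> r0 [k ks ->]; exists ((Num.sqrt r)%:C *: k); first by rewrite starR ks.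
by rewrite smulZl smulZr scalerA -rmorphM -expr2 sqr_sqrtr.
Qed.

Lemma saZ (r : R) x : x^† = x -> (r%:C *: x)^† = r%:C *: x.
Proof. by move=> h; rewrite starR h. Qed.

Lemma saB x y : x^† = x -> y^† = y -> (x - y)^† = x - y.
Proof. by rewrite starB => -> ->. Qed.

Lemma saD x y : x^† = x -> y^† = y -> (x + y)^† = x + y.
Proof. by rewrite starD => -> ->. Qed.

Lemma saM x y : x^† = x -> y^† = y -> x ∗ y = y ∗ x -> (x ∗ y)^† = x ∗ y.
Proof. by rewrite starM => -> ->. Qed.

(** The hypothesis says [h = t (1 - x)] with [nr x <= 1], so [sqrt t (1 - slim x)] is a root. It is
    a limit of polynomials in [h], whence the commutation. *)
Lemma ball_pos h (t : R) : h^† = h -> 0 < t -> nr (t%:C *: 𝟏 - h) <= t ->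
  exists k, [/\ k^† = k, h = k ∗ k, pos k & forall y, y ∗ h = h ∗ y -> y ∗ k = k ∗ y].
Proof.
move=> hs t0 ht; pose x := 𝟏 - (t^-1)%:C *: h.
have xs : x^† = x by rewrite /x saB ?star1 ?saZ.
have tt : (t%:C * (t^-1)%:C = 1 :> R[i])%R by rewrite -rmorphM divff ?gt_eqF ?rmorph1.
have x1 : nr x <= 1.
  have -> : x = (t^-1)%:C *: (t%:C *: 𝟏 - h).
    by rewrite scalerBr scalerA mulrC tt scale1r.
  by rewrite nrZR gtr0_norm ?invr_gt0// ler_pdivrMl// mulr1.
have [s1 ss] := (slim_le x1, slim_sa x1 xs).
set s := slim x in s1 ss.
have s2 : (𝟏 - s) ∗ (𝟏 - s) = (t^-1)%:C *: h.
  by rewrite slim_sq// /x opprB addrCA subrr addr0.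
exists ((Num.sqrt t)%:C *: (𝟏 - s)); split.
- by rewrite saZ// saB// star1.
- rewrite smulZl smulZr scalerA -rmorphM -expr2 sqr_sqrtr 1?ltW// s2.
  by rewrite scalerA tt scale1r.
(* [nr s <= 1] makes [1 - s] itself a square, that of [1 - slim s]. *)
- apply: posZ; first exact: sqrtr_ge0.
  exists (𝟏 - slim s); last by rewrite slim_sq.
  by rewrite saB ?star1// slim_sa.
- move=> y c; rewrite smulZl smulZr; congr (_ *: _).
  rewrite smulBl smulBr smulx1 smul1x slim_comm// /x smulBl smulBr smulx1 smul1x.
  by rewrite smulZl smulZr c.
Qed.

Lemma half_sum (c : R[i]) x : c + c = 1 -> c *: x + c *: x = x.
Proof. by rewrite -scalerDl => ->; rewrite scale1r. Qed.

Lemma unitary_le u : u^† ∗ u = 𝟏 -> nr u <= 1.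
Proof.
by move=> h; have := nrS u; rewrite h => k; have := @nr1 R A; have := nr_ge0 u; nra.
Qed.

(** [k + i m] is unitary. *)
Lemma pythagoras_le k m : k^† = k -> m^† = m -> k ∗ m = m ∗ k ->
  k ∗ k + m ∗ m = 𝟏 -> nr k <= 1 /\ nr m <= 1.
Proof.
move=> ks ms c e; pose u := k + 'i *: m.
have us : u^† = k - 'i *: m by rewrite starD starZ ks ms conjCi scaleNr.
have i2 : 'i * 'i = -1 :> R[i] by rewrite -expr2 sqrCi.
have u1 : nr u <= 1.
  apply: unitary_le; rewrite us -e smulBl !smulDr !smulZl !smulZr c scalerA i2.
  by rewrite scaleN1r; lmod.
have u2 : nr u^† <= 1 by rewrite nr_star.
have n2 : nr (2 : R[i]) = 2 by rewrite -(rmorph_nat (real_complex R)) nrR ger0_norm.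
have ni : nr ('i : R[i]) = 1 by rewrite /nr normCi.
split.
  have : nr (2 *: k) <= 2.
    have -> : 2 *: k = u + u^† by rewrite us /u; lmod.
    by apply: le_trans (nrD _ _) _; lra.
  by rewrite nrZ n2; lra.
have : nr ((2 * 'i) *: m) <= 2.
  have -> : (2 * 'i) *: m = u - u^† by rewrite us /u; lmod.
  by apply: le_trans (nrB _ _) _; lra.
have -> : nr ((2 * 'i) *: m) = 2 * nr m by rewrite -scalerA nrZ nrZ n2 ni mul1r.
lra.
Qed.

(** The bound is 1 although the triangle inequality gives 2: for [m] the root of [1 - k ∗ k], the
    element [k + i m] is unitary, so [m] is a contraction. *)
Lemma sq_ball k : k^† = k -> nr k <= 1 -> nr (𝟏 - k ∗ k) <= 1.
Proof.
move=> ks k1; have k2 : nr (k ∗ k) <= 1 by rewrite -[1]mulr1 nrM_le.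
pose m := 𝟏 - slim (k ∗ k).
have ms : m^† = m by rewrite saB ?star1 ?slim_sa// starM ks.
have m2 : m ∗ m = 𝟏 - k ∗ k by rewrite slim_sq.
rewrite -m2; suff m1 : nr m <= 1 by rewrite -[1]mulr1 nrM_le.
apply: (proj2 (pythagoras_le ks ms _ _)); last by rewrite m2 addrC subrK.
by rewrite /m smulBl smulBr smul1x smulx1 slim_comm// smulA.
Qed.

(** Converse of [ball_pos]. Positivity thus becomes a norm inequality, stable under sums and limits:
    see [posD] and [pos_lim]. *)
Lemma pos_ball h (t : R) : pos h -> nr h <= t -> nr (t%:C *: 𝟏 - h) <= t.
Proof.
move=> [k ks ->] ht; have [t0|t0] := eqVneq t 0.
  rewrite t0 in ht *; have -> : k ∗ k = 0 by exact: nr_le0.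
  by rewrite scale0r subr0 nr0.
have tp : 0 < t by rewrite lt_def t0 (le_trans _ ht).
pose j := ((Num.sqrt t)^-1)%:C *: k.
have jj : j ∗ j = (t^-1)%:C *: (k ∗ k).
  by rewrite /j smulZl smulZr scalerA -rmorphM -invfM -expr2 sqr_sqrtr 1?ltW.
have js : j^† = j by rewrite saZ.
have /(sq_ball js) : nr j <= 1.
  rewrite -(@expr_le1 _ 2)// -nr_sa2// jj nrZR gtr0_norm ?invr_gt0//.
  by rewrite ler_pdivrMl// mulr1.
rewrite jj => hj; rewrite (_ : _ - _ = t%:C *: (𝟏 - (t^-1)%:C *: (k ∗ k))).
  by rewrite nrZR gtr0_norm// -[X in _ <= X]mulr1 ler_pM2l.
by rewrite scalerBr scalerA -rmorphM divff// scale1r.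
Qed.

Lemma pos_sqrt h : pos h ->
  exists k, [/\ k^† = k, h = k ∗ k, pos k & forall y, y ∗ h = h ∗ y -> y ∗ k = k ∗ y].
Proof.
move=> hp; apply: (@ball_pos h (nr h + 1)); first exact: pos_sa.
  by have := nr_ge0 h; lra.
by apply: pos_ball => //; lra.
Qed.

Lemma posD a b : pos a -> pos b -> pos (a + b).
Proof.
move=> ap bp.
have [||//|k [ks -> _ _]] := @ball_pos (a + b) (nr a + 1 + nr b).
- by rewrite saD ?pos_sa.
- by have := nr_ge0 a; have := nr_ge0 b; lra.
- have -> : (nr a + 1 + nr b)%:C *: 𝟏 - (a + b) =
    ((nr a + 1)%:C *: 𝟏 - a) + ((nr b)%:C *: 𝟏 - b).
    by rewrite (rmorphD (real_complex R) _ (nr b)); lmod.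
  apply: le_trans (nrD _ _) (lerD _ _); apply: pos_ball => //; lra.
- by exists k.
Qed.

Lemma pos_sum I (r : seq I) (P : pred I) (F : I -> A) :
  (forall i, P i -> pos (F i)) -> pos (\sum_(i <- r | P i) F i).
Proof. by move=> h; apply: big_ind => //; [exact: pos0|exact: posD]. Qed.

Lemma pos_lim (u : nat -> A) h : (forall n, pos (u n)) -> ncv u h -> pos h.
Proof.
move=> up uh; have [N hN] := uh 1 ltr01.
have [||//|k [ks -> _ _]] := @ball_pos h (nr h + 1).
- apply: (ncv_uniq (ncv_star uh)); apply: ncv_ext uh => n; by rewrite pos_sa.
- by have := nr_ge0 h; lra.
- apply: (@ncv_le _ _ (fun n => (nr h + 1)%:C *: 𝟏 - u (n + N)%N)) => [n|].
    apply: pos_ball => //; have := hN (n + N)%N (leq_addl _ _).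
    have := nrD (u (n + N)%N - h) h; rewrite subrK; lra.
  apply: ncvB; first exact: ncv_cst.
  move=> e /uh [M hM]; exists M => n Mn; apply: hM; by rewrite (leq_trans Mn)// leq_addr.
- by exists k.
Qed.

(** Roots [k] of [h] and [l] of [-h] commute, so [z = k + i l] has [z^† z = k^2 + l^2 = 0], and [k]
    is half of [z + z^†]. *)
Lemma pos_anti h : pos h -> pos (- h) -> h = 0.
Proof.
move=> /pos_sqrt[k [ks hk _ ck]] /pos_sqrt[l [ls hl _ cl]].
have c : k ∗ l = l ∗ k by apply: cl; rewrite smulNl smulNr hk smulA.
pose z := k + 'i *: l.
have zs : z^† = k - 'i *: l by rewrite starD starZ ks ls conjCi scaleNr.
have i2 : 'i * 'i = -1 :> R[i] by rewrite -expr2 sqrCi.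
have : z^† ∗ z = 0.
  rewrite zs smulBl !smulDr !smulZl !smulZr c scalerA i2 scaleN1r -hl -hk; lmod.
move=> /sS_eq0 z0; have k0 : 2 *: k = z + z^† by rewrite zs /z; lmod.
move: k0; rewrite z0 star0 addr0 => /eqP; rewrite scaler_eq0 pnatr_eq0 /= => /eqP k0.
by rewrite hk k0 smul0x.
Qed.

Lemma pos_add0 a b : pos a -> pos b -> a + b = 0 -> a = 0.
Proof. by move=> ap bp e; apply: pos_anti => //; rewrite -(addKr a b) e addr0 in bp. Qed.

Lemma cartesian w : exists x y, [/\ x^† = x, y^† = y, w = x + 'i *: y &
  w^† ∗ w + w ∗ w^† = 2 *: (x ∗ x + y ∗ y)].
Proof.
have i2 : 'i * 'i = -1 :> R[i] by rewrite -expr2 sqrCi.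
have n2 : (2 : R[i]) != 0 by rewrite pnatr_eq0.
have ni : ('i : R[i]) != 0 by rewrite neq0Ci.
have c2 : ((2^-1 : R[i])^* = 2^-1)%R by rewrite fmorphV rmorph_nat.
pose x := 2^-1 *: (w + w^†); pose y := (- ('i / 2)) *: (w - w^†).
have xs : x^† = x by rewrite starZ starD starK c2 addrC.
have ys : y^† = y.
  rewrite starZ starB starK rmorphN rmorphM /= conjCi c2 mulNr opprK /y.
  by rewrite scaleNr -scalerN opprB.
have e : w = x + 'i *: y.
  have h2 : 'i * (- ('i / 2)) = 2^-1 :> R[i] by rewrite mulrN mulrA i2 mulN1r opprK.
  rewrite /x /y !scalerA h2 !scalerDr scalerN addrACA subrr addr0.
  by rewrite half_sum// [RHS]splitr mul1r.
exists x, y; split=> //.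
clearbody x y; rewrite e starD starZ xs ys conjCi.
rewrite ?(smulDl, smulDr, smulNl, smulNr, smulZl, smulZr) ?scalerA.
rewrite ?scaleNr ?scalerDr ?scalerA i2; lmod.
Qed.

(** [w^† w + w w^†] is twice [x^2 + y^2], positive in any case and here also negative, so the
    Cartesian parts of [w] vanish. *)
Lemma negS_both w a b : a^† = a -> b^† = b ->
  w^† ∗ w = - (a ∗ a) -> w ∗ w^† = - (b ∗ b) -> w = 0.
Proof.
move=> as_ bs ha hb; have [x [y [xs ys e h]]] := cartesian w.
have px : pos (x ∗ x) by exists x.
have py : pos (y ∗ y) by exists y.
have p2 : (2 : R[i]) = (2 : R)%:C by rewrite rmorph_nat.
have s0 : x ∗ x + y ∗ y = 0.
  apply: pos_anti; first exact: posD.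
  have -> : - (x ∗ x + y ∗ y) = (2^-1)%:C *: (a ∗ a + b ∗ b).
    have -> : a ∗ a + b ∗ b = - (2 *: (x ∗ x + y ∗ y)) by rewrite -h ha hb; lmod.
    by rewrite scalerN scalerA p2 -rmorphM mulVf ?pnatr_eq0// scale1r.
  by apply: posZ; rewrite ?invr_ge0//; apply: posD; [exists a|exists b].
have x0 : x = 0 by apply: sa2_eq0 => //; exact: pos_add0 s0.
have y0 : y = 0 by apply: sa2_eq0 => //; rewrite addrC in s0; exact: pos_add0 s0.
by rewrite e x0 y0 scaler0 addr0.
Qed.

(** Now [z z^† = 2 (x^2 + y^2) + s^2] is positive, say [p^2]. For [w = s z^†] both [w^† w = - p^4]
    and [w w^† = - s^4], so [w = 0]; then [(z z^†)^2 = - z s s z^† = 0]. *)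
Lemma negS z s : s^† = s -> z^† ∗ z = - (s ∗ s) -> z = 0.
Proof.
move=> ss hz; have [x [y [xs ys _ h]]] := cartesian z.
have /pos_sqrt[p [ps hp _ _]] : pos (z ∗ z^†).
  have -> : z ∗ z^† = 2%:C *: (x ∗ x + y ∗ y) + s ∗ s.
    by rewrite rmorph_nat -h hz; lmod.
  by apply: posD; [apply: posZ => //; apply: posD; [exists x|exists y]|exists s].
have z10 : s ∗ z^† = 0.
  apply: (@negS_both _ (p ∗ p) (s ∗ s)); rewrite ?starM ?starK ?ps ?ss//.
    rewrite -smulA (smulA s) -[s ∗ s]opprK -hz smulNl smulNr !smulA hp.
    by rewrite -!smulA hp.
  by rewrite smulA -(smulA s) hz smulNr smulNl !smulA.
apply: star_inj; rewrite star0; apply: sS_eq0; rewrite starK.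
apply: sa2_eq0; first by rewrite starM starK.
rewrite smulA -(smulA z) hz smulNr smulNl -!smulA.
by rewrite z10 !smulx0 oppr0.
Qed.

(** With [h = y^† y] and [k = |h|], the element [a = k - h] is twice the negative part and
    [h a = - k a]. Hence [(y a)^† (y a) = a h a] is minus a square, so [y a = 0] by [negS]; then
    [h a], [k a] and [a] vanish, and [h = k]. *)
Lemma posS y : pos (y^† ∗ y).
Proof.
set h := y^† ∗ y; have hs : h^† = h by rewrite starM starK.
have /pos_sqrt[k [ks hk /pos_sqrt[l [ls kl _ cl]] ck]] : pos (h ∗ h) by exists h.
have hkc : h ∗ k = k ∗ h by apply: ck; rewrite smulA.
pose a := k - h; have as_ : a^† = a by rewrite saB.
have ak : a ∗ k = k ∗ a by rewrite smulBl smulBr hkc.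
have al : a ∗ l = l ∗ a by apply: cl.
have ha : h ∗ a = - (k ∗ a) by rewrite !smulBr hk hkc; lmod.
have z0 : y ∗ a = 0.
  apply: (@negS _ (l ∗ a)); first by rewrite saM.
  rewrite starM as_ -smulA (smulA y^†) -/h ha smulNr; congr (- _).
  by rewrite -{1}al kl -!smulA.
have ha0 : h ∗ a = 0 by rewrite -smulA z0 smulx0.
have : a ∗ a = 0.
  rewrite {1}/a smulBl ha0 subr0; move: ha; rewrite ha0 => /esym/eqP.
  by rewrite oppr_eq0 => /eqP.
by move=> /(sa2_eq0 as_)/eqP; rewrite subr_eq0 => /eqP <-; exists l.
Qed.

Lemma pos_conj z h : pos h -> pos (z^† ∗ h ∗ z).
Proof.
move=> [k ks ->]; rewrite smulA -smulA -{1}ks -starM; exact: posS.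
Qed.

Lemma pos_comm a b : pos a -> pos b -> a ∗ b = b ∗ a -> pos (a ∗ b).
Proof.
move=> /pos_sqrt[k [ks -> _ ck]] /pos_sqrt[l [ls -> _ cl]] c.
have c1 : l ∗ l ∗ k = k ∗ (l ∗ l) by apply: ck.
have c2 : k ∗ l = l ∗ k by apply: cl.
exists (k ∗ l); first by rewrite saM.
by rewrite -!smulA; congr (k ∗ _); rewrite !smulA c2.
Qed.

(** The roots [k] of [h / r] and [l] of [1 - h / r] commute and satisfy [k^2 + l^2 = 1], hence are
    contractions. *)
Lemma pos_le_nr h (r : R) : pos h -> pos (r%:C *: 𝟏 - h) -> 0 <= r -> nr h <= r.
Proof.
move=> hp hr; rewrite le_eqVlt => /orP[/eqP r0|r0].
  move: hr; rewrite -r0 scale0r sub0r => hr.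
  by rewrite (pos_anti hp hr) nr0.
have rr : (r^-1)%:C * r%:C = 1 :> R[i] by rewrite -rmorphM mulVf ?gt_eqF.
have /pos_sqrt[k [ks hk _ ck]] : pos ((r^-1)%:C *: h).
  by apply: posZ hp; rewrite invr_ge0 ltW.
have /pos_sqrt[l [ls hl _ cl]] : pos ((r^-1)%:C *: (r%:C *: 𝟏 - h)).
  by apply: posZ hr; rewrite invr_ge0 ltW.
have c : k ∗ l = l ∗ k.
  apply: cl; rewrite scalerBr scalerA rr scale1r hk smulBl smulBr.
  by rewrite smul1x smulx1 !smulA.
have [] := pythagoras_le ks ls c.
  by rewrite -hk -hl scalerBr scalerA rr scale1r addrC subrK.
move=> k1 _; have : nr ((r^-1)%:C *: h) <= 1 by rewrite hk -[1]mulr1 nrM_le.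
by rewrite nrZR gtr0_norm ?invr_gt0// ler_pdivrMl// mulr1.
Qed.

Lemma nr_le_pos h (r : R) : h^† = h -> nr h <= r -> pos (r%:C *: 𝟏 - h).
Proof.
move=> hs hr; have [r0|r0] := eqVneq r 0.
  have -> : h = 0 by apply: nr_le0; rewrite -r0.
  by rewrite r0 scale0r subr0; exact: pos0.
have rp : 0 < r by rewrite lt_def r0 (le_trans _ hr).
have [|//||k [ks -> _ _]] := @ball_pos (r%:C *: 𝟏 - h) r; last by exists k.
  by rewrite saB ?saZ ?star1.
by rewrite opprB addrCA subrr addr0.
Qed.

Lemma nr_mono a b : pos a -> pos (b - a) -> nr a <= nr b.
Proof.
move=> ap ba; have bp : pos b by rewrite -(subrK a b); exact: posD.
apply: pos_le_nr => //.
have -> : (nr b)%:C *: 𝟏 - a = ((nr b)%:C *: 𝟏 - b) + (b - a) by lmod.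
by apply: posD => //; apply: nr_le_pos => //; exact: pos_sa.
Qed.

(** Norm bounds as order relations: contractivity of homomorphisms and of completely positive maps
    is read off in this form. *)
Lemma nrP x (r : R) : 0 <= r -> pos ((r ^+ 2)%:C *: 𝟏 - x^† ∗ x) <-> nr x <= r.
Proof.
move=> r0; split=> [h|h].
  have : nr (x^† ∗ x) <= r ^+ 2 by apply: pos_le_nr => //; [exact: posS|exact: sqr_ge0].
  by rewrite nrS ler_pXn2r// nnegrE.
apply: nr_le_pos; first by rewrite starM starK.
by rewrite nrS ler_pXn2r// nnegrE.
Qed.

Lemma conj_le x h (r : R) : h^† = h -> nr h <= r ->
  pos (r%:C *: (x^† ∗ x) - x^† ∗ h ∗ x).
Proof.
move=> hs /(nr_le_pos hs) /(pos_conj x).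
by rewrite smulBr smulZr smulBl smulZl smulx1.
Qed.

(** [a] and [a - y] are the positive and negative parts [(|y| + y) / 2] and [(|y| - y) / 2].
    Orthogonality is a computation; positivity of both is the same statement [H], with the roles of
    [b] and [c] exchanged. *)
Lemma sa_parts y : y^† = y -> exists a, [/\ pos a, pos (a - y),
  a ∗ (a - y) = 0 & forall z, z ∗ y = y ∗ z -> z ∗ a = a ∗ z].
Proof.
move=> ys.
have /pos_sqrt[k [ks hk kp ck]] : pos (y ∗ y) by exists y.
have ky : y ∗ k = k ∗ y by apply: ck; rewrite smulA.
suff H b c : b^† = b -> c^† = c -> b ∗ c = 0 -> c ∗ b = 0 -> b + c = 2 *: k ->
    b ∗ k = k ∗ b -> pos b.
  pose b := k + y; pose c := k - y.
  have bc : b ∗ c = 0 by rewrite /b /c smulDl !smulBr ky hk; lmod.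
  have cb : c ∗ b = 0 by rewrite /b /c smulBl !smulDr ky hk; lmod.
  have [bs cs] : b^† = b /\ c^† = c by rewrite saD// saB.
  have bp : pos b.
    apply: (H b c) => //; first by rewrite /b /c; lmod.
    by rewrite smulDl smulDr ky.
  have cp : pos c.
    apply: (H c b) => //; first by rewrite /b /c; lmod.
    by rewrite smulBl smulBr ky.
  have h2 : (2^-1)%:C + (2^-1)%:C = 1 :> R[i].
    by rewrite -rmorphD -[X in _ = X](rmorph1 (real_complex R)) [X in _ = X%:C]splitr mul1r.
  have e : (2^-1)%:C *: b - y = (2^-1)%:C *: c.
    by rewrite -[X in _ - X](half_sum y h2) /b /c; lmod.
  exists ((2^-1)%:C *: b); rewrite e; split.
  - by apply: posZ bp; rewrite invr_ge0.
  - by apply: posZ cp; rewrite invr_ge0.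
  - by rewrite smulZl smulZr bc !scaler0.
  - move=> z zy; rewrite smulZl smulZr smulDl smulDr zy ck// smulA zy -smulA zy.
    by rewrite smulA.
move=> bs cs bc cb bck bk.
(* Let [n = |b|]. From [c b = 0] follows [n c = 0], so [n b = 2 n k] is positive. For [d = n - b]
   one has [b d = - n d], so [- (n d)^2 = d n b d] is positive; hence [n d = 0] and [d = 0]. *)
have /pos_sqrt[n [ns hn np cn]] : pos (b ∗ b) by exists b.
have nb : b ∗ n = n ∗ b by apply: cn; rewrite smulA.
have nk : k ∗ n = n ∗ k by apply: cn; rewrite smulA -bk -smulA -bk smulA.
have nc0 : n ∗ c = 0.
  by apply: sS_eq0; rewrite starM ns cs smulA -(smulA c) -hn !smulA cb !smul0x.
have nbp : pos (n ∗ b).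
  have -> : n ∗ b = 2%:C *: (n ∗ k).
    by rewrite rmorph_nat -smulZr -bck smulDr nc0 addr0.
  by apply: posZ => //; apply: pos_comm.
pose d := n - b; have ds : d^† = d by rewrite saB.
have bd : b ∗ d = - (n ∗ d) by rewrite /d !smulBr hn nb; lmod.
have dn : d ∗ n = n ∗ d by rewrite /d smulBl smulBr nb.
have nd0 : n ∗ d = 0.
  apply: sa2_eq0; first by rewrite saM.
  apply: pos_anti; first by exists (n ∗ d) => //; rewrite saM.
  rewrite -smulNr -bd -{1}dn smulA -(smulA d n b) -[d ∗ _ ∗ _]smulA -{1}ds smulA.
  exact: pos_conj.
have : d ∗ d = 0 by rewrite {1}/d smulBl bd nd0 oppr0 subr0.
by move=> /(sa2_eq0 ds)/eqP; rewrite subr_eq0 => /eqP <-.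
Qed.

Lemma geometric_small (r : R) : 0 <= r -> r < 1 -> forall e, 0 < e ->
  exists N, forall n, (N <= n)%N -> r ^+ n <= e.
Proof.
move=> r0 r1 e e0.
have : r ^+ n @[n --> \oo] --> (0 : R) by apply: cvg_expr; rewrite ger0_norm.
move=> /cvgrPdist_le/(_ _ e0)[N _ h]; exists N => n /h /=.
by rewrite sub0r normrN ger0_norm ?exprn_ge0.
Qed.

Fixpoint upow x n : A := if n is m.+1 then x ∗ upow x m else 𝟏.

Lemma upow_comm x y n : y ∗ x = x ∗ y -> y ∗ upow x n = upow x n ∗ y.
Proof.
move=> c; elim: n => [|n IH] /=; first by rewrite smul1x smulx1.
by rewrite smulA c -!smulA IH.
Qed.

Lemma neumann x (r : R) : nr x <= r -> r < 1 ->
  exists v, [/\ (𝟏 - x) ∗ v = 𝟏, x^† = x -> v^† = v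
              & forall y, y ∗ x = x ∗ y -> y ∗ v = v ∗ y].
Proof.
move=> xr r1; have r0 : 0 <= r by exact: le_trans (nr_ge0 x) xr.
pose u n := \sum_(k < n) upow x k.
have uS n : u n.+1 = 𝟏 + x ∗ u n by rewrite /u big_ord_recl smul_sumr.
have up n : nr (upow x n) <= r ^+ n.
  elim: n => [|n IH] /=; first exact: nr1.
  by rewrite exprS; apply: nrM_le.
have ub (n j : nat) : nr (u (n + j)%N - u n) * (1 - r) <= r ^+ n.
  suff : nr (u (n + j)%N - u n) * (1 - r) <= r ^+ n - r ^+ (n + j).
    by have := exprn_ge0 (n + j) r0; lra.
  elim: j => [|j IH]; first by rewrite addn0 !subrr nr0 mul0r.
  rewrite addnS /u big_ord_recr /= -/(u _) addrAC.
  have := nrD (u (n + j)%N - u n) (upow x (n + j)); have := up (n + j)%N.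
  by rewrite exprS; move: (nr (_ + _)) => N; nra.
have [v hv] : exists v, ncv u v.
  apply: ncauchy_ncv => e e0.
  have r10 : 0 < 1 - r by rewrite subr_gt0.
  have [N hN] := geometric_small r0 r1 (mulr_gt0 e0 r10).
  exists N => m n; wlog mn : m n / (m <= n)%N => [hw mN nN|mN nN].
    by have [/hw|/ltnW/hw] := leqP m n => [->//|h]; rewrite nrC h.
  rewrite nrC -(subnKC mn) -(ler_pM2r r10).
  exact: le_trans (ub _ _) (hN _ mN).
exists v; split.
- have e : v = 𝟏 + x ∗ v.
    apply: (@ncv_uniq _ _ (fun n => u n.+1)).
      by move=> e /hv[N h]; exists N => n Nn; apply: h; exact: leqW.
    apply: ncv_ext (ncvD (ncv_cst 𝟏) (ncvM (ncv_cst x) hv)) => n; by rewrite uS.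
  by rewrite smulBl smul1x {1}e addrK.
- move=> xs; apply: (ncv_uniq (ncv_star hv)); apply: ncv_ext hv => n.
  rewrite star_sum; apply: eq_bigr => i _; elim: (i : nat) => [|j IH] /=.
    by rewrite star1.
  by rewrite starM xs -IH upow_comm.
- move=> y c; apply: (ncv_uniq (ncvM (ncv_cst y) hv)).
  apply: ncv_ext (ncvM hv (ncv_cst y)) => n.
  by rewrite smul_suml smul_sumr; apply: eq_bigr => i _; rewrite upow_comm.
Qed.

(** With [t = nr h + e] the element [x = 1 - h / t] has norm at most [1 - e / t], so a Neumann
    series gives [v = t h^(-1)] and [slim] gives [m = (h / t)^(1/2)]; then
    [s = t^(-1/2) m v = h^(-1/2)]. The bound on [nr s] comes from [e s^2 <= s h s = 1]. *)
Lemma inv_sqrt h (e : R) : h^† = h -> 0 < e -> pos (h - e%:C *: 𝟏) ->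
  exists s, [/\ pos s, s ∗ h ∗ s = 𝟏, nr s <= Num.sqrt (e^-1)
              & forall y, y ∗ h = h ∗ y -> y ∗ s = s ∗ y].
Proof.
move=> hs e0 hp.
pose t := nr h + e; have t0 : 0 < t by have := nr_ge0 h; rewrite /t; lra.
have tV : (t^-1)%:C * t%:C = 1 :> R[i] by rewrite -rmorphM mulVf ?gt_eqF.
pose x := 𝟏 - (t^-1)%:C *: h.
have xs : x^† = x by rewrite saB ?star1 ?saZ.
have xr : nr x <= 1 - e / t.
  apply: pos_le_nr.
  - rewrite (_ : x = (t^-1)%:C *: (t%:C *: 𝟏 - h)); last first.
      by rewrite scalerBr scalerA tV scale1r.
    by apply: posZ; rewrite ?invr_ge0 1?ltW//; apply: nr_le_pos => //; rewrite /t; lra.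
  - rewrite (_ : _ - x = (t^-1)%:C *: (h - e%:C *: 𝟏)).
      by apply: posZ; rewrite ?invr_ge0 1?ltW.
    by rewrite rmorphB rmorph1 rmorphM scalerBr scalerA /x [_%:C * e%:C]mulrC; lmod.
  - by rewrite subr_ge0 ler_pdivrMr// mul1r /t; have := nr_ge0 h; lra.
have x1 : nr x <= 1 by apply: (le_trans xr); rewrite gerBl divr_ge0 ?ltW.
have xE : x = 𝟏 - (t^-1)%:C *: h by [].
clearbody x; have [|v [hv vs vc]] := neumann xr; first by rewrite gtrBl divr_gt0.
pose m := 𝟏 - slim x.
have ms : m^† = m by rewrite saB ?star1 ?slim_sa.
have m2 : m ∗ m = 𝟏 - x by rewrite slim_sq.
have mx : m ∗ x = x ∗ m by rewrite /m smulBl smulBr smul1x smulx1 -slim_comm.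
have mv : m ∗ v = v ∗ m by exact: vc.
pose s := (Num.sqrt (t^-1))%:C *: (m ∗ v).
have ss : s^† = s by rewrite saZ// saM// vs.
have hx : h = t%:C *: (m ∗ m).
  by rewrite m2 xE opprB addrCA subrr addr0 scalerA mulrC tV scale1r.
have shs : s ∗ h ∗ s = 𝟏.
  have v2 : v ∗ (m ∗ m) = m ∗ m ∗ v by rewrite smulA -mv -smulA -mv smulA.
  rewrite /s hx !smulZl !smulZr !smulZl scalerA -rmorphM -expr2.
  rewrite sqr_sqrtr ?invr_ge0 1?ltW// scalerA tV scale1r -(smulA m) v2 m2 hv smulx1.
  by rewrite smulA m2.
have sc y : y ∗ h = h ∗ y -> y ∗ s = s ∗ y.
  move=> c; rewrite /s smulZl smulZr; congr (_ *: _).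
  have yx : y ∗ x = x ∗ y by rewrite xE smulBl smulBr smul1x smulx1 smulZl smulZr c.
  have ym : y ∗ m = m ∗ y by rewrite /m smulBr smulBl smul1x smulx1 slim_comm.
  by rewrite smulA ym -smulA vc// smulA.
have sp : pos s.
  apply: posZ; first exact: sqrtr_ge0.
  apply: pos_comm => //.
    have [s1 s2] := (slim_le x1, slim_sa x1 xs).
    exists (𝟏 - slim (slim x)); last by rewrite slim_sq.
    by rewrite saB ?star1// slim_sa.
  exists (m ∗ v); first by rewrite saM// vs.
  by rewrite {1}mv -smulA (smulA m m v) m2 hv smulx1.
clearbody s; exists s; split=> //.
- have := pos_conj s hp; rewrite ss smulBr smulBl shs smulZr smulZl smulx1.
  move=> h1; apply/nrP; first exact: sqrtr_ge0.
  rewrite sqr_sqrtr ?invr_ge0 1?ltW// ss.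
  have -> : (e^-1)%:C *: 𝟏 - s ∗ s = (e^-1)%:C *: (𝟏 - e%:C *: (s^† ∗ s)).
    by rewrite scalerBr scalerA -rmorphM mulVf ?gt_eqF// rmorph1 scale1r ss.
  by apply: posZ; [rewrite invr_ge0 ltW|rewrite ss].
Qed.

End Positivity.

(** * Linear maps and the norm topology *)

Section LinearMaps.
Context {K : numClosedFieldType} {U V : lmodType K} {f : U -> V} (lf : linear f).

Lemma lin0 : f 0 = 0.
Proof. by have := lf (-1) 0 0; rewrite scaler0 addr0 scaleN1r addNr. Qed.
Lemma linD x y : f (x + y) = f x + f y.
Proof. by have := lf 1 x y; rewrite !scale1r. Qed.
Lemma linZ c x : f (c *: x) = c *: f x.
Proof. by have := lf c x 0; rewrite !addr0 lin0 addr0. Qed.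
Lemma linN x : f (- x) = - f x.
Proof. by rewrite -scaleN1r linZ scaleN1r. Qed.
Lemma linB x y : f (x - y) = f x - f y.
Proof. by rewrite linD linN. Qed.
Lemma lin_sum I (r : seq I) (P : pred I) (F : I -> U) :
  f (\sum_(i <- r | P i) F i) = \sum_(i <- r | P i) f (F i).
Proof. by elim/big_rec2: _ => [|i y1 y2 _ <-]; rewrite ?lin0 ?linD. Qed.

End LinearMaps.

Section NormTopology.
Context {R : realType} {V : normedModType R[i]}.
Implicit Types (S : set V) (x y : V).

Lemma ball_nr x y (e : R) : ball x e%:C y <-> nr (x - y) < e.
Proof. by rewrite -ball_normE /= nrE ltcR. Qed.

Lemma closed_nr S : closed S <->
  forall x, (forall e : R, 0 < e -> exists2 y, S y & nr (x - y) <= e) -> S x.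
Proof.
split=> [cS x h|h x cx].
  apply: cS => B /nbhs_ballP[[a b]] /=; rewrite ltcE /= => /andP[/eqP -> a0] aB.
  have [|y Sy xy] := h (a / 2); first by rewrite divr_gt0.
  exists y; split=> //; apply: aB; apply/ball_nr.
  by apply: le_lt_trans xy _; rewrite ltr_pdivrMr// ltr_pMr// ltr1n.
apply: h => e e0; have [|y [Sy /ball_nr/ltW xy]] := cx (ball x e%:C).
  by apply: nbhsx_ballx; rewrite ltcR.
by exists y.
Qed.

Lemma dense_nr S : dense S <->
  forall x (e : R), 0 < e -> exists2 y, S y & nr (x - y) <= e.
Proof.
split=> [dS x e e0|h O [x Ox] Oo].
  have [||y [/ball_nr/ltW xy Sy]] := dS (ball x e%:C).
  - by exists x; apply: ballxx; rewrite ltcR.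
  - by apply: ball_open; rewrite ltcR.
  - by exists y.
have /nbhs_ballP[[a b]] /= := open_nbhs_nbhs (conj Oo Ox).
rewrite ltcE /= => /andP[/eqP -> a0] aB.
have [|y Sy xy] := h x (a / 2); first by rewrite divr_gt0.
exists y; split=> //; apply: aB; apply/ball_nr.
by apply: le_lt_trans xy _; rewrite ltr_pdivrMr// ltr_pMr// ltr1n.
Qed.

End NormTopology.

(** * *-homomorphisms *)

Section StarHoms.
Context {R : realType}.
Implicit Types A D : ucstarType R.

Section PositiveSquareRoot.
Context {A : ucstarType R}.
Implicit Types k n : A.

(** [d = k - n] satisfies [d (k + n) = 0]; the positive terms of [d k d + d n d = 0] vanish
    separately, so [d^3 = 0]. *)
Lemma pos_sqrt_uniq k n : pos k -> pos n -> k ∗ n = n ∗ k -> k ∗ k = n ∗ n -> k = n.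
Proof.
move=> kp np c e; pose d := k - n.
have ds : d^† = d by rewrite saB ?pos_sa.
have dd : d ∗ k ∗ d + d ∗ n ∗ d = 0.
  rewrite -smulDl -smulDr (_ : d ∗ (k + n) = 0) ?smul0x//.
  by rewrite /d smulBl !smulDr e c; lmod.
have pd h : pos h -> pos (d ∗ h ∗ d) by rewrite -{1}ds; exact: pos_conj.
have dk : d ∗ k ∗ d = 0 by apply: pos_add0 dd; exact: pd.
have dn : d ∗ n ∗ d = 0 by rewrite dk add0r in dd.
have dE : d = k - n by [].
clearbody d; have d3 : d ∗ d ∗ d = 0 by rewrite {2}dE smulBr smulBl dk dn subrr.
suff : d = 0 by move/eqP; rewrite dE; rewrite subr_eq0 => /eqP.
apply: sa2_eq0 => //; apply: sa2_eq0; first by rewrite saM.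
by rewrite smulA d3 smul0x.
Qed.

End PositiveSquareRoot.

Section Hom.
Context {A D : ucstarType R} {f : A -> D} (hf : is_star_hom f).
Let lf := star_hom_linear hf.
Let fM := star_homM hf.
Let fS := star_hom_star hf.

Lemma hom_pos h : pos h -> pos (f h).
Proof. by case=> k ks ->; exists (f k); rewrite -?fS ?ks ?fM. Qed.

(** [f] may fail to be unital: [f 1] is a projection, and its complement supplies the missing
    term. *)
Lemma hom_contract x : nr (f x) <= nr x.
Proof.
apply/nrP => //; set r := nr x.
have p1 : f 𝟏 ∗ f 𝟏 = f 𝟏 by rewrite -fM smul1x.
have -> : (r ^+ 2)%:C *: 𝟏 - (f x)^† ∗ f x
  = (r ^+ 2)%:C *: (𝟏 - f 𝟏) + f ((r ^+ 2)%:C *: 𝟏 - x^† ∗ x).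
  by rewrite (linB lf) (linZ lf) fM fS; lmod.
apply: posD; last exact: hom_pos (proj2 (nrP _ (nr_ge0 x)) (lexx _)).
apply: posZ; first exact: sqr_ge0.
exists (𝟏 - f 𝟏); first by rewrite saB ?star1// -fS star1.
by rewrite smulBl !smulBr !smul1x !smulx1 p1; lmod.
Qed.

Lemma hom_ncv u l : ncv u l -> ncv (fun n => f (u n)) (f l).
Proof.
move=> h e /h[N hN]; exists N => n /hN; apply: le_trans.
by rewrite -(linB lf); exact: hom_contract.
Qed.

(** [a] is the positive part of [y]. As [a^2 = a y], the element [- (f a)^2 = f a (- f y)] is
    positive, so [f a = 0]. *)
Lemma hom_neg_part y : y^† = y -> pos (- f y) -> exists a,
  [/\ pos a, pos (a - y) & f a = 0].
Proof.
move=> ys fy; have [a [ap ay a0 ac]] := sa_parts ys; exists a; split=> //.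
have ya : y ∗ a = a ∗ y by exact: ac.
apply: sa2_eq0; first by rewrite -fS pos_sa.
apply: pos_anti; first by exists (f a); rewrite // -fS pos_sa.
have -> : - (f a ∗ f a) = f a ∗ (- f y).
  move: a0; rewrite smulBr => /eqP; rewrite subr_eq0 => /eqP/(congr1 f).
  by rewrite !fM smulNr => ->.
by apply: pos_comm; rewrite ?smulNl ?smulNr -?fM ?ya//; exact: hom_pos.
Qed.

(** For [y = x^† x - nr (f x)^2] the image is negative; so the positive part of [y] is killed by
    [f], hence zero, and [y <= 0]. *)
Lemma inj_isometric : (forall x, f x = 0 -> x = 0) -> forall x, nr (f x) = nr x.
Proof.
move=> fi x; apply/eqP; rewrite eq_le hom_contract /=; set r := nr (f x).
have ys : (x^† ∗ x - (r ^+ 2)%:C *: 𝟏)^† = x^† ∗ x - (r ^+ 2)%:C *: 𝟏.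
  by rewrite saB ?saZ ?star1// starM starK.
have [|a [ap ay /fi a0]] := hom_neg_part ys.
  rewrite (linB lf) (linZ lf) fM fS opprB.
  have -> : (r ^+ 2)%:C *: f 𝟏 - (f x)^† ∗ f x
    = (f 𝟏)^† ∗ ((r ^+ 2)%:C *: 𝟏 - (f x)^† ∗ f x) ∗ f 𝟏.
    by rewrite smulBr smulBl smulZr smulx1 smulZl -!fS star1 -!fM !smul1x smulx1.
  exact: pos_conj (proj2 (nrP _ (nr_ge0 _)) (lexx _)).
by apply/nrP; [exact: nr_ge0|move: ay]; rewrite a0 sub0r opprB.
Qed.

Hypothesis f1 : f 𝟏 = 𝟏.

(** The quotient norm is attained. The positive part [a] of [x^† x - r^2] lies in the kernel;
    dividing [x] by the root of [h = 1 + a / r^2] does not change its image, and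
    [x^† x <= r^2 + a = r^2 h] bounds the result by [r]. *)
Lemma quot_lift x : exists2 y, f y = f x & nr y <= nr (f x).
Proof.
set r := nr (f x); have [r0|r0] := eqVneq r 0.
  by exists 0; [rewrite (lin0 lf) (nr_eq0 r0)|rewrite nr0 nr_ge0].
have rp : 0 < r by rewrite lt_def r0 nr_ge0.
have r2 : 0 < r ^+ 2 by rewrite exprn_gt0.
have rr : (r ^+ 2)%:C * ((r ^+ 2)^-1)%:C = 1 :> R[i] by rewrite -rmorphM divff ?gt_eqF.
have ys : (x^† ∗ x - (r ^+ 2)%:C *: 𝟏)^† = x^† ∗ x - (r ^+ 2)%:C *: 𝟏.
  by rewrite saB ?saZ ?star1// starM starK.
have [|a [ap ay fa0]] := hom_neg_part ys.
  by rewrite (linB lf) (linZ lf) fM fS f1 opprB; exact: (proj2 (nrP _ (nr_ge0 _)) (lexx _)).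
pose h := 𝟏 + ((r ^+ 2)^-1)%:C *: a.
have hh : h = 𝟏 + ((r ^+ 2)^-1)%:C *: a by [].
have [|//||s [sp shs _ _]] := @inv_sqrt _ _ h 1.
- by rewrite saD ?star1 ?saZ// pos_sa.
- rewrite rmorph1 scale1r /h addrC addKr.
  by apply: posZ ap; rewrite invr_ge0 ltW.
have fs1 : f s = 𝟏.
  have fh : f h = 𝟏 by rewrite hh (linD lf) (linZ lf) fa0 scaler0 addr0.
  have : f s ∗ f s = 𝟏 by rewrite -[X in X ∗ _]smulx1 -fh -!fM shs f1.
  move=> e; apply: pos_sqrt_uniq; [exact: hom_pos|exact: pos1| |].
    by rewrite smulx1 smul1x.
  by rewrite smulx1.
exists (x ∗ s); first by rewrite fM fs1 smulx1.
apply/nrP; first exact: nr_ge0.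
rewrite starM (pos_sa sp).
have -> : (r ^+ 2)%:C *: 𝟏 - s ∗ x^† ∗ (x ∗ s)
  = s ∗ (a - (x^† ∗ x - (r ^+ 2)%:C *: 𝟏)) ∗ s.
  have e1 : (r ^+ 2)%:C *: 𝟏 = s ∗ ((r ^+ 2)%:C *: 𝟏 + a) ∗ s.
    rewrite -{1}shs hh smulDr smulx1 smulDl smulZr smulZl scalerDr scalerA rr scale1r.
    by rewrite smulDr smulZr smulx1 smulDl smulZl.
  by rewrite [X in X - _]e1; move: (_ *: 𝟏) => t; nc.
by rewrite -{1}(pos_sa sp); apply: pos_conj.
Qed.

Lemma ker_closed_ideal : closed_ideal [set x | f x = 0].
Proof.
split=> /=.
- apply/closed_nr => x h; apply: nr_le0; apply/ler_addgt0Pl => e /h[y /= fy xy].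
  by rewrite addr0 -[f x]subr0 -fy -(linB lf) (le_trans (hom_contract _)).
- exact: lin0.
- by move=> c x y hx hy; rewrite (lf c) hx hy scaler0 addr0.
- by move=> b x hx; rewrite fM hx smulx0.
- by move=> b x hx; rewrite fM hx smul0x.
Qed.

Lemma surj_quotient : (forall c, exists b, f b = c) ->
  is_quotient [set x | f x = 0] f.
Proof.
move=> fs; split=> //=.
- move=> b j j0; rewrite !nrE lecR; have -> : f b = f (b + j) by rewrite (linD lf) j0 addr0.
  exact: hom_contract.
- move=> b; case=> [e1 e2]; rewrite ltcE /= => /andP[/eqP -> e10].
  have [y fy yb] := quot_lift b; exists (y - b); first by rewrite (linB lf) fy subrr.
  by rewrite addrC subrK !nrE ltcE /= add0r eqxx /=; lra.
Qed.

End Hom.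
End StarHoms.

(** * Operator norms *)

Section OperatorNorm.
Context {R : realType} {E : lmodType R[i]} (N : E -> R).
Implicit Types (u v w : E) (T S : E -> E).
Hypothesis N_ge0 : forall u, 0 <= N u.
Hypothesis ND : forall u v, N (u + v) <= N u + N v.
Hypothesis NZ : forall u (c : R[i]), N (c *: u) = nr c * N u.

Definition opb T (C : R) := 0 <= C /\ forall u, N (T u) <= C * N u.
Definition bounded T := exists C, opb T C.
(** For an unbounded [T] the set is empty and the value is 0. *)
Definition opn T : R := inf [set C | opb T C].

Lemma opn_le T C : opb T C -> opn T <= C.
Proof. by move=> h; apply: ge_inf => //; exists 0 => x []. Qed.

Lemma opn_ge0 T : 0 <= opn T.
Proof.
have [[C h]|n] := pselect (bounded T).
  by apply: lb_le_inf; [exists C|move=> x []].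
rewrite /opn (_ : [set C | opb T C] = set0) ?inf0//.
by rewrite -subset0 => C h; apply: n; exists C.
Qed.

Lemma opn_opb T : bounded T -> opb T (opn T).
Proof.
move=> [C hC]; split; first exact: opn_ge0.
move=> u; have [e0|e0] := eqVneq (N u) 0.
  by rewrite e0 mulr0; have [_ /(_ u)] := hC; rewrite e0 mulr0.
have ep : 0 < N u by rewrite lt_def e0 N_ge0.
rewrite -ler_pdivrMr//; apply: lb_le_inf; first by exists C.
by move=> x [_ /(_ u)]; rewrite ler_pdivrMr.
Qed.

Lemma opnP T u : bounded T -> N (T u) <= opn T * N u.
Proof. by move=> /opn_opb[]. Qed.

Lemma opbD T S C D : opb T C -> opb S D -> opb (fun u => T u + S u) (C + D).
Proof.
move=> [C0 hT] [D0 hS]; split; first exact: addr_ge0.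
by move=> u; rewrite mulrDl (le_trans (ND _ _))// lerD.
Qed.

Lemma opbM T S C D : opb T C -> opb S D -> opb (T \o S) (C * D).
Proof.
move=> [C0 hT] [D0 hS]; split; first exact: mulr_ge0.
by move=> u /=; rewrite (le_trans (hT _))// -mulrA ler_wpM2l.
Qed.

Lemma opbZ T C (c : R[i]) : opb T C -> opb (fun u => c *: T u) (nr c * C).
Proof.
move=> [C0 hT]; split; first by rewrite mulr_ge0.
by move=> u; rewrite NZ -mulrA ler_wpM2l.
Qed.

Lemma opb1 : opb id 1.
Proof. by split=> [|u]; rewrite ?ler01// mul1r. Qed.

End OperatorNorm.

(** * Pre-Hilbert modules *)

Record pre_hilbert (R : realType) (A : ucstarType R) (E : lmodType R[i]) := PreHilbert {
  dot : E -> E -> A ;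
  ract : E -> A -> E ;
  dot_linear : forall u, linear (dot u) ;
  dot_star : forall u v, (dot u v)^† = dot v u ;
  dot_pos : forall u, pos (dot u u) ;
  dot_ract : forall u v a, dot u (ract v a) = dot u v ∗ a }.

Section PreHilbert.
Context {R : realType} {A : ucstarType R} {E : lmodType R[i]} (H : pre_hilbert A E).
Implicit Types (u v w : E) (T S : E -> E).
Local Notation "<| u , v |>" := (dot H u v).

Lemma dotDr u v w : <|u, v + w|> = <|u, v|> + <|u, w|>.
Proof. exact: (linD (dot_linear H u)). Qed.
Lemma dotZr u v c : <|u, c *: v|> = c *: <|u, v|>.
Proof. exact: (linZ (dot_linear H u)). Qed.
Lemma dotDl u v w : <|v + w, u|> = <|v, u|> + <|w, u|>.
Proof. by rewrite -dot_star dotDr starD !dot_star. Qed.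
Lemma dotZl u v c : <|c *: v, u|> = (c^*)%R *: <|v, u|>.
Proof. by rewrite -dot_star dotZr starZ dot_star. Qed.
Lemma dotNr u v : <|u, - v|> = - <|u, v|>.
Proof. exact: (linN (dot_linear H u)). Qed.
Lemma dotNl u v : <|- v, u|> = - <|v, u|>.
Proof. by rewrite -dot_star dotNr starN dot_star. Qed.
Lemma dot_ractl u v a : <|ract H v a, u|> = a^† ∗ <|v, u|>.
Proof. by rewrite -dot_star dot_ract starM dot_star. Qed.
Lemma dot0r u : <|u, 0|> = 0.
Proof. exact: (lin0 (dot_linear H u)). Qed.

Definition en u : R := Num.sqrt (nr <|u, u|>).

Lemma en_ge0 u : 0 <= en u.
Proof. exact: sqrtr_ge0. Qed.

Lemma en2 u : en u ^+ 2 = nr <|u, u|>.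
Proof. by rewrite sqr_sqrtr. Qed.

Lemma en_le u (r : R) : 0 <= r -> nr <|u, u|> <= r ^+ 2 -> en u <= r.
Proof.
by move=> r0 h; rewrite -(@ler_pXn2r _ 2)// ?nnegrE// ?en2// en_ge0.
Qed.

(** Expand [<w, w> >= 0] for [w = p^(-1) u a - v] with [a = <u, v>], and bound [a^† <u, u> a] by
    [p a^† a]. A strict bound [p] avoids dividing by a norm that may vanish. *)
Lemma dot_cs u v (p : R) : nr <|u, u|> < p ->
  pos (<|v, v|> - (p^-1)%:C *: (<|u, v|>^† ∗ <|u, v|>)).
Proof.
move=> up; have p0 : 0 < p by apply: le_lt_trans up.
have pp : (p^-1)%:C * p%:C = 1 :> R[i] by rewrite -rmorphM mulVf ?gt_eqF.
set a := <|u, v|>.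
pose w := (p^-1)%:C *: ract H u a - v.
have -> : <|v, v|> - (p^-1)%:C *: (a^† ∗ a) = <|w, w|>
   + (p^-1 ^+ 2)%:C *: (p%:C *: (a^† ∗ a) - a^† ∗ <|u, u|> ∗ a).
  rewrite /w dotDl !dotDr ?(dotZl, dotZr, dotNl, dotNr) conjCR.
  rewrite dot_ractl !dot_ract dot_ractl -/a -(dot_star H u v) -/a !smulA.
  have pp2 : (p^-1 ^+ 2)%:C * p%:C = (p^-1)%:C :> R[i].
    by rewrite rmorphXn expr2 -mulrA pp mulr1.
  by rewrite scalerBr [X in _ + (X - _)]scalerA pp2 rmorphXn; lmod.
apply: posD; first exact: dot_pos.
apply: posZ; first exact: sqr_ge0.
by apply: conj_le; [exact: dot_star|exact: ltW].
Qed.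

Lemma cauchy_schwarz u v : nr <|u, v|> <= en u * en v.
Proof.
rewrite -(@ler_pXn2r _ 2)// ?nnegrE// ?mulr_ge0 ?en_ge0// exprMn !en2.
suff h (p : R) : nr <|u, u|> < p -> nr <|u, v|> ^+ 2 <= p * nr <|v, v|>.
  apply/ler_addgt0Pl => e e0.
  have d0 : 0 < 1 + nr <|v, v|> by rewrite ltr_pwDl.
  have hp : nr <|u, u|> < nr <|u, u|> + e / (1 + nr <|v, v|>).
    by rewrite ltrDl divr_gt0.
  apply: (le_trans (h _ hp)); rewrite mulrDl addrC lerD2r.
  by rewrite mulrAC ler_pdivrMr// ler_pM2l// lerDr.
move=> up; have p0 : 0 < p by apply: le_lt_trans up.
have : nr ((p^-1)%:C *: (<|u, v|>^† ∗ <|u, v|>)) <= nr <|v, v|>.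
  apply: nr_mono; last exact: dot_cs.
  by apply: posZ; [rewrite invr_ge0 ltW|exact: posS].
by rewrite nrZR gtr0_norm ?invr_gt0// nrS ler_pdivrMl.
Qed.

Lemma enD u v : en (u + v) <= en u + en v.
Proof.
apply: en_le; first by rewrite addr_ge0 ?en_ge0.
rewrite dotDl !dotDr; have h1 := cauchy_schwarz u v; have h2 := cauchy_schwarz v u.
have := en2 u; have := en2 v.
have := nrD (<|u, u|> + <|u, v|>) (<|v, u|> + <|v, v|>).
have := nrD <|u, u|> <|u, v|>; have := nrD <|v, u|> <|v, v|>.
nra.
Qed.

Lemma enZ u (c : R[i]) : en (c *: u) = nr c * en u.
Proof.
apply: (@pexpIrn _ 2) => //; rewrite ?nnegrE ?mulr_ge0 ?en_ge0//.
by rewrite exprMn !en2 dotZl dotZr !nrZ nr_conj; ring.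
Qed.

Lemma en_sum I (r : seq I) (P : pred I) (F : I -> E) :
  en (\sum_(i <- r | P i) F i) <= \sum_(i <- r | P i) en (F i).
Proof.
elim/big_rec2: _ => [|i a b _ h]; first by rewrite /en dot0r nr0 sqrtr0.
exact: le_trans (enD _ _) (lerD (lexx _) h).
Qed.

Local Notation opb := (opb en).
Local Notation opn := (opn en).
Local Notation bounded := (bounded en).
Let opn_opb T : bounded T -> opb T (opn T) := @opn_opb R E en en_ge0 T.
Let opnP T u : bounded T -> en (T u) <= opn T * en u := @opnP R E en en_ge0 T u.
Definition adjoint T S := forall u v, <|T u, v|> = <|u, S v|>.

Lemma adjointC T S : adjoint T S -> adjoint S T.
Proof. by move=> h u v; rewrite -dot_star -h dot_star. Qed.

Lemma opb_adjoint T S C : adjoint T S -> opb T C -> opb S C.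
Proof.
move=> h [C0 hT]; split=> // u; have [e0|e0] := eqVneq (en (S u)) 0.
  by rewrite e0 mulr_ge0 ?en_ge0.
have ep : 0 < en (S u) by rewrite lt_def e0 en_ge0.
rewrite -(ler_pM2r ep) -expr2 en2 (adjointC h).
apply: (le_trans (cauchy_schwarz _ _)); rewrite [C * _]mulrC -mulrA.
by apply: ler_wpM2l (hT _); exact: en_ge0.
Qed.

Lemma opn_adjoint T S : adjoint T S -> bounded T -> opn S = opn T.
Proof.
move=> h bT; apply/eqP; rewrite eq_le; apply/andP; split.
  exact: opn_le (opb_adjoint h (opn_opb bT)).
apply: opn_le; apply: (opb_adjoint (adjointC h)); apply: opn_opb.
by case: bT => C /(opb_adjoint h); exists C.
Qed.

Lemma opn_cstar T S : adjoint T S -> bounded T -> opn (S \o T) = opn T ^+ 2.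
Proof.
move=> h bT; have bS : bounded S by case: bT => C /(opb_adjoint h); exists C.
have [bSq bTq] := (opn_opb bS, opn_opb bT).
apply/eqP; rewrite eq_le; apply/andP; split.
  by rewrite expr2 -{1}(opn_adjoint h bT); apply/opn_le/opbM.
have bST : bounded (S \o T) by exists (opn S * opn T); apply: opbM.
have : opn T <= Num.sqrt (opn (S \o T)).
  apply: opn_le; split; first exact: sqrtr_ge0.
  move=> u; apply: en_le; first by rewrite mulr_ge0 ?sqrtr_ge0 ?en_ge0.
  rewrite h exprMn sqr_sqrtr ?opn_ge0//; apply: (le_trans (cauchy_schwarz _ _)).
  rewrite expr2 mulrA mulrC; apply: ler_wpM2r; first exact: en_ge0.
  exact: opnP.
move=> k; rewrite -[X in _ <= X](@sqr_sqrtr _ (opn (S \o T))) ?opn_ge0//.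
by rewrite ler_pXn2r// nnegrE ?opn_ge0 ?sqrtr_ge0.
Qed.

Lemma opn_eq0 T u : bounded T -> opn T = 0 -> en (T u) = 0.
Proof.
move=> bT o0; have := opnP u bT; rewrite o0 mul0r => h.
by apply/eqP; rewrite eq_le h en_ge0.
Qed.

End PreHilbert.

(** * Matrix algebras *)

Section Column.
Context {R : realType} (A : ucstarType R) (n : nat).
Local Notation E := {ffun 'I_n -> A}.

Definition cdot (u v : E) : A := \sum_i (u i)^† ∗ v i.
Definition cact (u : E) (a : A) : E := [ffun i => u i ∗ a].

Fact cdot_linear u : linear (cdot u).
Proof.
move=> c v w; rewrite /cdot scaler_sumr -big_split; apply: eq_bigr => i _ /=.
by rewrite !ffunE smulDr smulZr.
Qed.
Fact cdot_star u v : (cdot u v)^† = cdot v u.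
Proof. by rewrite star_sum; apply: eq_bigr => i _; rewrite starM starK. Qed.
Fact cdot_pos u : pos (cdot u u).
Proof. by apply: pos_sum => i _; exact: posS. Qed.
Fact cdot_ract u v a : cdot u (cact v a) = cdot u v ∗ a.
Proof. by rewrite smul_suml; apply: eq_bigr => i _; rewrite ffunE smulA. Qed.

Definition column : pre_hilbert A E :=
  PreHilbert cdot_linear cdot_star cdot_pos cdot_ract.

End Column.

Lemma eventually_all (I : finType) (P : I -> nat -> Prop) :
  (forall i, exists N, forall k, (N <= k)%N -> P i k) ->
  exists N, forall k, (N <= k)%N -> forall i, P i k.
Proof.
move=> /choice[N hN]; exists (\max_i N i) => k Nk i; apply: hN.
exact: leq_trans (leq_bigmax i) Nk.
Qed.

(** An alias of ['M[A]_n] that carries the C*-structure: complex scalars, and the norm of operators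
    on the column module. *)
Definition cmx (R : realType) (A : ucstarType R) (n : nat) : Type := 'M[A]_n.

Section MatrixAlgebra.
Context {R : realType} {A : ucstarType R} {n : nat}.
Local Notation E := {ffun 'I_n -> A}.
Local Notation M := (cmx A n).
Implicit Types (X Y Z : M) (u v : E).

HB.instance Definition _ := GRing.Zmodule.copy M 'M[A]_n.

Definition cmxZ (c : R[i]) X : M := map_mx (fun a : A => c *: a) X.

Fact cmxZA c d X : cmxZ c (cmxZ d X) = cmxZ (c * d) X.
Proof. by apply/matrixP => i j; rewrite !mxE scalerA. Qed.
Fact cmx1Z : left_id 1 cmxZ.
Proof. by move=> X; apply/matrixP => i j; rewrite !mxE scale1r. Qed.
Fact cmxZDr : right_distributive cmxZ +%R.
Proof. by move=> c X Y; apply/matrixP => i j; rewrite !mxE scalerDr. Qed.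
Fact cmxZDl X : {morph cmxZ^~ X : c d / c + d}.
Proof. by move=> c d; apply/matrixP => i j; rewrite !mxE scalerDl. Qed.
HB.instance Definition _ :=
  GRing.Zmodule_isLmodule.Build R[i] M cmxZA cmx1Z cmxZDr cmxZDl.

Lemma cmxZE (c : R[i]) X i j : (c *: X : M) i j = c *: X i j.
Proof. exact: mxE. Qed.

Definition cmx1 : M := \matrix_(i, j) (if i == j then 𝟏 else 0).
Definition cmxM X Y : M := mxsmul X Y.
Definition cmxS X : M := mxstar X.

Fact cmxMA X Y Z : cmxM X (cmxM Y Z) = cmxM (cmxM X Y) Z.
Proof.
apply/matrixP => i j; rewrite !mxE.
transitivity (\sum_k \sum_l X i k ∗ Y k l ∗ Z l j).
  by apply: eq_bigr => k _; rewrite mxE smul_sumr; apply: eq_bigr => l _; rewrite smulA.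
rewrite exchange_big; apply: eq_bigr => l _; by rewrite mxE smul_suml.
Qed.
Fact cmxM_linl Y : linear (cmxM^~ Y).
Proof.
move=> c X Z; apply/matrixP => i j; rewrite !mxE scaler_sumr -big_split.
by apply: eq_bigr => k _ /=; rewrite !mxE smulDl smulZl.
Qed.
Fact cmxM_linr Y : linear (cmxM Y).
Proof.
move=> c X Z; apply/matrixP => i j; rewrite !mxE scaler_sumr -big_split.
by apply: eq_bigr => k _ /=; rewrite !mxE smulDr smulZr.
Qed.
Lemma sum_pick (i : 'I_n) (F : 'I_n -> A) :
  \sum_k (if i == k then 𝟏 else 0) ∗ F k = F i.
Proof.
rewrite (bigD1 i) //= eqxx smul1x big1 ?addr0// => k /negbTE.
by rewrite eq_sym => ->; rewrite smul0x.
Qed.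
Lemma sum_pickr (i : 'I_n) (F : 'I_n -> A) :
  \sum_k F k ∗ (if k == i then 𝟏 else 0) = F i.
Proof. by rewrite (bigD1 i) //= eqxx smulx1 big1 ?addr0// => k /negbTE ->; rewrite smulx0. Qed.
Fact cmxM1x X : cmxM cmx1 X = X.
Proof.
apply/matrixP => i j; rewrite mxE -[RHS](sum_pick i (X ^~ j)).
by apply: eq_bigr => k _; rewrite mxE.
Qed.
Fact cmxMx1 X : cmxM X cmx1 = X.
Proof.
apply/matrixP => i j; rewrite mxE -[RHS](sum_pickr j (X i)).
by apply: eq_bigr => k _; rewrite mxE.
Qed.
Fact cmxS_conjlin (c : R[i]) X Y : cmxS (c *: X + Y) = (c^*)%R *: cmxS X + cmxS Y.
Proof. by apply/matrixP => i j; rewrite !mxE starD starZ. Qed.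
Fact cmxSM X Y : cmxS (cmxM X Y) = cmxM (cmxS Y) (cmxS X).
Proof.
apply/matrixP => i j; rewrite !mxE star_sum; apply: eq_bigr => k _.
by rewrite starM !mxE.
Qed.
Fact cmxSK X : cmxS (cmxS X) = X.
Proof. by apply/matrixP => i j; rewrite !mxE starK. Qed.

Definition mxact X u : E := [ffun i => \sum_j X i j ∗ u j].

Lemma mxactM X Y u : mxact (cmxM X Y) u = mxact X (mxact Y u).
Proof.
apply/ffunP => i; rewrite !ffunE.
transitivity (\sum_j \sum_k X i k ∗ Y k j ∗ u j).
  by apply: eq_bigr => j _; rewrite mxE smul_suml.
rewrite exchange_big; apply: eq_bigr => k _; rewrite ffunE smul_sumr.
by apply: eq_bigr => l _; rewrite smulA.
Qed.

Lemma mxact_adj X : adjoint (column A n) (mxact X) (mxact (cmxS X)).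
Proof.
move=> u v; rewrite /= /cdot.
transitivity (\sum_i \sum_j (u j)^† ∗ (X i j)^† ∗ v i).
  apply: eq_bigr => i _; rewrite ffunE star_sum smul_suml.
  by apply: eq_bigr => j _; rewrite starM.
rewrite exchange_big; apply: eq_bigr => j _; rewrite ffunE smul_sumr.
by apply: eq_bigr => i _; rewrite mxE smulA.
Qed.

Local Notation en := (en (column A n)).
Local Notation opb := (opb en).
Local Notation opn := (opn en).
Local Notation bounded := (bounded en).
Let opn_opb (T : E -> E) : bounded T -> opb T (opn T) := opn_opb (en_ge0 _) (T := T).
Let opnP (T : E -> E) u : bounded T -> en (T u) <= opn T * en u := opnP (en_ge0 _) u.
Let opbD (T S : E -> E) C D := @opbD R E en (@enD _ _ _ (column A n)) T S C D.
Let opbZ (T : E -> E) C c := @opbZ R E en (@enZ _ _ _ (column A n)) T C c.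

Lemma col_coord u i : nr (u i) <= en u.
Proof.
rewrite -(@ler_pXn2r _ 2)// ?nnegrE// ?en_ge0// en2 -nrS.
apply: nr_mono; first exact: posS.
rewrite /= /cdot (bigD1 i)//= addrAC subrr add0r.
by apply: pos_sum => j _; exact: posS.
Qed.

Lemma col_le u : en u <= \sum_i nr (u i).
Proof.
have -> : u = \sum_i [ffun j => if i == j then u i else 0].
  apply/ffunP => j; rewrite sum_ffunE (bigD1 j)//= ffunE eqxx big1 ?addr0//.
  by move=> i /negbTE ij; rewrite ffunE ij.
apply: (le_trans (en_sum _ _ _ _)); apply: ler_sum => i _.
apply: en_le => //; rewrite /= /cdot (bigD1 i)//= big1 => [|j /negbTE ji].
  rewrite addr0 !sum_ffunE !(bigD1 i (P := predT))//= !ffunE eqxx !big1.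
    by rewrite !addr0 nrS.
  by move=> j /negbTE ji; rewrite ffunE ji.
by rewrite !ffunE eq_sym ji smulx0.
Qed.

Lemma mxact_opb X : opb (mxact X) (\sum_i \sum_j nr (X i j)).
Proof.
split=> [|u]; first by do 2 apply: sumr_ge0 => ? _.
apply: (le_trans (col_le _)); rewrite mulr_suml; apply: ler_sum => i _.
rewrite ffunE mulr_suml; apply: (le_trans (nr_sum _ _ _)); apply: ler_sum => j _.
by apply: nrM_le => //; exact: col_coord.
Qed.

Lemma mxact_bd X : bounded (mxact X).
Proof. by exists (\sum_i \sum_j nr (X i j)); exact: mxact_opb. Qed.

Definition cmxn X : R := opn (mxact X).

Lemma cmxn_le X : cmxn X <= \sum_i \sum_j nr (X i j).
Proof. exact: opn_le (mxact_opb X). Qed.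

Lemma cmxn_coord X i j : nr (X i j) <= cmxn X.
Proof.
pose d : E := [ffun k => if k == j then 𝟏 else 0].
have -> : X i j = mxact X d i.
  rewrite ffunE -[LHS](sum_pickr j (X i)).
  by apply: eq_bigr => k _; rewrite ffunE.
apply: (le_trans (col_coord _ _)); apply: (le_trans (opnP _ (mxact_bd X))).
rewrite -[leRHS]mulr1 ler_wpM2l ?opn_ge0//; apply: en_le => //.
rewrite expr1n /= /cdot (bigD1 j)//= big1 => [|k /negbTE kj].
  by rewrite ffunE eqxx star1 smul1x addr0 nr1.
by rewrite !ffunE kj smulx0.
Qed.

Fact cmxnD X Y : cmxn (X + Y) <= cmxn X + cmxn Y.
Proof.
apply: opn_le; have := opbD (opn_opb (mxact_bd X)) (opn_opb (mxact_bd Y)).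
congr (opb _ _); apply/funext => u; apply/ffunP => i; rewrite !ffunE -big_split.
by apply: eq_bigr => j _ /=; rewrite mxE smulDl.
Qed.
Lemma mxactZ (c : R[i]) X u : mxact (c *: X) u = c *: mxact X u.
Proof.
apply/ffunP => i; rewrite !ffunE scaler_sumr.
by apply: eq_bigr => j _; rewrite mxE smulZl.
Qed.
Fact cmxnZ_le (c : R[i]) X : cmxn (c *: X) <= nr c * cmxn X.
Proof.
apply: opn_le; have := opbZ c (opn_opb (mxact_bd X)).
by congr (opb _ _); apply/funext => u; rewrite mxactZ.
Qed.
Fact cmxnZ (c : R[i]) X : cmxn (c *: X) = nr c * cmxn X.
Proof.
apply/eqP; rewrite eq_le cmxnZ_le /=; have [->|c0] := eqVneq c 0.
  by rewrite nr0 mul0r opn_ge0.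
have nc0 : 0 < nr c by rewrite lt_def nr_ge0 andbT; apply: contra c0 => /eqP/nr_eq0 ->.
have := cmxnZ_le c^-1 (c *: X); rewrite scalerA mulVf// scale1r.
have -> : nr c^-1 = (nr c)^-1.
  by apply: complexI; rewrite fmorphV /= -!nrE normfV.
by rewrite ler_pdivlMl.
Qed.
Fact cmxn_eq0 X : cmxn X = 0 -> X = 0.
Proof.
move=> h; apply/matrixP => i j; rewrite mxE; apply: nr_le0.
by rewrite -h cmxn_coord.
Qed.
Fact cmxnM X Y : cmxn (cmxM X Y) <= cmxn X * cmxn Y.
Proof.
apply: opn_le; have := opbM (opn_opb (mxact_bd X)) (opn_opb (mxact_bd Y)).
by congr (opb _ _); apply/funext => u; rewrite /= mxactM.
Qed.
Fact cmxnS X : cmxn (cmxM (cmxS X) X) = cmxn X ^+ 2.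
Proof.
rewrite /cmxn -(opn_cstar (mxact_adj X) (mxact_bd X)); congr (opn _).
by apply/funext => u; rewrite mxactM.
Qed.
Fact cmx_complete (u : nat -> M) :
    (forall e : R, 0 < e -> exists N, forall m n, (N <= m)%N -> (N <= n)%N ->
      cmxn (u m - u n) <= e) ->
    exists l, forall e : R, 0 < e -> exists N, forall n, (N <= n)%N ->
      cmxn (u n - l) <= e.
Proof.
move=> hu.
have hl i j : exists l : A, ncv (fun k => u k i j) l.
  apply: ncauchy_ncv => e /hu[N hN]; exists N => a b aN bN.
  have := cmxn_coord (u a - u b) i j; rewrite !mxE => h.
  exact: le_trans h (hN _ _ aN bN).
pose l : M := \matrix_(i, j) projT1 (cid (hl i j)).
have hij i j : ncv (fun k => u k i j) (l i j) by rewrite mxE; case: cid.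
(* The [n^2] entries share the error [e]; the added 1 covers [n = 0]. *)
exists l => e e0; pose d := e / (n%:R * n%:R + 1).
have d0 : 0 < d by rewrite divr_gt0// ltr_wpDl// mulr_ge0.
have [N hN] : exists N, forall k, (N <= k)%N -> forall i j, nr (u k i j - l i j) <= d.
  apply: eventually_all => i.
  apply: eventually_all => j; exact: hij.
exists N => k /hN h; apply: (le_trans (cmxn_le _)).
apply: (@le_trans _ _ (\sum_(i < n) \sum_(j < n) d)).
  by apply: ler_sum => i _; apply: ler_sum => j _; have := h i j; rewrite !mxE.
rewrite !sumr_const !card_ord -mulrnA -[_ *+ _]mulr_natr natrM.
by rewrite /d mulrAC ler_pdivrMr ?ltr_wpDl ?mulr_ge0// ler_pM2l// lerDl.
Qed.

HB.instance Definition _ := isUCStarAlg.Build R M cmxMA cmxM_linl cmxM_linr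
  cmxM1x cmxMx1 cmxS_conjlin cmxSM cmxSK cmxnD cmxnZ cmxn_eq0 cmxnM cmxnS cmx_complete.

Lemma nr_cmx X : nr X = cmxn X.
Proof. by apply: complexI; rewrite -nrE. Qed.

Lemma cmxME X Y i j : (X ∗ Y : M) i j = \sum_k X i k ∗ Y k j.
Proof. exact: mxE. Qed.
Lemma cmxSE X i j : (X^† : M) i j = (X j i)^†.
Proof. exact: mxE. Qed.
Lemma cmx1E i j : (𝟏 : M) i j = if i == j then 𝟏 else 0.
Proof. exact: mxE. Qed.
Lemma cmxDE X Y i j : (X + Y) i j = X i j + Y i j.
Proof. exact: mxE. Qed.
Lemma cmxNE X i j : (- X) i j = - X i j.
Proof. exact: mxE. Qed.
Lemma cmx0E i j : (0 : M) i j = 0.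
Proof. exact: mxE. Qed.

Lemma cmx_coord X i j : nr (X i j) <= nr X.
Proof. by rewrite nr_cmx cmxn_coord. Qed.

Lemma cmx_le X : nr X <= \sum_i \sum_j nr (X i j).
Proof. by rewrite nr_cmx cmxn_le. Qed.

End MatrixAlgebra.

(** * Completely positive maps *)

Section MatrixPositivity.
Context {R : realType} {D : ucstarType R}.

Definition qform (I : finType) (X : I -> I -> D) (xi : I -> D) : D :=
  \sum_i \sum_j (xi i)^† ∗ X i j ∗ xi j.

Lemma qformS (I J : finType) (Z : J -> I -> D) (xi : I -> D) :
  qform (fun i j => \sum_r (Z r i)^† ∗ Z r j) xi
  = \sum_r (\sum_i Z r i ∗ xi i)^† ∗ (\sum_i Z r i ∗ xi i).
Proof.
rewrite /qform.
under eq_bigr do under eq_bigr do rewrite smul_sumr smul_suml.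
under eq_bigr do rewrite exchange_big.
rewrite exchange_big; apply: eq_bigr => r _.
rewrite star_sum smul_suml; apply: eq_bigr => i _.
rewrite smul_sumr; apply: eq_bigr => j _.
by rewrite starM !smulA.
Qed.

Lemma pos_qform n (X : cmx D n) (xi : 'I_n -> D) : pos X -> pos (qform X xi).
Proof.
move=> [k ks ->]; rewrite (_ : qform _ xi = qform (fun i j => \sum_r (k r i)^† ∗ k r j) xi).
  by rewrite qformS; apply: pos_sum => r _; exact: posS.
apply: eq_bigr => i _; apply: eq_bigr => j _; congr (_ ∗ _ ∗ _).
by rewrite cmxME; apply: eq_bigr => r _; rewrite -{1}ks cmxSE.
Qed.

Lemma pos_sum0 (I : finType) (F : I -> D) :
  (forall i, pos (F i)) -> \sum_i F i = 0 -> forall i, F i = 0.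
Proof.
move=> h s i; apply: (pos_add0 (h i) _ (b := \sum_(j | j != i) F j)).
  by apply: pos_sum => j _.
by rewrite -[RHS]s [RHS](bigD1 i).
Qed.

(** Let [a = k^2] be the negative part of [X], so that [(k a)^† (k a) = - a X a]. The diagonal
    entries of [a X a] are the forms of [X] at the columns of [a], hence positive; the opposite
    signs force [k a = 0] and [a = 0]. *)
Lemma qform_pos n (X : cmx D n) : X^† = X -> (forall xi, pos (qform X xi)) -> pos X.
Proof.
move=> Xs hX.
have nXs : (- X)^† = - X by rewrite starN Xs.
have [a [ap aX a0 _]] := sa_parts nXs; rewrite opprK in aX a0.
have as_ := pos_sa ap.
have aX2 : a ∗ X = - (a ∗ a).
  by apply/eqP; rewrite -addr_eq0 addrC -smulDr a0.
have [k ks ak] := ap.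
have kak : (k ∗ a)^† ∗ (k ∗ a) = - (a ∗ X ∗ a).
  by rewrite starM as_ ks smulA -(smulA a) -ak aX2 smulNl opprK.
have diag j : qform X (fun i => a i j) = (a ∗ X ∗ a : cmx D n) j j.
  rewrite !cmxME /qform exchange_big; apply: eq_bigr => l _.
  rewrite cmxME smul_suml; apply: eq_bigr => i _.
  by rewrite -cmxSE as_.
have ka0 : k ∗ a = 0.
  apply/matrixP => r j; rewrite cmx0E.
  have e : \sum_i ((k ∗ a : cmx D n) i j)^† ∗ (k ∗ a : cmx D n) i j
    = ((k ∗ a)^† ∗ (k ∗ a) : cmx D n) j j.
    by rewrite [RHS]cmxME; apply: eq_bigr => i _; rewrite cmxSE.
  apply: sS_eq0.
  apply: (@pos_sum0 _ (fun i => ((k ∗ a : cmx D n) i j)^† ∗ (k ∗ a : cmx D n) i j) _ _ r) => [i|].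
    exact: posS.
  apply: pos_anti; first by apply: pos_sum => i _; exact: posS.
  by rewrite e kak cmxNE opprK -diag.
have a00 : a = 0.
  by apply: sa2_eq0 => //; rewrite {1}ak -smulA ka0 smulx0.
by move: aX; rewrite a00 add0r.
Qed.

Lemma positive_mxP n (X : cmx D n) : positive_mx X <-> pos X.
Proof.
split=> [[Y ->]|[k ks Xk]]; first exact: (posS (Y : cmx D n)).
by exists k; rewrite Xk -{1}ks.
Qed.

End MatrixPositivity.

Section CompletelyPositive.
Context {R : realType}.
Implicit Types A B D : ucstarType R.

(** Complete positivity through Gram matrices tested on vectors, free of matrix roots; [cpf_cp] and
    [cp_cpf] give the equivalence with [completely_positive]. *)
Definition cpf A D (f : A -> D) := linear f /\
  forall n (x : 'I_n -> A) (xi : 'I_n -> D),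
    pos (qform (fun i j => f ((x i)^† ∗ x j)) xi).

Lemma cpf_fin A D (f : A -> D) (I : finType) (x : I -> A) (xi : I -> D) :
  cpf f -> pos (qform (fun i j => f ((x i)^† ∗ x j)) xi).
Proof.
move=> [_ /(_ #|I| (fun i => x (enum_val i)) (fun i => xi (enum_val i)))].
congr (pos _); rewrite /qform (reindex_omap (@enum_val I I) (fun i => Some (enum_rank i))) /=.
  apply: eq_big => [i|i _]; first by rewrite enum_valK eqxx.
  rewrite [RHS](reindex_omap (@enum_val I I) (fun i => Some (enum_rank i))) /=.
    by apply: eq_bigl => j; rewrite enum_valK eqxx.
  by move=> j _; rewrite enum_rankK.
by move=> j _; rewrite enum_rankK.
Qed.

Section Basic.
Context {A D : ucstarType R} {f : A -> D} (hf : cpf f).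
Let lf : linear f := proj1 hf.

Lemma cpf_pos h : pos h -> pos (f h).
Proof.
move=> [k ks ->]; have := (proj2 hf) 1%N (fun=> k) (fun=> 𝟏).
by rewrite /qform !big_ord1 star1 smul1x smulx1 ks.
Qed.

Lemma cpf_star x : f x^† = (f x)^†.
Proof.
have saf h : h^† = h -> (f h)^† = f h.
  move=> hs; have -> : h = (nr h)%:C *: 𝟏 - ((nr h)%:C *: 𝟏 - h) by lmod.
  rewrite (linB lf) (linZ lf); apply: saB; first by apply/saZ/pos_sa/cpf_pos/pos1.
  by apply/pos_sa/cpf_pos/nr_le_pos.
have [u [v [us vs -> _]]] := cartesian x.
rewrite starD starZ us vs !(linD lf) !(linZ lf) starD starZ !saf//.
Qed.

Lemma cpf_cp : completely_positive f.
Proof.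
split=> // n X [Y XY]; apply/positive_mxP; apply: qform_pos.
  apply/matrixP => i j; rewrite cmxSE !mxE -cpf_star XY !mxE star_sum; congr (f _).
  by apply: eq_bigr => r _; rewrite starM !mxE starK.
move=> xi; have -> : qform (map_mx f X) xi =
   \sum_r qform (fun i j => f ((Y r i)^† ∗ Y r j)) xi.
  rewrite /qform; under [RHS]eq_bigr do under eq_bigr do rewrite -/(_ ∗ _ ∗ _).
  rewrite [RHS]exchange_big; apply: eq_bigr => i _.
  rewrite [RHS]exchange_big; apply: eq_bigr => j _.
  rewrite -smul_suml -smul_sumr; congr (_ ∗ _ ∗ _).
  rewrite mxE XY mxE (lin_sum lf); apply: eq_bigr => r _; by rewrite mxE.
by apply: pos_sum => r _; apply: (proj2 hf).
Qed.

(** Kadison's inequality: positivity at the pair [1], [x] with coefficients [- f x], [1], where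
    [1 - f 1 >= 0] compensates for [f] not being unital. *)
Lemma cpf_schwarz x : pos (𝟏 - f 𝟏) -> pos (f (x^† ∗ x) - (f x)^† ∗ f x).
Proof.
move=> f1; have := posD ((proj2 hf) 2 (fun i => if i == ord0 then 𝟏 else x)
  (fun i => if i == ord0 then - f x else 𝟏)) (pos_conj (f x) f1).
congr (pos _); rewrite /qform !big_ord_recl !big_ord0 /= !addr0 !star1 !smul1x !smulx1.
by rewrite starN cpf_star; nc.
Qed.

Lemma cpf_contractive : pos (𝟏 - f 𝟏) -> forall x, nr (f x) <= nr x.
Proof.
move=> f1 x; apply/nrP => //.
have -> : (nr x ^+ 2)%:C *: 𝟏 - (f x)^† ∗ f x
  = (nr x ^+ 2)%:C *: (𝟏 - f 𝟏) + f ((nr x ^+ 2)%:C *: 𝟏 - x^† ∗ x)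
    + (f (x^† ∗ x) - (f x)^† ∗ f x).
  by rewrite (linB lf) (linZ lf); lmod.
apply: posD; last exact: cpf_schwarz.
apply: posD; first by apply: posZ => //; exact: sqr_ge0.
by apply: cpf_pos; apply/nrP.
Qed.

Lemma contractive_one : contractive f -> pos (𝟏 - f 𝟏).
Proof.
move=> h; rewrite -[X in X - _]scale1r; apply: nr_le_pos.
  by rewrite -cpf_star star1.
by apply: le_trans (@nr1 _ A); rewrite -lecR -!nrE; exact: h.
Qed.

End Basic.

Lemma cp_cpf A D (f : A -> D) : completely_positive f -> cpf f.
Proof.
move=> [lf hf]; split=> // -[|n] x xi; first by rewrite /qform big_ord0; exact: pos0.
pose X : cmx A n.+1 := \matrix_(i, j) ((x i)^† ∗ x j).
have : positive_mx (map_mx f X).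
  (* The Gram matrix is [Y^† Y] for the [Y] whose row [ord0] is [x]; a row has to exist, hence the
     separate case [n = 0]. *)
  apply: hf; exists (\matrix_(i, j) if i == ord0 then x j else 0).
  apply/matrixP => i j; rewrite !mxE (bigD1 ord0) //= !mxE eqxx big1 ?addr0// => k.
  by move=> /negbTE k0; rewrite !mxE k0 smulx0.
move=> /positive_mxP/(pos_qform xi); congr (pos _).
by apply: eq_bigr => i _; apply: eq_bigr => j _; rewrite !mxE.
Qed.

Lemma cpf_hom A D (f : A -> D) : is_star_hom f -> cpf f.
Proof.
move=> [lf fM fS]; split=> // n x xi.
have := @qformS _ _ _ 'I_1 (fun _ i => f (x i)) xi.
rewrite big_ord1; under [qform _ _ in X in X -> _]eq_bigr do under eq_bigr do rewrite big_ord1 -fS -fM.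
by rewrite -/(qform _ _) => ->; exact: posS.
Qed.

Lemma cpf_comp A B D (f : A -> B) (g : B -> D) : cpf f -> cpf g -> cpf (g \o f).
Proof.
move=> /cpf_cp[lf hf] /cpf_cp[lg hg]; apply: cp_cpf; split=> [c x y|n X hX] /=.
  by rewrite lf lg.
by rewrite map_mx_comp; apply/hg/hf.
Qed.

Lemma cpf_conj A D (f : A -> D) z : cpf f -> cpf (fun x => z^† ∗ f x ∗ z).
Proof.
move=> [lf hf]; split=> [c x y|n x xi].
  by rewrite lf smulDr smulDl smulZr smulZl.
have := hf n x (fun i => z ∗ xi i); congr (pos _).
by apply: eq_bigr => i _; apply: eq_bigr => j _; rewrite starM !smulA.
Qed.

Lemma cpfD A D (f g : A -> D) : cpf f -> cpf g -> cpf (fun x => f x + g x).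
Proof.
move=> [lf hf] [lg hg]; split=> [c x y|n x xi].
  by rewrite lf lg scalerDr addrACA.
have := posD (hf n x xi) (hg n x xi); congr (pos _).
rewrite -big_split; apply: eq_bigr => i _; rewrite -big_split; apply: eq_bigr => j _.
by rewrite smulDr smulDl.
Qed.

Definition ampl A D (f : A -> D) n (X : cmx A n) : cmx D n := map_mx f X.

Lemma amplE A D (f : A -> D) n (X : cmx A n) i j : ampl f X i j = f (X i j).
Proof. exact: mxE. Qed.

Lemma ampl_linear A D (f : A -> D) n : linear f -> linear (@ampl A D f n).
Proof. by move=> lf c X Y; apply/matrixP => i j; rewrite !mxE lf. Qed.

Lemma ampl_hom A D (f : A -> D) n : is_star_hom f -> is_star_hom (@ampl A D f n).
Proof.
move=> [lf fM fS]; split=> [|X Y|X]; first exact: ampl_linear.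
  apply/matrixP => i j; rewrite !mxE (lin_sum lf).
  by apply: eq_bigr => k _; rewrite !mxE fM.
by apply/matrixP => i j; rewrite !mxE fS.
Qed.

(** Tested on a further vector [eta], the form over matrices unfolds to forms of [f] indexed by
    pairs of a matrix number and a column, with coefficients [zeta]; there is one such form for each
    inner index [r]. *)
Lemma cpf_ampl A D (f : A -> D) n : cpf f -> cpf (@ampl A D f n).
Proof.
move=> hf; have lf := proj1 hf; split=> [|N x xi]; first exact: ampl_linear.
set X := qform _ _; apply: (@qform_pos _ _ _ X).
  rewrite /X /qform star_sum exchange_big; apply: eq_bigr => k _.
  rewrite star_sum; apply: eq_bigr => l _.
  rewrite !starM starK smulA; congr (_ ∗ _ ∗ _).
  apply/matrixP => i j; rewrite cmxSE !amplE -(cpf_star hf) -cmxSE.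
  by rewrite starM starK.
move=> eta.
pose zeta (a : 'I_N * 'I_n) : D := \sum_p xi a.1 a.2 p ∗ eta p.
suff -> : qform X eta = \sum_r qform (fun a b : 'I_N * 'I_n =>
   f ((x a.1 r a.2)^† ∗ x b.1 r b.2)) zeta.
  by apply: pos_sum => r _; apply: (cpf_fin _ _ hf).
have -> : \sum_r qform (fun a b : 'I_N * 'I_n => f ((x a.1 r a.2)^† ∗ x b.1 r b.2)) zeta
  = qform (fun a b : 'I_N * 'I_n => ampl f ((x a.1)^† ∗ x b.1) a.2 b.2) zeta.
  rewrite /qform exchange_big; apply: eq_bigr => a _.
  rewrite exchange_big; apply: eq_bigr => b _.
  rewrite -smul_suml -smul_sumr; congr (_ ∗ _ ∗ _).
  by rewrite amplE cmxME (lin_sum lf); apply: eq_bigr => r _; rewrite cmxSE.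
pose g (k l : 'I_N) (i j p q : 'I_n) : D :=
  (eta p)^† ∗ (xi k i p)^† ∗ ampl f ((x k)^† ∗ x l) i j ∗ xi l j q ∗ eta q.
transitivity (\sum_p \sum_q \sum_k \sum_l \sum_j \sum_i g k l i j p q).
  apply: eq_bigr => p _; apply: eq_bigr => q _.
  rewrite /X /qform summxE smul_sumr smul_suml; apply: eq_bigr => k _.
  rewrite summxE smul_sumr smul_suml; apply: eq_bigr => l _.
  rewrite cmxME smul_sumr smul_suml; apply: eq_bigr => j _.
  rewrite cmxME smul_suml smul_sumr smul_suml; apply: eq_bigr => i _.
  by rewrite cmxSE /g !smulA.
transitivity (\sum_k \sum_i \sum_l \sum_j \sum_p \sum_q g k l i j p q).
  transitivity (\sum_k \sum_l \sum_j \sum_i \sum_p \sum_q g k l i j p q).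
    under eq_bigr do rewrite exchange_big.
    rewrite exchange_big; apply: eq_bigr => k _.
    under eq_bigr do rewrite exchange_big.
    rewrite exchange_big; apply: eq_bigr => l _.
    under eq_bigr do rewrite exchange_big.
    rewrite exchange_big; apply: eq_bigr => j _.
    under eq_bigr do rewrite exchange_big.
    by rewrite exchange_big.
  apply: eq_bigr => k _; under eq_bigr do rewrite exchange_big.
  by rewrite exchange_big.
rewrite pair_bigA; apply: eq_bigr => -[k i] _ /=.
rewrite pair_bigA; apply: eq_bigr => -[l j] _ /=.
rewrite /zeta star_sum !smul_suml; apply: eq_bigr => p _.
rewrite smul_sumr; apply: eq_bigr => q _.
by rewrite starM /g !smulA.
Qed.

Section CauchySchwarz.
Context {D : ucstarType R} (p b s : D).
Hypotheses (ps : p^† = p) (ss : s^† = s).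
Hypothesis hp : forall a c, pos (a^† ∗ p ∗ a + a^† ∗ b ∗ c + c^† ∗ b^† ∗ a + c^† ∗ s ∗ c).

(** The module Cauchy-Schwarz inequality on pairs, for the form of the matrix with rows [p, b] and
    [b^†, s], at the two unit vectors. *)
Lemma cauchy_schwarz2 : nr b ^+ 2 <= nr p * nr s.
Proof.
pose dt (u v : D * D) := u.1^† ∗ p ∗ v.1 + u.1^† ∗ b ∗ v.2 + u.2^† ∗ b^† ∗ v.1 + u.2^† ∗ s ∗ v.2.
have dl u : linear (dt u).
  by move=> c v w; rewrite /dt /= !smulDr !smulZr; lmod.
have dst u v : (dt u v)^† = dt v u.
  by rewrite /dt !starD !starM !starK ps ss !smulA; lmod.
have dr u (v : D * D) a : dt u (v.1 ∗ a, v.2 ∗ a) = dt u v ∗ a.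
  by rewrite /dt /= !smulDl !smulA.
pose H := PreHilbert dl dst (fun u => hp u.1 u.2) dr.
have := cauchy_schwarz H (𝟏, 0) (0, 𝟏).
rewrite -(@ler_pXn2r _ 2)// ?nnegrE// ?mulr_ge0 ?en_ge0// exprMn !en2 /= /dt /=.
by rewrite star0 star1 !smul0x !smulx0 !smul1x !smulx1 !addr0 !add0r.
Qed.

End CauchySchwarz.

(** In the Stinespring space of [f] this bounds the inner product of [y (x) eta] with
    [x (x) xi + x' (x) xi']. The second vector has two terms because differences of such vectors are
    estimated later. *)
Lemma cpf_cauchy_schwarz A D (f : A -> D) (x x' y : A) (xi xi' eta : D) : cpf f ->
  nr (eta^† ∗ (f (y^† ∗ x) ∗ xi + f (y^† ∗ x') ∗ xi')) ^+ 2 <=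
  nr (eta^† ∗ f (y^† ∗ y) ∗ eta) *
  nr (xi^† ∗ f (x^† ∗ x) ∗ xi + xi^† ∗ f (x^† ∗ x') ∗ xi' +
      xi'^† ∗ f (x'^† ∗ x) ∗ xi + xi'^† ∗ f (x'^† ∗ x') ∗ xi').
Proof.
move=> hf; have fS := cpf_star hf.
apply: cauchy_schwarz2.
- by rewrite !starM starK -fS starM starK smulA.
- rewrite !starD !starM !starK -!fS !starM !starK !smulA; lmod.
move=> a c; have := (proj2 hf) 3 (fun i => nth 0 [:: y; x; x'] i)
   (fun i => nth 0 [:: eta ∗ a; xi ∗ c; xi' ∗ c] i).
congr (pos _); rewrite /qform !big_ord_recl !big_ord0 /= !addr0.
rewrite !(starM, starD) !starK -!fS !starM !starK; nc.
Qed.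

End CompletelyPositive.

(** * Closed *-subalgebras *)

(** The unit [e] of the subalgebra may differ from the ambient one, as in a corner [e A e]. *)
Record subalg (R : realType) (A : ucstarType R) (e : A) (S : set A) : Prop := {
  subalg1 : S e ;
  subalg_unit : forall x, S x -> e ∗ x = x /\ x ∗ e = x ;
  subalg_lin : forall c x y, S x -> S y -> S (c *: x + y) ;
  subalgM : forall x y, S x -> S y -> S (x ∗ y) ;
  subalg_star : forall x, S x -> S x^† ;
  subalg_closed : forall (u : nat -> A) l, (forall n, S (u n)) -> ncv u l -> S l }.

Definition suba (R : realType) (A : ucstarType R) (e : A) (S : set A)
  (hS : subalg e S) : Type :=
  {x : A | x \in S}.

Section SubAlgebra.
Context {R : realType} {A : ucstarType R} {e : A} {S : set A} {hS : subalg e S}.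
Local Notation B := (suba hS).

Definition sval_ (x : B) : A := val x.
Definition smk (x : A) (h : S x) : B := exist _ x (mem_set h).
Lemma sval_in (x : B) : S (sval_ x).
Proof. exact: set_mem (valP x). Qed.
Lemma sval_inj (x y : B) : sval_ x = sval_ y -> x = y.
Proof. exact: val_inj. Qed.
Lemma smkK (x : A) (h : S x) : sval_ (smk h) = x.
Proof. by []. Qed.

Fact sub0 : S 0.
Proof.
have := subalg_lin hS (-1) (subalg1 hS) (subalg1 hS).
by rewrite scaleN1r addNr.
Qed.
Fact subD x y : S x -> S y -> S (x + y).
Proof. by move=> hx hy; have := subalg_lin hS 1 hx hy; rewrite scale1r. Qed.
Fact subZ c x : S x -> S (c *: x).
Proof. by move=> hx; have := subalg_lin hS c hx sub0; rewrite addr0. Qed.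
Fact subN x : S x -> S (- x).
Proof. by rewrite -scaleN1r; exact: subZ. Qed.

HB.instance Definition _ := Choice.copy B {x : A | x \in S}.

Definition s0 : B := smk sub0.
Definition sD (x y : B) : B := smk (subD (sval_in x) (sval_in y)).
Definition sN (x : B) : B := smk (subN (sval_in x)).
Definition sZ (c : R[i]) (x : B) : B := smk (subZ c (sval_in x)).
Definition sM (x y : B) : B := smk (subalgM hS (sval_in x) (sval_in y)).
Definition sS (x : B) : B := smk (subalg_star hS (sval_in x)).
Definition s1 : B := smk (subalg1 hS).

Fact sDA : associative sD.
Proof. by move=> x y z; apply: sval_inj; exact: addrA. Qed.
Fact sDC : commutative sD.
Proof. by move=> x y; apply: sval_inj; exact: addrC. Qed.
Fact s0D : left_id s0 sD.
Proof. by move=> x; apply: sval_inj; exact: add0r. Qed.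
Fact sND : left_inverse s0 sN sD.
Proof. by move=> x; apply: sval_inj; exact: addNr. Qed.
HB.instance Definition _ := GRing.isZmodule.Build B sDA sDC s0D sND.

Fact sZA c d x : sZ c (sZ d x) = sZ (c * d) x.
Proof. by apply: sval_inj; exact: scalerA. Qed.
Fact s1Z : left_id 1 sZ.
Proof. by move=> x; apply: sval_inj; exact: scale1r. Qed.
Fact sZDr : right_distributive sZ +%R.
Proof. by move=> c x y; apply: sval_inj; exact: scalerDr. Qed.
Fact sZDl x : {morph sZ^~ x : c d / c + d}.
Proof. by move=> c d; apply: sval_inj; exact: scalerDl. Qed.
HB.instance Definition _ :=
  GRing.Zmodule_isLmodule.Build R[i] B sZA s1Z sZDr sZDl.

Definition sn (x : B) : R := nr (sval_ x).

Fact sMA x y z : sM x (sM y z) = sM (sM x y) z.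
Proof. by apply: sval_inj; exact: smulA. Qed.
Fact sM_linl y : linear (sM^~ y).
Proof. by move=> c x z; apply: sval_inj; exact: smul_linearl. Qed.
Fact sM_linr y : linear (sM y).
Proof. by move=> c x z; apply: sval_inj; exact: smul_linearr. Qed.
Fact sM1x x : sM s1 x = x.
Proof. by apply: sval_inj; have [] := subalg_unit hS (sval_in x). Qed.
Fact sMx1 x : sM x s1 = x.
Proof. by apply: sval_inj; have [] := subalg_unit hS (sval_in x). Qed.
Fact sS_lin (c : R[i]) x y : sS (c *: x + y) = (c^*)%R *: sS x + sS y.
Proof. by apply: sval_inj; exact: star_conjlinear. Qed.
Fact sSM x y : sS (sM x y) = sM (sS y) (sS x).
Proof. by apply: sval_inj; exact: starM. Qed.
Fact sSK x : sS (sS x) = x.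
Proof. by apply: sval_inj; exact: starK. Qed.
Fact snD x y : sn (x + y) <= sn x + sn y.
Proof. exact: nrD. Qed.
Fact snZ (c : R[i]) x : sn (c *: x) = nr c * sn x.
Proof. exact: nrZ. Qed.
Fact sn_eq0 x : sn x = 0 -> x = 0.
Proof. by move=> /nr_eq0 h; apply: sval_inj. Qed.
Fact snM x y : sn (sM x y) <= sn x * sn y.
Proof. exact: nrM. Qed.
Fact snS x : sn (sM (sS x) x) = sn x ^+ 2.
Proof. exact: nrS. Qed.
Fact s_complete (u : nat -> B) :
  (forall e : R, 0 < e -> exists N, forall m n, (N <= m)%N -> (N <= n)%N ->
      sn (u m - u n) <= e) ->
    exists l, forall e : R, 0 < e -> exists N, forall n, (N <= n)%N ->
      sn (u n - l) <= e.
Proof.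
move=> hu; have [l hl] : exists l, ncv (fun n => sval_ (u n)) l by exact: ncauchy_ncv.
by exists (smk (subalg_closed hS (fun n => sval_in (u n)) hl)).
Qed.

HB.instance Definition _ := isUCStarAlg.Build R B sMA sM_linl sM_linr
  sM1x sMx1 sS_lin sSM sSK snD snZ sn_eq0 snM snS s_complete.

Lemma nr_sval (x : B) : nr (sval_ x) = nr x.
Proof. by apply: complexI; rewrite -[RHS]nrE. Qed.

Lemma sval_hom : is_star_hom sval_.
Proof. by []. Qed.

Lemma sval1 : sval_ 𝟏 = e.
Proof. by []. Qed.

End SubAlgebra.

(** * Completion of a *-algebra with a C*-seminorm *)

Record precstar (R : realType) (X : lmodType R[i]) := PreCStar {
  pmul : X -> X -> X ;
  pone : X ;
  pstar : X -> X ;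
  psn : X -> R ;
  pmulA : forall x y z, pmul x (pmul y z) = pmul (pmul x y) z ;
  pmul_linl : forall y, linear (pmul^~ y) ;
  pmul_linr : forall x, linear (pmul x) ;
  pmul1x : forall x, pmul pone x = x ;
  pmulx1 : forall x, pmul x pone = x ;
  pstar_conjlinear : forall (c : R[i]) x y,
    pstar (c *: x + y) = (c^*)%R *: pstar x + pstar y ;
  pstarM : forall x y, pstar (pmul x y) = pmul (pstar y) (pstar x) ;
  pstarK : forall x, pstar (pstar x) = x ;
  psnD : forall x y, psn (x + y) <= psn x + psn y ;
  psnZ : forall (c : R[i]) x, psn (c *: x) = nr c * psn x ;
  psnM : forall x y, psn (pmul x y) <= psn x * psn y ;
  psnS : forall x, psn (pmul (pstar x) x) = psn x ^+ 2 }.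

Section Completion.
Context {R : realType} {X : lmodType R[i]} (P : precstar X).
Local Notation pm := (pmul P).
Local Notation ps := (pstar P).
Local Notation p := (psn P).
Implicit Types (x y z : X) (u v w : nat -> X).

Lemma psn0 : p 0 = 0.
Proof. by rewrite -(scale0r 0) psnZ nr0 mul0r. Qed.
Lemma psnN x : p (- x) = p x.
Proof. by rewrite -scaleN1r psnZ nrN /nr normr1 mul1r. Qed.
Lemma psn_ge0 x : 0 <= p x.
Proof. by have := psnD P x (- x); rewrite subrr psn0 psnN; lra. Qed.
Lemma psn_tri z x y : p (x - y) <= p (x - z) + p (z - y).
Proof. by have := psnD P (x - z) (z - y); rewrite addrA subrK. Qed.
Lemma psnC x y : p (x - y) = p (y - x).
Proof. by rewrite -psnN opprB. Qed.
Lemma psn_star x : p (ps x) = p x.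
Proof.
have h y : p y <= p (ps y).
  have [->|y0] := eqVneq (p y) 0; first exact: psn_ge0.
  have yp : 0 < p y by rewrite lt_def y0 psn_ge0.
  by rewrite -(ler_pM2r yp) -expr2 -psnS psnM.
by apply/eqP; rewrite eq_le h -[X in _ <= p X](pstarK P) h.
Qed.
Lemma psn_abs x y : `|p x - p y| <= p (x - y).
Proof.
rewrite ler_norml; apply/andP; split.
  by have := psnD P (y - x) x; rewrite subrK psnC; lra.
by have := psnD P (x - y) y; rewrite subrK; lra.
Qed.

Definition pcauchy u := forall e : R, 0 < e ->
  exists N, forall m n, (N <= m)%N -> (N <= n)%N -> p (u m - u n) <= e.
Definition pnull u := forall e : R, 0 < e ->
  exists N, forall n, (N <= n)%N -> p (u n) <= e.

Lemma pcauchy_bd u : pcauchy u -> exists2 C : R, 0 < C & forall n, p (u n) <= C.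
Proof.
move=> /(_ 1 ltr01)[N hN].
pose S := \sum_(k < N.+1) p (u k).
have S0 : 0 <= S by apply: sumr_ge0 => k _; exact: psn_ge0.
have le_S k : (k <= N)%N -> p (u k) <= S.
  rewrite -ltnS => kN; rewrite /S (bigD1 (Ordinal kN))//= lerDl.
  by apply: sumr_ge0 => j _; exact: psn_ge0.
exists (S + 1); first by lra.
move=> n; have [nN|Nn] := leqP n N; first by have := le_S n nN; lra.
have := hN n N (ltnW Nn) (leqnn _); have := le_S N (leqnn _).
have := psnD P (u n - u N) (u N); rewrite subrK; lra.
Qed.

Lemma pnull_sub u v : pnull (fun n => u n - v n) -> pnull (fun n => v n - u n).
Proof. by move=> h e /h[N hN]; exists N => n /hN; rewrite psnC. Qed.

Lemma pnull_tri u v w : pnull (fun n => u n - v n) -> pnull (fun n => v n - w n) ->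
  pnull (fun n => u n - w n).
Proof.
move=> h1 h2 e e0; have e20 : 0 < e / 2 by rewrite divr_gt0.
have [N1 k1] := h1 _ e20; have [N2 k2] := h2 _ e20.
exists (maxn N1 N2) => n; rewrite geq_max => /andP[/k1 l1 /k2 l2].
by have := psn_tri (v n) (u n) (w n); lra.
Qed.

Lemma pcauchyD u v (c : R[i]) : pcauchy u -> pcauchy v -> pcauchy (fun n => c *: u n + v n).
Proof.
move=> hu hv e e0; have c0 : 0 < 1 + nr c by rewrite ltr_pwDl.
have [|N1 k1] := hu (e / 2 / (1 + nr c)); first by rewrite !divr_gt0.
have [|N2 k2] := hv (e / 2); first by rewrite divr_gt0.
exists (maxn N1 N2) => m n; rewrite !geq_max => /andP[m1 m2] /andP[n1 n2].
have -> : c *: u m + v m - (c *: u n + v n) = c *: (u m - u n) + (v m - v n).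
  by rewrite scalerBr opprD addrACA.
have a := k1 _ _ m1 n1; have b := k2 _ _ m2 n2; rewrite ler_pdivlMr// in a.
have := psnD P (c *: (u m - u n)) (v m - v n); rewrite psnZ.
have := psn_ge0 (u m - u n); nra.
Qed.

Lemma psnM_tri x y x' y' : p (pm x y - pm x' y') <= p (x - x') * p y + p x' * p (y - y').
Proof.
have -> : pm x y - pm x' y' = pm (x - x') y + pm x' (y - y').
  rewrite (linB (pmul_linr P x')) (linB (pmul_linl P y)); lmod.
by apply: le_trans (psnD _ _ _) (lerD _ _); exact: psnM.
Qed.

Lemma pcauchyM u v : pcauchy u -> pcauchy v -> pcauchy (fun n => pm (u n) (v n)).
Proof.
move=> hu hv; have [C C0 hC] := pcauchy_bd hu; have [D D0 hD] := pcauchy_bd hv.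
move=> e e0; have [|N1 k1] := hu (e / 2 / D); first by rewrite !divr_gt0.
have [|N2 k2] := hv (e / 2 / C); first by rewrite !divr_gt0.
exists (maxn N1 N2) => m n; rewrite !geq_max => /andP[m1 m2] /andP[n1 n2].
apply: (le_trans (psnM_tri _ _ _ _)); rewrite [e]splitr.
apply: lerD.
  rewrite -(divfK (lt0r_neq0 D0) (e / 2)).
  by apply: ler_pM; rewrite ?psn_ge0 ?k1.
rewrite -(divfK (lt0r_neq0 C0) (e / 2)) mulrC.
by apply: ler_pM; rewrite ?psn_ge0 ?k2.
Qed.

Lemma pnullM u v u' v' : pcauchy u' -> pcauchy v ->
  pnull (fun n => u n - u' n) -> pnull (fun n => v n - v' n) ->
  pnull (fun n => pm (u n) (v n) - pm (u' n) (v' n)).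
Proof.
move=> hu hv h1 h2; have [C C0 hC] := pcauchy_bd hu; have [D D0 hD] := pcauchy_bd hv.
move=> e e0; have [|N1 k1] := h1 (e / 2 / D); first by rewrite !divr_gt0.
have [|N2 k2] := h2 (e / 2 / C); first by rewrite !divr_gt0.
exists (maxn N1 N2) => n; rewrite geq_max => /andP[n1 n2].
apply: (le_trans (psnM_tri _ _ _ _)); rewrite [e]splitr.
apply: lerD.
  rewrite -(divfK (lt0r_neq0 D0) (e / 2)).
  by apply: ler_pM; rewrite ?psn_ge0 ?k1.
rewrite -(divfK (lt0r_neq0 C0) (e / 2)) mulrC.
by apply: ler_pM; rewrite ?psn_ge0 ?k2.
Qed.

Lemma pstarB x y : ps x - ps y = ps (x - y).
Proof.
have := pstar_conjlinear P (-1) y x.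
by rewrite rmorphN rmorph1 !scaleN1r => h; rewrite [LHS]addrC -h addrC.
Qed.

Lemma pcauchyS u : pcauchy u -> pcauchy (fun n => ps (u n)).
Proof. by move=> h e /h[N hN]; exists N => m n mN nN; rewrite pstarB psn_star hN. Qed.

Lemma pcauchy_cst x : pcauchy (fun=> x).
Proof. by move=> e e0; exists 0%N => m n _ _; rewrite subrr psn0 ltW. Qed.

Lemma psn_cvg u : pcauchy u -> cvg (p (u n) @[n --> \oo]).
Proof.
move=> h; apply: cauchy_cvg; apply: cauchy_exP => e e0.
have [|N hN] := h (e / 2); first by rewrite divr_gt0.
exists (p (u N)); exists N => // n /= Nn; rewrite /ball /=.
apply: le_lt_trans (psn_abs _ _) _; apply: le_lt_trans (hN _ _ _ _) _ => //.
by rewrite ltr_pdivrMr// ltr_pMr// ltr1n.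
Qed.

(** Elements of the completion are the classes of Cauchy sequences, as sets. *)
Definition cls u : set (nat -> X) := [set v | pnull (fun n => u n - v n)].

Definition compl : Type := {c : set (nat -> X) | `[< exists2 u, pcauchy u & c = cls u >]}.

HB.instance Definition _ := gen_eqMixin compl.
HB.instance Definition _ := gen_choiceMixin compl.

Fact mk_key u : `[< exists2 v, pcauchy v &
  cls (if `[< pcauchy u >] then u else fun=> 0) = cls v >].
Proof.
apply/asboolP; case: asboolP => hu; first by exists u.
by exists (fun=> 0) => //; exact: pcauchy_cst.
Qed.

(** Total: a sequence that is not Cauchy is replaced by 0. *)
Definition mk u : compl :=
  exist (fun c => is_true `[< exists2 v, pcauchy v & c = cls v >]) _ (mk_key u).

Definition rep (c : compl) : nat -> X := projT1 (cid2 (asboolW (valP c))).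

Lemma mkP u v : pcauchy u -> pcauchy v -> (mk u = mk v <-> pnull (fun n => u n - v n)).
Proof.
move=> /asboolP hu /asboolP hv; split=> [/(congr1 val) /=|h].
  rewrite hu hv => /(congr1 (fun s : set _ => s v)) /= e.
  suff : cls u v by [].
  rewrite e => d d0; exists 0%N => n _; by rewrite subrr psn0 ltW.
apply: val_inj; rewrite /= hu hv; apply/seteqP; split=> w /=.
  by apply: pnull_tri; exact: pnull_sub.
exact: pnull_tri.
Qed.

Lemma rep_cauchy c : pcauchy (rep c).
Proof. by rewrite /rep; case: cid2. Qed.

Lemma mk_rep c : mk (rep c) = c.
Proof.
apply: val_inj => /=; have /asboolP -> := rep_cauchy c.
by rewrite /rep; case: cid2.
Qed.

Lemma compl_ind (Q : compl -> Prop) : (forall u, pcauchy u -> Q (mk u)) -> forall c, Q c.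
Proof. by move=> h c; rewrite -(mk_rep c); apply/h/rep_cauchy. Qed.

Lemma rep_mk u : pcauchy u -> pnull (fun n => rep (mk u) n - u n).
Proof. by move=> hu; apply/mkP => //; [exact: rep_cauchy|rewrite mk_rep]. Qed.

(** Sum, opposite and scaling are all instances of this combination, so their independence of
    representatives is checked once, in [kLE]. *)
Definition kL (c : R[i]) (x y : compl) := mk (fun n => c *: rep x n + rep y n).
Definition kM (x y : compl) := mk (fun n => pm (rep x n) (rep y n)).
Definition kS (x : compl) := mk (fun n => ps (rep x n)).
Definition kn (x : compl) : R := lim (p (rep x n) @[n --> \oo]).
Definition iota_ x : compl := mk (fun=> x).

Lemma kLE c u v : pcauchy u -> pcauchy v ->
  kL c (mk u) (mk v) = mk (fun n => c *: u n + v n).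
Proof.
move=> hu hv; apply/mkP; [by apply: pcauchyD; exact: rep_cauchy|exact: pcauchyD|].
move=> e e0; have c0 : 0 < 1 + nr c by rewrite ltr_pwDl.
have [|N1 k1] := rep_mk hu (e := e / 2 / (1 + nr c)); first by rewrite !divr_gt0.
have [|N2 k2] := rep_mk hv (e := e / 2); first by rewrite divr_gt0.
exists (maxn N1 N2) => n; rewrite geq_max => /andP[/k1 + /k2 a2].
rewrite ler_pdivlMr// => a1; move: a1 a2; move: (rep (mk u) n) (rep (mk v) n) => x y a1 a2.
have -> : c *: x + y - (c *: u n + v n) = c *: (x - u n) + (y - v n).
  by rewrite scalerBr opprD addrACA.
have := psnD P (c *: (x - u n)) (y - v n); rewrite psnZ.
have := psn_ge0 (x - u n); nra.
Qed.

Lemma kME u v : pcauchy u -> pcauchy v -> kM (mk u) (mk v) = mk (fun n => pm (u n) (v n)).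
Proof.
move=> hu hv; apply/mkP; [by apply: pcauchyM; exact: rep_cauchy|exact: pcauchyM|].
by apply: pnullM => //; [exact: rep_cauchy|exact: rep_mk|exact: rep_mk].
Qed.

Lemma kSE u : pcauchy u -> kS (mk u) = mk (fun n => ps (u n)).
Proof.
move=> hu; apply/mkP; [by apply: pcauchyS; exact: rep_cauchy|exact: pcauchyS|].
by move=> e /(rep_mk hu)[N hN]; exists N => n /hN; rewrite pstarB psn_star.
Qed.

Lemma knE u : pcauchy u -> p (u n) @[n --> \oo] --> kn (mk u).
Proof.
move=> hu; have hr : p (rep (mk u) n) @[n --> \oo] --> kn (mk u).
  exact: psn_cvg (rep_cauchy _).
rewrite -[kn _]addr0.
have -> : (fun n => p (u n)) = (fun n => p (rep (mk u) n) + (p (u n) - p (rep (mk u) n))).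
  by apply/funext => n; rewrite addrC subrK.
apply: cvgD => //; apply/cvgrPdist_le => e /(rep_mk hu)[N hN].
exists N => // n /= /hN; rewrite sub0r normrN; apply: le_trans.
by rewrite distrC psn_abs.
Qed.

Lemma kn_le u (r : R) : pcauchy u -> (exists N, forall n, (N <= n)%N -> p (u n) <= r) ->
  kn (mk u) <= r.
Proof.
move=> hu [N hN]; apply: (ler_cvg_to (knE hu) (cvg_cst r)).
by exists N => // n; exact: hN.
Qed.

Lemma kn_iota x : kn (iota_ x) = p x.
Proof.
by apply: (@cvg_unique _ _ _ _ _ _ (knE (pcauchy_cst x))) => //; exact: cvg_cst.
Qed.

Definition kD (x y : compl) := kL 1 x y.
Definition kN (x : compl) := kL (-1) x (iota_ 0).
Definition kZ (c : R[i]) (x : compl) := kL c x (iota_ 0).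

Fact kDE u v : pcauchy u -> pcauchy v -> kD (mk u) (mk v) = mk (fun n => u n + v n).
Proof. by move=> hu hv; rewrite /kD kLE//; congr mk; apply/funext => n; rewrite scale1r. Qed.
Fact kZE c u : pcauchy u -> kZ c (mk u) = mk (fun n => c *: u n).
Proof.
move=> hu; rewrite /kZ kLE//; last exact: pcauchy_cst.
by congr mk; apply/funext => n; rewrite addr0.
Qed.
Lemma pcauchyZ c u : pcauchy u -> pcauchy (fun n => c *: u n).
Proof.
move=> hu; have := pcauchyD c hu (pcauchy_cst 0).
by under [X in pcauchy X -> _]eq_fun do rewrite addr0.
Qed.
Lemma pcauchyA u v : pcauchy u -> pcauchy v -> pcauchy (fun n => u n + v n).
Proof.
move=> hu hv; have := pcauchyD 1 hu hv.
by under [X in pcauchy X -> _]eq_fun do rewrite scale1r.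
Qed.
Hint Resolve pcauchyA pcauchyZ pcauchy_cst pcauchyM pcauchyS : core.

Fact kNE u : pcauchy u -> kN (mk u) = mk (fun n => - u n).
Proof.
move=> hu; rewrite /kN -/(kZ _ _) kZE//.
by congr mk; apply/funext => n; rewrite scaleN1r.
Qed.

Fact kDA : associative kD.
Proof.
elim/compl_ind => u hu; elim/compl_ind => v hv; elim/compl_ind => w hw.
by rewrite !kDE; auto; congr mk; apply/funext => n; rewrite addrA.
Qed.
Fact kDC : commutative kD.
Proof.
elim/compl_ind => u hu; elim/compl_ind => v hv.
by rewrite !kDE; auto; congr mk; apply/funext => n; rewrite addrC.
Qed.
Fact k0D : left_id (iota_ 0) kD.
Proof.
elim/compl_ind => u hu.
by rewrite !kDE; auto; congr mk; apply/funext => n; rewrite add0r.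
Qed.
Fact kND : left_inverse (iota_ 0) kN kD.
Proof.
elim/compl_ind => u hu; rewrite kNE// kDE//.
  by congr mk; apply/funext => n; rewrite addNr.
by have := pcauchyZ (-1) hu; under [X in pcauchy X -> _]eq_fun do rewrite scaleN1r.
Qed.
HB.instance Definition _ := GRing.isZmodule.Build compl kDA kDC k0D kND.

Fact kaddE (x y : compl) : x + y = kD x y. Proof. by []. Qed.

Fact kZA c d (x : compl) : kZ c (kZ d x) = kZ (c * d) x.
Proof.
elim/compl_ind: x => u hu; rewrite !kZE; auto.
by congr mk; apply/funext => n; rewrite scalerA.
Qed.
Fact k1Z : left_id 1 kZ.
Proof.
by elim/compl_ind => u hu; rewrite kZE//; congr mk; apply/funext => n; rewrite scale1r.
Qed.
Fact kZDr : right_distributive kZ +%R.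
Proof.
move=> c; elim/compl_ind => u hu; elim/compl_ind => v hv.
rewrite !kaddE (kDE hu hv) (kZE c hu) (kZE c hv) (kZE c (pcauchyA hu hv)).
rewrite (kDE (pcauchyZ c hu) (pcauchyZ c hv)).
by congr mk; apply/funext => n; rewrite scalerDr.
Qed.
Fact kZDl (x : compl) : {morph kZ^~ x : c d / c + d}.
Proof.
move=> c d; elim/compl_ind: x => u hu.
rewrite !kaddE !(kZE _ hu) (kDE (pcauchyZ c hu) (pcauchyZ d hu)).
by congr mk; apply/funext => n; rewrite scalerDl.
Qed.
HB.instance Definition _ :=
  GRing.Zmodule_isLmodule.Build R[i] compl kZA k1Z kZDr kZDl.

Lemma kLinE c u v : pcauchy u -> pcauchy v ->
  c *: mk u + mk v = mk (fun n => c *: u n + v n).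
Proof.
by move=> hu hv; rewrite kaddE -[c *: mk u]/(kZ _ _) kZE// kDE; auto.
Qed.

Fact kMA (x y z : compl) : kM x (kM y z) = kM (kM x y) z.
Proof.
elim/compl_ind: x => u hu; elim/compl_ind: y => v hv; elim/compl_ind: z => w hw.
by rewrite !kME; auto; congr mk; apply/funext => n; rewrite pmulA.
Qed.
Fact kM_linl (y : compl) : linear (kM^~ y).
Proof.
move=> c; elim/compl_ind: y => w hw; elim/compl_ind => u hu; elim/compl_ind => v hv.
rewrite kLinE//= !kME; auto; last exact: pcauchyD.
by rewrite kLinE; auto; congr mk; apply/funext => n; rewrite pmul_linl.
Qed.
Fact kM_linr (y : compl) : linear (kM y).
Proof.
move=> c; elim/compl_ind: y => w hw; elim/compl_ind => u hu; elim/compl_ind => v hv.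
rewrite kLinE//= !kME; auto; last exact: pcauchyD.
by rewrite kLinE; auto; congr mk; apply/funext => n; rewrite pmul_linr.
Qed.
Fact kM1x (x : compl) : kM (iota_ (pone P)) x = x.
Proof.
by elim/compl_ind: x => u hu; rewrite kME; auto; congr mk; apply/funext => n; rewrite pmul1x.
Qed.
Fact kMx1 (x : compl) : kM x (iota_ (pone P)) = x.
Proof.
by elim/compl_ind: x => u hu; rewrite kME; auto; congr mk; apply/funext => n; rewrite pmulx1.
Qed.
Fact kS_lin (c : R[i]) (x y : compl) : kS (c *: x + y) = (c^*)%R *: kS x + kS y.
Proof.
elim/compl_ind: x => u hu; elim/compl_ind: y => v hv.
rewrite kLinE// !kSE; auto; last exact: pcauchyD.
by rewrite kLinE; auto; congr mk; apply/funext => n; rewrite pstar_conjlinear.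
Qed.
Fact kSM (x y : compl) : kS (kM x y) = kM (kS y) (kS x).
Proof.
elim/compl_ind: x => u hu; elim/compl_ind: y => v hv.
rewrite kME// !kSE; auto; rewrite kME; auto.
by congr mk; apply/funext => n; rewrite pstarM.
Qed.
Fact kSK (x : compl) : kS (kS x) = x.
Proof.
elim/compl_ind: x => u hu; rewrite !kSE; auto.
by congr mk; apply/funext => n; rewrite pstarK.
Qed.

Fact knD (x y : compl) : kn (x + y) <= kn x + kn y.
Proof.
elim/compl_ind: x => u hu; elim/compl_ind: y => v hv.
rewrite kaddE kDE//.
apply: (ler_cvg_to (knE (pcauchyA hu hv)) (cvgD (knE hu) (knE hv))).
by exists 0%N => // n _; exact: psnD.
Qed.
Fact knZ (c : R[i]) (x : compl) : kn (c *: x) = nr c * kn x.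
Proof.
elim/compl_ind: x => u hu; rewrite -[_ *: _]/(kZ _ _) kZE//.
apply: (@cvg_unique _ _ _ _ _ _ (knE (pcauchyZ c hu))) => //.
have -> : (fun n => p (c *: u n)) = (fun n => nr c * p (u n)).
  by apply/funext => n; rewrite psnZ.
by apply: cvgMr; exact: knE.
Qed.
Fact kn_eq0 (x : compl) : kn x = 0 -> x = 0.
Proof.
elim/compl_ind: x => u hu h0; apply/mkP => // e e0.
have := knE hu; rewrite h0 => /cvgrPdist_le/(_ _ e0)[N _ hN].
exists N => n /hN /=; by rewrite subr0 sub0r normrN ger0_norm ?psn_ge0.
Qed.
Fact knM (x y : compl) : kn (kM x y) <= kn x * kn y.
Proof.
elim/compl_ind: x => u hu; elim/compl_ind: y => v hv; rewrite kME//.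
apply: (ler_cvg_to (knE (pcauchyM hu hv)) (cvgM (knE hu) (knE hv))).
by exists 0%N => // n _; exact: psnM.
Qed.
Fact knS (x : compl) : kn (kM (kS x) x) = kn x ^+ 2.
Proof.
elim/compl_ind: x => u hu; rewrite kSE// kME; auto.
apply: (@cvg_unique _ _ _ _ _ _ (knE (pcauchyM (pcauchyS hu) hu))) => //.
have -> : (fun n => p (pm (ps (u n)) (u n))) = (fun n => p (u n) * p (u n)).
  by apply/funext => n; rewrite psnS expr2.
by rewrite expr2; apply: cvgM; exact: knE.
Qed.

Lemma kn_dense (x : compl) (e : R) : 0 < e -> exists y, kn (x - iota_ y) <= e.
Proof.
move=> e0; elim/compl_ind: x => u hu; have [N hN] := hu _ e0.
exists (u N); rewrite addrC -scaleN1r kLinE; auto.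
apply: kn_le; first by apply: pcauchyD => //; exact: pcauchy_cst.
by exists N => n Nn; rewrite scaleN1r addrC hN.
Qed.

Lemma iota_linear : linear iota_.
Proof. by move=> c x y; rewrite /iota_ kLinE; auto. Qed.

Fact k_complete (x : nat -> compl) :
  (forall e : R, 0 < e -> exists N, forall m n, (N <= m)%N -> (N <= n)%N ->
      kn (x m - x n) <= e) ->
    exists l, forall e : R, 0 < e -> exists N, forall n, (N <= n)%N ->
      kn (x n - l) <= e.
Proof.
move=> hx.
have knC a b : kn (a - b) = kn (b - a).
  by rewrite -opprB -scaleN1r knZ nrN /nr normr1 mul1r.
have knT a b c : kn (a - c) <= kn (a - b) + kn (b - c).
  by have := knD (a - b) (b - c); rewrite addrA subrK.
have /choice[y hy] : forall k, exists y, kn (x k - iota_ y) <= k.+1%:R^-1.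
  by move=> k; apply: kn_dense; rewrite invr_gt0.
have y_cauchy : pcauchy y.
  move=> e e0; have e30 : 0 < e / 3 by rewrite divr_gt0.
  have [N1 h1] := hx _ e30; have [N2 h2] := invS_small e30.
  exists (maxn N1 N2) => m n; rewrite !geq_max => /andP[m1 m2] /andP[n1 n2].
  rewrite -kn_iota (linB iota_linear).
  have a1 := le_trans (hy m) (h2 _ m2); have a2 := le_trans (hy n) (h2 _ n2).
  have b := h1 _ _ m1 n1; have t := knT (x m) (x n) (iota_ (y n)).
  apply: (le_trans (knT _ (x m) _)); rewrite (knC (iota_ (y m)) (x m)).
  by apply: (le_trans (lerD a1 (le_trans t (lerD b a2)))); lra.
exists (mk y) => e e0; have e20 : 0 < e / 2 by rewrite divr_gt0.
have [N1 h1] := y_cauchy _ e20; have [N2 h2] := invS_small e20.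
exists (maxn N1 N2) => n; rewrite geq_max => /andP[n1 n2].
apply: (le_trans (knT _ (iota_ (y n)) _)); rewrite [e]splitr; apply: lerD.
  exact: le_trans (hy n) (h2 _ n2).
rewrite knC addrC -scaleN1r kLinE; auto.
apply: kn_le; first by apply: pcauchyD => //; exact: pcauchy_cst.
by exists N1 => k k1; rewrite scaleN1r addrC h1.
Qed.

HB.instance Definition _ := isUCStarAlg.Build R compl kMA kM_linl kM_linr
  kM1x kMx1 kS_lin kSM kSK knD knZ kn_eq0 knM knS k_complete.

Lemma nr_compl (x : compl) : nr x = kn x.
Proof. by apply: complexI; rewrite -nrE. Qed.

Lemma nr_iota x : nr (iota_ x) = p x.
Proof. by rewrite nr_compl kn_iota. Qed.

Lemma iotaM x y : iota_ (pm x y) = iota_ x ∗ iota_ y.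
Proof. by rewrite -[RHS]/(kM _ _) kME; auto. Qed.

Lemma iota_star x : iota_ (ps x) = (iota_ x)^†.
Proof. by rewrite -[RHS]/(kS _) kSE; auto. Qed.

Lemma iota_dense (x : compl) : exists u : nat -> X, ncv (fun n => iota_ (u n)) x.
Proof.
have /choice[y hy] : forall k, exists y, kn (x - iota_ y) <= k.+1%:R^-1.
  by move=> k; apply: kn_dense; rewrite invr_gt0.
exists y => e e0; have [N hN] := invS_small e0; exists N => n Nn.
by rewrite nrC nr_compl; exact: le_trans (hy n) (hN _ Nn).
Qed.

End Completion.

(** * Unitization *)

Section ComplexComplete.
Context {R : realType}.

Lemma nrcM (a b : R[i]) : nr (a * b) = nr a * nr b.
Proof. by apply: complexI; rewrite rmorphM /= -!nrE normrM. Qed.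

Lemma nr_Re (z : R[i]) : `|complex.Re z| <= nr z.
Proof.
rewrite /nr normc_def /= -sqrtr_sqr ler_sqrt ?addr_ge0 ?sqr_ge0//.
by rewrite lerDl sqr_ge0.
Qed.
Lemma nr_Im (z : R[i]) : `|complex.Im z| <= nr z.
Proof.
rewrite /nr normc_def /= -sqrtr_sqr ler_sqrt ?addr_ge0 ?sqr_ge0//.
by rewrite lerDr sqr_ge0.
Qed.

Lemma real_ncauchy (u : nat -> R) : (forall e : R, 0 < e -> exists N, forall m n,
    (N <= m)%N -> (N <= n)%N -> `|u m - u n| <= e) ->
  exists l, forall e : R, 0 < e -> exists N, forall n, (N <= n)%N -> `|u n - l| <= e.
Proof.
move=> h; have /cauchy_cvg/cvg_ex [l /cvgrPdist_le hl] : cauchy (u @ \oo).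
  apply: cauchy_exP => e e0; have [|N hN] := h (e / 2); first by rewrite divr_gt0.
  exists (u N); exists N => // n /= Nn; rewrite /ball /=.
  by apply: le_lt_trans (hN _ _ _ _) _ => //; rewrite ltr_pdivrMr// ltr_pMr// ltr1n.
exists l => e /hl[N _ hN]; exists N => n /hN; by rewrite distrC.
Qed.

Lemma complex_ncauchy (u : nat -> R[i]) : ncauchy u -> exists l, ncv u l.
Proof.
move=> h.
have [a ha] : exists a, forall e : R, 0 < e -> exists N, forall n, (N <= n)%N ->
    `|complex.Re (u n) - a| <= e.
  apply: real_ncauchy => e /h[N hN]; exists N => m n mN nN.
  by rewrite -raddfB; exact: le_trans (nr_Re _) (hN _ _ mN nN).
have [b hb] : exists b, forall e : R, 0 < e -> exists N, forall n, (N <= n)%N ->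
    `|complex.Im (u n) - b| <= e.
  apply: real_ncauchy => e /h[N hN]; exists N => m n mN nN.
  by rewrite -raddfB; exact: le_trans (nr_Im _) (hN _ _ mN nN).
exists (a +i* b) => e e0; have e20 : 0 < e / 2 by rewrite divr_gt0.
have [N1 h1] := ha _ e20; have [N2 h2] := hb _ e20.
exists (maxn N1 N2) => n; rewrite geq_max => /andP[/h1 k1 /h2 k2].
have -> : u n - (a +i* b) = (complex.Re (u n) - a)%:C + 'i * (complex.Im (u n) - b)%:C.
  rewrite {1}[u n]complexE; apply/eqP; rewrite eq_complex /=.
  by apply/andP; split; apply/eqP; ring.
apply: (le_trans (nrD _ _)); rewrite nrR [e]splitr; apply: lerD => //.
by rewrite /nr normrM normCi mul1r -/(nr _) nrR.
Qed.

End ComplexComplete.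

Definition unz (R : realType) (A : cstarAlgType R[i]) : Type := (A * R[i]^o)%type.

Section Unitization.
Context {R : realType} {A : cstarAlgType R[i]}.
Local Notation U := (unz A).
Implicit Types (x y z : U) (a b : A).

HB.instance Definition _ := GRing.Lmodule.copy U (A * R[i]^o)%type.

Definition zmul x y : U := (x.1 ∗ y.1 + (y.2 *: x.1 + x.2 *: y.1), x.2 * y.2).
Definition zone : U := (0, 1).
Definition zstar x : U := (x.1^†, (x.2^*)%R).
Definition zact x a : A := x.1 ∗ a + x.2 *: a.

Lemma nrZ_ (a : A) (c : R[i]) : nr (c *: a) = nr c * nr a.
Proof. exact: nrZ. Qed.

Lemma zact_opb x : opb (@nr R A) (zact x) (nr x.1 + nr x.2).
Proof.
split=> [|a]; first by rewrite addr_ge0.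
rewrite mulrDl; apply: (le_trans (nrD _ _)).
by apply: lerD; [exact: nrM|rewrite nrZ].
Qed.

Lemma zact_bd x : bounded (@nr R A) (zact x).
Proof. by exists (nr x.1 + nr x.2); exact: zact_opb. Qed.

Definition zop x : R := opn (@nr R A) (zact x).
(** The operator norm on [A] alone degenerates if [A] has a unit [e], as [(- e, 1)] acts by zero;
    the modulus of the scalar part, a character, repairs this. *)
Definition zn x : R := Num.max (nr x.2) (zop x).

Let zopP x a : nr (zact x a) <= zop x * nr a := opnP (@nr_ge0 R A) a (zact_bd x).
Let zop_opb x : opb (@nr R A) (zact x) (zop x) := opn_opb (@nr_ge0 R A) (zact_bd x).

Lemma zactM x y a : zact (zmul x y) a = zact x (zact y a).
Proof.
rewrite /zact /= !smulDl !smulDr !smulZl !smulZr smulA scalerDr scalerA; lmod.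
Qed.

Lemma zact_star x a b : a^† ∗ zact x b = (zact (zstar x) a)^† ∗ b.
Proof.
rewrite /zact /= starD starM starK starZ conjCK smulDl smulDr smulZl smulZr.
by rewrite smulA.
Qed.

Fact zopM x y : zop (zmul x y) <= zop x * zop y.
Proof.
apply: opn_le; have := opbM (zop_opb x) (zop_opb y).
by congr (opb _ _); apply/funext => a; rewrite /= zactM.
Qed.

Fact zop_sq x : zop x ^+ 2 <= zop (zmul (zstar x) x).
Proof.
set r := zop (zmul (zstar x) x); have r0 : 0 <= r by exact: opn_ge0.
have : zop x <= Num.sqrt r.
  apply: opn_le; split=> [|a]; first exact: sqrtr_ge0.
  rewrite -(@ler_pXn2r _ 2)// ?nnegrE ?mulr_ge0 ?sqrtr_ge0// exprMn sqr_sqrtr//.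
  rewrite -nrS zact_star -zactM.
  apply: (le_trans (nrM _ _)); rewrite nr_star expr2 mulrA.
  by apply: ler_wpM2r => //; exact: zopP.
move=> h; rewrite -[leRHS](@sqr_sqrtr _ r)//.
by rewrite ler_pXn2r// nnegrE ?opn_ge0 ?sqrtr_ge0.
Qed.

Fact zstarK x : zstar (zstar x) = x.
Proof. by case: x => a c; rewrite /zstar /= starK conjCK. Qed.

Fact zop_star x : zop (zstar x) = zop x.
Proof.
have h y : zop y <= zop (zstar y).
  have [->|y0] := eqVneq (zop y) 0; first exact: opn_ge0.
  have yp : 0 < zop y by rewrite lt_def y0 opn_ge0.
  by rewrite -(ler_pM2r yp) -expr2 (le_trans (zop_sq _))// zopM.
by apply/eqP; rewrite eq_le h -[X in _ <= zop X]zstarK h.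
Qed.

Fact zopS x : zop (zmul (zstar x) x) = zop x ^+ 2.
Proof.
by apply/eqP; rewrite eq_le zop_sq andbT expr2 -{1}(zop_star x) zopM.
Qed.

Fact zmulA x y z : zmul x (zmul y z) = zmul (zmul x y) z.
Proof.
congr pair; rewrite /= ?mulrA// !smulDl !smulDr !smulZl !smulZr !scalerDr !scalerA smulA.
lmod.
Qed.
Fact zmul_linl y : linear (zmul^~ y).
Proof.
move=> c x z; congr pair => /=; last by rewrite mulrDl scalerAl.
rewrite -[c *: x.2]/(c * x.2) smulDl smulZl; lmod.
Qed.
Fact zmul_linr y : linear (zmul y).
Proof.
move=> c x z; congr pair => /=; last by rewrite mulrDr scalerAr.
rewrite -[c *: x.2]/(c * x.2) smulDr smulZr; lmod.
Qed.
Fact zmul1x x : zmul zone x = x.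
Proof. by case: x => a c; rewrite /zmul /= smul0x scaler0 scale1r mul1r !add0r. Qed.
Fact zmulx1 x : zmul x zone = x.
Proof. by case: x => a c; rewrite /zmul /= smulx0 scaler0 scale1r mulr1 addr0 add0r. Qed.
Fact zstar_lin (c : R[i]) x y : zstar (c *: x + y) = (c^*)%R *: zstar x + zstar y.
Proof. by congr pair => /=; rewrite ?starD ?starZ// rmorphD rmorphM. Qed.
Fact zstarM x y : zstar (zmul x y) = zmul (zstar y) (zstar x).
Proof.
congr pair => /=; first by rewrite !starD !starZ starM; lmod.
by rewrite rmorphM mulrC.
Qed.

Fact znD x y : zn (x + y) <= zn x + zn y.
Proof.
rewrite /zn ge_max; apply/andP; split.
  apply: (le_trans (nrD _ _)); apply: lerD; by rewrite le_max lexx.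
have h : zop (x + y) <= zop x + zop y.
  apply: opn_le; have := opbD (@nrD R A) (zop_opb x) (zop_opb y).
  congr (opb _ _); apply/funext => a; rewrite /zact /= smulDl scalerDl; lmod.
by apply: (le_trans h); apply: lerD; rewrite le_max lexx orbT.
Qed.
Fact zopZ_le (c : R[i]) x : zop (c *: x) <= nr c * zop x.
Proof.
apply: opn_le; have := opbZ nrZ_ c (zop_opb x); congr (opb _ _).
by apply/funext => a; rewrite /zact /= smulZl scalerDr scalerA.
Qed.
Fact znZ (c : R[i]) x : zn (c *: x) = nr c * zn x.
Proof.
have e : zop (c *: x) = nr c * zop x.
  apply/eqP; rewrite eq_le zopZ_le /=; have [->|c0] := eqVneq c 0.
    by rewrite nr0 mul0r opn_ge0.
  have nc0 : 0 < nr c by rewrite lt_def nr_ge0 andbT; apply: contra c0 => /eqP/nr_eq0 ->.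
  have := zopZ_le c^-1 (c *: x); rewrite scalerA mulVf// scale1r.
  have -> : nr c^-1 = (nr c)^-1 by apply: complexI; rewrite fmorphV /= -!nrE normfV.
  by rewrite ler_pdivlMl.
rewrite /zn e maxr_pMr//; congr (Num.max _ _).
exact: nrcM.
Qed.

Lemma nr_zop1 a : nr a <= zop (a, 0).
Proof.
have [->|a0] := eqVneq (nr a) 0; first exact: opn_ge0.
have ap : 0 < nr a by rewrite lt_def a0 nr_ge0.
rewrite -(ler_pM2r ap) -expr2 -nrS' -[X in _ <= _ * X](nr_star a).
by have := zopP (a, 0) a^†; rewrite /zact /= scale0r addr0.
Qed.

Fact zn_eq0 x : zn x = 0 -> x = 0.
Proof.
move=> h; have h2 : x.2 = 0.
  by apply: nr_le0; rewrite -h le_max lexx.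
case: x h h2 => a c /= h c0; rewrite c0 in h *.
congr pair; apply: nr_le0; apply: (le_trans (nr_zop1 _)).
by rewrite -h le_max lexx orbT.
Qed.
Fact znM x y : zn (zmul x y) <= zn x * zn y.
Proof.
have n0 u : 0 <= zn u by rewrite le_max nr_ge0.
rewrite {1}/zn ge_max; apply/andP; split.
  have -> : nr (zmul x y).2 = nr x.2 * nr y.2 by exact: nrcM.
  by apply: ler_pM => //; rewrite le_max lexx.
apply: (le_trans (zopM _ _)); apply: ler_pM; rewrite ?opn_ge0// le_max lexx orbT//.
Qed.
Fact znS x : zn (zmul (zstar x) x) = zn x ^+ 2.
Proof.
rewrite /zn zopS; have -> : nr (zmul (zstar x) x).2 = nr x.2 ^+ 2.
  by rewrite expr2 -{1}[nr x.2](nr_conj x.2) -nrcM.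
have a0 := nr_ge0 x.2; have b0 : 0 <= zop x by exact: opn_ge0.
by case: (lerP (nr x.2) (zop x)) => h; [rewrite max_r|rewrite max_l] => //; nra.
Qed.
Fact zn_le x : zn x <= nr x.1 + nr x.2.
Proof. by rewrite ge_max lerDr nr_ge0 /=; exact: opn_le (zact_opb x). Qed.

Fact z_complete (u : nat -> U) :
  (forall e : R, 0 < e -> exists N, forall m n, (N <= m)%N -> (N <= n)%N ->
      zn (u m - u n) <= e) ->
    exists l, forall e : R, 0 < e -> exists N, forall n, (N <= n)%N ->
      zn (u n - l) <= e.
Proof.
move=> h.
have [c hc] : exists c, ncv (fun n => (u n).2 : R[i]) c.
  apply: complex_ncauchy => e /h[N hN]; exists N => m n mN nN.
  by apply: le_trans (hN _ _ mN nN); rewrite le_max lexx.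
have [a ha] : exists a, ncv (fun n => (u n).1) a.
  apply: ncauchy_ncv => e e0; have [|N hN] := h (e / 2); first by rewrite divr_gt0.
  exists N => m n mN nN; apply: (le_trans (nr_zop1 _)).
  suff h2 : zop ((u m).1 - (u n).1, 0) <= zn (u m - u n) + zn (u m - u n).
    by apply: (le_trans h2); rewrite [e]splitr; apply: lerD; exact: hN.
  set x := u m - u n; have -> : ((u m).1 - (u n).1, 0) = x + (0, - x.2) :> U.
    by congr pair; rewrite /= ?addr0// subrr.
  apply: (@le_trans _ _ (zn (x + (0, - x.2)))); first by rewrite le_max lexx orbT.
  apply: (le_trans (znD _ _)); rewrite lerD2l; apply: (le_trans (zn_le _)).
  by rewrite nr0 add0r nrN le_max lexx.
exists (a, c) => e e0; have e20 : 0 < e / 2 by rewrite divr_gt0.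
have [N1 h1] := ha _ e20; have [N2 h2] := hc _ e20.
exists (maxn N1 N2) => n; rewrite geq_max => /andP[/h1 k1 /h2 k2].
by apply: (le_trans (zn_le _)); rewrite [e]splitr; apply: lerD.
Qed.

HB.instance Definition _ := isUCStarAlg.Build R U zmulA zmul_linl zmul_linr
  zmul1x zmulx1 zstar_lin zstarM zstarK znD znZ zn_eq0 znM znS z_complete.

Lemma nr_unz x : nr x = zn x.
Proof. by apply: complexI; rewrite -nrE. Qed.

Lemma nr_inl a : nr ((a, 0) : U) = nr a.
Proof.
rewrite nr_unz; apply/eqP; rewrite eq_le; apply/andP; split.
  by apply: (le_trans (zn_le _)); rewrite nr0 addr0.
by apply: (le_trans (nr_zop1 _)); rewrite le_max lexx orbT.
Qed.

End Unitization.

(** * Reduction to surjections between unital algebras *)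

Section UnitalLifting.
Context {R : realType}.

Definition unital_lifting (M : cstarAlgType R[i]) :=
  forall (B C : ucstarType R) (q : B -> C), is_star_hom q -> q 𝟏 = 𝟏 ->
  (forall c, exists b, q b = c) ->
  forall f : M -> C, completely_positive f -> contractive f ->
  exists g : M -> B, [/\ completely_positive g, contractive g & forall a, q (g a) = f a].

(** Unitize both [B] and [C] and lift [(f m, 0)]. [Q] preserves the scalar part, so the lift has
    scalar part 0, and its first component is the lift sought. *)
Lemma unital_lifting_property M : unital_lifting M -> lifting_property M.
Proof.
move=> hM B J hJ C q hq f cpf_f cf.
have lq := star_hom_linear (quotient_hom hq).
pose Q (x : unz B) : unz C := (q x.1, x.2).
pose F (m : M) : unz C := (f m, 0).
have hQ : is_star_hom Q.
  split.
  - by move=> c x y; congr pair; rewrite /= lq.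
  - move=> x y; congr pair => /=.
    by rewrite !(linD lq) !(linZ lq) (star_homM (quotient_hom hq)).
  - by move=> x; congr pair; rewrite /= (star_hom_star (quotient_hom hq)).
have [||||g [[lg cpg] cg gF]] := hM (unz B) (unz C) Q hQ _ _ F.
- by congr pair; rewrite /= (lin0 lq).
- by case=> c z; have [b <-] := quotient_surj hq c; exists (b, z).
- have [lf hf] := cpf_f; split.
    by move=> c x y; congr pair; rewrite /= ?lf// scaler0 addr0.
  move=> n X /hf[Y fX]; exists (\matrix_(i, j) ((Y i j, 0) : unz C)).
  apply/matrixP => i j; have := congr1 (fun Z : 'M[C]_n => Z i j) fX.
  rewrite !mxE /F => ->.
  have -> : forall (I : Type) (r : seq I) (G : I -> C),
     ((\sum_(k <- r) G k, 0) : unz C) = \sum_(k <- r) ((G k, 0) : unz C).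
    move=> I r G; elim: r => [|k r IH]; rewrite ?big_nil// !big_cons -IH.
    by congr pair; rewrite /= addr0.
  apply: eq_bigr => k _; rewrite !mxE; congr pair => /=.
    by rewrite conjC0 !scale0r !addr0.
  by rewrite mulr0.
- by move=> x; rewrite nrE nr_inl -nrE.
have g2 m : (g m).2 = 0 by have := congr1 snd (gF m).
exists (fun m => (g m).1); split.
- split=> [c x y|n X /cpg[Y gX]]; first by rewrite lg.
  (* A diagonal entry of [Y^† Y] has scalar part [sum_k |(Y k i).2|^2], which is the scalar part of
     a value of [g], namely 0. *)
  have Y2 k i : (Y k i).2 = 0.
    have := congr1 (fun Z : 'M[unz B]_n => (Z i i).2) gX; rewrite !mxE /= g2.
    have -> : forall (I : Type) (r : seq I) (G : I -> unz B),
       (\sum_(k <- r) G k).2 = \sum_(k <- r) (G k).2.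
      by move=> I r G; elim: r => [|a r IH]; rewrite ?big_nil// !big_cons -IH.
    move=> /esym/eqP; rewrite psumr_eq0 => [/allP/(_ k)|l _]; last first.
      by rewrite !mxE /= mulrC -normCK exprn_ge0.
    rewrite mem_index_enum => /(_ isT) /=; rewrite !mxE /= mulrC -normCK.
    by rewrite sqrf_eq0 normr_eq0 => /eqP.
  exists (\matrix_(i, j) (Y i j).1).
  apply/matrixP => i j; have := congr1 (fun Z : 'M[unz B]_n => (Z i j).1) gX.
  rewrite !mxE => ->.
  have -> : forall (I : Type) (r : seq I) (G : I -> unz B),
     (\sum_(k <- r) G k).1 = \sum_(k <- r) (G k).1.
    by move=> I r G; elim: r => [|a r IH]; rewrite ?big_nil// !big_cons -IH.
  by apply: eq_bigr => k _; rewrite !mxE /= !Y2 conjC0 !scale0r !addr0.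
- move=> m; apply: le_trans (cg m); rewrite !nrE lecR -nr_inl.
  by rewrite [g m in leRHS]surjective_pairing g2.
- by move=> m; have := congr1 fst (gF m).
Qed.

End UnitalLifting.

(** An equality of structures, not an isomorphism, so that statements about [A] can be rewritten
    along it. *)
Lemma ucstar_of_unital (R : realType) (A : cstarAlgType R[i]) :
  unital A -> exists U : ucstarType R, (U : cstarAlgType R[i]) = A.
Proof.
case: A => A cA [e he].
pose m := CStarAlg_isUnital.Build R (CStarAlg.Pack cA)
  (fun x => proj1 (he x)) (fun x => proj2 (he x)).
pose U : ucstarType R := HB.pack (CStarAlg.Pack cA : Type) m cA.
by exists U; destruct cA; reflexivity.
Qed.

(** * Finite-dimensional C*-algebras *)

Section FiniteDimension.
Context {K : numClosedFieldType} {V : lmodType K}.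

Definition spanning n (b : 'I_n -> V) :=
  forall x, exists c : 'I_n -> K, x = \sum_i c i *: b i.

Lemma fd_basis : finite_dimensional V ->
  exists n (b : 'I_n -> V), spanning b /\ linearly_independent b.
Proof.
move=> [S /finite_seqP[s ->] hs].
pose Q n := `[< exists b : 'I_n -> V, spanning b >].
have exQ : exists n, Q n.
  exists (size s); apply/asboolP; exists (fun i => nth 0 s i) => x.
  have : linear_span [set` s] x by rewrite hs.
  move=> [n [c [v [hv ->]]]].
  have hi i : (index (v i) s < size s)%N by rewrite index_mem; exact: hv.
  exists (fun j : 'I_(size s) => \sum_(i | Ordinal (hi i) == j) c i).
  rewrite (partition_big (fun i => Ordinal (hi i)) predT)//=.
  apply: eq_bigr => j _; rewrite scaler_suml; apply: eq_bigr => i /eqP <-.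
  by rewrite /= nth_index//; exact: hv.
case: (ex_minnP exQ) => n /asboolP[b hb] hmin; exists n, b; split=> //.
move=> c c0 i; apply/eqP/negP => /negP ci.
case: n b hb hmin c c0 i ci => [|n] b hb hmin c c0 i ci; first by case: i ci.
have : (n.+1 <= n)%N; last by rewrite ltnn.
apply: hmin; apply/asboolP; exists (fun j => b (lift i j)) => x.
have [d ->] := hb x; exists (fun j => d (lift i j) - d i / c i * c (lift i j)).
have bi : b i = - (\sum_j (c (lift i j) / c i) *: b (lift i j)).
  move: c0; rewrite (bigD1_ord i) //= => /eqP; rewrite addr_eq0 => /eqP h.
  rewrite -[LHS]scale1r -(mulVf ci) -scalerA h scalerN scaler_sumr; congr (- _).
  by apply: eq_bigr => j _; rewrite scalerA mulrC.
rewrite (bigD1_ord i) //= bi scalerN addrC scaler_sumr -sumrB; apply: eq_bigr => j _.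
by rewrite scalerA -scalerBl; congr (_ *: _); field.
Qed.

Lemma fd_dependent n (b : 'I_n -> V) (u : 'I_n.+1 -> V) : spanning b ->
  exists c : 'I_n.+1 -> K, (exists i, c i != 0) /\ \sum_i c i *: u i = 0.
Proof.
move=> /(fun h i => h (u i)) /choice[C hC].
pose X : 'M[K]_(n.+1, n) := \matrix_(i, j) C i j.
have : kermx X != 0.
  by rewrite kermx_eq0 /row_free neq_ltn (leq_ltn_trans (rank_leq_col _)).
move=> /matrix0Pn[r [i ri]].
exists (fun i => kermx X r i); split; first by exists i.
under eq_bigr do rewrite hC scaler_sumr.
rewrite exchange_big big1// => j _.
under eq_bigr do rewrite scalerA.
rewrite -scaler_suml.
have := congr1 (fun Y : 'M[K]_(n.+1, n) => Y r j) (mulmx_ker X).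
rewrite !mxE => h; rewrite (_ : \sum_i _ = 0) ?scale0r// -[RHS]h.
by apply: eq_bigr => k _; congr (_ * _); rewrite mxE.
Qed.

End FiniteDimension.

Section FiniteUnital.
Context {R : realType}.

Lemma upowD (A : ucstarType R) (h : A) k l : upow h k ∗ upow h l = upow h (k + l).
Proof. by elim: k => [|k IH] /=; rewrite ?smul1x// -smulA IH. Qed.

(** For [v = h^(m+1) w] one has [v^† v = w^† h^m (h^(m+2) w)], so the powers can be cancelled one at
    a time. *)
Lemma sa_cancel (A : ucstarType R) (h w : A) m : h^† = h ->
  upow h m.+1 ∗ w = 0 -> h ∗ w = 0.
Proof.
move=> hs; elim: m => [|m IH]; first by rewrite /= smulx1.
move=> h0; apply: IH; apply: sS_eq0.
have ps k : (upow h k)^† = upow h k.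
  by elim: k => [|k IHk] /=; rewrite ?star1// starM IHk hs upow_comm.
by rewrite starM ps -smulA (smulA (upow h _)) upowD addSnnS -upowD -smulA h0 !smulx0.
Qed.

(** The powers of [h = sum b_i b_i^†] are dependent; factoring out the lowest one in the unitization
    gives [h^(j+1) (c_j + h r) = 0], so [h (1 - e) = 0] for [e = - h r / c_j] in [P]. Then [sum
    (b_i^† (1 - e))^† (b_i^† (1 - e)) = 0], so [e] is a right unit and, by adjoints, a unit. *)
Lemma fd_unital (P : cstarAlgType R[i]) : finite_dimensional P -> unital P.
Proof.
move=> /fd_basis[n [b [hb _]]].
pose inl (x : P) : unz P := (x, 0).
have inlM x y : inl (x ∗ y) = inl x ∗ inl y.
  by congr pair; rewrite /= ?scale0r ?addr0// mulr0.
have inlS x : inl x^† = (inl x)^† by congr pair; rewrite /= conjC0.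
have inlL : linear inl by move=> c x y; congr pair; rewrite /= scaler0 addr0.
pose h : P := \sum_i b i ∗ (b i)^†.
have hs : h^† = h by rewrite star_sum; apply: eq_bigr => i _; rewrite starM starK.
pose pw k : P := iter k (smul h) h.
have pwE k : inl (pw k) = upow (inl h) k.+1.
  by elim: k => [|k IH] /=; rewrite ?smulx1// inlM IH.
have [c [[i0 ci0] c0]] := fd_dependent (fun i : 'I_n.+1 => pw i) hb.
have ex : exists i, [exists j : 'I_n.+1, (c j != 0) && (j == i :> nat)].
  by exists i0; apply/existsP; exists i0; rewrite ci0 eqxx.
case: (ex_minnP ex) => m /existsP[j /andP[cj /eqP jm]] hmin.
pose r : unz P := \sum_(i < n.+1 | (j < i)%N) c i *: upow (inl h) (i - j).-1.
have rsum : upow (inl h) j.+1 ∗ (c j *: 𝟏 + inl h ∗ r) = 0.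
  have := congr1 inl c0; rewrite (lin0 inlL) (lin_sum inlL) => e.
  rewrite -[RHS]e smulDr smulZr smulx1 (bigD1 j)//= (linZ inlL) pwE; congr (_ + _).
  rewrite /r !smul_sumr [RHS](bigID (fun i : 'I_n.+1 => (j < i)%N)) /=.
  rewrite [X in _ = _ + X]big1 ?addr0 => [|i /andP[ij]]; last first.
    rewrite -leqNgt leq_eqVlt => /orP[/eqP/val_inj/eqP|ij2]; first by rewrite (negbTE ij).
    rewrite (linZ inlL) (_ : c i = 0) ?scale0r//; apply/eqP/negP => /negP ci.
    have := hmin i; rewrite -jm leqNgt ij2 => /(_ _)/negP; apply=> //.
    by apply/existsP; exists i; rewrite ci eqxx.
  apply: eq_big => [i|i ji]; first by rewrite neq_ltn; case: ltngtP.
  rewrite (linZ inlL) !smulZr pwE; congr (_ *: _).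
  have -> : inl h ∗ upow (inl h) (i - j).-1 = upow (inl h) (i - j).
    by rewrite -[in RHS](prednK (_ : 0 < i - j)%N) ?subn_gt0.
  by rewrite -[inl h ∗ upow _ j]/(upow (inl h) j.+1) upowD; congr (upow _ _); rewrite addSn subnKC// ltnW.
have inlhs : (inl h)^† = inl h by rewrite -inlS hs.
have key := sa_cancel inlhs rsum.
have ideal (z : unz P) : z.2 = 0 -> exists x, z = inl x.
  by case: z => a d /= ->; exists a.
have [e he] : exists e, - (c j)^-1 *: (inl h ∗ r) = inl e.
  by apply: ideal; rewrite /= mul0r scaler0.
have h1e : inl h ∗ (𝟏 - inl e) = 0.
  rewrite -he smulBr smulZr smulx1 scaleNr opprK.
  have : (c j)^-1 *: (inl h ∗ (c j *: 𝟏 + inl h ∗ r)) = 0 by rewrite key scaler0.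
  by rewrite smulDr smulZr smulx1 scalerDr scalerA mulVf// scale1r.
have b1e i : inl (b i)^† ∗ (𝟏 - inl e) = 0.
  apply: sS_eq0.
  apply: (@pos_sum0 _ _ _ (fun i => (inl (b i)^† ∗ (𝟏 - inl e))^† ∗ (inl (b i)^† ∗ (𝟏 - inl e)))).
    by move=> k; exact: posS.
  under eq_bigr do rewrite starM -smulA (smulA (inl _)^†) inlS starK -inlS -inlM.
  rewrite -smul_sumr -smul_suml.
  have -> : \sum_i inl (b i ∗ (b i)^†) = inl h by rewrite (lin_sum inlL).
  by rewrite h1e smulx0.
have xe (x : P) : x ∗ e = x.
  have [d dx] := hb x^†; suff : inl x ∗ (𝟏 - inl e) = 0.
    rewrite smulBr smulx1 -inlM => /eqP; rewrite subr_eq0 => /eqP/(congr1 fst) /=.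
    by move=> <-.
  have -> : inl x = \sum_i (d i)^* *: inl (b i)^†.
    rewrite -[x]starK dx star_sum (lin_sum inlL); apply: eq_bigr => i _.
    by rewrite starZ (linZ inlL).
  by rewrite smul_suml big1// => i _; rewrite smulZl b1e scaler0.
have ex' (x : P) : e ∗ x = x.
  have ee : e^† = e by rewrite -[LHS]xe -{2}[e]starK -starM xe starK.
  by rewrite -[x]starK -{1}ee -starM xe.
by exists e => x; split.
Qed.

End FiniteUnital.

(** * Positive traces and orthonormal bases *)

Section RealSpectrum.
Context {K : numClosedFieldType}.

(** In Schur triangular form the trace of [A^2] is the sum of the squares of the eigenvalues. If it
    vanishes, so do all eigenvalues, and Cayley-Hamilton applies to the characteristic polynomial
    [X^(n+1)]. *)
Lemma trace_sq_real n (A : 'M[K]_n.+1) : (forall a, eigenvalue A a -> a \is Num.real) ->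
  0 <= \tr (A *m A) /\ (\tr (A *m A) = 0 -> A ^+ n.+1 = 0).
Proof.
move=> hA; have [Q /unitarymx_unit Qu] := @Schur _ _ A isT.
move=> hT; pose T := Q *m A *m invmx Q; have {}hT : is_trig_mx T.
  by rewrite /T -mxpoly.conjumx.
have TQ : T *m Q = Q *m A by rewrite /T -mulmxA mulVmx// mulmx1.
have trE : \tr (A *m A) = \sum_i T i i ^+ 2.
  have -> : \tr (A *m A) = \tr (T *m T).
    rewrite /T [RHS]mxtrace_mulC !mulmxA mulmxKV// -!mulmxA [RHS]mxtrace_mulC.
    by rewrite !mulmxA mulmxKV.
  apply: eq_bigr => i _; rewrite mxE (bigD1 i)//= big1 ?addr0 ?expr2// => j ji.
  have /is_trig_mxP T0 := hT.
  case: (ltngtP i j) => [ij|ij|/val_inj/eqP ij].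
  - by rewrite T0 ?mul0r.
  - by rewrite [T j i]T0 ?mulr0.
  - by rewrite eq_sym (negbTE ji) in ij.
have Tr i : T i i \is Num.real.
  apply: hA; have : root (char_poly T) (T i i).
    by rewrite char_poly_trig// /root horner_prod (bigD1 i)//= hornerXsubC subrr mul0r.
  rewrite -eigenvalue_root_char => /eigenvalueP[v vT v0].
  apply/eigenvalueP; exists (v *m Q).
    by rewrite -mulmxA -TQ mulmxA vT scalemxAl.
  by apply: contra v0 => /eqP vQ; rewrite -(mulmxK Qu v) vQ mul0mx.
have T2 i : 0 <= T i i ^+ 2 by rewrite real_exprn_even_ge0.
rewrite trE; split; first by apply: sumr_ge0.
move=> /eqP; rewrite psumr_eq0// => /allP Td.
have T0 i : T i i = 0.
  by have := Td i (mem_index_enum _); rewrite /= sqrf_eq0 => /eqP.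
have chT : char_poly T = 'X ^+ n.+1.
  rewrite char_poly_trig// (eq_bigr (fun=> 'X)) => [|i _]; last by rewrite T0 subr0.
  by rewrite prodr_const card_ord.
have := Cayley_Hamilton T; rewrite chT rmorphXn /= horner_mx_X => Tn.
have TQm m : T ^+ m * Q = Q * A ^+ m.
  elim: m => [|m IH]; first by rewrite !expr0 mul1r mulr1.
  rewrite exprSr -mulrA (_ : T * Q = Q * A); last exact: TQ.
  by rewrite mulrA IH -mulrA -exprSr.
have := TQm n.+1; rewrite Tn mul0r => /(congr1 (mulmx (invmx Q))).
by rewrite mulmx0 -[Q * _]/(Q *m _) mulKmx.
Qed.

End RealSpectrum.

Section Orthonormal.
Context {R : realType} {V : lmodType R[i]} (phi : V -> V -> R[i]).
Hypothesis phi_lin : forall x (c : R[i]) y z, phi x (c *: y + z) = c * phi x y + phi x z.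
Hypothesis phi_sym : forall x y, (phi x y)^* = phi y x.
Hypothesis phi_pos : forall x, 0 <= phi x x.
Hypothesis phi_def : forall x, phi x x = 0 -> x = 0.

Let phiL x : linear (phi x : V -> R[i]^o).
Proof. by move=> c y z; rewrite phi_lin. Qed.
Let phi_sum x I (r : seq I) (P : pred I) (F : I -> V) :
  phi x (\sum_(i <- r | P i) F i) = \sum_(i <- r | P i) phi x (F i) := lin_sum (phiL x) r P F.
Let phiZ x c y : phi x (c *: y) = c * phi x y := linZ (phiL x) c y.
Let phiB x y z : phi x (y - z) = phi x y - phi x z := linB (phiL x) y z.
Let phiZl x c y : phi (c *: x) y = c^* * phi x y.
Proof. by rewrite -phi_sym phiZ -[phi x y]phi_sym; exact: rmorphM. Qed.

Definition orthonormal m (u : 'I_m -> V) := forall i j, phi (u i) (u j) = (i == j)%:R.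
Definition reaches m (u : 'I_m -> V) x := x = \sum_i phi (u i) x *: u i.

Lemma orthonormal_extend m (u : 'I_m -> V) (y : V) : orthonormal u ->
  exists m' (u' : 'I_m' -> V), [/\ orthonormal u', reaches u' y
    & forall x, reaches u x -> reaches u' x].
Proof.
move=> hu; pose z := y - \sum_i phi (u i) y *: u i.
have uz i : phi (u i) z = 0.
  rewrite phiB phi_sum (bigD1 i)//= phiZ hu eqxx mulr1 big1 ?addr0 ?subrr// => j ji.
  by rewrite phiZ hu eq_sym (negbTE ji) mulr0.
have zu i : phi z (u i) = 0 by rewrite -phi_sym uz conjC0.
have [z0|z0] := eqVneq z 0.
  exists m, u; split=> //; rewrite /reaches; apply/eqP.
  by rewrite -subr_eq0 -/z z0.
have pz : 0 < phi z z.
  by rewrite lt_def phi_pos andbT; apply: contra z0 => /eqP/phi_def ->.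
pose c := (sqrtC (phi z z))^-1; pose w := c *: z.
have c0 : 0 < c by rewrite invr_gt0 sqrtC_gt0.
have cc : c^* = c by rewrite conj_Creal// ger0_real// ltW.
have c2 : c * c * phi z z = 1.
  by rewrite /c -invfM -expr2 sqrtCK mulVf// gt_eqF.
have ww : phi w w = 1 by rewrite phiZ phiZl cc mulrA.
have uw i : phi (u i) w = 0 by rewrite phiZ uz mulr0.
have wu i : phi w (u i) = 0 by rewrite -phi_sym uw conjC0.
pose u' i := if unlift ord0 i is Some j then u j else w.
have u'0 : u' ord0 = w by rewrite /u' unlift_none.
have u'S j : u' (lift ord0 j) = u j by rewrite /u' liftK.
exists m.+1, u'; split.
- move=> i j; case: (unliftP ord0 i) => [i'|] ->; case: (unliftP ord0 j) => [j'|] ->;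
    by rewrite ?u'0 ?u'S ?hu ?uw ?wu ?ww ?eqxx.
- rewrite /reaches big_ord_recl u'0; under eq_bigr do rewrite u'S.
  rewrite /w phiZl cc scalerA mulrAC.
  have -> : phi z y = phi z z.
    rewrite [RHS](phiB z y) phi_sum big1 ?subr0// => i _.
    by rewrite phiZ zu mulr0.
  by rewrite c2 scale1r subrK.
- move=> x hx; rewrite /reaches big_ord_recl u'0; under eq_bigr do rewrite u'S.
  rewrite -hx (_ : phi w x = 0) ?scale0r ?add0r// hx phi_sum big1// => i _.
  by rewrite phiZ wu mulr0.
Qed.

Lemma orthonormal_basis n (b : 'I_n -> V) : spanning b ->
  exists m (u : 'I_m -> V), orthonormal u /\ forall x, reaches u x.
Proof.
move=> hb.
suff [m [u [hu bu]]] : exists m (u : 'I_m -> V), orthonormal u /\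
    forall i : 'I_n, reaches u (b i).
  exists m, u; split=> // x; have [c ->] := hb x; rewrite /reaches.
  rewrite {1}(eq_bigr _ (fun i _ => congr1 (GRing.scale (c i)) (bu i))).
  under eq_bigr do rewrite scaler_sumr.
  rewrite exchange_big; apply: eq_bigr => j _.
  by rewrite phi_sum scaler_suml; apply: eq_bigr => i _; rewrite phiZ scalerA.
suff H k : (k <= n)%N -> exists m (u : 'I_m -> V), orthonormal u /\
    forall i : 'I_n, (i < k)%N -> reaches u (b i).
  by have [m [u [hu bu]]] := H n (leqnn n); exists m, u; split=> // i; apply: bu.
elim: k => [|k IH] kn; first by exists 0%N, (fun=> 0); split=> [[]//|[]//].
have [m [u [hu bu]]] := IH (ltnW kn).
have [m' [u' [hu' yu' ku']]] := orthonormal_extend (b (Ordinal kn)) hu.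
exists m', u'; split=> // i; rewrite ltnS leq_eqVlt => /orP[/eqP ik|/bu/ku'//].
by rewrite (_ : i = Ordinal kn)//; apply: val_inj.
Qed.

End Orthonormal.

(** A *-representation of [P] on [K^d] together with a row [b] over [P] that intertwines
    it with left multiplication and satisfies [b b^* = 1]. *)
Record fd_frame (R : realType) (P : ucstarType R) d := FDFrame {
  fb : 'I_d -> P ;
  fl : P -> 'I_d -> 'I_d -> R[i] ;
  fe : 'I_d -> R[i] ;
  fl_lin : forall (c : R[i]) p q i j, fl (c *: p + q) i j = c * fl p i j + fl q i j ;
  flM : forall p q i j, fl (p ∗ q) i j = \sum_k fl p i k * fl q k j ;
  fl_star : forall p i j, fl p^† i j = ((fl p j i)^*)%R ;
  fl1 : forall i j, fl 𝟏 i j = (i == j)%:R ;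
  fl_mul : forall p j, p ∗ fb j = \sum_i fl p i j *: fb i ;
  fb_one : \sum_i fb i ∗ (fb i)^† = 𝟏 ;
  fe_one : \sum_j fe j *: fb j = 𝟏 ;
  fb_indep : linearly_independent fb }.

Section Frame.
Context {R : realType} {P : ucstarType R}.

Section Trace.
Context {n : nat} {b : 'I_n.+1 -> P}.
Hypotheses (bs : spanning b) (bi : linearly_independent b).

Let crd x : 'I_n.+1 -> R[i] := projT1 (cid (bs x)).
Let crdP x : x = \sum_i crd x i *: b i. Proof. by rewrite /crd; case: cid. Qed.
Let crd_uniq c x : x = \sum_i c i *: b i -> crd x =1 c.
Proof.
move=> h i; apply/eqP; rewrite -subr_eq0; apply/eqP.
apply: (bi (c := fun i => crd x i - c i)).
under eq_bigr do rewrite scalerBl.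
by rewrite sumrB -h -crdP subrr.
Qed.
Let crd_lin c x y i : crd (c *: x + y) i = c * crd x i + crd y i.
Proof.
apply: (crd_uniq (c := fun i => c * crd x i + crd y i)).
rewrite {1}(crdP x) {1}(crdP y) scaler_sumr -big_split; apply: eq_bigr => k _ /=.
by rewrite scalerDl scalerA.
Qed.

Let L p : 'M[R[i]]_n.+1 := \matrix_(i, j) crd (p ∗ b i) j.
Let LM p q : L (p ∗ q) = L q *m L p.
Proof.
apply/matrixP => i j; rewrite !mxE -smulA.
apply: (crd_uniq (c := fun j => \sum_k L q i k * L p k j)).
rewrite {1}(crdP (q ∗ b i)) smul_sumr.
under [RHS]eq_bigr do rewrite scaler_suml.
rewrite exchange_big; apply: eq_bigr => k _.
rewrite smulZr {1}(crdP (p ∗ b k)) scaler_sumr; apply: eq_bigr => l _.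
by rewrite !mxE scalerA.
Qed.

(** Trace of the left regular representation. Coordinates are rows, so [L] reverses products; only
    powers of one element are used. *)
Definition ltrace p : R[i] := \tr (L p).

Lemma ltrace_lin c x y : ltrace (c *: x + y) = c * ltrace x + ltrace y.
Proof.
rewrite /ltrace /mxtrace mulr_sumr -big_split; apply: eq_bigr => i _ /=.
by rewrite !mxE smulDl smulZl crd_lin.
Qed.

(** Left multiplication by a self-adjoint [k] has real eigenvalues: [k x = a x] gives
    [x^† k x = a x^† x], where [x^† k x] and [x^† x] are self-adjoint. If the trace of its square
    vanishes, [k] is nilpotent, hence 0. *)
Lemma ltrace_pos h : pos h -> 0 <= ltrace h /\ (ltrace h = 0 -> h = 0).
Proof.
move=> [k ks ->]; rewrite /ltrace LM.
have [|t0 tn] := @trace_sq_real _ _ (L k).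
  move=> a /eigenvalueP[v vL v0]; pose x := \sum_i v 0 i *: b i.
  have kx : k ∗ x = a *: x.
    rewrite /x smul_sumr scaler_sumr.
    under eq_bigr do rewrite smulZr (crdP (k ∗ _)) scaler_sumr.
    rewrite exchange_big; apply: eq_bigr => j _.
    under eq_bigr do rewrite scalerA.
    rewrite -scaler_suml scalerA; congr (_ *: _).
    have := congr1 (fun w : 'rV_n.+1 => w 0 j) vL; rewrite !mxE => <-.
    by apply: eq_bigr => i _; rewrite !mxE.
  have x0 : x^† ∗ x != 0.
    apply: contra v0 => /eqP/sS_eq0 xz; apply/eqP/rowP => i; rewrite mxE.
    exact: (bi (c := fun i => v 0 i)).
  have e : x^† ∗ (k ∗ x) = a *: (x^† ∗ x) by rewrite kx smulZr.
  have := congr1 star e; rewrite starZ !starM !starK ks -smulA e => /eqP.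
  rewrite -subr_eq0 -scalerBl scaler_eq0 (negbTE x0) orbF subr_eq0.
  by rewrite CrealE eq_sym.
split=> // /tn Ln; have := @sa_cancel _ P k 𝟏 n ks; rewrite !smulx1 => -> //.
  by rewrite smul0x.
have LP m : L (upow k m) = L k ^+ m.
  elim: m => [|m IH]; last by rewrite /= LM IH exprSr.
  apply/matrixP => i j; rewrite !mxE smul1x.
  apply: (crd_uniq (c := fun j => (i == j)%:R)).
  by rewrite (bigD1 i)//= eqxx scale1r big1 ?addr0// => l /negbTE; rewrite eq_sym => ->; rewrite scale0r.
have L0 : L (upow k n.+1) = 0 by rewrite LP.
have ub i : upow k n.+1 ∗ b i = 0.
  rewrite (crdP (_ ∗ b i)) big1// => j _.
  by have := congr1 (fun X : 'M[R[i]]_n.+1 => X i j) L0; rewrite !mxE => ->; rewrite scale0r.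
have [c c1] := bs 𝟏; rewrite -[LHS]smulx1 c1 smul_sumr big1// => i _.
by rewrite smulZr ub scaler0.
Qed.

Lemma ltrace_star x : (ltrace x)^* = ltrace x^†.
Proof.
have lt : linear (ltrace : P -> R[i]^o) by move=> c y z; rewrite ltrace_lin.
have real_sa h : h^† = h -> (ltrace h)^* = ltrace h.
  move=> hs; apply: conj_Creal.
  have -> : h = (nr h)%:C *: 𝟏 - ((nr h)%:C *: 𝟏 - h) by lmod.
  rewrite (linB lt); apply: rpredB; apply: ger0_real.
    by have [] := ltrace_pos (posZ (nr_ge0 h) pos1).
  by have [] := ltrace_pos (nr_le_pos hs (lexx _)).
have [u [v [us vs -> _]]] := cartesian x.
rewrite starD starZ us vs !(linD lt) !(linZ lt) rmorphD; congr (_ + _).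
  exact: real_sa.
by rewrite -[RHS]/(_ * _) -[in RHS](real_sa _ vs); exact: rmorphM.
Qed.

End Trace.

(** Take [u] orthonormal for the form [tr (x^† y)]. The element [z = sum u_i u_i^†] is central
    because left multiplications by [p] and [p^†] are adjoint, and invertible by [dot_cs]; the frame
    is [z^(-1/2) u_i]. *)
Lemma fd_frame_exists : finite_dimensional P -> exists d, inhabited (fd_frame P d).
Proof.
move=> /fd_basis[[|n] [b [bs bi]]].
  have P0 (x : P) : x = 0 by have [c ->] := bs x; rewrite big_ord0.
  exists 0%N; constructor.
  apply: (@FDFrame R P 0 (fun=> 0) (fun _ _ _ => 0) (fun=> 0)) => //;
    try by (move=> ? ? [] || move=> ? ? ? [] || move=> ? []).
  - by rewrite big_ord0 [𝟏]P0.
  - by rewrite big_ord0 [𝟏]P0.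
pose phi x y := ltrace bs (x^† ∗ y).
have phi_lin x (c : R[i]) y z : phi x (c *: y + z) = c * phi x y + phi x z.
  by rewrite /phi smulDr smulZr (ltrace_lin bs bi).
have phi_sym x y : (phi x y)^* = phi y x.
  by rewrite /phi (ltrace_star bs bi) starM starK.
have phi_pos x : 0 <= phi x x by have [] := ltrace_pos bs bi (posS x).
have phi_def x : phi x x = 0 -> x = 0.
  by move=> h; apply: sS_eq0; have [_] := ltrace_pos bs bi (posS x); apply.
have [d [u [hu ru]]] := orthonormal_basis phi_lin phi_sym phi_pos phi_def bs.
have phiL x : linear (phi x : P -> R[i]^o) by move=> c y z; rewrite phi_lin.
have phiZ x c y : phi x (c *: y) = c * phi x y by exact: (linZ (phiL x)).
pose z := \sum_i u i ∗ (u i)^†.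
have zs : z^† = z by rewrite star_sum; apply: eq_bigr => i _; rewrite starM starK.
have phi_adj x p y : phi x (p ∗ y) = phi (p^† ∗ x) y.
  by rewrite /phi starM starK smulA.
have zc p : p ∗ z = z ∗ p.
  rewrite smul_sumr smul_suml.
  transitivity (\sum_i \sum_j phi (u j) (p ∗ u i) *: (u j ∗ (u i)^†)).
    by apply: eq_bigr => i _; rewrite smulA {1}(ru (p ∗ u i)) smul_suml;
       apply: eq_bigr => j _; rewrite smulZl.
  rewrite exchange_big; apply: eq_bigr => j _.
  rewrite -smulA -{2}[p]starK -starM (ru (p^† ∗ u j)) star_sum smul_sumr.
  by apply: eq_bigr => i _; rewrite starZ smulZr phi_sym phi_adj.
have [e0 [e00 ze]] : exists e0 : R, 0 < e0 /\ pos (z - e0%:C *: 𝟏).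
  (* [<f, g> = 1] and [<g, g> = z], so Cauchy-Schwarz reads [1 <= p z] and bounds [z] from below. *)
  pose f : {ffun 'I_d -> P} := [ffun i => phi (u i) 𝟏 *: 𝟏].
  pose g : {ffun 'I_d -> P} := [ffun i => (u i)^†].
  have fg : cdot f g = 𝟏.
    rewrite /cdot -[RHS]star1 [in RHS](ru 𝟏) star_sum; apply: eq_bigr => i _.
    by rewrite !ffunE !starZ star1 smulZl smul1x.
  have gg : cdot g g = z.
    by apply: eq_bigr => i _; rewrite !ffunE starK.
  pose p := nr (cdot f f) + 1.
  have p0 : 0 < p by have := nr_ge0 (cdot f f); rewrite /p; lra.
  exists p^-1; split; first by rewrite invr_gt0.
  have := @dot_cs _ _ _ (column P d) f g p _.
  by rewrite /= fg gg star1 smul1x; apply; rewrite /p ltrDl.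
have [s [sp szs _ sc]] := inv_sqrt zs e00 ze.
have ss := pos_sa sp.
have scen p : p ∗ s = s ∗ p by exact: sc.
exists d; constructor.
(* The coefficients of 1 in the frame are those of [z ∗ s] in [u], since [s ∗ (z ∗ s) = 1]. *)
apply: (@FDFrame R P d (fun i => s ∗ u i) (fun p i j => phi (u i) (p ∗ u j))
   (fun j => phi (u j) (z ∗ s))).
- by move=> c p q i j; rewrite smulDl smulZl phi_lin.
- move=> p q i j; rewrite -smulA {1}(ru (q ∗ u j)) smul_sumr (lin_sum (phiL _)).
  by apply: eq_bigr => k _; rewrite smulZr phiZ mulrC.
- by move=> p i j; rewrite phi_adj starK phi_sym.
- by move=> i j; rewrite smul1x hu.
- move=> p j; rewrite smulA scen -smulA {1}(ru (p ∗ u j)) smul_sumr.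
  by apply: eq_bigr => i _; rewrite smulZr.
- rewrite -szs /z smul_sumr smul_suml; apply: eq_bigr => i _.
  by rewrite starM ss !smulA.
- under eq_bigr do rewrite -smulZr.
  by rewrite -smul_sumr -[\sum_i _](ru (z ∗ s)) smulA.
- move=> c; under eq_bigr do rewrite -smulZr.
  rewrite -smul_sumr => h i.
  have x0 : \sum_i c i *: u i = 0.
    by have := congr1 (smul (s ∗ z)) h; rewrite smulx0 smulA szs smul1x.
  have : phi (u i) (\sum_i c i *: u i) = c i.
    rewrite (lin_sum (phiL _)) (bigD1 i)//= phiZ hu eqxx mulr1 big1 ?addr0// => j ji.
    by rewrite phiZ hu eq_sym (negbTE ji) mulr0.
  by rewrite x0 (lin0 (phiL _)).
Qed.

End Frame.

(** * Tensor products with a finite-dimensional C*-algebra *)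

Lemma cmx_sumE (R : realType) (A : ucstarType R) n I (r : seq I) (Q : pred I)
    (F : I -> cmx A n) i j :
  (\sum_(k <- r | Q k) F k) i j = \sum_(k <- r | Q k) F k i j.
Proof.
by apply: (big_morph (fun X : cmx A n => X i j)) => [X Y|]; rewrite ?cmxDE ?cmx0E.
Qed.

Section FrameTensor.
Context {R : realType} {P : ucstarType R} {d : nat} (fr : fd_frame P d).
Local Notation fb := (fb fr).
Local Notation fl := (fl fr).
Local Notation fe := (fe fr).

Let flL i j : linear (fun p => fl p i j : R[i]^o).
Proof. by move=> c p q; exact: fl_lin. Qed.

Definition fd_coord p k : R[i] := \sum_l fe l * fl p k l.

Lemma fd_coordP p : p = \sum_k fd_coord p k *: fb k.
Proof.
rewrite -[LHS]smulx1 -(fe_one fr) smul_sumr.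
under eq_bigr do rewrite smulZr fl_mul scaler_sumr.
rewrite exchange_big; apply: eq_bigr => k _ /=.
by rewrite /fd_coord scaler_suml; apply: eq_bigr => l _; rewrite scalerA.
Qed.

Lemma fl_coord p i j : fl p i j = \sum_k fd_coord p k * fl (fb k) i j.
Proof.
by rewrite {1}(fd_coordP p) (lin_sum (flL i j)); apply: eq_bigr => k _; rewrite (linZ (flL i j)).
Qed.

Section Model.
Variable X : ucstarType R.
Implicit Types (Y Z : cmx X d) (x : X) (p : P).

(** [P (x) X] is realised inside the [d] by [d] matrices over [X], through the representation [fl]
    of [P]. *)
Definition ptelem p x : cmx X d := \matrix_(i, j) (fl p i j *: x).
Definition pcoord Y k : X := \sum_l fe l *: Y k l.
(** The span of the elementary tensors, as the solution set of linear equations between entries; in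
    this form it is visibly closed. *)
Definition ptset : set (cmx X d) :=
  [set Y : cmx X d | forall i j, Y i j = \sum_k fl (fb k) i j *: pcoord Y k].

Lemma ptelemE p x i j : ptelem p x i j = fl p i j *: x.
Proof. exact: mxE. Qed.

Lemma ptelem_linl x : linear (ptelem^~ x).
Proof. by move=> c p q; apply/matrixP => i j; rewrite !mxE fl_lin scalerDl scalerA. Qed.

Lemma ptelem_linr p : linear (ptelem p).
Proof.
by move=> c x y; apply/matrixP => i j; rewrite !mxE scalerDr !scalerA mulrC.
Qed.

Lemma ptelemM p q x y : ptelem p x ∗ ptelem q y = ptelem (p ∗ q) (x ∗ y).
Proof.
apply/matrixP => i j; rewrite cmxME !mxE flM scaler_suml; apply: eq_bigr => k _.
by rewrite !ptelemE smulZl smulZr scalerA.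
Qed.

Lemma ptelem_star p x : (ptelem p x)^† = ptelem p^† x^†.
Proof. by apply/matrixP => i j; rewrite cmxSE !ptelemE fl_star starZ. Qed.

Lemma ptelem1 : ptelem 𝟏 𝟏 = 𝟏.
Proof.
apply/matrixP => i j; rewrite cmx1E ptelemE fl1.
by case: eqP => _; rewrite ?scale1r ?scale0r.
Qed.

Lemma pcoord_linear k : linear (pcoord^~ k).
Proof.
move=> c Y Z; rewrite /pcoord scaler_sumr -big_split; apply: eq_bigr => l _ /=.
by rewrite cmxDE cmxZE scalerDr !scalerA mulrC.
Qed.

Lemma pcoord_elem p x k : pcoord (ptelem p x) k = fd_coord p k *: x.
Proof.
by rewrite /pcoord scaler_suml; apply: eq_bigr => l _; rewrite ptelemE scalerA.
Qed.

Lemma ptset_elem p x : ptset (ptelem p x).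
Proof.
move=> i j; rewrite ptelemE fl_coord scaler_suml; apply: eq_bigr => k _.
by rewrite pcoord_elem scalerA mulrC.
Qed.

Lemma ptset_decomp Y : ptset Y -> Y = \sum_k ptelem (fb k) (pcoord Y k).
Proof.
move=> hY; apply/matrixP => i j; rewrite cmx_sumE hY.
by apply: eq_bigr => k _; rewrite ptelemE.
Qed.

Lemma ptset_lin (c : R[i]) Y Z : ptset Y -> ptset Z -> ptset (c *: Y + Z).
Proof.
move=> hY hZ i j; rewrite cmxDE cmxZE hY hZ scaler_sumr -big_split.
by apply: eq_bigr => k _ /=; rewrite (pcoord_linear k c Y Z) scalerDr !scalerA mulrC.
Qed.

Lemma ptset0 : ptset 0.
Proof. by rewrite -(lin0 (ptelem_linr 𝟏)); exact: ptset_elem. Qed.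

Lemma ptset_sum I (r : seq I) (Q : pred I) (F : I -> cmx X d) :
  (forall i, Q i -> ptset (F i)) -> ptset (\sum_(i <- r | Q i) F i).
Proof.
move=> h; apply: big_ind => //; first exact: ptset0.
by move=> Y Z hY hZ; have := ptset_lin 1 hY hZ; rewrite scale1r.
Qed.

Lemma pt_subalg : subalg 𝟏 ptset.
Proof.
split.
- by rewrite -ptelem1; exact: ptset_elem.
- by move=> Y _; rewrite smul1x smulx1.
- exact: ptset_lin.
- move=> Y Z /ptset_decomp -> /ptset_decomp ->.
  rewrite smul_suml; apply: ptset_sum => k _; rewrite smul_sumr; apply: ptset_sum => l _.
  by rewrite ptelemM; exact: ptset_elem.
- move=> Y /ptset_decomp ->; rewrite star_sum; apply: ptset_sum => k _.
  by rewrite ptelem_star; exact: ptset_elem.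
- move=> u Y hu uY i j.
  have coord k l : ncv (fun n => u n k l) (Y k l).
    move=> e /uY[N hN]; exists N => n /hN; apply: le_trans.
    by rewrite -cmxNE -cmxDE cmx_coord.
  apply: (ncv_uniq (coord i j)).
  apply: (@ncv_ext _ _ (fun n => \sum_k fl (fb k) i j *: pcoord (u n) k)).
    by move=> n; rewrite -hu.
  by apply: ncv_sum => k; apply: ncvZ; apply: ncv_sum => l; apply: ncvZ.
Qed.

Definition ptens : ucstarType R := suba pt_subalg.
Definition pte p x : ptens := smk (hS := pt_subalg) (ptset_elem p x).

Lemma ptens_decomp (Y : ptens) : Y = \sum_k pte (fb k) (pcoord (sval_ Y) k).
Proof.
apply: sval_inj; rewrite (lin_sum (star_hom_linear sval_hom)).
exact: ptset_decomp (sval_in Y).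
Qed.

Lemma pte_linl x : linear (pte^~ x).
Proof. by move=> c p q; apply: sval_inj; exact: ptelem_linl. Qed.
Lemma pte_linr p : linear (pte p).
Proof. by move=> c x y; apply: sval_inj; exact: ptelem_linr. Qed.
Lemma pteM p q x y : pte p x ∗ pte q y = pte (p ∗ q) (x ∗ y).
Proof. by apply: sval_inj; exact: ptelemM. Qed.
Lemma pte_star p x : (pte p x)^† = pte p^† x^†.
Proof. by apply: sval_inj; exact: ptelem_star. Qed.
Lemma pte1 : pte 𝟏 𝟏 = 𝟏.
Proof. by apply: sval_inj; exact: ptelem1. Qed.

Lemma ptens_tensor : is_cstar_tensor (pte : P -> X -> ptens).
Proof.
split; [exact: pte_linl|exact: pte_linr|by move=> *; exact: pteM|exact: pte_star| |].
- move=> n a b ai h i.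
  have co k : \sum_i fd_coord (a i) k *: b i = 0.
    have := congr1 (fun Y : ptens => pcoord (sval_ Y) k) h.
    rewrite (lin_sum (star_hom_linear sval_hom)) (lin_sum (pcoord_linear k)).
    rewrite [RHS](lin0 (pcoord_linear k)) => e; rewrite -[RHS]e; apply: eq_bigr => j _.
    by rewrite -[sval_ _]/(ptelem _ _) pcoord_elem.
  (* Independence of [a] makes its coordinate matrix right invertible; [C'] writes each [b i] as a
     combination of the vanishing sums [co]. *)
  have /row_freeP[C' CC'] : row_free (\matrix_(i < n, k < d) fd_coord (a i) k).
    apply: inj_row_free => v hv; apply/rowP => j; rewrite mxE.
    apply: (ai (fun i => v 0 i)); rewrite [LHS]fd_coordP big1// => k _.
    have := congr1 (fun w : 'rV_d => w 0 k) hv; rewrite !mxE => e.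
    rewrite (_ : fd_coord _ k = 0) ?scale0r// /fd_coord -[RHS]e.
    under eq_bigr do rewrite (lin_sum (flL k _)) mulr_sumr.
    rewrite exchange_big; apply: eq_bigr => j' _ /=; rewrite mxE /fd_coord mulr_sumr.
    by apply: eq_bigr => l _; rewrite (linZ (flL k l)) mulrCA.
  transitivity (\sum_j (1%:M : 'M[R[i]]_n) j i *: b j).
    rewrite (bigD1 i)//= mxE eqxx scale1r big1 ?addr0// => j /negbTE ji.
    by rewrite mxE ji scale0r.
  rewrite -CC'; under eq_bigr do rewrite mxE scaler_suml.
  rewrite exchange_big big1// => k _.
  transitivity (C' k i *: \sum_i fd_coord (a i) k *: b i); last by rewrite co scaler0.
  rewrite scaler_sumr; apply: eq_bigr => j _.
  by rewrite mxE scalerA mulrC.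
- apply/dense_nr => Y e e0; exists Y; last by rewrite subrr nr0 ltW.
  exists d, (fun=> 1), (fun k => pte (fb k) (pcoord (sval_ Y) k)).
  split; first by move=> k; exists (fb k) => //; exists (pcoord (sval_ Y) k).
  by rewrite {1}(ptens_decomp Y); apply: eq_bigr => k _; rewrite scale1r.
Qed.

End Model.
End FrameTensor.

(** * Density arguments and multipliers of a unital algebra *)

Section DenseRange.
Context {R : realType}.

Lemma dense_span_eq0 (V W : normedModType R[i]) (S : set V) (f : V -> W) (C : R) :
  dense (linear_span S) -> linear f -> (forall x, nr (f x) <= C * nr x) ->
  (forall x, S x -> f x = 0) -> forall x, f x = 0.
Proof.
move=> /dense_nr dS lf fC f0 x; apply: nr_le0; apply/ler_addgt0Pr => e e0; rewrite add0r.
have C0 : 0 < `|C| + 1 by rewrite ltr_wpDl.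
have [|y [n [c [s [Ss ->]]]] xy] := dS x (e / (`|C| + 1)); first by rewrite divr_gt0.
set y0 := \sum_i _ in xy.
have fy0 : f y0 = 0.
  by rewrite (lin_sum lf) big1// => i _; rewrite (linZ lf) f0 ?scaler0.
rewrite -[f x]subr0 -fy0 -(linB lf); apply: le_trans (fC _) _.
apply: le_trans (_ : (`|C| + 1) * nr (x - y0) <= _).
  by apply: ler_wpM2r => //; have := ler_norm C; lra.
by rewrite mulrC -ler_pdivlMr.
Qed.

Lemma isometric_lim (A D : ucstarType R) (f : A -> D) (u : nat -> A) y : is_star_hom f ->
  (forall x, nr (f x) = nr x) -> ncv (fun n => f (u n)) y -> exists x, f x = y.
Proof.
move=> hf iso fu; have lf := star_hom_linear hf.
have [|l ul] := @ncauchy_ncv _ A u.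
  move=> e e0; have [N hN] := fu (e / 2) (divr_gt0 e0 (ltr0Sn _ 1)).
  exists N => m n /hN hm /hN hn; rewrite -iso (linB lf).
  by apply: le_trans (nr_tri y _ _) _; rewrite [nr (y - _)]nrC; lra.
by exists l; apply: ncv_uniq (hom_ncv hf ul) fu.
Qed.

Lemma isometric_surj (A D : ucstarType R) (f : A -> D) : is_star_hom f ->
  (forall x, nr (f x) = nr x) ->
  (forall y (e : R), 0 < e -> exists x, nr (y - f x) <= e) -> forall y, exists x, f x = y.
Proof.
move=> hf iso df y.
have [u hu] : {u : nat -> A & forall n, nr (y - f (u n)) <= n.+1%:R^-1}.
  apply: (@choice _ _ (fun n x => nr (y - f x) <= n.+1%:R^-1)) => n.
  by apply: df; rewrite invr_gt0.
apply: (isometric_lim (u := u)) => // e /invS_small[N hN]; exists N => n /hN; apply: le_trans.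
by rewrite nrC.
Qed.

Lemma is_unit_uniq (A : ucstarType R) (e : A) : is_unit e -> e = 𝟏.
Proof. by move=> h; rewrite -[RHS](proj1 (h 𝟏)) smulx1. Qed.

Lemma is_unit_one (A : ucstarType R) : is_unit (𝟏 : A).
Proof. by move=> x; rewrite smul1x smulx1. Qed.

Definition unital_hom (A D : ucstarType R) (f : A -> D) := is_star_hom f /\ f 𝟏 = 𝟏.

Section Canonical.
Variable B : ucstarType R.

Fact cmultP (b x y : B) : x ∗ (b ∗ y) = (x ∗ b) ∗ y.
Proof. exact: smulA. Qed.
Definition cmult (b : B) : multiplier B := Multiplier (cmultP b).

Lemma cmult_hom : is_star_hom cmult.
Proof.
split=> [c x y|x y|x]; apply: multiplier_eq => z /=.
- by rewrite smulDl smulZl.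
- by rewrite smulDr smulZr.
- by rewrite smulA.
- by rewrite smulA.
- by rewrite starM starK.
- by rewrite starM starK.
Qed.

Lemma cmult_mor (A : ucstarType R) (f : A -> B) : unital_hom f -> is_mor (cmult \o f).
Proof.
move=> [[lf fM fS] f1]; split.
  have [lc cM cS] := cmult_hom.
  by split=> [c x y|x y|x] /=; rewrite ?lf ?lc ?fM ?cM ?fS ?cS.
apply/dense_nr => b e e0; exists b; last by rewrite subrr nr0 ltW.
exists 1%N, (fun=> 1), (fun=> b); rewrite big_ord1 scale1r; split=> // _.
by exists 𝟏 => //; exists b => //=; rewrite f1 smul1x.
Qed.

Lemma multL_one (m : multiplier B) x : multL m x = multL m 𝟏 ∗ x.
Proof.
have h y : multL m y = multR m 𝟏 ∗ y by rewrite -multP smul1x.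
by rewrite h [multL m 𝟏]h smulx1.
Qed.

(** A left multiplier of a unital algebra is multiplication by its value at 1. Nondegeneracy makes
    the homomorphism unital: [e], the value for [L 1], fixes all products of [L a] with [b], and
    these span a dense subspace. *)
Lemma mor_unital_hom (A : ucstarType R) (L : A -> multiplier B) : is_mor L ->
  unital_hom (fun a => multL (L a) 𝟏).
Proof.
move=> [[lL LM LS] nd].
have hM x y : multL (L (x ∗ y)) 𝟏 = multL (L x) 𝟏 ∗ multL (L y) 𝟏.
  by rewrite LM /= multL_one.
split; first split=> //.
- by move=> c x y; rewrite lL.
- move=> x; rewrite LS /= star1; congr star.
  by rewrite -[LHS]smulx1 -multP smul1x.
set e := multL (L 𝟏) 𝟏.
have := @dense_span_eq0 B B _ (fun x => e ∗ x - x) (nr e + 1) nd.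
have h2 x : nr (e ∗ x - x) <= (nr e + 1) * nr x.
  rewrite mulrDl mul1r; apply: le_trans (nrB _ _) _.
  by rewrite lerD2r; exact: nrM.
move=> /(_ _ h2) h.
have : e ∗ 𝟏 - 𝟏 = 0.
  apply: h => [c x y|x [a _ [b _ <-]]]; first by nc.
  by rewrite multL_one smulA /e -hM smul1x subrr.
by rewrite smulx1 => /eqP; rewrite subr_eq0 => /eqP.
Qed.

End Canonical.
End DenseRange.

(** * Uniqueness of the C*-norm on the tensor product with [P] *)

Section Comparison.
Context {R : realType} {P X : ucstarType R} {d : nat} (fr : fd_frame P d).
Local Notation fb := (fb fr).

Section Unit.
Context {T : cstarAlgType R[i]} {t : P -> X -> T} (ht : is_cstar_tensor t).

Lemma tensor_unit : is_unit (t 𝟏 𝟏).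
Proof.
set e := t 𝟏 𝟏.
have bd (f : T -> T) : (forall y, nr (f y) <= nr e * nr y) ->
    forall y, nr (f y - y) <= (nr e + 1) * nr y.
  move=> h y; rewrite mulrDl mul1r; apply: le_trans (nrB _ _) _.
  by rewrite lerD2r.
move=> x; split; apply/eqP; rewrite -subr_eq0; apply/eqP; move: x.
- apply: (dense_span_eq0 (C := nr e + 1) (tensor_dense ht)).
  + by move=> c y z; nc.
  + by apply: (bd (smul e)) => y; exact: nrM.
  + by move=> _ [p _ [y _ <-]]; rewrite /e (tensorM ht) !smul1x subrr.
- apply: (dense_span_eq0 (C := nr e + 1) (tensor_dense ht)).
  + by move=> c y z; nc.
  + by apply: (bd (smul^~ e)) => y; rewrite mulrC; exact: nrM.
  + by move=> _ [p _ [y _ <-]]; rewrite /e (tensorM ht) !smulx1 subrr.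
Qed.

End Unit.

Section Map.
Context {T : ucstarType R} {t : P -> X -> T} (ht : is_cstar_tensor t).

Definition ptmap (Y : ptens fr X) : T := \sum_k t (fb k) (pcoord fr (sval_ Y) k).

Lemma ptmap_elem p x : ptmap (pte fr p x) = t p x.
Proof.
have tl := tensor_linearl ht; have tr := tensor_linearr ht.
rewrite [in RHS](fd_coordP fr p) (lin_sum (tl x)); apply: eq_bigr => k _.
by rewrite (linZ (tl x)) -(linZ (tr _)) -[sval_ _]/(ptelem _ _ _) pcoord_elem.
Qed.

Lemma ptmap_linear : linear ptmap.
Proof.
move=> c Y Z; rewrite /ptmap scaler_sumr -big_split; apply: eq_bigr => k _ /=.
by rewrite -(tensor_linearr ht) -(pcoord_linear fr).
Qed.

Lemma ptmap_hom : is_star_hom ptmap.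
Proof.
have lm := ptmap_linear; split=> // [Y Z|Y].
  rewrite (ptens_decomp Y) (ptens_decomp Z) smul_suml !(lin_sum lm) smul_suml.
  apply: eq_bigr => k _; rewrite !smul_sumr (lin_sum lm); apply: eq_bigr => l _.
  by rewrite pteM !ptmap_elem (tensorM ht).
rewrite (ptens_decomp Y) star_sum !(lin_sum lm) star_sum; apply: eq_bigr => k _.
by rewrite pte_star !ptmap_elem (tensor_star ht).
Qed.

Lemma ptmap_inj Y : ptmap Y = 0 -> Y = 0.
Proof.
move=> /(tensor_inj ht (@fb_indep _ _ _ fr)) h.
rewrite (ptens_decomp Y) big1// => k _; rewrite h.
exact: (lin0 (@pte_linr _ _ _ fr X (fb k))).
Qed.

Lemma ptmap1 : ptmap 𝟏 = 𝟏.
Proof. by rewrite -pte1 ptmap_elem; apply: is_unit_uniq; exact: tensor_unit. Qed.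

Lemma nr_ptmap Y : nr (ptmap Y) = nr Y.
Proof. by apply: (inj_isometric ptmap_hom) => Z; exact: ptmap_inj. Qed.

Lemma ptmap_surj y : exists Y, ptmap Y = y.
Proof.
apply: isometric_surj ptmap_hom nr_ptmap _ y => y e e0.
have /dense_nr/(_ y e e0)[_ [n [c [s [Ss ->]]]] ye] := tensor_dense ht.
have [Y hY] : {Y : 'I_n -> ptens fr X & forall i, ptmap (Y i) = s i}.
  apply: (@choice _ _ (fun i Y => ptmap Y = s i)) => i.
  by have [p _ [x _ <-]] := Ss i; exists (pte fr p x); exact: ptmap_elem.
exists (\sum_i c i *: Y i); rewrite (lin_sum ptmap_linear).
by under eq_bigr do rewrite (linZ ptmap_linear) hY.
Qed.

End Map.

(** Every C*-tensor product receives an injective, hence isometric, homomorphism from the matrix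
    model; so all C*-norms on the algebraic tensor product agree. *)
Lemma ptens_min : is_min_tensor (@pte _ _ _ fr X : P -> X -> ptens fr X).
Proof.
split; first exact: ptens_tensor.
move=> T' t' ht'.
have [U eU] := ucstar_of_unital (ex_intro _ _ (tensor_unit ht')).
case: _ / eU t' ht' => t' ht' n a b; rewrite !nrE lecR.
rewrite -(nr_ptmap ht') (lin_sum (ptmap_linear ht')) le_eqVlt; apply/orP; left.
by apply/eqP; congr nr; apply: eq_bigr => i _; rewrite (ptmap_elem ht').
Qed.

End Comparison.

Arguments ptmap {R P X d} fr {T} t Y.

Lemma is_star_hom_comp (K : numClosedFieldType) (A B D : starAlgType K) (f : A -> B) (g : B -> D) :
  is_star_hom f -> is_star_hom g -> is_star_hom (g \o f).
Proof.
by move=> [lf fM fS] [lg gM gS]; split=> [c x y|x y|x] /=; rewrite ?lf ?lg ?fM ?gM ?fS ?gS.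
Qed.

(** * Applying a map to the second tensor factor *)

Section PtensAmpl.
Context {R : realType} {P : ucstarType R} {d : nat} (fr : fd_frame P d).
Context {X Y : ucstarType R} {l : X -> Y} (ll : linear l).

Lemma pcoord_ampl (Z : cmx X d) k : pcoord fr (ampl l Z) k = l (pcoord fr Z k).
Proof.
rewrite /pcoord (lin_sum ll); apply: eq_bigr => j _.
by rewrite amplE (linZ ll).
Qed.

Lemma ptset_ampl (Z : cmx X d) : ptset fr Z -> ptset fr (ampl l Z).
Proof.
move=> hZ i j; rewrite amplE hZ (lin_sum ll); apply: eq_bigr => k _.
by rewrite pcoord_ampl (linZ ll).
Qed.

Definition ptampl (Z : ptens fr X) : ptens fr Y :=
  smk (hS := pt_subalg fr Y) (ptset_ampl (sval_in Z)).

End PtensAmpl.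
Arguments ptampl {R P d} fr {X Y l} ll Z.

Section PtensAmplHom.
Context {R : realType} {P : ucstarType R} {d : nat} (fr : fd_frame P d).
Context {X Y : ucstarType R} {l : X -> Y} (hl : unital_hom l).
Let ll : linear l := star_hom_linear (proj1 hl).

Lemma ptampl_elem p x : ptampl fr ll (pte fr p x) = pte fr p (l x).
Proof.
by apply: sval_inj; apply/matrixP => i j; rewrite !mxE (linZ ll).
Qed.

Lemma ptampl_unital_hom : unital_hom (ptampl fr ll).
Proof.
split; last by rewrite -[in LHS]pte1 ptampl_elem (proj2 hl) pte1.
have [la lM lS] := ampl_hom d (proj1 hl).
split=> [c Z W|Z W|Z]; apply: sval_inj; [exact: la|exact: lM|exact: lS].
Qed.

End PtensAmplHom.

(** Entries suffice because the coordinates of an element of [ptens] are linear combinations of its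
    entries. The factorization is unital for the unit [e] of the subalgebra, even where [e] is not
    that of [X]. *)
Lemma ptens_corestrict (R : realType) (P : ucstarType R) d (fr : fd_frame P d)
    (O X : ucstarType R) (e : X) (S : set X) (hS : subalg e S) (Psi : O -> ptens fr X) :
  is_star_hom Psi -> Psi 𝟏 = pte fr 𝟏 e -> (forall a i j, S (sval_ (Psi a) i j)) ->
  exists2 Psi0 : O -> ptens fr (suba hS), unital_hom Psi0
    & forall a i j, sval_ (sval_ (Psi0 a) i j) = sval_ (Psi a) i j.
Proof.
move=> [lq qM qS] q1 SPsi.
pose W a : cmx (suba hS) d := \matrix_(i, j) smk (hS := hS) (SPsi a i j).
have hsv := @sval_hom _ _ _ _ hS; have ls := star_hom_linear hsv.
have Wp a : ptset fr (W a).
  move=> i j; apply: sval_inj; rewrite mxE smkK (sval_in (Psi a) i j) (lin_sum ls).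
  apply: eq_bigr => k _; rewrite (linZ ls); congr (_ *: _).
  rewrite /pcoord (lin_sum ls); apply: eq_bigr => n _.
  by rewrite (linZ ls) mxE.
pose Psi0 a : ptens fr (suba hS) := smk (hS := pt_subalg fr _) (Wp a).
pose E := ptampl fr ls.
have hE : is_star_hom E.
  have [la lM lS] := ampl_hom d hsv.
  split=> [c Z V|Z V|Z]; apply: sval_inj; [exact: la|exact: lM|exact: lS].
have [lE EM ES] := hE.
have Einj (Y Z : ptens fr (suba hS)) : E Y = E Z -> Y = Z.
  move=> h; apply: sval_inj; apply/matrixP => i j; apply: sval_inj.
  by have := congr1 (fun V : ptens fr X => sval_ V i j) h; rewrite !amplE.
have EPsi a : E (Psi0 a) = Psi a.
  by apply: sval_inj; apply/matrixP => i j; rewrite amplE mxE smkK.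
exists Psi0; last by move=> a i j; rewrite mxE smkK.
split; first split=> [c a b|a b|a]; apply: Einj.
- by rewrite lE !EPsi lq.
- by rewrite EM !EPsi qM.
- by rewrite ES !EPsi qS.
- rewrite EPsi q1; apply: sval_inj; apply/matrixP => i j.
  rewrite ptelemE amplE fl1 sval1 cmx1E.
  by case: eqP => _; rewrite ?scale1r ?scale0r ?(lin0 ls).
Qed.

(** * The universal property in matrix form *)

Section QuantumMaps.
Context {R : realType} {P O M T : ucstarType R} {t : P -> M -> T} {Phi : O -> T}.
Context {d : nat} (fr : fd_frame P d) (U : is_quantum_maps t Phi).
Let tT : is_cstar_tensor t := min_tensor_tensor (qmaps_tensor U).

Definition ptinv (y : T) : ptens fr M := projT1 (cid (ptmap_surj fr tT y)).

Lemma ptinvK y : ptmap fr t (ptinv y) = y.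
Proof. by rewrite /ptinv; case: cid. Qed.

Lemma ptmap_injective : injective (ptmap fr t).
Proof.
move=> Y Z h; apply/eqP; rewrite -subr_eq0; apply/eqP/(ptmap_inj tT).
by rewrite (linB (ptmap_linear tT)) h subrr.
Qed.

Lemma ptinv_elem p m : ptinv (t p m) = pte fr p m.
Proof. by apply: ptmap_injective; rewrite ptinvK ptmap_elem. Qed.

Lemma ptinv_unital_hom : unital_hom ptinv.
Proof.
have [lm mM mS] := ptmap_hom fr tT.
split; last by apply: ptmap_injective; rewrite ptinvK ptmap1.
split=> [c y z|y z|y]; apply: ptmap_injective.
- by rewrite lm !ptinvK.
- by rewrite mM !ptinvK.
- by rewrite mS !ptinvK.
Qed.

Definition qphi (a : O) : ptens fr M := ptinv (Phi a).
(** The coefficients [Phi_ij(a)]: matrix entries of [Phi a] in the representation of [P] carried by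
    the frame. *)
Definition qcoef a i j : M := sval_ (qphi a) i j.

Lemma qphi_unital_hom : unital_hom qphi.
Proof.
have [h h1] := ptinv_unital_hom; split.
  exact: is_star_hom_comp (qmaps_hom U) h.
by rewrite /qphi (is_unit_uniq (qmaps_unit U (@is_unit_one _ O))).
Qed.

Section Factor.
Context {X : ucstarType R}.

(** The universal property speaks of multipliers; for unital [X] they are identified with elements
    by evaluation at 1. *)
Lemma quantum_maps_exists (Psi : O -> ptens fr X) : unital_hom Psi ->
  exists2 l : M -> X, unital_hom l & forall a i j, sval_ (Psi a) i j = l (qcoef a i j).
Proof.
move=> hPsi; have [L [[mL [F [Fm FL FR] PF]] _]] := qmaps_universal U (ptens_min fr (X := X))
  (cmult_mor hPsi).
pose l m := multL (L m) 𝟏; have hl1 : unital_hom l := mor_unital_hom mL.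
exists l => //; have [hl l1] := hl1.
have ll := star_hom_linear hl.
move=> a i j.
have evL : linear (fun y : T => multL (F y) 𝟏).
  by move=> c y z; rewrite (star_hom_linear (mor_hom Fm)).
have -> : Psi a = \sum_k pte fr (fb fr k) (l (pcoord fr (sval_ (qphi a)) k)).
  have := congr1 (fun m => multL m 𝟏) (PF a); rewrite /= smulx1 => ->.
  rewrite -{1}(ptinvK (Phi a)) (lin_sum evL); apply: eq_bigr => k _.
  by rewrite -[in LHS]pte1 FL smulx1.
rewrite /qcoef (sval_in (qphi a) i j) (lin_sum ll) (lin_sum (star_hom_linear sval_hom)) cmx_sumE.
by apply: eq_bigr => k _; rewrite (linZ ll) -ptelemE.
Qed.

Lemma quantum_maps_unique (l1 l2 : M -> X) : unital_hom l1 -> unital_hom l2 ->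
  (forall a i j, l1 (qcoef a i j) = l2 (qcoef a i j)) -> l1 =1 l2.
Proof.
move=> h1 h2 e m.
pose Psi1 a := ptampl fr (star_hom_linear (proj1 h1)) (qphi a).
have ePsi a : Psi1 a = ptampl fr (star_hom_linear (proj1 h2)) (qphi a).
  by apply: sval_inj; apply/matrixP => i j; rewrite !amplE; exact: e.
have hPsi : unital_hom Psi1.
  have [hq q1] := qphi_unital_hom; have [ha a1] := ptampl_unital_hom fr h1.
  by split; [exact: is_star_hom_comp hq ha|rewrite /Psi1 q1].
have fac (l : M -> X) (hl : unital_hom l) :
    (forall a, Psi1 a = ptampl fr (star_hom_linear (proj1 hl)) (qphi a)) ->
    is_mor (@cmult _ X \o l) /\ exists2 F, is_id_tensor t (@pte _ _ _ fr X) (@cmult _ X \o l) F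
      & forall a, (@cmult _ _ \o Psi1) a = F (Phi a).
  move=> el; split; first exact: cmult_mor.
  exists (@cmult _ _ \o (ptampl fr (star_hom_linear (proj1 hl)) \o ptinv)) => [|a]; last first.
    by rewrite /= el.
  split=> [|p m' p' x|p m' p' x].
  - apply: cmult_mor; have [hi i1] := ptinv_unital_hom; have [ha a1] := ptampl_unital_hom fr hl.
    by split; [exact: is_star_hom_comp hi ha|rewrite /= i1].
  - by rewrite /= ptinv_elem ptampl_elem pteM.
  - by rewrite /= ptinv_elem ptampl_elem pteM.
have [L [_ Lu]] := qmaps_universal U (ptens_min fr (X := X)) (cmult_mor hPsi).
have := congr1 (fun f => multL (f m) 𝟏) (etrans (esym (Lu _ (fac _ h1 (fun=> erefl)))) (Lu _ (fac _ h2 ePsi))).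
by rewrite /= !smulx1.
Qed.

End Factor.

(** [Phi] corestricts to [S] and so factors through a map [l] into [S]; the inclusion after [l]
    fixes the coefficients, hence is the identity by uniqueness. *)
Lemma quantum_maps_generate (S : set M) : subalg 𝟏 S -> (forall a i j, S (qcoef a i j)) ->
  forall m, S m.
Proof.
move=> hS Sq; have [hq q1] := qphi_unital_hom.
have [|Psi hPsi PsiE] := ptens_corestrict hS hq _ Sq; first by rewrite q1 pte1.
have [l hl lE] := quantum_maps_exists hPsi.
have hsl : unital_hom (@sval_ _ _ _ _ hS \o l).
  by split; [exact: is_star_hom_comp (proj1 hl) sval_hom|rewrite /= (proj2 hl) sval1].
have hid : unital_hom (id : M -> M) by [].
move=> m; have /(_ _ m) <- := quantum_maps_unique hsl hid; first exact: sval_in.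
by move=> a i j; rewrite /= -lE PsiE.
Qed.

(** [Psi] has its entries in the corner [e X e], where it is unital, and the universal property is
    used there. This serves the dilated representation, whose unit is only a projection of the
    ambient algebra. *)
Lemma quantum_maps_corner (X : ucstarType R) (e : X) (Psi : O -> ptens fr X) :
  e^† = e -> e ∗ e = e -> is_star_hom Psi -> Psi 𝟏 = pte fr 𝟏 e ->
  exists l : M -> X, [/\ is_star_hom l, l 𝟏 = e
    & forall a i j, sval_ (Psi a) i j = l (qcoef a i j)].
Proof.
move=> es ee hPsi Psi1.
pose S : set X := [set x | e ∗ x = x /\ x ∗ e = x].
have hS : subalg e S.
  split=> //.
  - by move=> c x y [h1 h2] [k1 k2]; split; rewrite ?(smulDr, smulDl, smulZr, smulZl) ?h1 ?h2 ?k1 ?k2.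
  - by move=> x y [h1 h2] [k1 k2]; split; rewrite ?smulA ?h1// -smulA k2.
  - by move=> x [h1 h2]; split; rewrite -{1}es -starM ?h1 ?h2.
  - move=> u y hu uy; split.
      apply: (ncv_uniq (ncvM (ncv_cst e) uy)); apply: ncv_ext uy => n.
      by have [-> _] := hu n.
    apply: (ncv_uniq (ncvM uy (ncv_cst e))); apply: ncv_ext uy => n.
    by have [_ ->] := hu n.
have SPsi a i j : S (sval_ (Psi a) i j).
  have [_ PM _] := hPsi; split.
    have := congr1 (fun Y : ptens fr X => sval_ Y i j) (PM 𝟏 a).
    rewrite smul1x Psi1 => {2}->; rewrite -[sval_ (_ ∗ _)]/(ptelem fr 𝟏 e ∗ sval_ (Psi a)).
    rewrite cmxME (bigD1 i)//= big1 ?addr0 => [|k /negbTE ki].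
      by rewrite ptelemE fl1 eqxx scale1r.
    by rewrite ptelemE fl1 eq_sym ki scale0r smul0x.
  have := congr1 (fun Y : ptens fr X => sval_ Y i j) (PM a 𝟏).
  rewrite smulx1 Psi1 => {2}->; rewrite -[sval_ (_ ∗ _)]/(sval_ (Psi a) ∗ ptelem fr 𝟏 e).
  rewrite cmxME (bigD1 j)//= big1 ?addr0 => [|k /negbTE kj].
    by rewrite ptelemE fl1 eqxx scale1r.
  by rewrite ptelemE fl1 kj scale0r smulx0.
have [Psi0 hPsi0 Psi0E] := ptens_corestrict hS hPsi Psi1 SPsi.
have [l [hl l1] lE] := quantum_maps_exists hPsi0.
exists (@sval_ _ _ _ _ hS \o l); split.
- exact: is_star_hom_comp hl sval_hom.
- by rewrite /= l1 sval1.
- by move=> a i j; rewrite /= -lE Psi0E.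
Qed.

End QuantumMaps.

(** * Submodules *)

Definition lin_closed (K : numClosedFieldType) (V : lmodType K) (S : set V) :=
  S 0 /\ forall (c : K) x y, S x -> S y -> S (c *: x + y).

Definition sublm (K : numClosedFieldType) (V : lmodType K) (S : set V)
  (hS : lin_closed S) : Type := {x : V | x \in S}.

Section SubModule.
Context {K : numClosedFieldType} {V : lmodType K} {S : set V} {hS : lin_closed S}.
Local Notation B := (sublm hS).

Definition lval (x : B) : V := val x.
Definition lmk (x : V) (h : S x) : B := exist _ x (mem_set h).
Lemma lval_in (x : B) : S (lval x).
Proof. exact: set_mem (valP x). Qed.
Lemma lval_inj (x y : B) : lval x = lval y -> x = y.
Proof. exact: val_inj. Qed.

Fact lmD x y : S x -> S y -> S (x + y).
Proof. by move=> hx hy; have := (proj2 hS) 1 _ _ hx hy; rewrite scale1r. Qed.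
Fact lmZ c x : S x -> S (c *: x).
Proof. by move=> hx; have := (proj2 hS) c _ _ hx (proj1 hS); rewrite addr0. Qed.
Fact lmN x : S x -> S (- x).
Proof. by rewrite -scaleN1r; exact: lmZ. Qed.

HB.instance Definition _ := Choice.copy B {x : V | x \in S}.

Definition lm0 : B := lmk (proj1 hS).
Definition lm_add (x y : B) : B := lmk (lmD (lval_in x) (lval_in y)).
Definition lm_opp (x : B) : B := lmk (lmN (lval_in x)).
Definition lm_scale (c : K) (x : B) : B := lmk (lmZ c (lval_in x)).

Fact lmDA : associative lm_add.
Proof. by move=> x y z; apply: lval_inj; exact: addrA. Qed.
Fact lmDC : commutative lm_add.
Proof. by move=> x y; apply: lval_inj; exact: addrC. Qed.
Fact lm0D : left_id lm0 lm_add.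
Proof. by move=> x; apply: lval_inj; exact: add0r. Qed.
Fact lmND : left_inverse lm0 lm_opp lm_add.
Proof. by move=> x; apply: lval_inj; exact: addNr. Qed.
HB.instance Definition _ := GRing.isZmodule.Build B lmDA lmDC lm0D lmND.

Fact lmZA c d' (x : B) : lm_scale c (lm_scale d' x) = lm_scale (c * d') x.
Proof. by apply: lval_inj; exact: scalerA. Qed.
Fact lm1Z : left_id 1 lm_scale.
Proof. by move=> x; apply: lval_inj; exact: scale1r. Qed.
Fact lmZDr : right_distributive lm_scale +%R.
Proof. by move=> c x y; apply: lval_inj; exact: scalerDr. Qed.
Fact lmZDl (x : B) : {morph lm_scale^~ x : c d' / c + d'}.
Proof. by move=> c d'; apply: lval_inj; exact: scalerDl. Qed.
HB.instance Definition _ := GRing.Zmodule_isLmodule.Build K B lmZA lm1Z lmZDr lmZDl.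

End SubModule.

(** * Adjointable operators on a pre-Hilbert module *)

Section Adjointable.
Context {R : realType} {A : ucstarType R} {E : lmodType R[i]} (H : pre_hilbert A E).
Hypothesis dot_inj : forall u v, (forall w, dot H w u = dot H w v) -> u = v.
Implicit Types T S : E -> E.

Definition adjointable T := bounded (en H) T /\ exists S, adjoint H T S.

Let ND := enD H.
Let NZ := enZ H.

Lemma adjoint_linear T S : adjoint H T S -> linear T.
Proof.
move=> /adjointC h c u v; apply: dot_inj => w.
by rewrite -h dot_linear dot_linear !h.
Qed.

Lemma adjoint_uniq T S S' : adjoint H T S -> adjoint H T S' -> S = S'.
Proof. by move=> h h'; apply/funext => u; apply: dot_inj => w; rewrite -h h'. Qed.

Fact adjointable_closed : lin_closed (adjointable : set (E -> E)).
Proof.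
split=> [|c T T' [[C bT] [S aT]] [[C' bT'] [S' aT']]].
  split; last by exists (fun=> 0) => u v; rewrite dot0r -dot_star dot0r star0.
  by exists 0; split=> // u; rewrite /en dot0r nr0 sqrtr0 mul0r.
split; first by exists (nr c * C + C'); apply: (opbD ND) bT'; exact: (opbZ NZ).
exists (fun u => c^*%R *: S u + S' u) => u v.
by rewrite dotDl dotZl dotDr dotZr aT aT'.
Qed.

Local Notation adjm := (sublm adjointable_closed).
Implicit Types x y : adjm.

Definition aop x : E -> E := lval x.
Definition adj_of x : E -> E := projT1 (cid (proj2 (lval_in x))).
Lemma adj_ofP x : adjoint H (aop x) (adj_of x).
Proof. by rewrite /adj_of; case: cid. Qed.
Lemma aop_bd x : bounded (en H) (aop x).
Proof. exact: (proj1 (lval_in x)). Qed.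
Lemma aop_inj x y : aop x =1 aop y -> x = y.
Proof. by move=> h; apply: lval_inj; apply/funext. Qed.

Fact amul_in x y : adjointable (aop x \o aop y).
Proof.
have [C hC] := aop_bd x; have [D hD] := aop_bd y.
split; first by exists (C * D); exact: opbM.
by exists (adj_of y \o adj_of x) => u v; rewrite /= !adj_ofP.
Qed.
Fact aone_in : adjointable id.
Proof. by split; [exists 1; exact: opb1|exists id]. Qed.
Fact astar_in x : adjointable (adj_of x).
Proof.
split; last by exists (aop x); apply: adjointC; exact: adj_ofP.
by have [C hC] := aop_bd x; exists C; apply: opb_adjoint hC; exact: adj_ofP.
Qed.
Definition amul x y : adjm := lmk (amul_in x y).
Definition aone : adjm := lmk aone_in.
Definition astar x : adjm := lmk (astar_in x).
Definition asn x : R := opn (en H) (aop x).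

Lemma astar_eq x T : adjoint H (aop x) T -> aop (astar x) = T.
Proof. by move=> h; apply: adjoint_uniq h; exact: adj_ofP. Qed.

Fact amulA x y z : amul x (amul y z) = amul (amul x y) z.
Proof. exact: aop_inj. Qed.
Fact amul_linl y : linear (amul^~ y).
Proof. by move=> c x z; exact: aop_inj. Qed.
Fact amul_linr x : linear (amul x).
Proof. by move=> c y z; apply: aop_inj => u; exact: (adjoint_linear (adj_ofP x)). Qed.
Fact amul1x x : amul aone x = x.
Proof. exact: aop_inj. Qed.
Fact amulx1 x : amul x aone = x.
Proof. exact: aop_inj. Qed.
Fact astar_conjlinear (c : R[i]) x y : astar (c *: x + y) = (c^*)%R *: astar x + astar y.
Proof.
apply: lval_inj; apply: astar_eq => u v.
by rewrite /aop /= dotDl dotZl dotDr dotZr -!adj_ofP.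
Qed.
Fact astarM x y : astar (amul x y) = amul (astar y) (astar x).
Proof. by apply: lval_inj; apply: astar_eq => u v; rewrite -[LHS]/(dot H (aop x (aop y u)) v) !adj_ofP. Qed.
Fact astarK x : astar (astar x) = x.
Proof. by apply: lval_inj; apply: astar_eq; apply: adjointC; exact: adj_ofP. Qed.
Lemma asnP x : opb (en H) (aop x) (asn x).
Proof. by apply: opn_opb; [exact: en_ge0|exact: aop_bd]. Qed.
Fact asnD x y : asn (x + y) <= asn x + asn y.
Proof. by apply: opn_le; apply: (opbD ND); exact: asnP. Qed.
Fact asnZ (c : R[i]) x : asn (c *: x) = nr c * asn x.
Proof.
have le d z : asn (d *: z) <= nr d * asn z.
  by apply: opn_le; apply: (opbZ NZ); exact: asnP.
have [->|c0] := eqVneq c 0.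
  by apply/eqP; rewrite eq_le le nr0 mul0r opn_ge0.
apply/eqP; rewrite eq_le le /=.
have nc0 : 0 < nr c by rewrite lt_def nr_ge0 andbT; apply: contra c0 => /eqP/nr_eq0 ->.
have := le c^-1 (c *: x); rewrite scalerA mulVf// scale1r.
have -> : nr c^-1 = (nr c)^-1 by apply: complexI; rewrite fmorphV /= -!nrE normfV.
by rewrite ler_pdivlMl.
Qed.
Fact asnM x y : asn (amul x y) <= asn x * asn y.
Proof. by apply: opn_le; apply: opbM; exact: asnP. Qed.
Fact asnS x : asn (amul (astar x) x) = asn x ^+ 2.
Proof. by apply: (opn_cstar (adj_ofP x)); exact: aop_bd. Qed.

Definition adjoints : precstar adjm := PreCStar amulA amul_linl amul_linr amul1x amulx1
  astar_conjlinear astarM astarK asnD asnZ asnM asnS.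

(** Norm completion of the adjointable operators. Its elements need not act on [E], so facts about
    operators are carried over by limits. *)
Definition adjalg : ucstarType R := compl adjoints.
Definition adjin (T S : E -> E) (b : bounded (en H) T) (a : adjoint H T S) : adjalg :=
  iota_ adjoints (lmk (conj b (ex_intro _ S a)) : adjm).

Lemma nr_adjin T S (b : bounded (en H) T) (a : adjoint H T S) : nr (adjin b a) = opn (en H) T.
Proof. exact: nr_iota. Qed.

Section Rules.
Context {T S T' S' T'' S'' : E -> E}.
Context (b : bounded (en H) T) (a : adjoint H T S).
Context (b' : bounded (en H) T') (a' : adjoint H T' S').
Context (b'' : bounded (en H) T'') (a'' : adjoint H T'' S'').

Lemma adjin_eq : T =1 T' -> adjin b a = adjin b' a'.
Proof. by move=> h; congr (iota_ _ _); exact: aop_inj. Qed.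

Lemma adjinM : (forall u, T (T' u) = T'' u) -> adjin b a ∗ adjin b' a' = adjin b'' a''.
Proof. by move=> h; rewrite -iotaM; congr (iota_ _ _); exact: aop_inj. Qed.

Lemma adjin_lin (c : R[i]) : (forall u, c *: T u + T' u = T'' u) ->
  c *: adjin b a + adjin b' a' = adjin b'' a''.
Proof. by move=> h; rewrite -iota_linear; congr (iota_ _ _); exact: aop_inj. Qed.

Lemma adjin_star (bS : bounded (en H) S) (aS : adjoint H S T) : (adjin b a)^† = adjin bS aS.
Proof. by rewrite -iota_star; congr (iota_ _ _); apply: lval_inj; exact: astar_eq. Qed.

End Rules.

End Adjointable.

(** * The module of a positive definite kernel *)

Record pd_kernel (R : realType) (A : ucstarType R) (W : Type) := PDKernel {
  kernel :> W -> W -> A ;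
  kernel_star : forall x y, (kernel x y)^† = kernel y x ;
  kernel_pos : forall r : seq (W * A),
    pos (\sum_(s <- r) \sum_(t <- r) s.2^† ∗ kernel s.1 t.1 ∗ t.2) }.

Section KernelModule.
Context {R : realType} {A : ucstarType R} {W : Type} (K : pd_kernel A W).

(** Vectors are functions on [W], as in a reproducing kernel space, instead of classes of formal
    sums: the quotient by null vectors is automatic. *)
Definition kfun (r : seq (W * A)) : W -> A := fun x => \sum_(s <- r) K x s.1 ∗ s.2.
Definition kset : set (W -> A) := [set F | exists r, F = kfun r].

Fact kset_closed : lin_closed kset.
Proof.
split; first by exists [::]; apply/funext => x; rewrite /kfun big_nil.
move=> c _ _ [r ->] [r' ->]; exists ([seq (s.1, c *: s.2) | s <- r] ++ r').
apply/funext => x; rewrite /kfun big_cat big_map; congr (_ + _).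
by rewrite -[LHS]/(c *: kfun r x) scaler_sumr; apply: eq_bigr => s _; rewrite smulZr.
Qed.

Definition kmod := sublm kset_closed.
HB.instance Definition _ := GRing.Lmodule.copy kmod (sublm kset_closed).
Implicit Types F G : kmod.

Definition kval F : W -> A := lval (F : sublm kset_closed).
Lemma kval_inj F G : kval F =1 kval G -> F = G.
Proof. by move=> h; apply: lval_inj; apply/funext. Qed.
Lemma kval_lin (c : R[i]) F G x : kval (c *: F + G) x = c *: kval F x + kval G x.
Proof. by []. Qed.

Definition krep F : seq (W * A) := projT1 (cid (lval_in (F : sublm kset_closed))).
Lemma krepP F : kval F = kfun (krep F).
Proof. by rewrite /krep; case: cid. Qed.

Definition kdot F G : A := \sum_(s <- krep F) s.2^† ∗ kval G s.1.

Lemma kfun_dot r r' : \sum_(s <- r) s.2^† ∗ kfun r' s.1 =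
  \sum_(s <- r) \sum_(t <- r') s.2^† ∗ K s.1 t.1 ∗ t.2.
Proof.
by apply: eq_bigr => s _; rewrite smul_sumr; apply: eq_bigr => t _; rewrite smulA.
Qed.

Lemma kfun_star r r' : (\sum_(s <- r) s.2^† ∗ kfun r' s.1)^† =
  \sum_(s <- r') s.2^† ∗ kfun r s.1.
Proof.
rewrite !kfun_dot star_sum exchange_big; apply: eq_bigr => s _.
rewrite star_sum; apply: eq_bigr => t _.
by rewrite !starM kernel_star starK smulA.
Qed.

(** Independence of the representative: the adjoint moves the chosen representative to the other
    side, where only the function [kval F] is seen. *)
Lemma kdotE r F G : kval F = kfun r -> kdot F G = \sum_(s <- r) s.2^† ∗ kval G s.1.
Proof.
move=> hr; apply: star_inj; rewrite /kdot krepP !kfun_star.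
by rewrite -krepP hr.
Qed.

Fact kdot_linear F : linear (kdot F).
Proof.
move=> c G G'; rewrite /kdot scaler_sumr -big_split; apply: eq_bigr => s _ /=.
by rewrite kval_lin smulDr smulZr.
Qed.
Fact kdot_star F G : (kdot F G)^† = kdot G F.
Proof. by rewrite /kdot krepP kfun_star -krepP. Qed.
Fact kdot_pos F : pos (kdot F F).
Proof. by rewrite /kdot krepP kfun_dot; exact: kernel_pos. Qed.

Fact kract_in F (a : A) : kset (fun x => kval F x ∗ a).
Proof.
exists [seq (s.1, s.2 ∗ a) | s <- krep F]; apply/funext => x.
rewrite krepP /kfun big_map smul_suml; apply: eq_bigr => s _; exact/esym/smulA.
Qed.
Definition kract F a : kmod := lmk (kract_in F a).
Fact kdot_ract F G a : kdot F (kract G a) = kdot F G ∗ a.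
Proof. by rewrite /kdot smul_suml; apply: eq_bigr => s _; rewrite smulA. Qed.

Definition khilb : pre_hilbert A kmod := PreHilbert kdot_linear kdot_star kdot_pos kdot_ract.
Local Notation en := (en khilb).

Fact kel_in w (b : A) : kset (fun x => K x w ∗ b).
Proof. by exists [:: (w, b)]; apply/funext => x; rewrite /kfun big_seq1. Qed.
Definition kel w b : kmod := lmk (kel_in w b).

Lemma kdot_kel w b F : kdot (kel w b) F = b^† ∗ kval F w.
Proof.
rewrite (@kdotE [:: (w, b)]) ?big_seq1//.
by apply/funext => x; rewrite /kfun big_seq1.
Qed.

Lemma kdot_inj F G : (forall H, kdot H F = kdot H G) -> F = G.
Proof.
move=> h; apply: kval_inj => w; have := h (kel w 𝟏).
by rewrite !kdot_kel star1 !smul1x.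
Qed.

Lemma kval_le w F : nr (kval F w) <= en (kel w 𝟏) * en F.
Proof.
have := cauchy_schwarz khilb (kel w 𝟏) F.
by rewrite /= kdot_kel star1 smul1x.
Qed.

Lemma en_kel w b : en (kel w b) <= Num.sqrt (nr (K w w)) * nr b.
Proof.
apply: en_le; first by rewrite mulr_ge0 ?sqrtr_ge0.
rewrite /= kdot_kel exprMn sqr_sqrtr// expr2 mulrA [_ * nr b]mulrC mulrC.
by rewrite mulrC -{1}[nr b]nr_star; apply: nrM_le => //; apply: nrM.
Qed.

(** The operator [|w> a <w'|]. *)
Definition kop w (a : A) w' F : kmod := kel w (a ∗ kval F w').

Lemma kop_adjoint w a w' : adjoint khilb (kop w a w') (kop w' a^† w).
Proof.
move=> F G; rewrite /= kdot_kel -[RHS]kdot_star kdot_kel.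
by rewrite !starM !starK smulA.
Qed.

Lemma kop_bounded w a w' : bounded en (kop w a w').
Proof.
exists (Num.sqrt (nr (K w w)) * nr a * en (kel w' 𝟏)); split.
  by rewrite !mulr_ge0 ?sqrtr_ge0 ?en_ge0.
move=> F; apply: le_trans (en_kel _ _) _; rewrite -!mulrA; apply: ler_wpM2l.
  exact: sqrtr_ge0.
by apply: le_trans (nrM _ _) _; apply: ler_wpM2l => //; exact: kval_le.
Qed.

Lemma kop_comp w a w' u b u' F : kop w a w' (kop u b u' F) = kop w (a ∗ K w' u ∗ b) u' F.
Proof.
apply: kval_inj => x.
rewrite -[LHS]/(K x w ∗ (a ∗ (K w' u ∗ (b ∗ kval F u')))).
by rewrite -[RHS]/(K x w ∗ (a ∗ K w' u ∗ b ∗ kval F u')) !smulA.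
Qed.

End KernelModule.

(** * Dilation of completely positive maps *)

Record cp_matrix (R : realType) (O A : ucstarType R) (I : Type) (g : O -> I -> I -> A) : Prop := {
  cpm_linear : forall i j, linear (fun a => g a i j) ;
  cpm_star : forall a i j, (g a i j)^† = g a^† j i ;
  cpm_pos : forall r : seq (O * I * A), pos (\sum_(s <- r) \sum_(t <- r)
    s.2^† ∗ g (s.1.1^† ∗ t.1.1) s.1.2 t.1.2 ∗ t.2) }.

Section Dilation.
Context {R : realType} {O A : ucstarType R} {I : Type} {g : O -> I -> I -> A}.
Hypothesis hg : cp_matrix g.
Local Notation W := (option (O * I)).

(** [None] spans a copy of [A], orthogonal to the module of [g]. *)
Definition gker (x y : W) : A :=
  match x, y with
  | Some (a, i), Some (b, j) => g (a^† ∗ b) i j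
  | None, None => 𝟏
  | _, _ => 0
  end.

Fact gker_star x y : (gker x y)^† = gker y x.
Proof.
case: x y => [[a i]|] [[b j]|] /=; rewrite ?star0 ?star1//.
by rewrite (cpm_star hg) starM starK.
Qed.

Fact gker_pos (r : seq (W * A)) :
  pos (\sum_(s <- r) \sum_(t <- r) s.2^† ∗ gker s.1 t.1 ∗ t.2).
Proof.
pose nz (s : W * A) : A := if s.1 is Some _ then 0 else s.2.
pose h (s : W * A) : option (O * I * A) := if s.1 is Some p then Some (p, s.2) else None.
pose T (s t : O * I * A) := s.2^† ∗ g (s.1.1^† ∗ t.1.1) s.1.2 t.1.2 ∗ t.2.
have termE s t : s.2^† ∗ gker s.1 t.1 ∗ t.2 = (nz s)^† ∗ nz t +
    oapp (fun s' => oapp (T s') 0 (h t)) 0 (h s).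
  case: s t => [[[a i]|] s] [[[b j]|] t] /=; rewrite /nz /T /=.
  - by rewrite smulx0 add0r.
  - by rewrite ?star0 !(smulx0, smul0x) addr0.
  - by rewrite ?star0 !(smulx0, smul0x) addr0.
  - by rewrite smulx1 addr0.
under eq_bigr do (under eq_bigr do rewrite termE).
under eq_bigr do rewrite big_split.
rewrite big_split; apply: posD.
  under eq_bigr do rewrite -smul_sumr.
  by rewrite -smul_suml -star_sum; exact: posS.
have := cpm_pos hg (pmap h r); congr pos.
rewrite big_pmap; apply: eq_bigr => s _; case: (h s) => [s'|] /=; last by rewrite big1.
by rewrite big_pmap.
Qed.

Definition gkernel : pd_kernel A W := PDKernel gker_star gker_pos.
Local Notation E := (kmod gkernel).
Local Notation H := (khilb gkernel).
Implicit Types F G : E.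

Definition shift (a : O) (s : W * A) : W * A :=
  if s.1 is Some (b, i) then (Some (a ∗ b, i), s.2) else (None, 0).

Lemma kfun_shift a r x : kfun gkernel [seq shift a s | s <- r] x =
  if x is Some (b, i) then kfun gkernel r (Some (a^† ∗ b, i)) else 0.
Proof.
rewrite /kfun big_map; case: x => [[b i]|].
  apply: eq_bigr => -[[[c j]|] s] _ /=; last by rewrite smulx0 smul0x.
  by rewrite starM starK smulA.
by rewrite big1// => -[[[c j]|] s] _ /=; rewrite ?smul0x ?smulx0.
Qed.

Fact rho_in a F : kset gkernel
  (fun x => if x is Some (b, i) then kval F (Some (a^† ∗ b, i)) else 0).
Proof.
exists [seq shift a s | s <- krep F]; apply/funext => x.
by rewrite kfun_shift krepP; case: x.
Qed.
Definition rho (a : O) F : E := lmk (rho_in a F).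

Lemma rhoE a F b i : kval (rho a F) (Some (b, i)) = kval F (Some (a^† ∗ b, i)).
Proof. by []. Qed.
Lemma rhoN a F : kval (rho a F) None = 0.
Proof. by []. Qed.
Lemma kopE w a w' F x : kval (kop w a w' F) x = gker x w ∗ (a ∗ kval F w').
Proof. by []. Qed.

Lemma kelE w b x : kval (kel gkernel w b) x = gker x w ∗ b.
Proof. by []. Qed.

Lemma rho_rep a F : kval (rho a F) = kfun gkernel [seq shift a s | s <- krep F].
Proof. by apply/funext => x; rewrite kfun_shift -krepP; case: x. Qed.

Lemma rho_adjoint a : adjoint H (rho a) (rho a^†).
Proof.
move=> F G; rewrite /= (kdotE _ (rho_rep a F)) big_map; apply: eq_bigr => s _.
case: s => [[[b i]|] s]; rewrite /shift /=; first by rewrite rhoE starK.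
by rewrite rhoN star0 smul0x smulx0.
Qed.

Lemma kval_conjlin F (c : R[i]) a b i :
  kval F (Some (c *: a + b, i)) = c^*%R *: kval F (Some (a, i)) + kval F (Some (b, i)).
Proof.
rewrite krepP /kfun scaler_sumr -big_split; apply: eq_bigr => -[[[b' j]|] s] _ /=.
  by rewrite starD starZ smulDl smulZl (cpm_linear hg) smulDl smulZl.
by rewrite !smul0x scaler0 addr0.
Qed.

Lemma rhoM a b F : rho a (rho b F) = rho (a ∗ b) F.
Proof. by apply: kval_inj => -[[c i]|]; rewrite ?rhoN// !rhoE starM smulA. Qed.

Lemma rho_linear F : linear (rho^~ F).
Proof.
move=> c a b; apply: kval_inj => x; rewrite kval_lin; case: x => [[e i]|].
  by rewrite !rhoE starD starZ smulDl smulZl kval_conjlin conjCK.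
by rewrite !rhoN scaler0 addr0.
Qed.

(** [rho] annihilates the direction [None]; the second summand is the projection onto it. *)
Lemma rho1 F : F = rho 𝟏 F + kop None 𝟏 None F.
Proof.
apply: kval_inj => x; rewrite -[rho _ _]scale1r kval_lin scale1r.
rewrite kopE; case: x => [[e i]|] /=; first by rewrite rhoE star1 smul1x smul0x addr0.
by rewrite rhoN add0r !smul1x.
Qed.

Lemma rho_bounded a : bounded (en H) (rho a).
Proof.
exists (nr a); split=> // F.
apply: en_le; first by rewrite mulr_ge0// en_ge0.
rewrite exprMn en2 -[_ ^+ 2]ger0_norm ?sqr_ge0// -nrZR.
apply: nr_mono; first exact: dot_pos.
(* [y] is a root of [nr a ^+ 2 - a^† ∗ a]; the gap between the squared norms consists of that of
   [rho y F] and the [None] component of [F]. *)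
have [y ys yE] := proj2 (nrP a (nr_ge0 a)) (lexx _).
have -> : (nr a ^+ 2)%:C *: dot H F F - dot H (rho a F) (rho a F) =
   dot H (rho y F) (rho y F) + (nr a ^+ 2)%:C *: dot H F (kop None 𝟏 None F).
  rewrite {2}(rho1 F) dotDr scalerDr addrAC; congr (_ + _).
  rewrite !rho_adjoint ys !rhoM -yE (linB (rho_linear F)) (linZ (rho_linear F)).
  by rewrite dotDr dotZr dotNr.
apply: posD; first exact: dot_pos.
apply: posZ; first exact: sqr_ge0.
by rewrite -dot_star /= kdot_kel smul1x starM starK; exact: posS.
Qed.

Fact gdot_inj F G : (forall F', dot H F' F = dot H F' G) -> F = G.
Proof. exact: kdot_inj. Qed.
Definition dilalg : ucstarType R := adjalg gdot_inj.
Definition dop w a w' : dilalg :=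
  adjin gdot_inj (kop_bounded gkernel w a w') (kop_adjoint w a w').
Definition drho a : dilalg :=
  adjin gdot_inj (rho_bounded a) (rho_adjoint a).

Lemma dopM w a w' u b u' : dop w a w' ∗ dop u b u' = dop w (a ∗ gker w' u ∗ b) u'.
Proof. by apply: adjinM => F; exact: kop_comp. Qed.

Lemma dop_linear w w' : linear (fun a => dop w a w').
Proof.
move=> c a b; apply/esym/adjin_lin => F; apply: kval_inj => x.
by rewrite kval_lin !kopE !(smulDr, smulDl, smulZr, smulZl).
Qed.

Lemma dop_star w a w' : (dop w a w')^† = dop w' a^† w.
Proof.
rewrite /dop (adjin_star _ _ _ (kop_bounded gkernel w' a^† w) (adjointC (kop_adjoint w a w'))).
exact: adjin_eq.
Qed.

Lemma drhoM a b : drho a ∗ drho b = drho (a ∗ b).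
Proof. by apply: adjinM => F; exact: rhoM. Qed.

Lemma drho_linear : linear drho.
Proof. by move=> c a b; apply/esym/adjin_lin => F; exact/esym/rho_linear. Qed.

Lemma drho_star a : (drho a)^† = drho a^†.
Proof.
rewrite /drho (adjin_star _ _ _ (rho_bounded a^†) (adjointC (rho_adjoint a))).
exact: adjin_eq.
Qed.

Lemma drho_hom : is_star_hom drho.
Proof.
by split=> [|a b|a]; [exact: drho_linear|rewrite drhoM|rewrite drho_star].
Qed.

Lemma drho_dop a b i c w : drho a ∗ dop (Some (b, i)) c w = dop (Some (a ∗ b, i)) c w.
Proof.
apply: adjinM => F; apply: kval_inj => -[[e j]|]; last by rewrite rhoN kopE smul0x.
by rewrite rhoE !kopE /= starM starK -smulA.
Qed.

Let J a := dop None a None.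

Lemma dop_hom : is_star_hom J.
Proof.
split=> [|a b|a]; first exact: dop_linear.
  by rewrite dopM smulx1.
by rewrite /J dop_star.
Qed.

Lemma dop_inj a : J a = 0 -> a = 0.
Proof.
move=> Ja; apply: sS_eq0; apply: nr_eq0.
have o0 : opn (en H) (kop None a None) = 0 by rewrite -(nr_adjin gdot_inj (kop_bounded _ _ _ _)
  (kop_adjoint _ _ _)) -[adjin _ _ _]/(J a) Ja nr0.
have := en2 H (kop None a None (kel gkernel None 𝟏)).
rewrite (opn_eq0 _ (kop_bounded _ _ _ _) o0) expr0n /= kdot_kel kopE.
by rewrite kelE /= !smul1x smulx1 => <-.
Qed.

Lemma dop_isometric a : nr (J a) = nr a.
Proof. by apply: (inj_isometric dop_hom) => b; exact: dop_inj. Qed.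

(** For an operator [y] on the module the compression is [J] of the inner product of [e] with [y e],
    where [e] is the unit vector at [None]. The range of the isometric [J] is closed, which covers
    the completion. *)
Lemma dop_corner x : exists a, J 𝟏 ∗ x ∗ J 𝟏 = J a.
Proof.
have [u ux] := iota_dense x.
have /choice[al alE] : forall k, exists a, J 𝟏 ∗ iota_ _ (u k) ∗ J 𝟏 = J a.
  move=> k; set y := u k; pose G := adj_of y (kel gkernel None 𝟏).
  exists (kval G None)^†; have ya := @adj_ofP _ _ _ _ y.
  have e b : kval (aop y (kel gkernel None b)) None = (kval G None)^† ∗ b.
    have := kdot_kel None 𝟏 (aop y (kel gkernel None b)).
    rewrite star1 smul1x => <-; rewrite -[kdot _ _]/(dot H _ _) -(adjointC ya).
    by rewrite -dot_star [dot _ _ _]kdot_kel starM starK.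
  have comp F : kop None 𝟏 None (aop y (kop None 𝟏 None F)) = kop None (kval G None)^† None F.
    by rewrite /kop e !smul1x.
  pose j : sublm (adjointable_closed H) := lmk (conj (kop_bounded gkernel None 𝟏 None)
    (ex_intro _ _ (kop_adjoint None 𝟏 None))).
  have -> : J 𝟏 = iota_ (adjoints gdot_inj) j by [].
  rewrite -(iotaM (adjoints gdot_inj) j y) -(iotaM (adjoints gdot_inj) _ j).
  by congr (iota_ (adjoints gdot_inj) _); apply: aop_inj; exact: comp.
have Jx : ncv (fun k => J (al k)) (J 𝟏 ∗ x ∗ J 𝟏).
  apply: (@ncv_ext _ _ (fun k => J 𝟏 ∗ iota_ _ (u k) ∗ J 𝟏)) => [k|]; first exact: alE.
  by apply: ncvM (ncv_cst _); apply: ncvM ux; exact: ncv_cst.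
by have [a Ja] := isometric_lim dop_hom dop_isometric Jx; exists a.
Qed.

End Dilation.

(** [kap] is the compression to the corner followed by the inverse of [J]. A form [h] of [kap] has
    [J h = z^† z]; positivity is brought back through the isometry [J] as the norm condition of
    [ball_pos]. *)
Lemma corner_cp (R : realType) (A X : ucstarType R) (J : A -> X) : is_star_hom J ->
  (forall a, J a = 0 -> a = 0) -> (forall x, exists a, J 𝟏 ∗ x ∗ J 𝟏 = J a) ->
  exists2 kap : X -> A, cpf kap & cancel J kap.
Proof.
move=> hJ J0 corner.
pose kap x := projT1 (cid (corner x)).
have kapP x : J 𝟏 ∗ x ∗ J 𝟏 = J (kap x) by rewrite /kap; case: cid.
clearbody kap.
have lJ := star_hom_linear hJ; have JM := star_homM hJ.
have Jinj a b : J a = J b -> a = b.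
  by move=> h; apply/eqP; rewrite -subr_eq0; apply/eqP/J0; rewrite (linB lJ) h subrr.
have Jiso := inj_isometric hJ J0.
have J1l a : J 𝟏 ∗ J a = J a by rewrite -JM smul1x.
have J1r a : J a ∗ J 𝟏 = J a by rewrite -JM smulx1.
exists kap; last by move=> a; apply: Jinj; rewrite -kapP -!JM smul1x smulx1.
split=> [c x y|m x xi].
  by apply: Jinj; rewrite -kapP lJ -!kapP; nc.
set h := qform _ _; pose z := \sum_i x i ∗ J (xi i).
have Jh : J h = z^† ∗ z.
  rewrite star_sum smul_suml (lin_sum lJ); apply: eq_bigr => i _.
  rewrite smul_sumr (lin_sum lJ); apply: eq_bigr => j _.
  rewrite !JM -kapP starM -(star_hom_star hJ) !smulA J1r.
  by rewrite -!smulA J1l.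
have hs : h^† = h.
  by apply: Jinj; rewrite (star_hom_star hJ) Jh starM starK.
pose t := nr h + 1; have t0 : 0 < t by rewrite ltr_wpDl.
have [|k [ks -> _ _]] := ball_pos hs t0; last by exists k.
rewrite -Jiso; have -> : J (t%:C *: 𝟏 - h) = J 𝟏 ∗ (t%:C *: 𝟏 - J h) ∗ J 𝟏.
  by rewrite (linB lJ) (linZ lJ) smulBr smulBl smulZr smulx1 smulZl J1l J1l J1r.
apply: le_trans (nrM _ _) _; rewrite -[t]mulr1; apply: ler_pM => //; last by rewrite Jiso nr1.
rewrite -[X in _ <= X]mul1r; apply: nrM_le; first by rewrite Jiso nr1.
by rewrite mulr1; apply: pos_ball; [rewrite Jh; exact: posS|rewrite Jiso /t lerDl].
Qed.

(** A Stinespring dilation inside an algebra: [V i] is the operator from the copy of [A] to the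
    class of [1 (x) i]. The embedding [J] gives [A] a corner of [X], and [kap] returns from it. *)
Theorem dilation (R : realType) (O A : ucstarType R) (I : Type) (g : O -> I -> I -> A) :
  cp_matrix g ->
  exists (X : ucstarType R) (J : A -> X) (rho : O -> X) (V : I -> X) (kap : X -> A),
  [/\ is_star_hom J, is_star_hom rho, cpf kap /\ cancel J kap,
      forall i, rho 𝟏 ∗ V i = V i /\ V i ∗ J 𝟏 = V i
    & forall a i j, (V i)^† ∗ rho a ∗ V j = J (g a i j)].
Proof.
move=> hg; have [kap hk kJ] := corner_cp (dop_hom hg) (@dop_inj _ _ _ _ _ hg) (@dop_corner _ _ _ _ _ hg).
exists (dilalg hg), (fun a => dop hg None a None), (drho hg).
exists (fun i => dop hg (Some (𝟏, i)) 𝟏 None), kap; split.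
- exact: dop_hom.
- exact: drho_hom.
- by split.
- move=> i; split; first by rewrite drho_dop smul1x.
  by rewrite dopM !smulx1.
- by move=> a i j; rewrite dop_star -smulA drho_dop smulx1 dopM star1 smul1x smulx1 /= star1 smul1x.
Qed.

(** * Twisting a representation by the unitary of a self-adjoint contraction *)

Section FrameSums.
Context {R : realType} {P X : ucstarType R} {d : nat} (fr : fd_frame P d).
Local Notation fb := (fb fr).

(** [p = sum_s p b_s b_s^†], expanded by [fl_mul]. *)
Lemma fl_frame p i j : \sum_r \sum_s fl fr p r s * fl fr (fb r ∗ (fb s)^†) i j = fl fr p i j.
Proof.
have flL : linear (fun p => fl fr p i j : R[i]^o) by move=> c p' q; exact: fl_lin.
rewrite -[in RHS](smulx1 p) -(fb_one fr) smul_sumr (lin_sum flL) exchange_big.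
apply: eq_bigr => s _; rewrite smulA fl_mul smul_suml (lin_sum flL).
by apply: eq_bigr => r _; rewrite smulZl (linZ flL).
Qed.

(** The preceding identity in [P (x) X]: an element is the sum of the [b_r b_s^† (x) Y_rs] over its
    own entries. The twist produces exactly such a sum. *)
Lemma ptset_frame (Y : cmx X d) i j : ptset fr Y ->
  \sum_r \sum_s fl fr (fb r ∗ (fb s)^†) i j *: Y r s = Y i j.
Proof.
move=> hY; rewrite [in RHS]hY.
transitivity (\sum_r \sum_s \sum_k (fl fr (fb k) r s * fl fr (fb r ∗ (fb s)^†) i j) *: pcoord fr Y k).
  apply: eq_bigr => r _; apply: eq_bigr => s _; rewrite hY scaler_sumr.
  by apply: eq_bigr => k _; rewrite scalerA mulrC.
under eq_bigr do rewrite exchange_big.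
rewrite exchange_big; apply: eq_bigr => k _.
under eq_bigr do rewrite -scaler_suml.
by rewrite -scaler_suml fl_frame.
Qed.

Definition fcol (x : 'I_d -> X) : ptens fr X := \sum_i pte fr (fb i)^† (x i).
Definition fmat (G : 'I_d -> 'I_d -> X) : ptens fr X :=
  \sum_i \sum_j pte fr (fb i ∗ (fb j)^†) (G i j).

Lemma fcol_mul (x x' : 'I_d -> X) (y : X) :
  (fcol x)^† ∗ pte fr 𝟏 y ∗ fcol x' = fmat (fun i j => (x i)^† ∗ y ∗ x' j).
Proof.
rewrite star_sum !smul_suml; apply: eq_bigr => i _.
rewrite smul_sumr; apply: eq_bigr => j _.
by rewrite pte_star starK !pteM smulx1.
Qed.

Lemma fcol_one (x : 'I_d -> X) y : fcol x ∗ pte fr 𝟏 y = fcol (fun i => x i ∗ y).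
Proof. by rewrite smul_suml; apply: eq_bigr => i _; rewrite pteM smulx1. Qed.

Lemma one_fcol (x : 'I_d -> X) y : pte fr 𝟏 y ∗ fcol x = fcol (fun i => y ∗ x i).
Proof. by rewrite smul_sumr; apply: eq_bigr => i _; rewrite pteM smul1x. Qed.

Lemma fcol0 (x : 'I_d -> X) : (forall i, x i = 0) -> fcol x = 0.
Proof.
move=> x0; apply: big1 => i _; rewrite x0.
exact: (lin0 (@pte_linr _ _ _ fr X _)).
Qed.

Lemma fmat_eq (G G' : 'I_d -> 'I_d -> X) : (forall i j, G i j = G' i j) -> fmat G = fmat G'.
Proof. by move=> h; apply: eq_bigr => i _; apply: eq_bigr => j _; rewrite h. Qed.

Lemma fmatB (G G' : 'I_d -> 'I_d -> X) : fmat G - fmat G' = fmat (fun i j => G i j - G' i j).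
Proof.
rewrite /fmat -sumrB; apply: eq_bigr => i _; rewrite -sumrB; apply: eq_bigr => j _.
by rewrite (linB (@pte_linr _ _ _ fr X _)).
Qed.

Lemma fmat_sum n (G : 'I_n -> 'I_d -> 'I_d -> X) :
  fmat (fun i j => \sum_k G k i j) = \sum_k fmat (G k).
Proof.
rewrite [RHS]exchange_big; apply: eq_bigr => i _.
rewrite [RHS]exchange_big; apply: eq_bigr => j _.
by rewrite (lin_sum (@pte_linr _ _ _ fr X _)).
Qed.

Lemma fmat_diag y : fmat (fun i j => if i == j then y else 0) = pte fr 𝟏 y.
Proof.
have l0 := lin0 (@pte_linr _ _ _ fr X _).
rewrite -(fb_one fr) (lin_sum (@pte_linl _ _ _ fr X y)); apply: eq_bigr => i _.
rewrite (bigD1 i)//= eqxx big1 ?addr0// => j /negbTE ji.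
by rewrite eq_sym ji l0.
Qed.

Lemma fmatE (G : 'I_d -> 'I_d -> X) i j :
  sval_ (fmat G) i j = \sum_r \sum_s fl fr (fb r ∗ (fb s)^†) i j *: G r s.
Proof.
have ls := star_hom_linear (@sval_hom _ _ _ _ (pt_subalg fr X)).
rewrite (lin_sum ls) cmx_sumE; apply: eq_bigr => r _.
by rewrite (lin_sum ls) cmx_sumE; apply: eq_bigr => s _; exact: ptelemE.
Qed.

Lemma pte_one_unital_hom : unital_hom (pte fr 𝟏 : X -> ptens fr X).
Proof.
split; last exact: pte1.
split=> [|x y|x]; first exact: pte_linr.
  by rewrite pteM smul1x.
by rewrite pte_star star1.
Qed.

End FrameSums.

Section Twist.
Context {R : realType} {P O A X : ucstarType R} {d : nat} (fr : fd_frame P d).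
Variables (g : O -> cmx A d) (J : A -> X) (rho : O -> X) (V : 'I_d -> X) (w : X) (z : A).
Hypotheses (hJ : is_star_hom J) (hrho : is_star_hom rho).
Hypotheses (g1 : pos (𝟏 - g 𝟏)) (z1 : nr z <= 1).
Hypotheses (rV : forall i, rho 𝟏 ∗ V i = V i) (rw : rho 𝟏 ∗ w = w).
Hypotheses (VV : forall a i j, (V i)^† ∗ rho a ∗ V j = J (g a i j)).
Hypotheses (ww : w^† ∗ w = J z) (wV : forall i, w^† ∗ V i = 0).

Let lJ := star_hom_linear hJ.
Let JM := star_homM hJ.
Let JS := star_hom_star hJ.
Local Notation Y := (ptens fr X).
Let one (x : X) : Y := pte fr 𝟏 x.
Let oneL : linear one. Proof. exact: pte_linr. Qed.
Let oneM x y : one (x ∗ y) = one x ∗ one y.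
Proof. by rewrite /one pteM smul1x. Qed.
Let oneS x : one x^† = (one x)^†.
Proof. by rewrite /one pte_star star1. Qed.
Let one_le x : nr (one x) <= nr x.
Proof. exact: hom_contract (proj1 (pte_one_unital_hom fr)) x. Qed.

Let W : Y := one w.
Let C : Y := fcol fr V.
Let c : Y := C ∗ W^†.

(** [C^† C] is the matrix [J (g 1)] summed against the frame. Once the projection [1 - 1 (x) J 1] is
    split off, [1 - g 1 = k ∗ k] turns the rest into a sum of [c_r^† c_r], one column for each row
    of [k]. *)
Lemma twist_nrC : nr C <= 1.
Proof.
apply/nrP; rewrite ?ler01// expr1n rmorph1 scale1r.
have -> : C^† ∗ C = fmat fr (fun i j => J (g 𝟏 i j)).
  rewrite -[C^†]smulx1 -(pte1 fr X) fcol_mul; apply: fmat_eq => i j.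
  by rewrite smulx1 -VV -smulA rV.
have -> : 𝟏 - fmat fr (fun i j => J (g 𝟏 i j)) = (𝟏 - one (J 𝟏)) +
    fmat fr (fun i j => J ((𝟏 - g 𝟏) i j)).
  have -> : one (J 𝟏) = fmat fr (fun i j => J ((𝟏 : cmx A d) i j)).
    rewrite /one -fmat_diag; apply: fmat_eq => i j; rewrite cmx1E.
    by case: eqP => // _; rewrite (lin0 lJ).
  rewrite -[X in _ = _ + X](_ : fmat fr (fun i j => J ((𝟏 : cmx A d) i j)) -
    fmat fr (fun i j => J (g 𝟏 i j)) = _).
    by rewrite addrA subrK.
  by rewrite fmatB; apply: fmat_eq => i j; rewrite cmxDE cmxNE (linB lJ).
apply: posD.
  exists (𝟏 - one (J 𝟏)); first by rewrite saB ?star1// -oneS -JS star1.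
  by rewrite smulBl !smulBr !smul1x !smulx1 -oneM -JM smul1x; lmod.
have [k ks ->] := g1.
have -> : fmat fr (fun i j => J ((k ∗ k) i j)) =
    \sum_r (fcol fr (fun j => J (k r j)))^† ∗ fcol fr (fun j => J (k r j)).
  under [RHS]eq_bigr do rewrite -[(fcol _ _)^†]smulx1 -(pte1 fr X) fcol_mul.
  rewrite -fmat_sum; apply: fmat_eq => i j.
  rewrite cmxME (lin_sum lJ); apply: eq_bigr => r _.
  by rewrite smulx1 -JS -JM -cmxSE ks.
by apply: pos_sum => r _; exact: posS.
Qed.

Lemma twist_nrW : nr W <= 1.
Proof.
apply: le_trans (one_le w) _; rewrite -(@ler_pXn2r _ 2)// ?nnegrE// expr1n -nrS ww.
exact: le_trans (hom_contract hJ z) z1.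
Qed.

Lemma twist_nrc : nr c <= 1.
Proof. by rewrite -[1]mulr1; apply: nrM_le; rewrite ?nr_star ?twist_nrC ?twist_nrW. Qed.

Lemma twist_WC : W^† ∗ C = 0.
Proof. by rewrite -oneS one_fcol; apply: fcol0 => i; exact: wV. Qed.

Lemma twist_CW : C^† ∗ W = 0.
Proof. by rewrite -[W]starK -starM twist_WC star0. Qed.

Lemma twist_cc : c ∗ c = 0.
Proof. by rewrite /c smulA -(smulA C) twist_WC smulx0 smul0x. Qed.

Let k : Y := c + c^†.
Let k_sa : k^† = k. Proof. by rewrite starD starK addrC. Qed.

(** As [W^† C = 0], [c^2 = 0] and [k^2 = c c^† + c^† c]; so [1 - k^2] is the product of the
    commuting positive elements [1 - c^† c] and [1 - c c^†]. *)
Lemma twist_pos : pos (𝟏 - k ∗ k).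
Proof.
have ccS : c^† ∗ c^† = 0 by rewrite -starM twist_cc star0.
have p1 : pos (𝟏 - c^† ∗ c).
  by have := proj2 (nrP c ler01) twist_nrc; rewrite expr1n rmorph1 scale1r.
have p2 : pos (𝟏 - c ∗ c^†).
  have := proj2 (nrP c^† ler01); rewrite expr1n rmorph1 scale1r starK; apply.
  by rewrite nr_star twist_nrc.
have e1 : (𝟏 - c^† ∗ c) ∗ (𝟏 - c ∗ c^†) = 𝟏 - c^† ∗ c - c ∗ c^†.
  rewrite smulBl !smulBr smul1x smulx1 -[X in _ - (_ - X)]smulA.
  by rewrite (smulA c) twist_cc smul0x smulx0 smul1x; lmod.
have e2 : (𝟏 - c ∗ c^†) ∗ (𝟏 - c^† ∗ c) = 𝟏 - c^† ∗ c - c ∗ c^†.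
  rewrite smulBl !smulBr smul1x smulx1 -[X in _ - (_ - X)]smulA.
  by rewrite (smulA c^†) ccS smul0x smulx0 smul1x; lmod.
have -> : 𝟏 - k ∗ k = (𝟏 - c^† ∗ c) ∗ (𝟏 - c ∗ c^†).
  by rewrite e1 /k smulDl !smulDr twist_cc ccS; lmod.
by apply: pos_comm => //; rewrite e1 e2.
Qed.

Lemma twist_kW : k ∗ W = C ∗ one (J z).
Proof.
rewrite /k smulDl /c starM starK -!smulA twist_CW smulx0 addr0.
by rewrite -oneS -oneM ww.
Qed.

(** [k W = C (1 (x) J z)]: the squared length [z] of [w] enters once on each side. *)
Lemma twist_compress a : W^† ∗ k ∗ one (rho a) ∗ k ∗ W = fmat fr (fun i j => J (z^† ∗ g a i j ∗ z)).
Proof.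
have -> : W^† ∗ k = (k ∗ W)^† by rewrite starM k_sa.
rewrite -[X in X = _]smulA twist_kW fcol_one fcol_mul; apply: fmat_eq => i j.
by rewrite starM -JS -!smulA (smulA _ (rho a)) (smulA _ (V j)) VV -!JM smulA.
Qed.

Let E : Y := one (rho 𝟏).
Let E_sa : E^† = E. Proof. by rewrite -oneS -(star_hom_star hrho) star1. Qed.
Lemma twist_Ek : E ∗ k = k.
Proof.
have Ec : E ∗ c = c.
  by rewrite /c smulA one_fcol; congr (_ ∗ _); apply: eq_bigr => i _; rewrite rV.
have EW : E ∗ W = W by rewrite -oneM rw.
have cE : c ∗ E = c by rewrite /c -smulA -{1}E_sa -starM EW.
by rewrite /k smulDr Ec -{1}E_sa -starM cE.
Qed.

Lemma twist_unitary : exists s U : Y,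
  [/\ s^† = s, s ∗ s = 𝟏 - k ∗ k, U^† ∗ U = 𝟏,
      is_star_hom (fun a => U^† ∗ one (rho a) ∗ U) /\ U^† ∗ one (rho 𝟏) ∗ U = one (rho 𝟏)
    & forall y, U^† ∗ y ∗ U = k ∗ y ∗ k + 'i *: (k ∗ y ∗ s) - 'i *: (s ∗ y ∗ U)].
Proof.
have [s [ss sE _ sc]] := pos_sqrt twist_pos.
have kE : E ∗ k = k := twist_Ek.
have kS := k_sa.
clearbody k.
have kE' : k ∗ E = k by rewrite -{1}kS -{1}E_sa -starM kE kS.
have ks : k ∗ s = s ∗ k by apply: sc; nc.
have Es : E ∗ s = s ∗ E.
  by apply: sc; rewrite smulBr smulBl smulA kE -smulA kE' smulx1 smul1x.
have i2 : 'i * 'i = -1 :> R[i] by rewrite -expr2 sqrCi.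
have ci : ('i^* = - 'i :> R[i])%R by rewrite conjCi.
pose U := k + 'i *: s; have UE : U = k + 'i *: s by [].
have US : U^† = k - 'i *: s by rewrite UE starD starZ kS ss ci scaleNr.
clearbody U.
have U1 : U^† ∗ U = 𝟏.
  rewrite US UE smulBl !smulDr !smulZl !smulZr ks scalerA i2 -sE; lmod.
have U2 : U ∗ U^† = 𝟏.
  rewrite US UE smulDl !smulBr !smulZl !smulZr ks scalerA i2 -sE; lmod.
exists s, U; split=> //.
  split; first split=> [x a b|a b|a].
  - by rewrite (star_hom_linear hrho) oneL; nc.
  - rewrite (star_homM hrho) oneM -[RHS]smulA [U ∗ _]smulA [U ∗ _]smulA.
    by rewrite U2 smul1x !smulA.
  - by rewrite !starM starK -oneS -(star_hom_star hrho) smulA.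
  rewrite -/E -smulA (_ : E ∗ U = U ∗ E) ?smulA ?U1 ?smul1x//.
  by rewrite UE smulDl smulDr smulZr smulZl Es kE kE'.
move=> y; rewrite US smulBl smulBl smulZl smulZl {1}UE; nc.
Qed.

Lemma twist : exists k s U : Y,
  [/\ [/\ k^† = k, s^† = s, s ∗ s = 𝟏 - k ∗ k, U^† ∗ U = 𝟏 & pte fr 𝟏 (rho 𝟏) ∗ k = k],
      is_star_hom (fun a => U^† ∗ pte fr 𝟏 (rho a) ∗ U),
      U^† ∗ pte fr 𝟏 (rho 𝟏) ∗ U = pte fr 𝟏 (rho 𝟏),
      forall y, U^† ∗ y ∗ U = k ∗ y ∗ k + 'i *: (k ∗ y ∗ s) - 'i *: (s ∗ y ∗ U)
    & forall a, (pte fr 𝟏 w)^† ∗ (k ∗ pte fr 𝟏 (rho a) ∗ k) ∗ pte fr 𝟏 w =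
        fmat fr (fun i j => J (z^† ∗ g a i j ∗ z))].
Proof.
have [s [U [ss sE U1 [hPsi UE] dec]]] := twist_unitary.
exists k, s, U; split=> //; first by split=> //; exact: twist_Ek.
by move=> a; rewrite !smulA; exact: twist_compress.
Qed.

End Twist.

(** * Lifting one completely positive map up to a controlled error *)

Section MatrixHelpers.
Context {R : realType} {A : ucstarType R} {n : nat}.

Lemma pos_diag (X : cmx A n) i : pos X -> pos (X i i).
Proof.
move=> [k ks ->]; rewrite cmxME; apply: pos_sum => r _.
by rewrite -{1}ks cmxSE; exact: posS.
Qed.

Definition dmx (a : A) : cmx A n := \matrix_(i, j) (if i == j then a else 0).

Lemma dmxM a b : dmx a ∗ dmx b = dmx (a ∗ b).
Proof.
apply/matrixP => i j; rewrite cmxME !mxE (bigD1 i)//= big1 ?addr0 => [|k /negbTE ki].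
  by rewrite !mxE eqxx; case: eqP => // _; rewrite smulx0.
by rewrite mxE eq_sym ki smul0x.
Qed.

Lemma pos_dmx a : pos a -> pos (dmx a).
Proof.
move=> [k ks ->]; exists (dmx k); last by rewrite dmxM.
by apply/matrixP => i j; rewrite cmxSE !mxE eq_sym; case: eqP => _; rewrite ?ks ?star0.
Qed.

Lemma dmx1 : dmx 𝟏 = 𝟏.
Proof. by apply/matrixP => i j; rewrite [LHS]mxE cmx1E. Qed.

End MatrixHelpers.

Section Column0.
Context {R : realType} {A : ucstarType R} {n : nat}.
Implicit Types (X : cmx A n.+1) (a b : A).

(** The vector [e_i a], stored in column [ord0] of a square matrix so that vectors and operators
    live in the same algebra. *)
Definition ecol i a : cmx A n.+1 := \matrix_(k, l) (if (k == i) && (l == ord0) then a else 0).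

Lemma ecol_form i j a b X k l : ((ecol i a)^† ∗ X ∗ ecol j b) k l =
  if (k == ord0) && (l == ord0) then a^† ∗ X i j ∗ b else 0.
Proof.
rewrite cmxME (bigD1 j)//= big1 ?addr0 => [|m /negbTE mj]; last by rewrite !mxE mj smulx0.
rewrite cmxME (bigD1 i)//= big1 ?addr0 => [|m /negbTE mi]; last first.
  by rewrite cmxSE !mxE mi star0 smul0x.
rewrite cmxSE !mxE !eqxx /=.
by case: (k == ord0); case: (l == ord0); rewrite ?star0 ?smul0x ?smulx0.
Qed.

Lemma nr_corner0 X : (forall k l, (k == ord0) && (l == ord0) = false -> X k l = 0) ->
  nr X = nr (X ord0 ord0).
Proof.
move=> hX; apply/eqP; rewrite eq_le cmx_coord andbT; apply: le_trans (cmx_le X) _.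
rewrite big_ord_recl big_ord_recl [X in _ + X + _]big1 => [|i _]; last by rewrite hX ?nr0.
rewrite [X in _ + X]big1 ?addr0// => i _; rewrite big1// => j _.
by rewrite hX ?nr0.
Qed.

Lemma nr_ecol_form i j a b X : nr ((ecol i a)^† ∗ X ∗ ecol j b) = nr (a^† ∗ X i j ∗ b).
Proof.
by rewrite nr_corner0 => [|k l h]; rewrite ecol_form ?h.
Qed.

Lemma nr_ecol i a : nr (ecol i a) <= nr a.
Proof.
apply: le_trans (cmx_le _) _.
rewrite (bigD1 i)//= [X in _ + X]big1 => [|k /negbTE ki]; last first.
  by rewrite big1// => l _; rewrite mxE ki nr0.
rewrite (bigD1 ord0)//= big1 => [|l /negbTE l0]; last by rewrite mxE l0 andbF nr0.
by rewrite mxE !eqxx !addr0.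
Qed.

End Column0.

Section CpSeq.
Context {R : realType} {O A : ucstarType R} {n : nat} {g : O -> cmx A n.+1} (hg : cpf g).

Lemma cpf_seq (r : seq (O * cmx A n.+1)) :
  pos (\sum_(s <- r) \sum_(t <- r) s.2^† ∗ g (s.1^† ∗ t.1) ∗ t.2).
Proof.
have := (proj2 hg) (size r) (fun i => (tnth (in_tuple r) i).1) (fun i => (tnth (in_tuple r) i).2).
rewrite /qform; congr pos; rewrite [RHS]big_tnth; apply: eq_bigr => i _.
by rewrite [RHS]big_tnth.
Qed.

(** The index [None] adds an orthogonal copy of the vector with index [0]. *)
Definition double0 (a : O) (i j : option 'I_n.+1) : A :=
  match i, j with
  | Some i, Some j => g a i j
  | None, None => g a ord0 ord0
  | _, _ => 0
  end.

Lemma cp_matrix_double0 : cp_matrix double0.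
Proof.
have gl := proj1 hg; split.
- move=> [i|] [j|] c a b //=; rewrite ?scaler0 ?addr0//; by rewrite gl cmxDE cmxZE.
- by move=> a [i|] [j|] /=; rewrite ?star0// -cmxSE -(cpf_star hg).
move=> r.
(* The terms with index [Some] and those with index [None] give two separate forms of [g], each
   positive. *)
pose x1 (s : O * option 'I_n.+1 * A) : cmx A n.+1 := if s.1.2 is Some i then ecol i s.2 else 0.
pose x2 (s : O * option 'I_n.+1 * A) : cmx A n.+1 := if s.1.2 is Some i then 0 else ecol ord0 s.2.
have e0 (y : cmx A n.+1) : (y ∗ 0) ord0 ord0 = 0 by rewrite smulx0 cmx0E.
have e0' (y z : cmx A n.+1) : (0^† ∗ y ∗ z) ord0 ord0 = 0 by rewrite star0 !smul0x cmx0E.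
have termE s t : s.2^† ∗ double0 (s.1.1^† ∗ t.1.1) s.1.2 t.1.2 ∗ t.2 =
    ((x1 s)^† ∗ g (s.1.1^† ∗ t.1.1) ∗ x1 t) ord0 ord0 +
    ((x2 s)^† ∗ g (s.1.1^† ∗ t.1.1) ∗ x2 t) ord0 ord0.
  rewrite /x1 /x2; case: s t => [[a [i|]] s] [[b [j|]] t] /=;
  by rewrite ?e0 ?e0' ?addr0 ?add0r ?ecol_form ?eqxx ?smulx0 ?smul0x.
under eq_bigr do (under eq_bigr do rewrite termE).
under eq_bigr do rewrite big_split.
rewrite big_split; apply: posD.
  under eq_bigr do rewrite -cmx_sumE.
  rewrite -cmx_sumE; apply: pos_diag.
  by have := cpf_seq [seq (s.1.1, x1 s) | s <- r]; rewrite big_map;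
     under eq_bigr do rewrite big_map.
under eq_bigr do rewrite -cmx_sumE.
rewrite -cmx_sumE; apply: pos_diag.
by have := cpf_seq [seq (s.1.1, x2 s) | s <- r]; rewrite big_map;
   under eq_bigr do rewrite big_map.
Qed.

End CpSeq.

Section CompressedMap.
Context {R : realType} {P A C X : ucstarType R} {d : nat} (fr : fd_frame P d.+1).
Variables (f : X -> C) (w : X).
Hypothesis hf : cpf f.
Hypothesis fw : pos (𝟏 - f (w^† ∗ w)).
Let lf := proj1 hf.
Local Notation Y := (ptens fr X).

Definition compress (y : Y) : cmx C d.+1 := ampl f (sval_ ((pte fr 𝟏 w)^† ∗ y ∗ pte fr 𝟏 w)).

Lemma cpf_compress : cpf compress.
Proof.
have h1 : cpf (fun y : Y => (pte fr 𝟏 w)^† ∗ y ∗ pte fr 𝟏 w).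
  by apply: (cpf_conj (f := id)); apply: cpf_hom; split.
exact: cpf_comp h1 (cpf_comp (cpf_hom (@sval_hom _ _ _ _ (pt_subalg fr X))) (cpf_ampl d.+1 hf)).
Qed.

Lemma compressE y i j : compress y i j = f (w^† ∗ sval_ y i j ∗ w).
Proof.
rewrite amplE; congr f.
rewrite -[sval_ _]/((ptelem fr 𝟏 w)^† ∗ sval_ y ∗ ptelem fr 𝟏 w) ptelem_star star1.
rewrite cmxME (bigD1 j)//= big1 ?addr0 => [|k /negbTE kj]; last first.
  by rewrite ptelemE fl1 kj scale0r smulx0.
rewrite cmxME (bigD1 i)//= big1 ?addr0 => [|k /negbTE ki]; last first.
  by rewrite ptelemE fl1 eq_sym ki scale0r smul0x.
by rewrite !ptelemE !fl1 !eqxx !scale1r.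
Qed.

Lemma compress1 : compress 𝟏 = dmx (f (w^† ∗ w)).
Proof.
apply/matrixP => i j; rewrite compressE sval1 cmx1E mxE.
by case: eqP => _; rewrite ?smulx1// smulx0 smul0x (lin0 lf).
Qed.

Lemma compress_le y : nr (compress y) <= nr y.
Proof.
apply: (cpf_contractive cpf_compress); rewrite compress1 -dmx1.
have -> : dmx 𝟏 - dmx (f (w^† ∗ w)) = dmx (𝟏 - f (w^† ∗ w)) :> cmx C d.+1.
  by apply/matrixP => i j; rewrite cmxDE cmxNE !mxE; case: eqP => // _; rewrite subr0.
exact: pos_dmx.
Qed.

Lemma compress_cs (x y : Y) i j (xi eta : C) :
  nr (eta^† ∗ compress (y^† ∗ x) i j ∗ xi) ^+ 2 <=
  nr (eta^† ∗ compress (y^† ∗ y) i i ∗ eta) * nr (xi^† ∗ compress (x^† ∗ x) j j ∗ xi).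
Proof.
have := @cpf_cauchy_schwarz R _ _ compress x 0 y (ecol j xi) 0 (ecol i eta) cpf_compress.
by rewrite !smulx0 star0 !smul0x !addr0 smulA !nr_ecol_form.
Qed.

Lemma compress_form_le y i (xi : C) (r : R) : nr y <= r ->
  nr (xi^† ∗ compress y i i ∗ xi) <= r * nr xi ^+ 2.
Proof.
move=> yr; rewrite mulrC expr2 -mulrA [nr xi * r]mulrC mulrA.
apply: nrM_le => //; apply: nrM_le; first by rewrite nr_star.
apply: le_trans (cmx_coord _ _ _) _; exact: le_trans (compress_le y) yr.
Qed.

(** An outer factor [y] costs the square root of the form at [y^† ∗ y]; this is used with [y] the
    [s] of the twist. *)
Lemma compress_cs_le (x y : Y) i j (xi eta : C) (r : R) : 0 <= r -> nr x <= r ->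
  nr (eta^† ∗ compress (y^† ∗ x) i j ∗ xi) <=
    r * (Num.sqrt (nr (eta^† ∗ compress (y^† ∗ y) i i ∗ eta)) * nr xi).
Proof.
move=> r0 xr; rewrite -(@ler_pXn2r _ 2)// ?nnegrE ?mulr_ge0 ?sqrtr_ge0//.
apply: le_trans (compress_cs _ _ _ _ _ _) _.
rewrite !exprMn sqr_sqrtr// mulrCA ler_wpM2l//; apply: compress_form_le.
by rewrite nrS ler_pXn2r// nnegrE.
Qed.

End CompressedMap.
Arguments compress {R P C X d} fr f w y.

Section OneStep.
Context {R : realType} {P O M T : ucstarType R} {t : P -> M -> T} {Phi : O -> T}.
Context {d : nat} (fr : fd_frame P d.+1) (U : is_quantum_maps t Phi).
Hypothesis O_lifting : lifting_property O.
Context {A C : ucstarType R} {q : A -> C} (hq : is_star_hom q) (q1 : q 𝟏 = 𝟏).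
Hypothesis q_surj : forall c, exists a, q a = c.
Context {Th : M -> C} (hTh : cpf Th) (Th1 : pos (𝟏 - Th 𝟏)).
Local Notation qc := (qcoef fr U).
Let lTh := proj1 hTh.
Let lq := star_hom_linear hq.

Lemma qcoef1 i j : qc 𝟏 i j = if i == j then 𝟏 else 0.
Proof. by rewrite /qcoef (proj2 (qphi_unital_hom fr U)) sval1 cmx1E. Qed.

(** The lifting property of [O] is applied to the map from [a] to the matrix of the [Th (Phi_ij a)].
    It is completely positive because the model of [P (x) M] sits in the matrices over [M], where
    [Th] is amplified. *)
Lemma lift_coefs : exists g : O -> cmx A d.+1,
  [/\ cpf g, pos (𝟏 - g 𝟏) & forall a i j, q (g a i j) = Th (qc a i j)].
Proof.
pose psi : O -> cmx C d.+1 := @ampl _ _ _ Th d.+1 \o (@sval_ _ _ _ _ _ \o qphi fr U).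
have hpsi : cpf psi.
  apply: cpf_comp (cpf_ampl d.+1 hTh).
  exact: cpf_comp (cpf_hom (proj1 (qphi_unital_hom fr U))) (cpf_hom sval_hom).
have psiE a i j : psi a i j = Th (qc a i j) by rewrite amplE.
have psi1 : pos (𝟏 - psi 𝟏).
  suff -> : 𝟏 - psi 𝟏 = dmx (𝟏 - Th 𝟏) by exact: pos_dmx.
  apply/matrixP => i j; rewrite cmxDE cmxNE psiE qcoef1 cmx1E mxE.
  by case: eqP => // _; rewrite (lin0 lTh) subr0.
have hQ := ampl_hom d.+1 hq.
have Q1 : ampl q (𝟏 : cmx A d.+1) = 𝟏.
  by apply/matrixP => i j; rewrite amplE !cmx1E; case: eqP; rewrite ?q1 ?(lin0 lq).
have Qs (c : cmx C d.+1) : exists b : cmx A d.+1, ampl q b = c.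
  have [s sE] := choice q_surj.
  by exists (map_mx s c); apply/matrixP => i j; rewrite amplE mxE sE.
have psic : contractive psi.
  by move=> x; rewrite !nrE lecR; exact: cpf_contractive.
have [g [gcp gc gE]] := O_lifting (ker_closed_ideal hQ) (surj_quotient hQ Q1 Qs)
  (cpf_cp hpsi) psic.
exists g; split; [exact: cp_cpf|by apply: contractive_one => //; exact: cp_cpf|].
by move=> a i j; rewrite -psiE -gE amplE.
Qed.

(** The length of [s W xi] in the form of the compression: [s^2 = 1 - k^2], and compression by [w]
    sends 1 to [Th 1] and [k^2] to its cube. *)
Definition defect (xi : C) : R :=
  Num.sqrt (nr (xi^† ∗ (Th 𝟏 - Th 𝟏 ∗ Th 𝟏 ∗ Th 𝟏) ∗ xi)).

(** [D m] is the compression to [w] of the homomorphism given by the twisted representation. Its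
    value at 1 is exact; of the three terms of the twist, the leading one is the desired product and
    the other two are bounded by Cauchy-Schwarz. *)
Lemma one_step_lift : exists D : M -> A,
  [/\ cpf D, pos (𝟏 - D 𝟏), q (D 𝟏) = Th 𝟏
    & forall a i j (xi eta : C),
      nr (eta^† ∗ (q (D (qc a i j)) - Th 𝟏 ∗ Th (qc a i j) ∗ Th 𝟏) ∗ xi)
        <= nr a * (nr eta * defect xi + defect eta * nr xi)].
Proof.
have [g [hg g1 gE]] := lift_coefs.
have [X [J [rho [V [kap [hJ hrho [hkap kapJ] VE VV]]]]]] := dilation (cp_matrix_double0 hg).
(* [w] duplicates [V (Some ord0)] orthogonally to all [V (Some i)]; [z] is its squared length. *)
pose w := V None; pose z := g 𝟏 ord0 ord0.
have qz : q z = Th 𝟏 by rewrite gE qcoef1 eqxx.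
have z1 : nr z <= 1.
  apply: le_trans (cmx_coord _ _ _) _.
  by apply: le_trans (cpf_contractive hg g1 _) _; exact: nr1.
have zp : pos (𝟏 - z).
  by have := pos_diag ord0 g1; rewrite cmxDE cmxNE cmx1E eqxx.
have rw : rho 𝟏 ∗ w = w by have [] := VE None.
have ww : w^† ∗ w = J z by rewrite -{2}rw smulA VV.
have wV i : w^† ∗ V (Some i) = 0.
  by rewrite -(proj1 (VE (Some i))) smulA VV /= (lin0 (star_hom_linear hJ)).
have [k [s [u [[ks ss sE uu Ek] hPsi uE dec cmp]]]] := twist fr hJ hrho g1 z1
  (fun i => proj1 (VE (Some i))) rw (fun a i j => VV a (Some i) (Some j)) ww wV.
have rr : rho 𝟏 ∗ rho 𝟏 = rho 𝟏 by rewrite -(star_homM hrho) smul1x.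
have rs : (rho 𝟏)^† = rho 𝟏 by rewrite -(star_hom_star hrho) star1.
have [l [hl l1 lE]] := quantum_maps_corner U rs rr hPsi uE.
pose D m := kap (w^† ∗ l m ∗ w).
have hD : cpf D by exact: cpf_comp (cpf_conj w (cpf_hom hl)) hkap.
have D1 : D 𝟏 = z by rewrite /D l1 -smulA rw ww kapJ.
have hf : cpf (q \o kap) := cpf_comp hkap (cpf_hom hq).
have lf := proj1 hf.
have fww : (q \o kap) (w^† ∗ w) = Th 𝟏 by rewrite /= ww kapJ qz.
have fw : pos (𝟏 - (q \o kap) (w^† ∗ w)) by rewrite fww.
pose mu := compress fr (q \o kap) w.
have lmu : linear mu := proj1 (cpf_compress fr w hf).
have thS : (Th 𝟏)^† = Th 𝟏 by rewrite -(cpf_star hTh) star1.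
(* The sum over the frame recombines into the coefficient itself, by [ptset_frame]. *)
have E1 a i j : mu (k ∗ pte fr 𝟏 (rho a) ∗ k) i j = Th 𝟏 ∗ Th (qc a i j) ∗ Th 𝟏.
  rewrite amplE cmp fmatE (lin_sum lf).
  rewrite /qcoef -(ptset_frame i j (sval_in (qphi fr U a))) (lin_sum lTh) smul_sumr smul_suml.
  apply: eq_bigr => r _; rewrite (lin_sum lf) (lin_sum lTh) smul_sumr smul_suml.
  apply: eq_bigr => m _; rewrite (linZ lf) (linZ lTh) smulZr smulZl; congr (_ *: _).
  by rewrite /= kapJ !(star_homM hq) (star_hom_star hq) qz thS gE.
have E2 i : mu (s ∗ s) i i = Th 𝟏 - Th 𝟏 ∗ Th 𝟏 ∗ Th 𝟏.
  rewrite sE (linB lmu) cmxDE cmxNE [mu 𝟏](compress1 fr w hf) mxE eqxx fww.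
  by rewrite -{2}Ek smulA E1 qcoef1 eqxx.
have k1 : nr k <= 1.
  by apply/nrP; rewrite ?ler01// expr1n rmorph1 scale1r ks -sE -{1}ss; exact: posS.
have u1 := unitary_le uu.
have ra a : nr (pte fr 𝟏 (rho a)) <= nr a.
  apply: le_trans (hom_contract (proj1 (pte_one_unital_hom fr)) _) _.
  exact: hom_contract.
have muS y : mu y^† = (mu y)^† := cpf_star (cpf_compress fr w hf) y.
exists D; split=> //; rewrite ?D1// => a i j xi eta.
have err y r (x1 x2 : C) i' j' : 0 <= r -> nr y <= r ->
    nr (x2^† ∗ mu (s ∗ y) i' j' ∗ x1) <= r * (defect x2 * nr x1).
  move=> r0 yr; have := compress_cs_le hf fw s i' j' x1 x2 r0 yr.
  by rewrite ss -/mu E2.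
have e1 : nr (eta^† ∗ mu (k ∗ pte fr 𝟏 (rho a) ∗ s) i j ∗ xi) <= nr a * (defect xi * nr eta).
  rewrite -nr_star !starM starK -cmxSE -muS !starM ss ks smulA.
  rewrite -(star_hom_star (proj1 (pte_one_unital_hom fr))).
  apply: err => //; rewrite -[nr a]mulr1; apply: nrM_le => //.
  by rewrite (star_hom_star (proj1 (pte_one_unital_hom fr))) nr_star.
have e2 : nr (eta^† ∗ mu (s ∗ pte fr 𝟏 (rho a) ∗ u) i j ∗ xi) <= nr a * (defect eta * nr xi).
  by rewrite -[s ∗ _ ∗ _]smulA; apply: err => //; rewrite -[nr a]mulr1; apply: nrM_le.
have -> : q (D (qc a i j)) = mu (u^† ∗ pte fr 𝟏 (rho a) ∗ u) i j.
  by rewrite [RHS]compressE lE.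
rewrite dec (linB lmu) (linD lmu) !(linZ lmu) !cmxDE cmxNE !cmxZE E1.
set X1 := mu _ i j; set X2 := mu _ i j; set X0 := Th 𝟏 ∗ _ ∗ _.
have -> : eta^† ∗ (X0 + 'i *: X1 - 'i *: X2 - X0) ∗ xi =
  'i *: (eta^† ∗ X1 ∗ xi) - 'i *: (eta^† ∗ X2 ∗ xi) by nc.
apply: le_trans (nrB _ _) _; rewrite !nrZ nr_i !mul1r mulrDr lerD//.
by rewrite [nr eta * _]mulrC.
Qed.

End OneStep.

Section DiagonalEntry.
Context {R : realType} {A : ucstarType R} {n : nat}.

Lemma cpf_diag (i : 'I_n) : cpf (fun X : cmx A n => X i i).
Proof.
split=> [c X Y|m x xi]; first by rewrite cmxDE cmxZE.
rewrite /qform.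
suff -> : \sum_k \sum_l (xi k)^† ∗ ((x k)^† ∗ x l) i i ∗ xi l =
    \sum_r (\sum_k x k r i ∗ xi k)^† ∗ (\sum_k x k r i ∗ xi k).
  by apply: pos_sum => r _; exact: posS.
under [RHS]eq_bigr do rewrite star_sum smul_suml.
rewrite [RHS]exchange_big; apply: eq_bigr => k _.
under [RHS]eq_bigr do rewrite smul_sumr.
rewrite [RHS]exchange_big; apply: eq_bigr => l _.
rewrite cmxME smul_sumr smul_suml; apply: eq_bigr => r _.
by rewrite cmxSE starM !smulA.
Qed.

Lemma dmx_hom : is_star_hom (@dmx R A n).
Proof.
split=> [c a b|a b|a]; last first.
- by apply/matrixP => i j; rewrite cmxSE !mxE eq_sym; case: eqP => _; rewrite ?star0.
- by rewrite dmxM.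
- by apply/matrixP => i j; rewrite cmxDE cmxZE !mxE; case: eqP => _; rewrite ?scaler0 ?addr0.
Qed.

End DiagonalEntry.

(** * Gram matrices of words and the choice of constants *)

Section GramMap.
Context {R : realType} {M C : ucstarType R} {phi : M -> C} (hphi : cpf phi).
Context {n : nat} (y : 'I_n.+1 -> M).

Definition gram (m : M) : cmx C n.+1 := \matrix_(r, s) phi ((y r)^† ∗ m ∗ y s).

Lemma gramE m r s : gram m r s = phi ((y r)^† ∗ m ∗ y s).
Proof. exact: mxE. Qed.

Lemma cpf_gram : cpf gram.
Proof.
pose Y : cmx M n.+1 := \matrix_(k, l) (if k == ord0 then y l else 0).
have hY : cpf (fun m => ampl phi (Y^† ∗ dmx m ∗ Y)).
  exact: cpf_comp (cpf_conj Y (cpf_hom dmx_hom)) (cpf_ampl n.+1 hphi).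
suff -> : gram = (fun m => ampl phi (Y^† ∗ dmx m ∗ Y)) by [].
apply/funext => m; apply/matrixP => r s; rewrite gramE amplE; congr phi.
rewrite cmxME (bigD1 ord0)//= big1 ?addr0 => [|k /negbTE k0]; last by rewrite !mxE k0 smulx0.
rewrite cmxME (bigD1 ord0)//= big1 ?addr0 => [|k /negbTE k0]; last first.
  by rewrite cmxSE !mxE k0 star0 smul0x.
by rewrite cmxSE !mxE eqxx.
Qed.

End GramMap.
Arguments gram {R M C} phi {n} y m.

Lemma cpfZ (R : realType) (A D : ucstarType R) (f : A -> D) (r : R) : 0 <= r -> cpf f ->
  cpf (fun x => r%:C *: f x).
Proof.
move=> r0 /(cpf_conj ((Num.sqrt r)%:C *: 𝟏)); congr cpf; apply/funext => x.
by rewrite starR star1 !(smulZl, smulZr) smul1x smulx1 scalerA -rmorphM -expr2 sqr_sqrtr.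
Qed.

(** From [z - T z T = (1 - T) z T + z (1 - T)]. *)
Lemma compression_split (R : realType) (A : ucstarType R) (x y E z T : A) : T^† = T ->
  x^† ∗ (E - z) ∗ y = x^† ∗ (E - T ∗ z ∗ T) ∗ y -
    ((𝟏 - T) ∗ x)^† ∗ (z ∗ (T ∗ y)) - x^† ∗ (z ∗ ((𝟏 - T) ∗ y)).
Proof. by move=> Ts; rewrite starM starB star1 Ts; nc. Qed.

(** [6 tau] comes from the one-step error and [3/2 tau^2] from each of the two corrections. *)
Fact gram_error (R : realType) (tau x : R) : tau ^+ 2 <= tau ->
  x <= 1 * (3 / 2 * (2 * tau) + 2 * tau * (3 / 2)) ->
  x + tau ^+ 2 * (1 * (1 * (3 / 2))) + 3 / 2 * (1 * tau ^+ 2) <= 9 * tau.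
Proof. by move: (tau ^+ 2) => s; lra. Qed.

Section Approximant.
Context {R : realType} {P O M T : ucstarType R} {t : P -> M -> T} {Phi : O -> T}.
Context {d : nat} (fr : fd_frame P d.+1) (U : is_quantum_maps t Phi).
Hypothesis O_lifting : lifting_property O.
Context {A C : ucstarType R} {q : A -> C} (hq : is_star_hom q) (q1 : q 𝟏 = 𝟏).
Hypothesis q_surj : forall c, exists a, q a = c.
Context {phi : M -> C} (hphi : cpf phi) (phi1 : pos (𝟏 - phi 𝟏)).
Context {n : nat} {y : 'I_n.+1 -> M} (y1 : forall s, nr (y s) <= 1).
Context {tau : R} (tau0 : 0 < tau) (tau1 : tau <= 1).
Local Notation qc := (qcoef fr U).

(** [S = h^(-1/2)] and [Q = h^(1/2)] for [h = del + G 1]. The one-step lift applies to [Th = S G S],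
    and conjugation by [Q] undoes the normalization, so [F 1 = G 1] holds exactly. [f] is the corner
    entry of [D] conjugated by a lift of [Q e_0], rescaled to a contraction. *)
Lemma gram_lift : exists (F : M -> cmx C n.+1) (f : M -> A),
  [/\ cpf F, F 𝟏 = gram phi y 𝟏,
      forall a i j r s, nr a <= 1 ->
        nr (F (qc a i j) r s - phi ((y r)^† ∗ qc a i j ∗ y s)) <= 9 * tau,
      cpf f /\ pos (𝟏 - f 𝟏)
    & forall m, q (f m) = ((1 + tau ^+ 4)^-1)%:C *: F m ord0 ord0].
Proof.
(* A fourth power: [(1 - Th 1) e_s = del S ecol_s], with [nr S <= del^(-1/2)], has norm at most
   [tau^2], and the defect, which takes a square root, is of order [tau]. *)
pose del := tau ^+ 4; have delE : del = tau ^+ 4 by []. 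
have del0 : 0 < del by rewrite /del exprn_gt0.
have del1 : del <= 1 by rewrite /del exprn_ile1// ltW.
clearbody del.
have hG := cpf_gram hphi y; set G := gram phi y in hG *.
have Gp : pos (G 𝟏) := cpf_pos hG pos1.
pose h := del%:C *: 𝟏 + G 𝟏.
have hE : h = del%:C *: 𝟏 + G 𝟏 by [].
have hs : h^† = h by rewrite saD ?saZ ?star1// pos_sa.
have [|S [Sp ShS nrS_ Sc]] := inv_sqrt hs del0; first by rewrite hE addrAC subrr add0r.
clearbody h.
have Ss := pos_sa Sp.
have hS : h ∗ S = S ∗ h by exact: Sc.
pose Q := S ∗ h; have QE : Q = S ∗ h by [].
have Qs : Q^† = Q by rewrite starM Ss hs hS.
clearbody Q.
have QS : Q ∗ S = 𝟏 by rewrite QE.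
have SQ : S ∗ Q = 𝟏 by rewrite -Ss -Qs -starM QS star1.
have QQ : Q ∗ Q = h by rewrite {2}QE smulA QS smul1x.
pose Th m := S^† ∗ G m ∗ S.
have hTh : cpf Th := cpf_conj S hG.
have QThQ m : Q ∗ Th m ∗ Q = G m.
  by rewrite /Th Ss -!smulA SQ smulx1 !smulA QS smul1x.
have Th_1 : 𝟏 - Th 𝟏 = del%:C *: (S ∗ S).
  by rewrite -ShS hE /Th Ss; nc.
have Th1 : pos (𝟏 - Th 𝟏).
  by rewrite Th_1; apply: posZ; [exact: ltW|exists S].
have hq' := ampl_hom n.+1 hq.
have q1' : ampl q (𝟏 : cmx A n.+1) = 𝟏.
  apply/matrixP => i j; rewrite amplE !cmx1E; case: eqP => //.
  by rewrite (lin0 (star_hom_linear hq)).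
have qs' (c : cmx C n.+1) : exists b : cmx A n.+1, ampl q b = c.
  have [s sE] := choice q_surj.
  by exists (map_mx s c); apply/matrixP => i j; rewrite amplE mxE sE.
have [D [hD D1 qD1 err]] := one_step_lift fr U O_lifting hq' q1' qs' hTh Th1.
(* [nr (e s) ^+ 2] is the norm of a diagonal entry of [h], at most [1 + del], whence the bound
   [3 / 2]. *)
pose e s : cmx C n.+1 := Q ∗ ecol s 𝟏.
have eform X r s : (e r)^† ∗ X ∗ e s = (ecol r 𝟏)^† ∗ (Q ∗ X ∗ Q) ∗ ecol s 𝟏.
  by rewrite /e starM Qs !smulA.
have form X r s : nr ((e r)^† ∗ X ∗ e s) = nr ((Q ∗ X ∗ Q) r s).
  by rewrite eform nr_ecol_form star1 smul1x smulx1.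
have nre s : nr (e s) ^+ 2 <= 1 + del.
  rewrite -nrS -[(e s)^†]smulx1 form smulx1 QQ hE cmxDE cmxZE cmx1E eqxx gramE smulx1.
  apply: le_trans (nrD _ _) _; rewrite addrC lerD//.
    apply: le_trans (cpf_contractive hphi phi1 _) _.
    by rewrite nrS expr_le1.
  by rewrite nrZR gtr0_norm//; have := @nr1 R C; have := nr_ge0 (𝟏 : C); nra.
have nre' s : nr (e s) <= 3 / 2.
  by have := nre s; have := nr_ge0 (e s); nra.
have small s : nr ((𝟏 - Th 𝟏) ∗ e s) <= tau ^+ 2.
  rewrite Th_1 /e smulZl -smulA (smulA S Q) SQ smul1x nrZR gtr0_norm//.
  have del2 : del = (tau ^+ 2) ^+ 2 by rewrite delE -exprM.
  have t2 : 0 < tau ^+ 2 by rewrite exprn_gt0.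
  have nrS : nr S <= (tau ^+ 2)^-1.
    by apply: le_trans nrS_ _; rewrite del2 -exprVn sqrtr_sqr ger0_norm// invr_ge0 ltW.
  have nrSe : nr (S ∗ ecol s (𝟏 : C)) <= (tau ^+ 2)^-1.
    rewrite -[X in _ <= X]mulr1; apply: nrM_le => //.
    by apply: le_trans (nr_ecol _ _) _; exact: nr1.
  apply: le_trans (_ : del * (tau ^+ 2)^-1 <= _); first by rewrite ler_pM2l.
  by rewrite del2 expr2 mulfK// gt_eqF.
clearbody e Th.
have Th1s : (Th 𝟏)^† = Th 𝟏 by rewrite -(cpf_star hTh) star1.
have nrTh x : nr (Th x) <= nr x := cpf_contractive hTh Th1 x.
have nrT : nr (Th 𝟏) <= 1 by apply: le_trans (nrTh _) _; exact: nr1.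
have dfc s : defect (Th := Th) (e s) <= 2 * tau.
  have tt : 0 <= 2 * tau by rewrite mulr_ge0// ltW.
  rewrite -(@ler_pXn2r _ 2)// ?nnegrE ?sqrtr_ge0// sqr_sqrtr//.
  have -> : (e s)^† ∗ (Th 𝟏 - Th 𝟏 ∗ Th 𝟏 ∗ Th 𝟏) ∗ e s =
      (e s)^† ∗ ((Th 𝟏 + Th 𝟏 ∗ Th 𝟏) ∗ ((𝟏 - Th 𝟏) ∗ e s)) by nc.
  apply: le_trans (_ : 3 / 2 * (2 * tau ^+ 2) <= _); last by have := sqr_ge0 tau; nra.
  apply: nrM_le; first by rewrite nr_star.
  apply: nrM_le => //; apply: le_trans (nrD _ _) _.
  by rewrite -[2]/(1 + 1) lerD//; rewrite -[1]mulr1 nrM_le.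
pose F m := Q^† ∗ ampl q (D m) ∗ Q.
have hF : cpf F := cpf_conj Q (cpf_comp hD (cpf_hom hq')).
have e0 s : nr (e s) <= Num.sqrt (1 + del).
  by rewrite -[nr _]ger0_norm// -sqrtr_sqr ler_sqrt// addr_ge0// ltW.
have [x0 x0E] := qs' (e ord0).
have [x xE xe] := quot_lift hq' q1' x0; rewrite x0E in xE xe.
(* [x] is no longer than [e ord0], whose squared norm is at most [1 + del]; this factor makes [f]
   contractive. *)
pose c := (1 + del)^-1; have c0 : 0 <= c by rewrite invr_ge0 addr_ge0// ltW.
pose f m := c%:C *: (x^† ∗ D m ∗ x) ord0 ord0.
have hf : cpf f by apply: cpfZ => //; exact: cpf_comp (cpf_conj x hD) (cpf_diag ord0).
exists F, f; split=> //.
- by rewrite /F qD1 Qs QThQ.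
- move=> a i j r s a1; set z := qc a i j.
  have z1 : nr z <= 1.
    apply: le_trans (cmx_coord _ _ _) _; rewrite nr_sval.
    exact: le_trans (hom_contract (proj1 (qphi_unital_hom fr U)) a) a1.
  have Thz : nr (Th z) <= 1 by apply: le_trans (nrTh z) z1.
  rewrite -gramE -/G -cmxNE -cmxDE -QThQ.
  have -> : F z - Q ∗ Th z ∗ Q = Q ∗ (ampl q (D z) - Th z) ∗ Q by rewrite /F Qs; nc.
  rewrite -form; set E := ampl q (D z).
  have -> : (e r)^† ∗ (E - Th z) ∗ e s = (e r)^† ∗ (E - Th 𝟏 ∗ Th z ∗ Th 𝟏) ∗ e s -
      ((𝟏 - Th 𝟏) ∗ e r)^† ∗ (Th z ∗ (Th 𝟏 ∗ e s)) - (e r)^† ∗ (Th z ∗ ((𝟏 - Th 𝟏) ∗ e s)).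
    exact: compression_split.
  have b1 := err a i j (e s) (e r).
  have b2 : nr (((𝟏 - Th 𝟏) ∗ e r)^† ∗ (Th z ∗ (Th 𝟏 ∗ e s))) <= tau ^+ 2 * (1 * (1 * (3 / 2))).
    by apply: nrM_le; rewrite ?nr_star//; apply: nrM_le => //; exact: nrM_le.
  have b3 : nr ((e r)^† ∗ (Th z ∗ ((𝟏 - Th 𝟏) ∗ e s))) <= 3 / 2 * (1 * tau ^+ 2).
    by apply: nrM_le; rewrite ?nr_star//; exact: nrM_le.
  apply: le_trans (nrB _ _) _; apply: le_trans (lerD (nrB _ _) b3) _.
  apply: le_trans (lerD (lerD b1 b2) (lexx _)) _.
  have b4 : nr a * (nr (e r) * defect (Th := Th) (e s) + defect (Th := Th) (e r) * nr (e s))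
      <= 1 * (3 / 2 * (2 * tau) + 2 * tau * (3 / 2)).
    apply: ler_pM => //; first by rewrite addr_ge0// mulr_ge0// sqrtr_ge0.
    by apply: lerD; apply: ler_pM; rewrite ?sqrtr_ge0.
  apply: gram_error b4; by rewrite expr2 ler_piMr// ltW.
- split=> //; rewrite -[𝟏]scale1r -(rmorph1 (real_complex R)).
  apply: nr_le_pos; first by rewrite -(cpf_star hf) star1.
  rewrite /f nrZR ger0_norm// mulrC ler_pdivrMr ?mul1r ?ltr_pwDl//; last exact: ltW.
  apply: le_trans (cmx_coord _ _ _) _.
  apply: le_trans (_ : nr x * 1 * nr x <= _).
    apply: nrM_le => //; apply: nrM_le; first by rewrite nr_star.
    by apply: le_trans (cpf_contractive hD D1 _) _; exact: nr1.
  by rewrite mulr1 -expr2; apply: le_trans (nre ord0); rewrite ler_pXn2r ?nnegrE.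
- move=> m; rewrite /f (linZ (star_hom_linear hq)) -delE; congr (_ *: _).
  rewrite -[q _]amplE !(star_homM hq') (star_hom_star hq') xE eform.
  by rewrite ecol_form star1 smul1x smulx1 /F Qs.
Qed.

End Approximant.

(** * Approximate lifts on finitely many words *)

Section Propagation.
Context {R : realType} {P O M T : ucstarType R} {t : P -> M -> T} {Phi : O -> T}.
Context {d : nat} (fr : fd_frame P d) (U : is_quantum_maps t Phi).
Local Notation qc := (qcoef fr U).

Lemma qcoef_sum a b i j : \sum_k qc a i k ∗ qc b k j = qc (a ∗ b) i j.
Proof.
rewrite /qcoef (star_homM (proj1 (qphi_unital_hom fr U))).
by rewrite -[sval_ (_ ∗ _)]/(sval_ (qphi fr U a) ∗ sval_ (qphi fr U b)) cmxME.
Qed.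

Lemma qcoef_star a i j : (qc a i j)^† = qc a^† j i.
Proof.
rewrite /qcoef (star_hom_star (proj1 (qphi_unital_hom fr U))).
by rewrite -[sval_ (_^†)]/((sval_ (qphi fr U a))^†) cmxSE.
Qed.

Lemma nr_qcoef a i j : nr (qc a i j) <= nr a.
Proof.
apply: le_trans (cmx_coord _ _ _) _; rewrite nr_sval.
exact: hom_contract (proj1 (qphi_unital_hom fr U)) a.
Qed.

Context {C : ucstarType R} {phi : M -> C} (hphi : cpf phi) (phi1 : pos (𝟏 - phi 𝟏)).
Context {n : nat} {y : 'I_n.+1 -> M} (y1 : forall s, nr (y s) <= 1).
Context {F : M -> cmx C n.+1} {eps : R} (hF : cpf F) (F1 : F 𝟏 = gram phi y 𝟏).
Hypothesis Fq : forall a i j r s, nr a <= 1 ->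
  nr (F (qc a i j) r s - phi ((y r)^† ∗ qc a i j ∗ y s)) <= eps.
Let lF := proj1 hF.
Let lphi := proj1 hphi.

Lemma nr_F00 m : nr (F m ord0 ord0) <= nr m.
Proof.
have h : cpf (fun m => F m ord0 ord0) := cpf_comp hF (cpf_diag ord0).
apply: (cpf_contractive h) => /=; rewrite -[𝟏]scale1r -(rmorph1 (real_complex R)).
apply: nr_le_pos; first by rewrite -(cpf_star h) star1.
rewrite F1 gramE smulx1; apply: le_trans (cpf_contractive hphi phi1 _) _.
by rewrite nrS expr_le1.
Qed.

(** The squared length of [x (x) e_s - 1 (x) e_r] in the Stinespring space of [F], stored in the
    corner entry. For the Gram map it would be [phi] of [v^† v] with [v = x y_s - y_r], zero when
    [y_r = x y_s]. *)
Let Z (x : M) (s r : 'I_n.+1) : cmx C n.+1 :=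
  (ecol s 𝟏)^† ∗ F (x^† ∗ x) ∗ ecol s 𝟏 + (ecol s 𝟏)^† ∗ F (x^† ∗ 𝟏) ∗ (- ecol r 𝟏) +
  (- ecol r 𝟏)^† ∗ F (𝟏^† ∗ x) ∗ ecol s 𝟏 + (- ecol r 𝟏)^† ∗ F (𝟏^† ∗ 𝟏) ∗ (- ecol r 𝟏).

Let ZE x s r k l : Z x s r k l = if (k == ord0) && (l == ord0) then
  F (x^† ∗ x) s s - F x^† s r - F x r s + F 𝟏 r r else 0.
Proof.
rewrite /Z !star1 !smulx1 !smul1x !starN !smulNr !smulNl opprK !cmxDE !cmxNE !ecol_form.
by case: (_ && _); rewrite ?star1 ?smul1x ?smulx1// !subr0 addr0.
Qed.

Let Z_pos x s r : pos (Z x s r).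
Proof.
have := (proj2 hF) 2 (fun i => nth 0 [:: x; 𝟏] i) (fun i => nth 0 [:: ecol s 𝟏; - ecol r 𝟏] i).
by congr pos; rewrite /qform !big_ord_recl !big_ord0 /= !addr0 !addrA.
Qed.

Let step m x s r : nr (F (m ∗ x) ord0 s - F m ord0 r) ^+ 2 <= nr m ^+ 2 * nr (Z x s r).
Proof.
have := @cpf_cauchy_schwarz R _ _ F x 𝟏 m^† (ecol s 𝟏) (- ecol r 𝟏) (ecol ord0 𝟏) hF.
rewrite starK smulx1 -/(Z x s r) nr_ecol_form star1 smul1x smulx1 => h.
apply: (le_trans _ (le_trans h _)); last first.
  by apply: ler_wpM2r => //; apply: le_trans (nr_F00 _) _; rewrite nrS'.
rewrite ler_pXn2r// ?nnegrE// smulNr smulDr smulNr !smulA.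
have -> : F (m ∗ x) ord0 s - F m ord0 r =
    ((ecol ord0 𝟏)^† ∗ F (m ∗ x) ∗ ecol s 𝟏 - (ecol ord0 𝟏)^† ∗ F m ∗ ecol r 𝟏) ord0 ord0.
  by rewrite cmxDE cmxNE !ecol_form star1 !smul1x !smulx1.
exact: cmx_coord.
Qed.

(** A single [Z] involves [x^† x], not a generator; but the [Z] are positive, so one is at most
    their sum over the row index. [1 + 2 d] counts the approximations of [F]: one for
    [Phi_jj (a^† a)] and [d] for each of the two cross terms. *)
Lemma propagate m a i j s (r : 'I_d -> 'I_n.+1) : nr m <= 1 -> nr a <= 1 ->
  (forall k, y (r k) = qc a k j ∗ y s) ->
  nr (F (m ∗ qc a i j) ord0 s - F m ord0 (r i)) ^+ 2 <= (1 + 2 * d%:R) * eps.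
Proof.
move=> m1 a1 yr; apply: le_trans (step _ _ _ _) _.
apply: le_trans (_ : 1 * nr (Z (qc a i j) s (r i)) <= _).
  by apply: ler_wpM2r => //; rewrite expr_le1.
rewrite mul1r; pose ZZ := \sum_k Z (qc a k j) s (r k).
apply: le_trans (_ : nr ZZ <= _).
  apply: nr_mono => //; rewrite /ZZ (bigD1 i)//= addrC addrK.
  by apply: pos_sum.
have aS1 : nr a^† <= 1 by rewrite nr_star.
have aa1 : nr (a^† ∗ a) <= 1 by rewrite nrS expr_le1.
rewrite nr_corner0 => [|k l h]; last by rewrite cmx_sumE big1// => k' _; rewrite ZE h.
rewrite cmx_sumE; under eq_bigr do rewrite ZE eqxx /=.
have sumq : \sum_k (qc a k j)^† ∗ qc a k j = qc (a^† ∗ a) j j.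
  by rewrite -qcoef_sum; apply: eq_bigr => k _; rewrite qcoef_star.
(* By [F1] and [y (r k) = qc a k j ∗ y s] the terms in [phi] balance, so only differences controlled
   by [Fq] remain. *)
have -> : \sum_k (F ((qc a k j)^† ∗ qc a k j) s s - F (qc a k j)^† s (r k)
      - F (qc a k j) (r k) s + F 𝟏 (r k) (r k)) =
    (F (qc (a^† ∗ a) j j) s s - phi ((y s)^† ∗ qc (a^† ∗ a) j j ∗ y s)) -
    \sum_k (F (qc a^† j k) s (r k) - phi ((y s)^† ∗ qc a^† j k ∗ y (r k))) -
    \sum_k (F (qc a k j) (r k) s - phi ((y (r k))^† ∗ qc a k j ∗ y s)).
  rewrite -sumq (lin_sum lF) cmx_sumE smul_sumr smul_suml (lin_sum lphi) -!sumrB.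
  apply: eq_bigr => k _; rewrite F1 gramE !yr starM !smulx1 -!qcoef_star !smulA.
  lmod.
apply: le_trans (nrB _ _) _; rewrite mulrDl mul1r.
rewrite [2 * _]mulr_natl mulr2n mulrDl addrA; apply: lerD.
  apply: le_trans (nrB _ _) _; apply: lerD; first exact: Fq.
  apply: le_trans (nr_sum _ _ _) _; apply: le_trans (ler_sum _ (fun k _ => Fq _ _ _ _ aS1)) _.
  by rewrite sumr_const card_ord mulr_natl.
apply: le_trans (nr_sum _ _ _) _; apply: le_trans (ler_sum _ (fun k _ => Fq _ _ _ _ a1)) _.
by rewrite sumr_const card_ord mulr_natl.
Qed.

End Propagation.

Section Words.
Context {R : realType} {P O M T : ucstarType R} {t : P -> M -> T} {Phi : O -> T}.
Context {d : nat} (fr : fd_frame P d.+1) (U : is_quantum_maps t Phi).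
Local Notation qc := (qcoef fr U).
Local Notation letter := (O * 'I_d.+1 * 'I_d.+1)%type.
Local Notation word := (seq letter).

Definition wev (u : word) : M := foldr (fun x m => qc x.1.1 x.1.2 x.2 ∗ m) 𝟏 u.
Definition short (u : word) := all (fun x : letter => nr x.1.1 <= 1) u.

Lemma nr_wev u : short u -> nr (wev u) <= 1.
Proof.
elim: u => [_|[[a i] j] u IH /= /andP[a1 /IH u1]]; first exact: nr1.
by rewrite -[1]mulr1; apply: nrM_le => //; exact: le_trans (nr_qcoef fr U a i j) a1.
Qed.

(** The words obtained from a nonempty suffix of [u] by changing the row index of its first letter:
    the vectors that [propagate] asks for along the way. *)
Fixpoint variants (u : word) : seq word :=
  if u is (a, i, j) :: u' then [seq (a, k, j) :: u' | k <- enum 'I_d.+1] ++ variants u'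
  else [::].

Lemma short_variants u v : short u -> v \in variants u -> short v.
Proof.
elim: u => [//|[[a i] j] u IH /= /andP[a1 su]]; rewrite mem_cat => /orP[/mapP[k _ ->]|].
  by rewrite /= a1.
exact: IH.
Qed.

Hypothesis O_lifting : lifting_property O.
Context {A C : ucstarType R} {q : A -> C} (hq : is_star_hom q) (q1 : q 𝟏 = 𝟏).
Hypothesis q_surj : forall c, exists a, q a = c.
Context {phi : M -> C} (hphi : cpf phi) (phi1 : pos (𝟏 - phi 𝟏)).

Lemma word_lift_bound (us : seq word) (kap : R) : all short us -> 0 < kap -> kap <= 1 ->
  exists f : M -> A, [/\ cpf f, pos (𝟏 - f 𝟏)
    & forall u, u \in us -> nr (q (f (wev u)) - phi (wev u)) <= (size u).+1%:R * kap].
Proof.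
move=> us_short k0 k1.
pose L := flatten (map variants us).
(* The empty word comes first, so [y ord0] is the unit. *)
pose y (s : 'I_(size L).+1) := wev (nth [::] ([::] :: L) s).
have L_short v : v \in [::] :: L -> short v.
  rewrite inE => /orP[/eqP -> //|/flatten_mapP[u uus]].
  by apply: short_variants; exact: (allP us_short).
have y1 s : nr (y s) <= 1 by apply/nr_wev/L_short/mem_nth.
pose idx (u : word) : 'I_(size L).+1 := inord (index u ([::] :: L)).
have yidx u : u \in [::] :: L -> y (idx u) = wev u.
  move=> uL; rewrite /y inordK ?nth_index//.
  by have := uL; rewrite -index_mem.
have idx0 : idx [::] = ord0 by apply: val_inj; rewrite /= inordK.
have y0 : y ord0 = 𝟏 by [].
clearbody y.
(* [propagate] turns the error [9 tau] of [gram_lift] into a square at most [D tau];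
   [tau = kap ^+ 2 / D] makes each letter cost [kap]. *)
pose D : R := (1 + 2 * d.+1%:R) * 9.
have D1 : 1 <= D.
  by rewrite /D; have : (0 : R) <= d.+1%:R by []; lra.
have D0 : 0 < D by apply: lt_le_trans D1.
pose tau := kap ^+ 2 / D.
have tau0 : 0 < tau by rewrite divr_gt0// exprn_gt0.
have tauk : tau <= kap.
  rewrite ler_pdivrMr// expr2; apply: ler_wpM2l; [exact: ltW|exact: le_trans k1 D1].
have tau1 : tau <= 1 by exact: le_trans tauk k1.
have [F [f [hF F1 Fq [hf f1] qf]]] := gram_lift fr U O_lifting hq q1 q_surj hphi phi1 y1 tau0 tau1.
have stepk : (1 + 2 * d.+1%:R) * (9 * tau) = kap ^+ 2.
  by rewrite mulrA -/D mulrC /tau mulfVK// gt_eqF.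
have step := propagate hphi phi1 y1 hF F1 Fq.
(* Letters move one at a time from the word inside [F] to the column index; the accumulated left
   factor [m] stays a contraction. *)
have walk u m : short u -> {subset variants u <= L} -> nr m <= 1 ->
    nr (F (m ∗ wev u) ord0 ord0 - F m ord0 (idx u)) <= (size u)%:R * kap.
  elim: u m => [|[[a i] j] u IH] m.
    by rewrite /= smulx1 idx0 subrr nr0 mul0r.
  move=> /= /andP[a1 su] uL m1.
  have uL' : {subset variants u <= L} by move=> v vu; apply: uL; rewrite mem_cat vu orbT.
  have kL k : (a, k, j) :: u \in L.
    by apply: uL; rewrite mem_cat; apply/orP; left; apply/mapP; exists k => //; rewrite mem_enum.
  have uin : u \in [::] :: L.
    case: u uL' {IH kL su uL} => [|[[b k] l] u] uL'; first by rewrite inE eqxx.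
    rewrite inE; apply/orP; right; apply: uL'; rewrite /= mem_cat; apply/orP; left.
    by apply/mapP; exists k => //; rewrite mem_enum.
  have mq : nr (m ∗ qc a i j) <= 1.
    by rewrite -[1]mulr1; apply: nrM_le => //; exact: le_trans (nr_qcoef fr U a i j) a1.
  have h1 := IH _ su uL' mq.
  have h2 : nr (F (m ∗ qc a i j) ord0 (idx u) - F m ord0 (idx ((a, i, j) :: u))) <= kap.
    rewrite -(@ler_pXn2r _ 2)// ?nnegrE ?(ltW k0)// -stepk.
    apply: (step m a i j (idx u) (fun k => idx ((a, k, j) :: u)) m1 a1) => k.
    by rewrite !yidx// inE kL orbT.
  rewrite -natr1 mulrDl mul1r smulA.
  by apply: le_trans (nr_tri (F (m ∗ qc a i j) ord0 (idx u)) _ _) _; apply: lerD.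
exists f; split=> // u uus; have su := allP us_short _ uus.
have uL : {subset variants u <= L}.
  by move=> v vu; apply/flatten_mapP; exists u.
have uin : u \in [::] :: L.
  case: u uL {uus su} => [|[[b k] l] u] uL; first by rewrite inE eqxx.
  rewrite inE; apply/orP; right; apply: uL; rewrite /= mem_cat; apply/orP; left.
  by apply/mapP; exists k => //; rewrite mem_enum.
have := walk u 𝟏 su uL (@nr1 R M); rewrite smul1x F1 gramE y0 star1 smulx1 smul1x yidx//.
set c := (1 + tau ^+ 4)^-1 in qf *; rewrite qf => h.
have t4 : 0 < tau ^+ 4 by rewrite exprn_gt0.
have p0 : 0 < 1 + tau ^+ 4 by rewrite addr_gt0.
have c1 : c <= 1 by rewrite /c invf_le1// lerDl ltW.
have c0 : 0 <= c by rewrite invr_ge0 ltW.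
(* The normalization [c] of [f] costs one more [kap], hence [(size u).+1]. *)
have cE : 1 - c <= kap.
  have t4k : tau ^+ 4 <= kap.
    by apply: le_trans tauk; rewrite exprS ler_piMr ?(ltW tau0)// exprn_ile1// ltW.
  apply: le_trans t4k; have ce : c * (1 + tau ^+ 4) = 1.
    by rewrite mulVf// gt_eqF.
  have -> : 1 - c = c * tau ^+ 4 by rewrite -ce mulrDr mulr1 addrAC subrr add0r.
  by apply: ler_piMl c1; exact: ltW.
have -> : c%:C *: F (wev u) ord0 ord0 - phi (wev u) =
    c%:C *: (F (wev u) ord0 ord0 - phi (wev u)) - (1 - c)%:C *: phi (wev u).
  by rewrite rmorphB rmorph1 scalerBl scale1r scalerBr; lmod.
apply: le_trans (nrB _ _) _; rewrite !nrZR !ger0_norm ?subr_ge0//.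
have -> : (size u).+1%:R * kap = (size u)%:R * kap + kap by rewrite -natr1 mulrDl mul1r.
apply: lerD.
  by apply: le_trans h; apply: ler_piMl.
rewrite -[kap]mulr1; apply: ler_pM; rewrite ?subr_ge0//.
by apply: le_trans (cpf_contractive hphi phi1 _) _; exact: nr_wev.
Qed.

Lemma word_lift (us : seq word) (eps : R) : all short us -> 0 < eps ->
  exists f : M -> A, [/\ cpf f, pos (𝟏 - f 𝟏)
    & forall u, u \in us -> nr (q (f (wev u)) - phi (wev u)) <= eps].
Proof.
move=> us_short e0; pose m := (\max_(u <- us) size u)%N.
have m0 : 0 < m.+1%:R :> R by [].
pose kap := Num.min 1 (eps / m.+1%:R).
have k0 : 0 < kap by rewrite lt_min ltr01 divr_gt0.
have k1 : kap <= 1 by rewrite ge_min lexx.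
have [f [hf f1 fu]] := word_lift_bound us_short k0 k1.
exists f; split=> // u uus; apply: le_trans (fu u uus) _.
apply: le_trans (_ : m.+1%:R * kap <= _).
  apply: ler_wpM2r; first exact: ltW.
  by rewrite ler_nat ltnS /m (big_rem u)//= leq_maxl.
by rewrite mulrC -ler_pdivlMr// ge_min lexx orbT.
Qed.

End Words.

(** * Quasi-central elements of an ideal *)

Section QuasiCentral.
Context {R : realType} {B C : ucstarType R} {q : B -> C} (hq : is_star_hom q).
Let lq := star_hom_linear hq.
Let qM := star_homM hq.
Let qS := star_hom_star hq.
Implicit Types (js bs : seq B).

(** [e = h (h + eps)^(-1)] with [h = sum j^† j] and [eps = del^2]. Each [j^† j] is at most [h], and
    [(1 - e) h (1 - e) = eps^2 S e S] has norm at most [eps]. *)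
Lemma approx_unit js (del : R) : 0 < del -> (forall j, j \in js -> q j = 0) ->
  exists e, [/\ pos e, nr e <= 1, q e = 0 & forall j, j \in js -> nr (j ∗ (𝟏 - e)) <= del].
Proof.
move=> d0 jq; pose h := \sum_(j <- js) j^† ∗ j.
have hp : pos h by apply: pos_sum => j _; exact: posS.
have qh : q h = 0.
  by rewrite (lin_sum lq) big_seq big1// => j jin; rewrite qM (jq j jin) smulx0.
have hj j : j \in js -> pos (h - j^† ∗ j).
  move=> jin; rewrite /h (big_rem j)//= addrAC subrr add0r.
  by apply: pos_sum => i _; exact: posS.
clearbody h; pose eps := del ^+ 2; have e0 : 0 < eps by rewrite exprn_gt0.
pose k := h + eps%:C *: 𝟏.
have ks : k^† = k by rewrite saD ?saZ ?star1// pos_sa.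
have [|S [Sp SkS nrS_ _]] := inv_sqrt ks e0; first by rewrite /k addrK.
have Ss := pos_sa Sp.
have nSd : nr S <= del^-1.
  by apply: le_trans nrS_ _; rewrite /eps -exprVn sqrtr_sqr ger0_norm// invr_ge0 ltW.
pose e := S ∗ h ∗ S.
have ep : pos e by rewrite /e -{1}Ss; exact: pos_conj.
have e1 : 𝟏 - e = eps%:C *: (S ∗ S) by rewrite -SkS /k /e; nc.
have ee : nr e <= 1.
  apply: pos_le_nr => //; rewrite rmorph1 scale1r e1.
  by apply: posZ; [exact: ltW|exists S].
exists e; split=> //; first by rewrite /e !qM qh smulx0 smul0x.
move=> j /hj hjp; rewrite -(@ler_pXn2r _ 2)// ?nnegrE ?(ltW d0)// -nrS starM smulA -smulA.
apply: le_trans (_ : nr ((𝟏 - e)^† ∗ h ∗ (𝟏 - e)) <= _).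
  rewrite smulA -(smulA _ j^†); apply: nr_mono.
    exact: pos_conj (posS j).
  have := pos_conj (𝟏 - e) hjp.
  by move: (𝟏 - e) => z; rewrite smulBr smulBl.
have -> : (𝟏 - e)^† ∗ h ∗ (𝟏 - e) = (eps ^+ 2)%:C *: (S ∗ e ∗ S).
  rewrite e1 starR starM Ss smulZl smulZl smulZr scalerA -rmorphM -expr2; congr (_ *: _).
  by rewrite /e !smulA.
rewrite nrZR ger0_norm ?sqr_ge0//.
apply: le_trans (_ : eps ^+ 2 * (del^-1 * 1 * del^-1) <= _).
  by apply: ler_wpM2l; [exact: sqr_ge0|apply: nrM_le => //; apply: nrM_le].
by rewrite mulr1 -invfM -expr2 -/eps expr2 mulfK// gt_eqF.
Qed.

(** Approximate units are added one at a time, each almost annihilating the commutators of the sum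
    so far, which lie in the ideal. The new commutator is then nearly orthogonal to the old one, so
    squares of norms add: commutators grow like [sqrt n], while [E] acts on [js] almost as [n]. *)
Lemma quasi_central_sum bs js (del : R) n : 0 < del -> (forall j, j \in js -> q j = 0) ->
  exists E, [/\ E^† = E, nr E <= n%:R, q E = 0,
    forall j, j \in js -> nr (j ∗ (n%:R%:C *: 𝟏 - E)) <= n%:R * del
    & forall b, b \in bs -> nr (E ∗ b - b ∗ E) ^+ 2 <= n%:R * (4 * nr b ^+ 2 + 1)].
Proof.
move=> d0 jq; elim: n => [|n [E [Es En qE Ej Eb]]].
  exists 0; split=> [||||b _]; rewrite ?star0 ?nr0 ?(lin0 lq)//.
    by move=> j _; rewrite scale0r subr0 smulx0 nr0 mul0r.
  by rewrite smul0x smulx0 subr0 nr0 expr0n mul0r.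
pose K := \sum_(b <- bs) nr b.
have bK b : b \in bs -> nr b <= K.
  by move=> bin; rewrite /K (big_rem b)//= lerDl sumr_ge0.
have K0 : 0 <= K by rewrite sumr_ge0.
clearbody K.
pose c b := E ∗ b - b ∗ E.
have qc b : q (c b) = 0 by rewrite (linB lq) !qM qE smul0x smulx0 subr0.
(* Chosen so that the cross term [x^† ∗ y] is at most [1 / 2]; with its adjoint it contributes the 1
   in [4 * nr b ^+ 2 + 1]. *)
pose del' := Num.min del (2 * (K + 1))^-1.
have K1 : 0 < 2 * (K + 1) by rewrite mulr_gt0// ltr_wpDl.
have d'0 : 0 < del' by rewrite lt_min d0 invr_gt0.
have [|e [ep e1 qe ej]] := @approx_unit (js ++ [seq (c b)^† | b <- bs] ++
    [seq (c b)^† ∗ b | b <- bs]) _ d'0.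
  move=> j; rewrite !mem_cat => /or3P[/jq//|/mapP[b _ ->]|/mapP[b _ ->]].
    by rewrite qS qc star0.
  by rewrite qM qS qc star0 smul0x.
have es := pos_sa ep.
exists (E + e); split.
- exact: saD.
- by rewrite -natr1; apply: le_trans (nrD _ _) _; exact: lerD.
- by rewrite (linD lq) qE qe addr0.
- move=> j jin; have -> : j ∗ (n.+1%:R%:C *: 𝟏 - (E + e)) =
      j ∗ (n%:R%:C *: 𝟏 - E) + j ∗ (𝟏 - e).
    by rewrite -smulDr; congr (_ ∗ _); rewrite -natr1 rmorphD rmorph1 scalerDl; lmod.
  rewrite -natr1 mulrDl mul1r; apply: le_trans (nrD _ _) _; apply: lerD; first exact: Ej.
  apply: le_trans (ej _ _) _; first by rewrite mem_cat jin.
  by rewrite ge_min lexx.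
move=> b bin.
have -> : (E + e) ∗ b - b ∗ (E + e) = c b + (e ∗ b - b ∗ e) by rewrite /c; nc.
set x := c b; set y := e ∗ b - b ∗ e.
have y2 : nr y <= 2 * nr b.
  rewrite -[2]/(1 + 1) mulrDl mul1r; apply: le_trans (nrB _ _) _; apply: lerD.
    by rewrite -[X in _ <= X]mul1r nrM_le.
  by rewrite -[X in _ <= X]mulr1 nrM_le.
have xy : nr (x^† ∗ y) <= 1 / 2.
  have -> : x^† ∗ y = x^† ∗ b ∗ (𝟏 - e) - x^† ∗ (𝟏 - e) ∗ b by rewrite /y; nc.
  have h1 : nr (x^† ∗ b ∗ (𝟏 - e)) <= del'.
    by apply: ej; rewrite !mem_cat (map_f (fun b => (c b)^† ∗ b) bin) !orbT.
  have h2 : nr (x^† ∗ (𝟏 - e) ∗ b) <= del' * K.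
    apply: nrM_le (bK _ bin); apply: ej.
    by rewrite !mem_cat (map_f (fun b => (c b)^†) bin) !orbT.
  apply: le_trans (nrB _ _) _; apply: le_trans (lerD h1 h2) _.
  apply: le_trans (_ : (2 * (K + 1))^-1 * (1 + K) <= _).
    rewrite mulrDr mulr1; have h : del' <= (2 * (K + 1))^-1 by rewrite ge_min lexx orbT.
    by apply: lerD => //; apply: ler_wpM2r.
  by rewrite invfM -mulrA [1 + K]addrC mulVf ?mulr1 ?div1r// gt_eqF// ltr_wpDl.
rewrite -nrS.
have -> : (x + y)^† ∗ (x + y) = x^† ∗ x + (x^† ∗ y + (x^† ∗ y)^†) + y^† ∗ y.
  by rewrite starD starM starK; nc.
apply: le_trans (nrD _ _) _; rewrite -natr1 mulrDl mul1r nrS.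
apply: le_trans (lerD (nrD _ _) (lexx _)) _; rewrite nrS -addrA; apply: lerD; first exact: Eb.
have y4 : nr y ^+ 2 <= 4 * nr b ^+ 2.
  have -> : 4 * nr b ^+ 2 = (2 * nr b) ^+ 2 by rewrite exprMn -natrX.
  by rewrite ler_pXn2r// nnegrE// mulr_ge0.
have := nrD (x^† ∗ y) (x^† ∗ y)^†; rewrite nr_star.
by move: (nr (_ + _)) (nr (x^† ∗ y)) xy (nr y ^+ 2) y4 => u v xy w y4; lra.
Qed.

(** The average [E / n]: its commutators are of order [n^(-1/2)]. *)
Lemma quasi_central bs js (del : R) : 0 < del -> (forall j, j \in js -> q j = 0) ->
  exists e, [/\ e^† = e, nr e <= 1, q e = 0,
    forall j, j \in js -> nr (j ∗ (𝟏 - e)) <= del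
    & forall b, b \in bs -> nr (e ∗ b - b ∗ e) <= del].
Proof.
move=> d0 jq.
pose K := \sum_(b <- bs) (4 * nr b ^+ 2 + 1).
have p0 (b : B) : 0 <= 4 * nr b ^+ 2 + 1 by rewrite addr_ge0 ?mulr_ge0 ?sqr_ge0.
have bK b : b \in bs -> 4 * nr b ^+ 2 + 1 <= K.
  by move=> bin; rewrite /K (big_rem b)//= lerDl sumr_ge0.
have K0 : 0 <= K by rewrite sumr_ge0.
clearbody K.
have [N /(_ N (leqnn N)) hN] := @invS_small R (del ^+ 2 / (K + 1)) (divr_gt0 (exprn_gt0 2 d0)
  (ltr_wpDl K0 ltr01)).
have [E [Es En qE Ej Eb]] := quasi_central_sum bs N.+1 d0 jq.
have n0 : 0 < N.+1%:R :> R by [].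
have ni : N.+1%:R^-1 * N.+1%:R = 1 :> R by rewrite mulVf// gt_eqF.
have ni0 : 0 < N.+1%:R^-1 :> R by rewrite invr_gt0.
move: (N.+1%:R : R) (N.+1%:R^-1 : R) hN n0 ni ni0 En Ej Eb => n i hN n0 ni i0 En Ej Eb.
exists (i%:C *: E); split.
- exact: saZ.
- by rewrite nrZR gtr0_norm// -ni ler_pM2l.
- by rewrite (linZ lq) qE scaler0.
- move=> j jin; have -> : j ∗ (𝟏 - i%:C *: E) = i%:C *: (j ∗ (n%:C *: 𝟏 - E)).
    rewrite -smulZr scalerBr scalerA -rmorphM ni rmorph1 scale1r//.
  rewrite nrZR gtr0_norm//; apply: le_trans (_ : i * (n * del) <= _).
    by rewrite ler_pM2l//; exact: Ej.
  by rewrite mulrA ni mul1r.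
move=> b bin; have -> : i%:C *: E ∗ b - b ∗ (i%:C *: E) = i%:C *: (E ∗ b - b ∗ E) by nc.
rewrite nrZR gtr0_norm// -(@ler_pXn2r _ 2)// ?nnegrE ?mulr_ge0 ?(ltW d0) ?(ltW i0)//.
rewrite exprMn; apply: le_trans (_ : i ^+ 2 * (n * (K + 1)) <= _).
  apply: ler_wpM2l; first exact: sqr_ge0.
  apply: le_trans (Eb b bin) _; rewrite ler_pM2l//.
  by apply: le_trans (bK b bin) _; rewrite lerDl.
rewrite expr2 mulrA -(mulrA i i n) ni mulr1 -ler_pdivlMr//.
by rewrite ltr_wpDl.
Qed.

(** Each iteration of [ssq] adds at most half of the commutator of [x], so [n] iterations cost at
    most [n] times it; the remainder is [slim_approx]. *)
Lemma slim_commutator (x b : B) n : nr x <= 1 ->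
  nr (slim x ∗ b - b ∗ slim x) <= 4 / n.+2%:R * nr b + n%:R * nr (x ∗ b - b ∗ x).
Proof.
move=> x1.
have h : nr (ssq x n ∗ b - b ∗ ssq x n) <= n%:R * nr (x ∗ b - b ∗ x).
  elim: n => [|n IH]; first by rewrite /= smul0x smulx0 subr0 nr0 mul0r.
  rewrite /=; set s := ssq x n in IH *.
  have s1 : nr s <= 1 by apply: le_trans (ssq_le n x1) _; have [] := @tsq_bounds R n.
  have -> : (2^-1)%:C *: (x + s ∗ s) ∗ b - b ∗ ((2^-1)%:C *: (x + s ∗ s)) =
     (2^-1)%:C *: ((x ∗ b - b ∗ x) + (s ∗ (s ∗ b - b ∗ s) + (s ∗ b - b ∗ s) ∗ s)) by nc.
  rewrite nrZR ger0_norm ?invr_ge0//.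
  have c1 : nr (s ∗ (s ∗ b - b ∗ s)) <= 1 * (n%:R * nr (x ∗ b - b ∗ x)) by exact: nrM_le.
  have c2 : nr ((s ∗ b - b ∗ s) ∗ s) <= n%:R * nr (x ∗ b - b ∗ x) * 1 by exact: nrM_le.
  have c3 := nrD (x ∗ b - b ∗ x) (s ∗ (s ∗ b - b ∗ s) + (s ∗ b - b ∗ s) ∗ s).
  have c4 := nrD (s ∗ (s ∗ b - b ∗ s)) ((s ∗ b - b ∗ s) ∗ s).
  have c0 := nr_ge0 (x ∗ b - b ∗ x).
  rewrite -[n.+1%:R]natr1 mulrDl mul1r; move: c0 c1 c2 c3 c4; move: (n%:R * _) => z.
  move: (nr (x ∗ b - b ∗ x)) (nr (_ ∗ _)) (nr (_ ∗ s)) (nr (_ + _)) (nr (_ + _)) => *; lra.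
have a := slim_approx n x1; set s := ssq x n in h a.
have -> : slim x ∗ b - b ∗ slim x = (slim x - s) ∗ b - b ∗ (slim x - s) + (s ∗ b - b ∗ s) by nc.
apply: le_trans (nrD _ _) _; apply: lerD h.
apply: le_trans (nrB _ _) _.
have -> : 4 / n.+2%:R * nr b = 2 / n.+2%:R * nr b + nr b * (2 / n.+2%:R).
  by move: (n.+2%:R^-1) => z; lra.
by apply: lerD; exact: nrM_le.
Qed.

End QuasiCentral.

(** * Lifting a pointwise limit of liftable maps *)

Fact mixing_identity (R : realType) (B : ucstarType R) (e1 e2 b c : B) :
  e1 ∗ e1 + e2 ∗ e2 = 𝟏 -> e1 ∗ b ∗ e1 + e2 ∗ c ∗ e2 - b =
  e2 ∗ ((c - b) ∗ e2) + ((e1 ∗ b - b ∗ e1) ∗ e1 + (e2 ∗ b - b ∗ e2) ∗ e2).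
Proof.
move=> h; transitivity (e1 ∗ b ∗ e1 + e2 ∗ c ∗ e2 - b ∗ (e1 ∗ e1 + e2 ∗ e2)); last by nc.
by rewrite h smulx1.
Qed.

Section Arveson.
Context {R : realType} {M B C : ucstarType R}.
Context {q : B -> C} (hq : is_star_hom q) (q1 : q 𝟏 = 𝟏).
Let lq := star_hom_linear hq.
Let qM := star_homM hq.

(** [e1 = e] and [e2 = sqrt (1 - e^2)]: a partition of unity by squares, with [e1] in the ideal. *)
Lemma quasi_central_pair (bs js : seq B) (del : R) : 0 < del -> (forall j, j \in js -> q j = 0) ->
  exists e1 e2 : B, [/\ [/\ e1^† = e1, e2^† = e2, nr e1 <= 1 & nr e2 <= 1],
    e1 ∗ e1 + e2 ∗ e2 = 𝟏, q e1 = 0 /\ q e2 = 𝟏,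
    forall j, j \in js -> nr (j ∗ (𝟏 - e1)) <= del
    & forall b, b \in bs -> nr (e1 ∗ b - b ∗ e1) <= del /\ nr (e2 ∗ b - b ∗ e2) <= del].
Proof.
move=> d0 jq; pose K := \sum_(b <- bs) nr b.
have bK b : b \in bs -> nr b <= K.
  by move=> bin; rewrite /K (big_rem b)//= lerDl sumr_ge0.
have K0 : 0 <= K by rewrite sumr_ge0.
clearbody K.
(* [N] iterations leave a tail of the square root that contributes at most [del / 2] to a
   commutator; the commutators of [e] are then taken [4 (N+1)] times smaller than [del]. *)
have [N /(_ N.+1 (leqnSn N)) hN] := @invS_small R (del / (8 * (K + 1)))
  (divr_gt0 d0 (mulr_gt0 (ltr0Sn _ 7) (ltr_wpDl K0 ltr01))).
pose n := N.
have n0 : 0 < (4 * n.+1%:R : R) by [].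
have d'0 : 0 < del / (4 * n.+1%:R) by rewrite divr_gt0.
have [e [es e1 qe ej eb]] := quasi_central hq bs d'0 jq.
have ee1 : nr (e ∗ e) <= 1 by rewrite -[1]mulr1 nrM_le.
have d'1 : del / (4 * n.+1%:R) <= del.
  rewrite ler_pdivrMr// ler_peMr ?(ltW d0)//.
  have : 1 <= n.+1%:R :> R by rewrite ler1n.
  lra.
pose s := slim (e ∗ e).
have ss : s^† = s by apply: slim_sa => //; rewrite saM.
have sE := slim_sq ee1; rewrite -/s in sE.
have qs : q s = 0.
  have h := hom_ncv hq (slimP ee1).
  apply: ncv_uniq h _; apply: ncv_ext (ncv_cst 0) => k.
  elim: k => [|k IH] /=; first by rewrite (lin0 lq).
  by rewrite (linZ lq) (linD lq) !qM -IH qe smulx0 addr0 scaler0.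
have ce : e ∗ s = s ∗ e by apply: slim_comm => //; rewrite smulA.
have c2 : e ∗ (𝟏 - s) = (𝟏 - s) ∗ e by rewrite smulBr smulBl smulx1 smul1x ce.
have e2s : (𝟏 - s)^† = 𝟏 - s by rewrite saB ?star1.
have sum1 : e ∗ e + (𝟏 - s) ∗ (𝟏 - s) = 𝟏 by rewrite sE addrC subrK.
exists e, (𝟏 - s); split=> //.
- by split=> //; have [] := pythagoras_le es e2s c2 sum1.
- by rewrite (linB lq) q1 qs subr0.
- by move=> j jin; apply: le_trans (ej j jin) d'1.
move=> b bin; have cb := eb b bin; split; first exact: le_trans cb d'1.
have -> : (𝟏 - s) ∗ b - b ∗ (𝟏 - s) = - (s ∗ b - b ∗ s) by nc.
rewrite nrN; apply: le_trans (slim_commutator b n ee1) _.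
have ceb : nr (e ∗ e ∗ b - b ∗ (e ∗ e)) <= 2 * (del / (4 * n.+1%:R)).
  have -> : e ∗ e ∗ b - b ∗ (e ∗ e) = e ∗ (e ∗ b - b ∗ e) + (e ∗ b - b ∗ e) ∗ e by nc.
  rewrite -[2]/(1 + 1) mulrDl; apply: le_trans (nrD _ _) _; apply: lerD; first exact: nrM_le.
  by rewrite mulrC; exact: nrM_le.
have h1 : 4 / n.+2%:R * nr b <= del / 2.
  apply: le_trans (_ : 4 * (del / (8 * (K + 1))) * (K + 1) <= _).
    apply: ler_pM => //; first by rewrite ler_pM2l.
    by apply: le_trans (bK b bin) _; rewrite lerDl.
  have -> : 4 * (del / (8 * (K + 1))) * (K + 1) = del / 2 by field; rewrite gt_eqF// ltr_wpDl.
  by [].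
have h2 : n%:R * nr (e ∗ e ∗ b - b ∗ (e ∗ e)) <= del / 2.
  apply: le_trans (_ : n.+1%:R * (2 * (del / (4 * n.+1%:R))) <= _).
    by apply: ler_pM => //; rewrite ler_nat.
  have -> : n.+1%:R * (2 * (del / (4 * n.+1%:R))) = del / 2 by field; rewrite nat1r pnatr_eq0.
  by [].
by apply: le_trans (lerD h1 h2) _; rewrite -splitr.
Qed.

(** [g = e1 psi e1 + e2 phi e2] has the image of [phi], since [q e1 = 0] and [q e2 = 1], and stays
    near [psi]: [phi w - psi w] is an ideal element [r w], which [e2] almost annihilates, plus a
    rest of norm at most [eta]. *)
Lemma arveson_step (psi phi : M -> B) (ws : seq M) (eta eps : R) :
  cpf psi -> cpf phi -> pos (𝟏 - psi 𝟏) -> pos (𝟏 - phi 𝟏) -> 0 < eps ->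
  (forall w, w \in ws -> nr (q (phi w) - q (psi w)) <= eta) ->
  exists g : M -> B, [/\ cpf g, pos (𝟏 - g 𝟏), forall m, q (g m) = q (phi m)
    & forall w, w \in ws -> nr (g w - psi w) <= eta + eps].
Proof.
move=> hpsi hphi psi1 phi1 e0 dq.
have /choice[r rP] : forall w, exists j, q j = 0 /\ nr (phi w - psi w - j) <= nr (q (phi w - psi w)).
  move=> w; have [d0 qd d0le] := quot_lift hq q1 (phi w - psi w).
  exists (phi w - psi w - d0); split; first by rewrite (linB lq) qd subrr.
  by rewrite opprB addrC subrK.
pose js := [seq r w | w <- ws].
pose K := \sum_(w <- ws) nr (r w).
have jK w : w \in ws -> nr (r w) <= K.
  by move=> win; rewrite /K (big_rem w)//= lerDl sumr_ge0.
have K0 : 0 <= K by rewrite sumr_ge0.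
clearbody K.
(* A square appears because [r w ∗ e2] is estimated through its squared norm, with
   [e2^2 = (1 - e1) (1 + e1)]. *)
pose del := Num.min (eps / 4) ((eps / 2) ^+ 2 / (2 * (K + 1))).
have K1 : 0 < 2 * (K + 1) by rewrite mulr_gt0// ltr_wpDl.
have d0 : 0 < del by rewrite lt_min !divr_gt0// exprn_gt0// divr_gt0.
have [|e1 [e2 [[e1s e2s n1 n2] e12 [qe1 qe2] ej eb]]] :=
    @quasi_central_pair ([seq psi w | w <- ws]) js del d0 _.
  by move=> _ /mapP[w _ ->]; have [] := rP w.
have hg : cpf (fun m => e1^† ∗ psi m ∗ e1 + e2^† ∗ phi m ∗ e2).
  exact: cpfD (cpf_conj e1 hpsi) (cpf_conj e2 hphi).
exists (fun m => e1^† ∗ psi m ∗ e1 + e2^† ∗ phi m ∗ e2); split=> //.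
- have -> : 𝟏 - (e1^† ∗ psi 𝟏 ∗ e1 + e2^† ∗ phi 𝟏 ∗ e2) =
      e1^† ∗ (𝟏 - psi 𝟏) ∗ e1 + e2^† ∗ (𝟏 - phi 𝟏) ∗ e2.
    by move: (psi 𝟏) (phi 𝟏) => x y; rewrite -{1}e12 e1s e2s; nc.
  by apply: posD; exact: pos_conj.
- by move=> m; rewrite e1s e2s (linD lq) !qM qe1 qe2 smul0x smul0x add0r smul1x smulx1.
move=> w win; rewrite e1s e2s.
set b := psi w; set d := phi w - b.
have -> : e1 ∗ b ∗ e1 + e2 ∗ phi w ∗ e2 - b =
    e2 ∗ (d ∗ e2) + ((e1 ∗ b - b ∗ e1) ∗ e1 + (e2 ∗ b - b ∗ e2) ∗ e2).
  exact: mixing_identity.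
have [c1 c2] := eb b (map_f psi win).
have d4 : del <= eps / 4 by rewrite ge_min lexx.
have h1 : nr ((e1 ∗ b - b ∗ e1) ∗ e1 + (e2 ∗ b - b ∗ e2) ∗ e2) <= eps / 2.
  apply: le_trans (nrD _ _) _.
  have -> : eps / 2 = eps / 4 * 1 + eps / 4 * 1 by lra.
  by apply: lerD; apply: nrM_le => //; exact: le_trans d4.
have [qr dr] := rP w; rewrite -/b -/d in dr.
have h2 : nr (r w ∗ e2) <= eps / 2.
  have e20 : 0 <= eps / 2 by rewrite divr_ge0// ltW.
  rewrite -(@ler_pXn2r _ 2)// ?nnegrE// -nrS' starM e2s -smulA (smulA e2) smulA.
  have -> : r w ∗ (e2 ∗ e2) ∗ (r w)^† = r w ∗ (𝟏 - e1) ∗ ((𝟏 + e1) ∗ (r w)^†).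
    have -> : e2 ∗ e2 = (𝟏 - e1) ∗ (𝟏 + e1) by rewrite -{1}(addKr (e1 ∗ e1) (e2 ∗ e2)) e12; nc.
    by rewrite !smulA.
  apply: le_trans (_ : del * (2 * (K + 1)) <= _); last first.
    by rewrite -ler_pdivlMr// ge_min lexx orbT.
  apply: nrM_le; first exact: (ej _ (map_f r win)).
  apply: nrM_le.
    by rewrite -[2]/(1 + 1); apply: le_trans (nrD _ _) _; apply: lerD; rewrite ?nr1.
  by rewrite nr_star; apply: le_trans (jK w win) _; rewrite lerDl.
have h3 : nr (e2 ∗ (d ∗ e2)) <= eta + eps / 2.
  apply: le_trans (_ : 1 * nr (d ∗ e2) <= _); first exact: nrM_le.
  rewrite mul1r -[d](subrK (r w)) smulDl; apply: le_trans (nrD _ _) _; apply: lerD h2.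
  apply: le_trans (_ : nr (d - r w) * 1 <= _); first exact: nrM_le.
  rewrite mulr1; apply: le_trans dr _; rewrite (linB lq); exact: dq.
apply: le_trans (nrD _ _) _; apply: le_trans (lerD h3 h1) _.
by rewrite -addrA -splitr.
Qed.

End Arveson.

Lemma ncv_ncauchy (R : realType) (V : normedModType R[i]) (u : nat -> V) l : ncv u l -> ncauchy u.
Proof.
move=> ul e e0; have [N hN] := ul (e / 2) (divr_gt0 e0 (ltr0Sn _ 1)).
exists N => m n /hN hm /hN hn; apply: le_trans (nr_tri l _ _) _.
by rewrite [nr (l - _)]nrC; lra.
Qed.

Section Limit.
Context {R : realType} {M B C : ucstarType R}.
Context {q : B -> C} (hq : is_star_hom q) (q1 : q 𝟏 = 𝟏).
Context {f : M -> C} (hf : cpf f) (f1 : pos (𝟏 - f 𝟏)).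
Context {w : nat -> M} (w_dense : dense (linear_span [set w n | n in setT])).
Hypothesis approx : forall n (eps : R), 0 < eps -> exists g : M -> B,
  [/\ cpf g, pos (𝟏 - g 𝟏) & forall i, (i < n)%N -> nr (q (g (w i)) - f (w i)) <= eps].
Let lq := star_hom_linear hq.

Let h n : R := 2^-1 ^+ n.
Let h0 n : 0 < h n. Proof. by rewrite exprn_gt0// invr_gt0. Qed.
Let hS n : h n = 2 * h n.+1. Proof. by rewrite /h exprS mulrA divff ?mul1r. Qed.

Definition good_lift n (psi : M -> B) := [/\ cpf psi, pos (𝟏 - psi 𝟏)
  & forall i, (i < n)%N -> nr (q (psi (w i)) - f (w i)) <= h n].

(** [arveson_step] with [eta = h n + h n.+1] and [eps = h n], in total at most [3 * h n]. *)
Lemma good_lift_next n psi : good_lift n psi -> exists psi', good_lift n.+1 psi' /\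
  forall i, (i < n)%N -> nr (psi' (w i) - psi (w i)) <= 3 * h n.
Proof.
move=> [hpsi psi1 pw]; have [phi [hphi phi1 phiw]] := approx n.+1 (h0 n.+1).
have [|g [hg g1 gq gw]] := @arveson_step R M B C q hq q1 psi phi [seq w i | i <- iota 0 n]
    (h n + h n.+1) (h n) hpsi hphi psi1 phi1 (h0 n).
  move=> v vin; have [i iin ->] := mapP vin.
  have {iin} ilt : (i < n)%N by rewrite mem_iota in iin.
  apply: le_trans (nr_tri (f (w i)) _ _) _; rewrite addrC; apply: lerD.
    by rewrite nrC; exact: pw.
  by apply: phiw; rewrite ltnW.
exists g; split; first by split=> // i ilt; rewrite gq; exact: phiw.
move=> i ilt; apply: le_trans (gw _ _) _; first by rewrite map_f// mem_iota.
by have := h0 n.+1; rewrite (hS n); lra.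
Qed.

Lemma good_lift_seq : exists psi : nat -> M -> B, (forall n, good_lift n (psi n)) /\
  forall n i, (i < n)%N -> nr (psi n.+1 (w i) - psi n (w i)) <= 3 * h n.
Proof.
(* Dependent choice from ordinary choice: a successor is chosen for every pair, good or not. *)
have /choice[nxt nxtP] : forall p : nat * (M -> B), exists psi',
    good_lift p.1 p.2 -> good_lift p.1.+1 psi' /\
    forall i, (i < p.1)%N -> nr (psi' (w i) - p.2 (w i)) <= 3 * h p.1.
  move=> [n psi]; have [/good_lift_next[psi' P]|nG] := pselect (good_lift n psi).
    by exists psi'.
  by exists psi => /nG.
have [g0 [hg0 g01 _]] := approx 0 ltr01.
pose psi := fix psi n := if n is m.+1 then nxt (m, psi m) else g0.
have psiG n : good_lift n (psi n).
  elim: n => [|n IH]; first by split.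
  by have [] := nxtP (n, psi n) IH.
by exists psi; split=> // n i ilt; have [_] := nxtP (n, psi n) (psiG n); apply.
Qed.

Lemma lift_of_approx : exists g : M -> B, [/\ cpf g, pos (𝟏 - g 𝟏) & forall m, q (g m) = f m].
Proof.
have [psi [psiG psiS]] := good_lift_seq.
have psic n m : nr (psi n m) <= nr m by have [hp p1 _] := psiG n; exact: cpf_contractive.
have psil n : linear (psi n) by have [[lp _] _ _] := psiG n.
have h_small e : 0 < e -> exists N, forall n, (N <= n)%N -> h n <= e.
  apply: geometric_small; first by rewrite invr_ge0.
  by rewrite invf_lt1 ?ltr1n.
have wcv i : exists l, ncv (fun n => psi n (w i)) l.
  apply: (@ncauchy_ncv _ B) => e e0.
  have [N hN] := h_small (e / 12) (divr_gt0 e0 (ltr0Sn _ 11)).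
  pose N' := maxn N i.+1.
  (* Telescoping, as [3 * h k = 6 * h k - 6 * h k.+1]. *)
  have near n : nr (psi (N' + n)%N (w i) - psi N' (w i)) <= 6 * h N' - 6 * h (N' + n)%N.
    elim: n => [|n IH]; first by rewrite addn0 !subrr nr0.
    apply: le_trans (nr_tri (psi (N' + n)%N (w i)) _ _) _; rewrite addnS.
    have := psiS (N' + n)%N i; rewrite (leq_trans (leq_maxr N i.+1) (leq_addr _ _)) => /(_ isT).
    by move: IH; rewrite [h (N' + n)%N]hS; lra.
  exists N' => m n mN nN.
  have near' k : (N' <= k)%N -> nr (psi k (w i) - psi N' (w i)) <= e / 2.
    move=> /subnKC <-; apply: le_trans (near _) _.
    by have := hN N' (leq_maxl _ _); have := h0 (N' + (k - N'))%N; lra.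
  apply: le_trans (nr_tri (psi N' (w i)) _ _) _; rewrite [nr (psi N' _ - _)]nrC.
  by rewrite [e]splitr; apply: lerD; exact: near'.
(* Convergence extends from the [w i] to all of [M] by linearity, density and the uniform bound
   [psic]. *)
have /choice[g gP] : forall m, exists l, ncv (fun n => psi n m) l.
  move=> m; apply: (@ncauchy_ncv _ B) => e e0.
  have /dense_nr/(_ m (e / 3) (divr_gt0 e0 (ltr0Sn _ 2)))[y [n [c [s [sw ->]]]] my] := w_dense.
  set y0 := \sum_i _ in my.
  have /choice[l lP] : forall i, exists l, ncv (fun k => psi k (s i)) l.
    by move=> i; have [j _ <-] := sw i; exact: wcv.
  have ycv : ncv (fun k => psi k y0) (\sum_i c i *: l i).
    apply: (@ncv_ext _ _ (fun k => \sum_i c i *: psi k (s i))).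
      by move=> k; rewrite (lin_sum (psil k)); apply: eq_bigr => i _; rewrite (linZ (psil k)).
    by apply: ncv_sum => i; apply: ncvZ.
  have [N hN] := ncv_ncauchy ycv (divr_gt0 e0 (ltr0Sn _ 2)).
  exists N => a b aN bN.
  have d k : nr (psi k m - psi k y0) <= e / 3.
    by rewrite -(linB (psil k)); apply: le_trans (psic _ _) my.
  apply: le_trans (nr_tri (psi a y0) _ _) _.
  apply: le_trans (lerD (d a) (nr_tri (psi b y0) _ _)) _.
  have := hN a b aN bN; have := d b; rewrite [nr (psi b m - _)]nrC.
  by move: (nr _) (nr _) => x z; lra.
have lg : linear g.
  move=> c x y; apply: ncv_uniq (gP _) _.
  apply: (@ncv_ext _ _ (fun n => c *: psi n x + psi n y)); first by move=> n; rewrite psil.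
  by apply: ncvD (gP y); apply: ncvZ.
have hg : cpf g.
  split=> // n x xi.
  apply: (@pos_lim _ _ (fun k => qform (fun i j => psi k ((x i)^† ∗ x j)) xi)).
    by move=> k; have [[_ hp] _ _] := psiG k; exact: hp.
  apply: ncv_sum => i; apply: ncv_sum => j; apply: ncvM (ncv_cst _).
  exact: ncvM (ncv_cst _) (gP _).
have g1 : pos (𝟏 - g 𝟏).
  apply: (@pos_lim _ _ (fun k => 𝟏 - psi k 𝟏)); first by move=> k; have [] := psiG k.
  exact: ncvB (ncv_cst _) (gP _).
exists g; split=> // m; apply/eqP; rewrite -subr_eq0; apply/eqP; move: m.
have lf := proj1 hf.
apply: (dense_span_eq0 (C := 2) w_dense) => [c x y|x|_ [i _ <-]].
- by rewrite lg lq lf scalerBr; lmod.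
- rewrite -[2]/(1 + 1) mulrDl mul1r; apply: le_trans (nrB _ _) _; apply: lerD.
    by apply: le_trans (hom_contract hq _) _; exact: cpf_contractive.
  exact: cpf_contractive.
apply/eqP; rewrite subr_eq0; apply/eqP.
apply: ncv_uniq (hom_ncv hq (gP (w i))) _ => e e0.
have [N hN] := h_small e e0; exists (maxn N i.+1) => n; rewrite geq_max => /andP[nN ni].
by have [_ _ pw] := psiG n; apply: le_trans (pw i ni) (hN n nN).
Qed.

End Limit.

(** * Linear spans *)

Section LinearSpan.
Context {K : numClosedFieldType} {V : lmodType K} (S : set V).

Lemma span_sub x : S x -> linear_span S x.
Proof.
move=> Sx; exists 1%N, (fun=> 1), (fun=> x); split=> //.
by rewrite big_ord1 scale1r.
Qed.

Lemma span_lin (c : K) x y : linear_span S x -> linear_span S y -> linear_span S (c *: x + y).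
Proof.
move=> [m [a [s [Ss ->]]]] [n [b [r [Sr ->]]]].
exists (m + n)%N, (fun i => match fintype.split i with inl j => c * a j | inr j => b j end),
  (fun i => match fintype.split i with inl j => s j | inr j => r j end); split.
  by move=> i; case: (fintype.split i).
rewrite big_split_ord /= scaler_sumr; congr (_ + _); apply: eq_bigr => i _.
  by rewrite (unsplitK (inl i)) scalerA.
by rewrite (unsplitK (inr i)).
Qed.

Lemma span_ind (Q : V -> Prop) : Q 0 -> (forall (c : K) x y, S x -> Q y -> Q (c *: x + y)) ->
  forall x, linear_span S x -> Q x.
Proof.
move=> Q0 QS x [n [c [s [Ss ->]]]].
elim: n c s Ss => [|n IH] c s Ss; first by rewrite big_ord0.
by rewrite big_ord_recl; apply: QS => //; exact: IH.
Qed.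

End LinearSpan.

(** * The span of the words is dense *)

Section Dense.
Context {R : realType} {P O M T : ucstarType R} {t : P -> M -> T} {Phi : O -> T}.
Context {d : nat} (fr : fd_frame P d.+1) (U : is_quantum_maps t Phi).
Local Notation qc := (qcoef fr U).

Lemma qcoef_linear i j : linear (fun a => qc a i j).
Proof.
move=> c a b; rewrite /qcoef (star_hom_linear (proj1 (qphi_unital_hom fr U))).
by rewrite (star_hom_linear sval_hom) cmxDE cmxZE.
Qed.

Context {a : nat -> O} (a_dense : forall o (e : R), 0 < e -> exists k, nr (o - a k) <= e).

(** Scaled to norm at most 1, as [short] requires; spans are unaffected. *)
Definition aletter k : O := ((1 + nr (a k))^-1)%:C *: a k.
Definition aword (u : seq (nat * 'I_d.+1 * 'I_d.+1)) :=
  [seq (aletter x.1.1, x.1.2, x.2) | x <- u].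
Definition nth_word n := aword (odflt [::] (unpickle n)).

Lemma nr_aletter k : nr (aletter k) <= 1.
Proof.
have p : 0 < 1 + nr (a k) by rewrite ltr_pwDl.
rewrite nrZR ger0_norm ?invr_ge0 ?(ltW p)// mulrC ler_pdivrMr// mul1r.
by rewrite lerDr.
Qed.

Lemma short_nth_word n : short (nth_word n).
Proof. by rewrite /short all_map; apply/allP => x _; exact: nr_aletter. Qed.

Local Notation W := [set wev fr U (nth_word n) | n in setT].

Lemma wev_cat u v : wev fr U (u ++ v) = wev fr U u ∗ wev fr U v.
Proof. by elim: u => [|x u IH] /=; rewrite ?smul1x// IH smulA. Qed.

Lemma words_aword u : W (wev fr U (aword u)).
Proof. by exists (pickle u); rewrite // /nth_word pickleK. Qed.

Let near m := forall e : R, 0 < e -> exists2 y, linear_span W y & nr (m - y) <= e.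

Let near_span m : linear_span W m -> near m.
Proof. by move=> sm e e0; exists m => //; rewrite subrr nr0 ltW. Qed.

Let near_lim m : (forall e : R, 0 < e -> exists2 y, near y & nr (m - y) <= e) -> near m.
Proof.
move=> h e e0; have e2 : 0 < e / 2 by rewrite divr_gt0.
have [y /(_ _ e2)[z sz yz] my] := h _ e2; exists z => //.
by apply: le_trans (nr_tri y _ _) _; rewrite [e]splitr lerD.
Qed.

Let near_lin (c : R[i]) x y : near x -> near y -> near (c *: x + y).
Proof.
move=> nx ny e e0; have c0 : 0 < 1 + nr c by rewrite ltr_pwDl.
have [x' sx xx'] := nx (e / 2 / (1 + nr c)) (divr_gt0 (divr_gt0 e0 (ltr0Sn _ 1)) c0).
have [y' sy yy'] := ny (e / 2) (divr_gt0 e0 (ltr0Sn _ 1)).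
exists (c *: x' + y'); first exact: span_lin.
have -> : c *: x + y - (c *: x' + y') = c *: (x - x') + (y - y').
  by rewrite scalerBr; lmod.
apply: le_trans (nrD _ _) _; rewrite [e]splitr; apply: lerD => //.
rewrite nrZ; apply: le_trans (_ : (1 + nr c) * nr (x - x') <= _).
  by rewrite mulrDl mul1r lerDr.
by rewrite mulrC -ler_pdivlMr.
Qed.

Let near0 : near 0.
Proof. by apply: near_span; exists 0%N, (fun=> 0), (fun=> 0); rewrite big_ord0; split=> // -[]. Qed.

Let spanM x y : linear_span W x -> linear_span W y -> linear_span W (x ∗ y).
Proof.
have s0 : linear_span W 0 by exists 0%N, (fun=> 0), (fun=> 0); rewrite big_ord0; split=> // -[].
move=> sx sy; elim/(span_ind (S := W)): x / sx => [|c x z [n _ <-] sz]; first by rewrite smul0x.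
rewrite smulDl smulZl; apply: span_lin => //.
elim/(span_ind (S := W)): y / sy {sz} => [|c' y z' [n' _ <-] sz]; first by rewrite smulx0.
rewrite smulDr smulZr; apply: span_lin => //; apply: span_sub.
rewrite -wev_cat /nth_word -map_cat; exact: words_aword.
Qed.

Let nearM x y : near x -> near y -> near (x ∗ y).
Proof.
move=> nx ny; have nl z : linear_span W z -> near (z ∗ y).
  move=> sz e e0; have z0 : 0 < 1 + nr z by rewrite ltr_pwDl.
  have [y' sy yy'] := ny (e / (1 + nr z)) (divr_gt0 e0 z0).
  exists (z ∗ y'); first exact: spanM.
  rewrite -smulBr; apply: le_trans (nrM _ _) _.
  apply: le_trans (_ : (1 + nr z) * nr (y - y') <= _).
    by rewrite mulrDl mul1r lerDr.
  by rewrite mulrC -ler_pdivlMr.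
apply: near_lim => e e0; have y0 : 0 < 1 + nr y by rewrite ltr_pwDl.
have [x' sx xx'] := nx (e / (1 + nr y)) (divr_gt0 e0 y0).
exists (x' ∗ y); first exact: nl.
rewrite -smulBl; apply: le_trans (nrM _ _) _.
apply: le_trans (_ : nr (x - x') * (1 + nr y) <= _).
  by rewrite mulrDr mulr1 lerDr.
by rewrite -ler_pdivlMr.
Qed.

Let near_qcoef o i j : near (qc o i j).
Proof.
apply: near_lim => e /(a_dense o)[k ok]; exists (qc (a k) i j).
  have p : 0 < 1 + nr (a k) by rewrite ltr_pwDl.
  have -> : a k = (1 + nr (a k))%:C *: aletter k.
    by rewrite scalerA -rmorphM divff ?scale1r// gt_eqF.
  rewrite (linZ (qcoef_linear i j)) -[X in near X]addr0; apply: near_lin near0.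
  apply/near_span/span_sub; have := words_aword [:: (k, i, j)].
  by rewrite /= smulx1.
rewrite -(linB (qcoef_linear i j)); exact: le_trans (nr_qcoef fr U _ i j) ok.
Qed.

Let near_wev_star u : near (wev fr U u)^†.
Proof.
elim: u => [|[[b i] j] u IH] /=.
  by rewrite star1; apply/near_span/span_sub; exact: (words_aword [::]).
by rewrite starM qcoef_star; exact: nearM.
Qed.

(** The closure of the span is a closed *-subalgebra containing the coefficients, hence everything.
    The adjoint of a letter involves [a^†], which the sequence [a] only approximates; so adjoints
    are handled in the closure. *)
Lemma words_dense : dense (linear_span W).
Proof.
apply/dense_nr => m; apply: (quantum_maps_generate (fr := fr) (U := U) (S := near)) => //.
split.
- by apply/near_span/span_sub; exact: (words_aword [::]).
- by move=> x _; rewrite smul1x smulx1.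
- exact: near_lin.
- exact: nearM.
- move=> x nx; apply: near_lim => e /nx[y sy xy].
  exists y^†; last by rewrite -starB nr_star.
  elim/(span_ind (S := W)): y / sy {xy} => [|c y z [n _ <-] nz]; first by rewrite star0.
  by rewrite starD starZ; exact: near_lin.
- move=> u l nu ul; apply: near_lim => e /ul[N hN]; exists (u N) => //.
  by rewrite nrC; exact: hN.
Qed.

End Dense.

(** When [P = 0] the algebra [M] is spanned by its unit. *)
Section ScalarAlgebra.
Context {R : realType} {M B C : ucstarType R}.
Context {q : B -> C} (hq : is_star_hom q) (q1 : q 𝟏 = 𝟏).
Hypothesis q_surj : forall c, exists b, q b = c.

Lemma scalar_subalg : subalg 𝟏 [set m : M | exists c, m = c *: 𝟏].
Proof.
split=> /=.
- by exists 1; rewrite scale1r.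
- by move=> x _; rewrite smul1x smulx1.
- by move=> c _ _ [a ->] [b ->]; exists (c * a + b); rewrite scalerDl scalerA.
- by move=> _ _ [a ->] [b ->]; exists (b * a); rewrite smulZl smulZr smul1x !scalerA mulrC.
- by move=> _ [a ->]; exists a^*%R; rewrite starZ star1.
move=> u l hu ul; have [z|z] := eqVneq (𝟏 : M) 0.
  by exists 0; rewrite -[l]smul1x z smul0x scaler0.
have [c cE] := choice hu.
have n0 : 0 < nr (𝟏 : M) by rewrite lt_def nr_ge0 andbT; apply: contra z => /eqP/nr_eq0 ->.
have [|x cx] := @complex_ncauchy R c.
  move=> e e0; have [N hN] := ncv_ncauchy ul (mulr_gt0 e0 n0).
  exists N => m n mN nN; have := hN m n mN nN.
  by rewrite !cE -scalerBl nrZ ler_pM2r.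
exists x; apply: ncv_uniq ul _ => e e0.
have [N hN] := cx (e / nr (𝟏 : M)) (divr_gt0 e0 n0); exists N => n nN.
by rewrite cE -scalerBl nrZ -ler_pdivlMr//; exact: hN.
Qed.

(** [M] is identified with the scalars by a character [chi]; lift the root of [f 1] to a contraction
    [b] and take [chi m] times [b^† b]. *)
Lemma scalar_lift (f : M -> C) : cpf f -> pos (𝟏 - f 𝟏) -> (forall m : M, exists c, m = c *: 𝟏) ->
  exists g : M -> B, [/\ cpf g, pos (𝟏 - g 𝟏) & forall m, q (g m) = f m].
Proof.
move=> hf f1 M1; have lf := proj1 hf.
(* The character requires [𝟏] to be nonzero. *)
have [z|z] := eqVneq (𝟏 : M) 0.
  exists (fun=> 0); split.
  - split=> [c x y|n x xi]; first by rewrite scaler0 addr0.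
    by rewrite /qform big1 => [|i _]; [exact: pos0|rewrite big1// => j _; rewrite smulx0 smul0x].
  - by rewrite subr0; exact: pos1.
  - by move=> m; rewrite (lin0 (star_hom_linear hq)) -[m]smul1x z smul0x (lin0 lf).
have [chi chiE] := choice M1.
have chi_eq a b : a *: (𝟏 : M) = b *: 𝟏 -> a = b.
  move=> /eqP; rewrite -subr_eq0 -scalerBl scaler_eq0 (negbTE z) orbF subr_eq0.
  exact: eqP.
have chi1 : chi 𝟏 = 1 by apply: chi_eq; rewrite -chiE scale1r.
have chiL c x y : chi (c *: x + y) = c * chi x + chi y.
  by apply: chi_eq; rewrite -chiE scalerDl -scalerA -!chiE.
have chiM x y : chi (x^† ∗ y) = (chi x)^*%R * chi y.
  apply: chi_eq; rewrite -chiE {1}(chiE x) {1}(chiE y) starZ star1 smulZl smulZr smul1x.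
  by rewrite scalerA.
have [k [ks kE _ _]] := pos_sqrt (cpf_pos hf pos1).
have k1 : nr k <= 1.
  by apply/nrP; rewrite ?ler01// expr1n rmorph1 scale1r ks -kE.
have [b0 b0k] := q_surj k; have [b bk b1] := quot_lift hq q1 b0; rewrite b0k in bk b1.
exists (fun m => chi m *: (b^† ∗ b)); split.
- split=> [c x y|n x xi]; first by rewrite chiL scalerDl scalerA.
  have -> : qform (fun i j => chi ((x i)^† ∗ x j) *: (b^† ∗ b)) xi =
      (\sum_i chi (x i) *: (b ∗ xi i))^† ∗ \sum_i chi (x i) *: (b ∗ xi i).
    rewrite star_sum smul_suml; apply: eq_bigr => i _; rewrite smul_sumr; apply: eq_bigr => j _.
    by rewrite chiM starZ starM smulZl !smulZr smulZl scalerA !smulA.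
  exact: posS.
- rewrite chi1 scale1r; have := proj2 (nrP b ler01) (le_trans b1 k1).
  by rewrite expr1n rmorph1 scale1r.
- move=> m; rewrite (linZ (star_hom_linear hq)) (star_homM hq) (star_hom_star hq) bk ks -kE.
  by rewrite -(linZ lf) -chiE.
Qed.

End ScalarAlgebra.

(** * The lifting property of [M] *)

Section Main.
Context {R : realType} {P O M T : ucstarType R} {t : P -> M -> T} {Phi : O -> T}.
Context {d : nat} (fr : fd_frame P d) (U : is_quantum_maps t Phi).
Hypotheses (O_lifting : lifting_property O) (O_separable : separable O).

Lemma separable_seq : exists a : nat -> O,
  forall o (e : R), 0 < e -> exists k, nr (o - a k) <= e.
Proof.
have [S /countable_injP[c cinj] /dense_nr dS] := O_separable.
(* The countable set is enumerated through its injection [c] into the naturals, with 0 outside the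
   range. *)
exists (fun n => xget 0 [set x | S x /\ c x = n]) => o e e0.
have [x Sx ox] := dS o e e0; exists (c x).
case: xgetP => [y -> [Sy cy]|/(_ x)[]//].
by rewrite (cinj _ _ (mem_set Sy) (mem_set Sx) cy).
Qed.

Lemma quantum_maps_unital_lifting : unital_lifting M.
Proof.
move=> B C q hq q1 qs f fcp fc.
have hf := cp_cpf fcp; have f1 := contractive_one hf fc.
suff [g [hg g1 gf]] : exists g : M -> B,
    [/\ cpf g, pos (𝟏 - g 𝟏) & forall m, q (g m) = f m].
  exists g; split=> //; first exact: cpf_cp.
  by move=> x; rewrite !nrE lecR; exact: cpf_contractive.
(* Without frame vectors there are no coefficients, and [M] is generated by its unit. *)
case: d fr => [|d'] fr'.
  apply: scalar_lift => // m.
  apply: (quantum_maps_generate (fr := fr') (U := U) scalar_subalg) => a.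
  by case.
have [a ad] := separable_seq.
apply: (lift_of_approx hq q1 hf f1 (words_dense fr' U ad)) => n eps e0.
have us_short : all (@short _ _ d') [seq nth_word (d := d') (a := a) i | i <- iota 0 n].
  by rewrite all_map; apply/allP => i _; exact: short_nth_word.
have [g [hg g1 gw]] := word_lift fr' U O_lifting hq q1 qs hf f1 us_short e0.
by exists g; split=> // i ilt; apply: gw; rewrite map_f// mem_iota.
Qed.

End Main.

Theorem theorem4p1 (R : realType) (P O : cstarAlgType R[i])
    (P_finite : finite_dimensional P)
    (O_compact : unital O) (O_separable : separable O)
    (O_lifting : lifting_property O)
    (M T : cstarAlgType R[i]) (t : P -> M -> T) (Phi : O -> T)
    (MPhi_universal : is_quantum_maps t Phi) :
  lifting_property M.
Proof.
(* Each algebra is replaced by an equal one with a chosen unit; that of [T] comes from [t 𝟏 𝟏]. *)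
have [P' eP] := ucstar_of_unital (fd_unital P_finite).
case: _ / eP P_finite t MPhi_universal => P_finite t U.
have [Ou eO] := ucstar_of_unital O_compact.
case: _ / eO O_compact O_separable O_lifting Phi U => _ O_separable O_lifting Phi U.
have [M' eM] := ucstar_of_unital (qmaps_unital U).
case: _ / eM t U => t U.
have [T' eT] := ucstar_of_unital (ex_intro _ _ (tensor_unit (min_tensor_tensor (qmaps_tensor U)))).
case: _ / eT t Phi U => t Phi U.
have [d [fr]] := fd_frame_exists P_finite.
exact/unital_lifting_property/(quantum_maps_unital_lifting fr U).
Qed.
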